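(* Let $0\le\beta<\alpha<1$. For each $\varepsilon\in(0,1)$ let $u_\varepsilon$ be the unique solution, $\varepsilon$-periodic in $y$, of $$\begin{cases}\partial_t u_\varepsilon-\Delta u_\varepsilon=0&\text{in }\Omega_\varepsilon,\\ \partial_n u_\varepsilon=0&\text{on }\Gamma^0_\varepsilon,\\ \partial_n u_\varepsilon=1&\text{on }\Gamma^1_\varepsilon,\\ \partial_n u_\varepsilon=\frac{\alpha-\beta}{2}\varepsilon&\text{on }\Gamma^\alpha_\varepsilon,\\ \partial_n u_\varepsilon=\frac{\beta}{\alpha}&\text{on }\Gamma^\beta_\varepsilon,\end{cases}$$ with its initial datum $u_\varepsilon(t=0)$. Extend $u_\varepsilon$ to $\Omega$ by $\varepsilon$-periodicity in $y$ and by $0$ outside the material (i.e. in the cracks), and assume that the (extended) initial data satisfy $u_\varepsilon(t=0)\rightharpoonup u_0$ weakly in $L^2(\Omega)$ as $\varepsilon\to0$. Then, for any $T>0$, $$u_\varepsilon\rightharpoonup u\quad\text{weakly in }L^2(\Omega\times[0,T])\text{ as }\varepsilon\to0,$$ where $u$ is the unique solution of the homogenized problem $$\begin{cases}-\Delta u+\partial_t u=\alpha-\beta&\text{in }\{-1<x<0\},\\ \partial_n u=1-\alpha&\text{on }\{x=-1\},\\ u\text{ is }1\text{-periodic in }y,\end{cases}\qquad \begin{cases}-\Delta u+\partial_t u=0&\text{in }\{0<x<1\},\\ \partial_n u=0&\text{on }\{x=1\},\\ u\text{ is }1\text{-periodic in }y,\end{cases}$$ with the transmission conditions $$u(x=0^-)=(1-\alpha)\,u(x=0^+),\qquad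 \partial_x u(x=0^-)=\partial_x u(x=0^+)+\beta,$$ and the initial condition $u(t=0)=u_0$ in $\Omega$.
   Context: Geometry. For $\varepsilon>0$, one period of the cracked medium is $$\Omega_\varepsilon=\{(x,y)\in\mathbb R^2:\ -1<x<1,\ |y|<\tfrac{\varepsilon}{2}\}\setminus\{(x,y):\ -1\le x\le 0,\ |y|\le \tfrac{\alpha\varepsilon}{2}\},$$ with boundary parts $\Gamma_\varepsilon^0=\{x=1,\ |y|<\varepsilon/2\}$ (right side), $\Gamma_\varepsilon^1=\{x=-1,\ \alpha\varepsilon/2<|y|<\varepsilon/2\}$ (left side), $\Gamma_\varepsilon^\alpha=\{-1<x<0,\ y=\pm\alpha\varepsilon/2\}$ (horizontal sides of the crack), $\Gamma_\varepsilon^\beta=\{x=0,\ |y|<\alpha\varepsilon/2\}$ (bottom of the crack). On the remaining sides $y=\pm\varepsilon/2$, periodicity of period $\varepsilon$ in $y$ is imposed. $\partial_n$ denotes the outward normal derivative. The macroscopic domain is $$\Omega=\{(x,y)\in\mathbb R^2:\ -1<x<1,\ -\tfrac12<y<\tfrac12\},\quad \Omega^+=\Omega\cap\{x>0\},\quad \Omega^-=\Omega\cap\{x<0\}.$$ Extension. The function $u_\varepsilon$ is viewed as a function on $\Omega$ by repeating it $\varepsilon$-periodically in $y$ (it then lives on the union of the translates $\Omega_\varepsilon+k\varepsilon e_2$, $k\in\mathbb Z$, $e_2=(0,1)$, up to the lines separating the cells) and setting it equal to $0$ in the cracks. Solution classes. Solutions $u_\varepsilon$ are understood in $C([0,T],H^1(\Omega_\varepsilon))\cap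 C^1([0,T],L^2(\Omega_\varepsilon))$ for any $T>0$. Solutions $u$ of the homogenized problem are understood as pairs $(u_-,u_+)=(u|_{\Omega^-},u|_{\Omega^+})$ in $$\big(C([0,T],H^1(\Omega^-))\cap C^1([0,T],L^2(\Omega^-))\big)\times\big(C([0,T],H^1(\Omega^+))\cap C^1([0,T],L^2(\Omega^+))\big)$$ for any $T>0$. Equations and flux (Neumann) conditions are understood in the usual weak sense, and values at $x=0^\pm$ are traces from $\Omega^\pm$. Existence and uniqueness of $u_\varepsilon$ and of $u$ in these classes are standing assumptions here. *)

(* Defs.v *)
From HB Require Import structures.
From mathcomp Require Import all_boot all_order all_algebra.
From mathcomp Require Import all_classical all_reals all_analysis.

Set Implicit Arguments.
Unset Strict Implicit.
Unset Printing Implicit Defensive.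

Import Order.TTheory GRing.Theory Num.Theory.
Import numFieldNormedType.Exports.

Local Open Scope classical_set_scope.
Local Open Scope ring_scope.

Notation plane R := (R * R)%type (only parsing).

Definition lebesgue1 (R : realType)
    : {measure set (measurableTypeR R) -> \bar R} := lebesgue_measure.

Definition lebesgue2 (R : realType)
    : {measure set (measurableTypeR R * measurableTypeR R)%type -> \bar R} :=
  (@lebesgue_measure R \x @lebesgue_measure R)%E.

(* Points of space-time are pairs (p, t). *)
Definition lebesgue_st (R : realType)
    : {measure set (measurableTypeR R * measurableTypeR R * measurableTypeR R)%type
               -> \bar R} :=
  (lebesgue2 R \x @lebesgue_measure R)%E.

Definition L2norm d (X : measurableType d) (R : realType)
    (mu : {measure set X -> \bar R}) (D : set X) (f : X -> R) : \bar R :=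
  'N[mu]_(2%:E)[EFin \o (f \_ D)].

Definition L2 d (X : measurableType d) (R : realType)
    (mu : {measure set X -> \bar R}) (D : set X) (f : X -> R) : Prop :=
  f \_ D \in Lfun mu 2%:E.

Definition weak_L2_cvg d (X : measurableType d) (R : realType)
    (mu : {measure set X -> \bar R}) (D : set X)
    (f : R -> X -> R) (f0 : X -> R) : Prop :=
  [/\ forall e : R, 0 < e < 1 -> L2 mu D (f e),
      L2 mu D f0 &
      forall g : X -> R, L2 mu D g ->
        \int[mu]_(x in D) (f e x * g x) @[e --> 0^'+]
          --> \int[mu]_(x in D) (f0 x * g x)].

Definition e1 (R : realType) : plane R := (1, 0).
Definition e2 (R : realType) : plane R := (0, 1).

Fixpoint Ck (R : realType) (k : nat) (f : plane R -> R) : Prop :=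
  continuous f /\
  if k is k'.+1 then
    [/\ forall p, derivable f p (e1 R), forall p, derivable f p (e2 R),
        Ck k' (fun p => 'D_(e1 R) f p) & Ck k' (fun p => 'D_(e2 R) f p)]
  else True.

Definition test_function (R : realType) (D : set (plane R))
    (phi : plane R -> R) : Prop :=
  (forall k, Ck k phi) /\
  exists K : set (plane R),
    [/\ compact K, K `<=` D & forall p, ~ K p -> phi p = 0].

Definition weak_partial (R : realType) (D : set (plane R)) (e : plane R)
    (f g : plane R -> R) : Prop :=
  forall phi : plane R -> R, test_function D phi ->
    \int[lebesgue2 R]_(p in D) (f p * 'D_e phi p) =
    - \int[lebesgue2 R]_(p in D) (g p * phi p).

(* A function together with (a version of) its weak gradient.  Only the values
   on the domain under consideration matter. *)
Record jet (R : realType) := Jet {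
  jval :> plane R -> R;
  jdx : plane R -> R;
  jdy : plane R -> R }.

Definition jet_sub (R : realType) (w w' : jet R) : jet R :=
  Jet (fun p => w p - w' p)
      (fun p => jdx w p - jdx w' p) (fun p => jdy w p - jdy w' p).

Definition jet_of (R : realType) (phi : plane R -> R) : jet R :=
  Jet phi (fun p => 'D_(e1 R) phi p) (fun p => 'D_(e2 R) phi p).

Definition H1 (R : realType) (D : set (plane R)) (w : jet R) : Prop :=
  [/\ L2 (lebesgue2 R) D w,
      L2 (lebesgue2 R) D (jdx w) /\ L2 (lebesgue2 R) D (jdy w),
      weak_partial D (e1 R) w (jdx w) &
      weak_partial D (e2 R) w (jdy w)].

Definition H1norm (R : realType) (D : set (plane R)) (w : jet R) : \bar R :=
  (L2norm (lebesgue2 R) D w + L2norm (lebesgue2 R) D (jdx w)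
   + L2norm (lebesgue2 R) D (jdy w))%E.

Definition vsegment (R : realType) (a s : R) : plane R := (a, s).
Definition hsegment (R : realType) (b s : R) : plane R := (s, b).

(* g is the trace of w in H^1(D) on the segment c(J): the trace operator is the
   extension by continuity of the restriction of functions that are C^1 up to
   the boundary. *)
Definition is_trace (R : realType) (D : set (plane R)) (c : R -> plane R)
    (J : set R) (w : jet R) (g : R -> R) : Prop :=
  L2 (lebesgue1 R) J g /\
  exists phi : nat -> plane R -> R,
    [/\ forall n, Ck 1 (phi n),
        H1norm D (jet_sub (jet_of (phi n)) w) @[n --> \oo] --> 0%E &
        L2norm (lebesgue1 R) J (fun s => phi n (c s) - g s) @[n --> \oo]
          --> 0%E].

(* Periodicity of period l in y, for D containing the sides
   {x in I, y = +-l/2} in its boundary. *)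
Definition periodic_y (R : realType) (D : set (plane R)) (I : set R) (l : R)
    (w : jet R) : Prop :=
  exists g : R -> R,
    is_trace D (hsegment (l / 2)) I w g /\ is_trace D (hsegment (- (l / 2))) I w g.

(* u belongs to C([0,T], H^1(D)) and C^1([0,T], L^2(D)), with time derivative
   ut.  The last clause selects a representative for which u is a function on
   D x [0,T] in the sense of Lebesgue: a priori each u t could be changed on a
   null set depending on t. *)
Definition evolution_class (R : realType) (D : set (plane R)) (T : R)
    (u : R -> jet R) (ut : R -> plane R -> R) : Prop :=
  [/\ forall t : R, 0 <= t <= T -> H1 D (u t) /\ L2 (lebesgue2 R) D (ut t),
      forall t : R, 0 <= t <= T ->
        H1norm D (jet_sub (u s) (u t)) @[s --> within `[0, T] (nbhs t)]
          --> 0%E,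
      forall t : R, 0 <= t <= T ->
        L2norm (lebesgue2 R) D (fun p => ut s p - ut t p)
          @[s --> within `[0, T] (nbhs t)] --> 0%E,
      forall t : R, 0 <= t <= T ->
        L2norm (lebesgue2 R) D
          (fun p => (u s p - u t p) / (s - t) - ut t p)
          @[s --> within (`[0, T] `\ t) (nbhs t)] --> 0%E &
      measurable_fun (D `*` `[0, T]) (fun q : plane R * R => u q.2 q.1)].

(* The left-hand side of the weak heat equation. *)
Definition heat_form (R : realType) (D : set (plane R))
    (ut : plane R -> R) (u phi : jet R) : R :=
  \int[lebesgue2 R]_(p in D) (ut p * phi p) +
  \int[lebesgue2 R]_(p in D) (jdx u p * jdx phi p + jdy u p * jdy phi p).

Section CrackedProblem.
Context (R : realType).
Implicit Types (alpha beta eps : R) (u : R -> plane R -> R).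

Definition crack_cell alpha eps : set (plane R) :=
  [set p | -1 < p.1 < 1 /\ `|p.2| < eps / 2] `\`
  [set p | -1 <= p.1 <= 0 /\ `|p.2| <= alpha * eps / 2].

Definition cracked_solution alpha beta eps u : Prop :=
  exists ux uy ut : R -> plane R -> R,
  let w t := Jet (u t) (ux t) (uy t) in
  let D := crack_cell alpha eps in
  let left_side : set R := [set y | alpha * eps / 2 < `|y| < eps / 2] in
  let crack_side : set R := `]-1, 0[%classic in
  let crack_bottom : set R := [set y | `|y| < alpha * eps / 2] in
  [/\ forall T : R, 0 < T -> evolution_class D T w ut,
      forall t : R, 0 <= t -> periodic_y D `]-1, 1[%classic eps (w t) &
      forall t : R, 0 <= t ->
      forall (phi : jet R) (g1 gtop gbot gb : R -> R),
        H1 D phi -> periodic_y D `]-1, 1[%classic eps phi ->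
        is_trace D (vsegment (-1)) left_side phi g1 ->
        is_trace D (hsegment (alpha * eps / 2)) crack_side phi gtop ->
        is_trace D (hsegment (- (alpha * eps / 2))) crack_side phi gbot ->
        is_trace D (vsegment 0) crack_bottom phi gb ->
        heat_form D (ut t) (w t) phi =
          \int[lebesgue1 R]_(y in left_side) g1 y
          + (alpha - beta) / 2 * eps *
            (\int[lebesgue1 R]_(x in crack_side) gtop x
             + \int[lebesgue1 R]_(x in crack_side) gbot x)
          + beta / alpha * \int[lebesgue1 R]_(y in crack_bottom) gb y].

(* The point of the strip -eps/2 <= y < eps/2 congruent to p. *)
Definition reduce_y eps (p : plane R) : plane R :=
  (p.1, p.2 - eps * (Num.floor (p.2 / eps + 2^-1))%:~R).

Definition extend alpha eps (f : plane R -> R) (p : plane R) : R :=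
  if reduce_y eps p \in crack_cell alpha eps then f (reduce_y eps p) else 0.

End CrackedProblem.

Section HomogenizedProblem.
Context (R : realType).
Implicit Types (alpha beta : R) (um up : R -> plane R -> R).

Definition Omega : set (plane R) :=
  [set p | -1 < p.1 < 1 /\ - 2^-1 < p.2 < 2^-1].
Definition Omega_plus : set (plane R) := Omega `&` [set p | 0 < p.1].
Definition Omega_minus : set (plane R) := Omega `&` [set p | p.1 < 0].

(* The value 0 on the null line {x = 0} keeps the result measurable, whatever
   fm and fp are there. *)
Definition glue_x0 (fm fp : plane R -> R) (p : plane R) : R :=
  if p.1 < 0 then fm p else if 0 < p.1 then fp p else 0.

(* Integrating by parts on both sides of {x = 0} against a test function phi in
   H^1(Omega), the terms on {x = 0} add up to the integral of
   (d_x um - d_x up) phi = beta phi: the last clause contains both equations,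
   the flux conditions at x = -1 and x = 1 and the flux transmission
   condition. *)
Definition homogenized_solution alpha beta um up : Prop :=
  exists umx umy umt upx upy upt : R -> plane R -> R,
  let wm t := Jet (um t) (umx t) (umy t) in
  let wp t := Jet (up t) (upx t) (upy t) in
  let Y : set R := `]- 2^-1, 2^-1[%classic in
  [/\ forall T : R, 0 < T -> evolution_class Omega_minus T wm umt /\
                         evolution_class Omega_plus T wp upt,
      forall t : R, 0 <= t -> periodic_y Omega_minus `]-1, 0[%classic 1 (wm t) /\
                          periodic_y Omega_plus `]0, 1[%classic 1 (wp t),
      forall t : R, 0 <= t -> exists g : R -> R,
        is_trace Omega_plus (vsegment 0) Y (wp t) g /\
        is_trace Omega_minus (vsegment 0) Y (wm t) (fun y => (1 - alpha) * g y) &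
      forall t : R, 0 <= t ->
      forall (phi : jet R) (gl g0 : R -> R),
        H1 Omega phi -> periodic_y Omega `]-1, 1[%classic 1 phi ->
        is_trace Omega (vsegment (-1)) Y phi gl ->
        is_trace Omega (vsegment 0) Y phi g0 ->
        heat_form Omega_minus (umt t) (wm t) phi
        + heat_form Omega_plus (upt t) (wp t) phi =
          (alpha - beta) * \int[lebesgue2 R]_(p in Omega_minus) phi p
          + (1 - alpha) * \int[lebesgue1 R]_(y in Y) gl y
          + beta * \int[lebesgue1 R]_(y in Y) g0 y].

End HomogenizedProblem.

Arguments Omega {R}.
Arguments Omega_plus {R}.
Arguments Omega_minus {R}.

(* Main.v *)
Require Import Defs.
From HB Require Import structures.
From mathcomp Require Import all_boot all_order all_algebra.
From mathcomp Require Import all_classical all_reals all_analysis.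
From mathcomp Require Import measurable_realfun.
From mathcomp Require Import ring lra zify.

Set Implicit Arguments.
Unset Strict Implicit.
Unset Printing Implicit Defensive.

Import Order.TTheory GRing.Theory Num.Theory.
Import numFieldNormedType.Exports.

Local Open Scope classical_set_scope.
Local Open Scope ring_scope.

(** The homogenized problem has one unknown on each side of the interface, and
    the jump [u(0-) = (1 - alpha) u(0+)] of its solution prevents any compactness
    in H^1. The proof avoids compactness, and also uniqueness, by comparing
    moments of both solutions for which closed systems of ordinary differential
    equations hold.

    Transverse profiles. With [s x = sin (pi x / 2)], let [psi_j] be [s ^ j] for
    [x <= 0], and [s ^ j] (even [j]) or [(1 - alpha) s ^ j] (odd [j]) for [x > 0].
    These functions are continuous, have zero slope at [-1] and [1], and satisfy
    [psi_j' (0+) = (1 - alpha) psi_j' (0-)]. They are thus the profiles for which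
    an integration by parts leaves no flux of the profile against the solution:
    in the homogenized problem the two traces at 0 cancel by the transmission
    condition, and in the cracked cell a profile of slope [c] carries the flux
    [(1 - alpha) eps c] through the gaps on the left and the same flux through
    the full width on the right. Moreover
    [psi_j'' = (pi / 2)^2 (j (j - 1) psi_(j-2) - j^2 psi_j)], and the powers
    [cos (2 pi (y - z)) ^ i] obey the same kind of recursion, so that the moments
    against [psi_j (x) cos (2 pi (y - z)) ^ i] solve a triangular system.

    Cracked side. For the solution in one cell, divided by [eps], the factor in
    [y] is replaced by its mean. A C^1 function [ptest], equal to [psi_j] up to a
    layer of width [eps] at the right of the interface, is tested in the weak
    equation, and its gradient is compared with a vector field of divergence
    exactly [psi_j''] and without normal component on the boundary
    ([moment_cracked]). Both differ by O(eps) in L^2, so the error is bounded by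
    [eps] times the norm of the gradient of the solution, which the dissipation
    in the energy inequality ([energy]) absorbs. The source terms of both systems
    coincide ([profile_load]): the flux on the horizontal sides of the crack
    becomes the volume source, and the flux on its bottom the jump [beta] of the
    derivative.
    Gronwall's lemma and an induction on both exponents make the difference of the
    moments vanish uniformly in time ([moment_step], [moment_error_uvanishes]).

    From one cell to the extension. A weakly convergent family of initial data is
    bounded ([weak_bounded]), so the squared norm on one cell is O(eps) at all
    times ([energy_uniform]). Unfolding turns the pairing of the extension with a
    product [a x * chi y] into an integral on one cell, where the translates of
    [chi] form a Riemann sum that tends to the mean of [chi] ([extend_tensor]).

    Conclusion. The products of profiles and powers of cosines are enough to test
    weak convergence of a bounded family ([good_density]): polynomials of [s] and
    of the cosines approximate indicators of level sets, these give the corners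
    [x < c, y < b], which generate the Borel sets. Weak convergence at each time
    and the uniform bound give weak convergence in space-time by dominated
    convergence ([space_time_convergence]). *)

(** * Square-integrable functions *)

Section L2toolkit.
Context d (X : measurableType d) (R : realType) (mu : {measure set X -> \bar R}).
Implicit Types (D E : set X) (f g : X -> R).

Lemma rintD D f g : measurable D -> mu.-integrable D (EFin \o f) ->
  mu.-integrable D (EFin \o g) -> mu.-integrable D (EFin \o (fun x => f x + g x)).
Proof. by move=> mD If Ig; apply: eq_integrable (integrableD mD If Ig). Qed.

Lemma rintZ D (c : R) f : measurable D -> mu.-integrable D (EFin \o f) ->
  mu.-integrable D (EFin \o (fun x => c * f x)).
Proof. by move=> mD If; apply: eq_integrable (integrableZl mD c If). Qed.

Lemma rintB D f g : measurable D -> mu.-integrable D (EFin \o f) ->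
  mu.-integrable D (EFin \o g) -> mu.-integrable D (EFin \o (fun x => f x - g x)).
Proof. by move=> mD If Ig; apply: eq_integrable (integrableB mD If Ig). Qed.

Definition sq D f : R := \int[mu]_(x in D) f x ^+ 2.

Lemma sqE D f : sq D f = \int[mu]_(x in D) f x ^+ 2. Proof. by []. Qed.

Lemma sq_ge0 D f : 0 <= sq D f.
Proof. by apply: Rintegral_ge0 => x _; rewrite sqr_ge0. Qed.

Lemma L2normE D f : measurable D ->
  L2norm mu D f = ((\int[mu]_(x in D) (f x ^+ 2)%:E) `^ 2^-1)%E.
Proof.
move=> mD; rewrite /L2norm unlock; congr (_ `^ _)%E.
rewrite [RHS]integral_mkcond; apply: eq_integral => x _ /=.
rewrite /patch /=; case: ifPn => _ /=.
  by rewrite powR_mulrn// real_normK// num_real.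
by rewrite normr0 powR0.
Qed.

Lemma L2P D f : measurable D ->
  L2 mu D f <-> measurable_fun D f /\ mu.-integrable D (EFin \o (fun x => f x ^+ 2)).
Proof.
move=> mD; split => [L|[mf intf]].
- have mf : measurable_fun D f.
    by apply/(measurable_restrictT _ mD); move: L => /andP[/[!inE]].
  split => //; apply/(integrable_mkcond _ mD).
  apply: eq_integrable (Lfun2_integrable_sqr L) => // x _ /=.
  by rewrite /patch; case: ifPn => //=; rewrite expr0n.
- apply/andP; split; first by rewrite inE; apply/(measurable_restrictT _ mD).
  rewrite inE /=; change (L2norm mu D f < +oo)%E; rewrite L2normE//.
  apply: poweR_lty; have := integrable_lty mD intf.
  by apply: le_lt_trans; apply: le_refl.
Qed.

Lemma L2_meas D f : measurable D -> L2 mu D f -> measurable_fun D f.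
Proof. by move=> mD /(L2P _ mD)[]. Qed.

Lemma L2_sqr_int D f : measurable D -> L2 mu D f ->
  mu.-integrable D (EFin \o (fun x => f x ^+ 2)).
Proof. by move=> mD /(L2P _ mD)[]. Qed.

Lemma L2norm_sqrt D f : measurable D -> L2 mu D f ->
  L2norm mu D f = (Num.sqrt (sq D f))%:E.
Proof.
move=> mD Lf; rewrite L2normE// /sq /Rintegral.
have := integrable_fin_num mD (L2_sqr_int mD Lf) => /fineK <-.
by rewrite poweR_EFin powR12_sqrt// fine_ge0// integral_ge0// => x _; rewrite lee_fin sqr_ge0.
Qed.

Lemma L2norm_lt D f (e : R) : measurable D -> measurable_fun D f ->
  (L2norm mu D f < e%:E)%E -> L2 mu D f /\ sq D f < e ^+ 2.
Proof.
move=> mD mf h.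
have Lf : L2 mu D f.
  apply/andP; split; first by rewrite inE; apply/(measurable_restrictT _ mD).
  by rewrite inE /=; change (L2norm mu D f < +oo)%E; rewrite (lt_trans h)// ltry.
split => //; move: h; rewrite L2norm_sqrt// lte_fin => h.
rewrite -(sqr_sqrtr (sq_ge0 D f)) ltr_pXn2r// nnegrE ?sqrtr_ge0//.
by apply: ltW; apply: le_lt_trans h; rewrite sqrtr_ge0.
Qed.

Lemma sq_L2norm D f (e : R) : 0 <= e -> measurable D -> L2 mu D f ->
  sq D f <= e ^+ 2 -> (L2norm mu D f <= e%:E)%E.
Proof.
move=> e0 mD Lf h; rewrite L2norm_sqrt// lee_fin -(ger0_norm e0) -sqrtr_sqr.
by rewrite ler_sqrt// sqr_ge0.
Qed.

Lemma L2_eq D f g : {in D, f =1 g} -> L2 mu D f -> L2 mu D g.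
Proof.
move=> fg; rewrite /L2; suff -> : f \_ D = g \_ D by [].
by apply/funext => x; rewrite /patch; case: ifPn => // /fg.
Qed.

Lemma sq_eq D f g : {in D, f =1 g} -> sq D f = sq D g.
Proof. by move=> fg; apply: eq_Rintegral => x /fg ->. Qed.

Lemma L2_le D f g : measurable D -> measurable_fun D f ->
  mu.-integrable D (EFin \o g) -> (forall x, D x -> f x ^+ 2 <= g x) -> L2 mu D f.
Proof.
move=> mD mf ig fg; apply/L2P => //; split => //.
apply: le_integrable ig => //.
  by apply/measurable_EFinP; apply: measurable_funX.
move=> x Dx /=; rewrite lee_fin ger0_norm ?sqr_ge0//.
by rewrite (le_trans (fg _ Dx))// ler_norm.
Qed.

Lemma L2_mul_int D f g : measurable D -> L2 mu D f -> L2 mu D g ->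
  mu.-integrable D (EFin \o (fun x => f x * g x)).
Proof.
move=> mD Lf Lg.
have [mf If] := (L2P f mD).1 Lf; have [mg Ig] := (L2P g mD).1 Lg.
apply: le_integrable (integrableD mD If Ig) => //.
  by apply/measurable_EFinP; apply: measurable_funM.
move=> x Dx /=; rewrite lee_fin normrM (ger0_norm (addr_ge0 (sqr_ge0 _) (sqr_ge0 _))).
rewrite -(real_normK (num_real (f x))) -(real_normK (num_real (g x))).
have := sqr_ge0 (`|f x| - `|g x|); have := normr_ge0 (f x); have := normr_ge0 (g x).
move: `|f x| `|g x| => a b; nra.
Qed.

Lemma L2D D f g : measurable D -> L2 mu D f -> L2 mu D g ->
  L2 mu D (fun x => f x + g x).
Proof.
move=> mD Lf Lg.
have [mf If] := (L2P f mD).1 Lf; have [mg Ig] := (L2P g mD).1 Lg.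
apply: (@L2_le _ _ (fun x => 2 * f x ^+ 2 + 2 * g x ^+ 2)) => //.
- exact: measurable_funD.
- by apply: rintD => //; apply: rintZ.
- by move=> x _; have := sqr_ge0 (f x - g x); move: (f x) (g x) => a b; nra.
Qed.

Lemma L2Z D (c : R) f : measurable D -> L2 mu D f -> L2 mu D (fun x => c * f x).
Proof.
move=> mD Lf; have [mf If] := (L2P f mD).1 Lf.
apply: (@L2_le _ _ (fun x => c ^+ 2 * f x ^+ 2)) => //.
- by apply: measurable_funM => //.
- exact: rintZ.
- by move=> x _; rewrite exprMn.
Qed.

Lemma L2B D f g : measurable D -> L2 mu D f -> L2 mu D g ->
  L2 mu D (fun x => f x - g x).
Proof.
move=> mD Lf Lg; apply: L2_eq (L2D mD Lf (L2Z (-1) mD Lg)) => x _.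
by rewrite mulN1r.
Qed.

Lemma L2_bmul D (b f : X -> R) (M : R) : measurable D -> measurable_fun D b ->
  (forall x, D x -> `|b x| <= M) -> L2 mu D f -> L2 mu D (fun x => b x * f x).
Proof.
move=> mD mb bM Lf; have [mf If] := (L2P f mD).1 Lf.
apply: (@L2_le _ _ (fun x => M ^+ 2 * f x ^+ 2)) => //.
- exact: measurable_funM.
- exact: rintZ.
- move=> x Dx; rewrite exprMn ler_wpM2r ?sqr_ge0// -real_normK ?num_real//.
  by rewrite lerXn2r ?nnegrE// ?(bM _ Dx)// (le_trans _ (bM _ Dx)).
Qed.

Lemma L2_sub D E f : measurable D -> measurable E -> E `<=` D ->
  L2 mu D f -> L2 mu E f.
Proof.
move=> mD mE ED /(L2P _ mD)[mf If]; apply/L2P => //; split.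
  exact: measurable_funS mf.
exact: integrableS If.
Qed.

Lemma bounded_integrable D f (M : R) : measurable D -> (mu D < +oo)%E ->
  measurable_fun D f -> (forall x, D x -> `|f x| <= M) ->
  mu.-integrable D (EFin \o f).
Proof.
move=> mD fD mf fM; apply: (@le_integrable _ _ _ _ _ mD _ (cst M%:E)) => //.
- exact/measurable_EFinP.
- by move=> x Dx /=; rewrite lee_fin (le_trans (fM _ Dx))// ler_norm.
- apply/integrableP; split; first exact: measurable_cst.
  by rewrite integral_cst//= lte_mul_pinfty.
Qed.

Lemma L2_bounded D f (M : R) : measurable D -> (mu D < +oo)%E ->
  measurable_fun D f -> (forall x, D x -> `|f x| <= M) -> L2 mu D f.
Proof.
move=> mD fD mf fM; apply: (@L2_le _ _ (fun=> M ^+ 2)) => //.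
  apply: (@bounded_integrable _ _ (M ^+ 2)) => //.
  by move=> x _; rewrite ger0_norm// sqr_ge0.
move=> x Dx; rewrite -real_normK ?num_real//.
by rewrite lerXn2r ?nnegrE// ?(fM _ Dx)// (le_trans _ (fM _ Dx)).
Qed.

Lemma L2_cst D (c : R) : measurable D -> (mu D < +oo)%E -> L2 mu D (fun=> c).
Proof. by move=> mD fD; apply: (@L2_bounded _ _ `|c|). Qed.

Lemma L2_int D f : measurable D -> (mu D < +oo)%E -> L2 mu D f ->
  mu.-integrable D (EFin \o f).
Proof.
move=> mD fD Lf; apply: eq_integrable (L2_mul_int mD Lf (L2_cst 1 mD fD)) => // x _.
by rewrite /= mulr1.
Qed.

Lemma le_sq D f g : measurable D -> L2 mu D g -> measurable_fun D f ->
  (forall x, D x -> `|f x| <= `|g x|) -> L2 mu D f /\ sq D f <= sq D g.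
Proof.
move=> mD Lg mf fg.
have h x : D x -> f x ^+ 2 <= g x ^+ 2.
  move=> Dx; rewrite -(real_normK (num_real (f x))) -(real_normK (num_real (g x))).
  by rewrite lerXn2r ?nnegrE// fg.
have Lf : L2 mu D f by apply: (L2_le mD mf (L2_sqr_int mD Lg)).
by split => //; apply: le_Rintegral => //; exact: L2_sqr_int.
Qed.

Lemma sqZ D (c : R) f : measurable D -> L2 mu D f ->
  sq D (fun x => c * f x) = c ^+ 2 * sq D f.
Proof.
move=> mD Lf; rewrite -RintegralZl//; last exact: L2_sqr_int.
by apply: eq_Rintegral => x _; rewrite exprMn.
Qed.

Lemma sqD_le D f g : measurable D -> L2 mu D f -> L2 mu D g ->
  sq D (fun x => f x + g x) <= 2 * sq D f + 2 * sq D g.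
Proof.
move=> mD Lf Lg.
have If := L2_sqr_int mD Lf; have Ig := L2_sqr_int mD Lg.
rewrite -!RintegralZl// -RintegralD//.
- apply: le_Rintegral => //; first exact: L2_sqr_int (L2D mD Lf Lg).
    by apply: rintD => //; apply: rintZ.
  by move=> x _; have := sqr_ge0 (f x - g x); move: (f x) (g x) => a b; nra.
- exact: rintZ.
- exact: rintZ.
Qed.

(** The Cauchy-Schwarz inequality, from the discriminant of the nonnegative
    quadratic polynomial [sq (f - c g)] in [c]. *)
Lemma cauchy_schwarz D f g : measurable D -> L2 mu D f -> L2 mu D g ->
  (\int[mu]_(x in D) (f x * g x)) ^+ 2 <= sq D f * sq D g.
Proof.
move=> mD Lf Lg.
have If := L2_sqr_int mD Lf; have Ig := L2_sqr_int mD Lg.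
have Ifg := L2_mul_int mD Lf Lg.
set p := \int[mu]_(x in D) (f x * g x).
have pos (c : R) : 0 <= sq D f - 2 * c * p + c ^+ 2 * sq D g.
  rewrite /p /sq -!RintegralZl// -RintegralB//; last exact: rintZ.
  rewrite -RintegralD//.
  - apply: Rintegral_ge0 => x _.
    by have := sqr_ge0 (f x - c * g x); move: (f x) (g x) => a b; nra.
  - by apply: rintB => //; apply: rintZ.
  - exact: rintZ.
have [g0|g0] := eqVneq (sq D g) 0.
  have [->|p0] := eqVneq p 0; first by rewrite expr0n /= g0 mulr0.
  have := pos ((sq D f + 1) / (2 * p)); rewrite g0 mulr0 addr0.
  by rewrite (_ : 2 * _ * p = sq D f + 1); [lra | field].
have gp : 0 < sq D g by rewrite lt_def g0 sq_ge0.
have := pos (p / sq D g); rewrite -(pmulr_rge0 _ gp).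
rewrite (_ : _ * (_ + _) = sq D f * sq D g - p ^+ 2); first by lra.
by field.
Qed.

Lemma cauchy_schwarz_norm D f g : measurable D -> L2 mu D f -> L2 mu D g ->
  `|\int[mu]_(x in D) (f x * g x)| <= Num.sqrt (sq D f) * Num.sqrt (sq D g).
Proof.
move=> mD Lf Lg; rewrite -sqrtrM ?sq_ge0// -sqrtr_sqr ler_sqrt ?mulr_ge0 ?sq_ge0//.
exact: cauchy_schwarz.
Qed.

Lemma cauchy_schwarz1 D f : measurable D -> (mu D < +oo)%E -> L2 mu D f ->
  (\int[mu]_(x in D) f x) ^+ 2 <= fine (mu D) * sq D f.
Proof.
move=> mD fD Lf; have := cauchy_schwarz mD (L2_cst 1 mD fD) Lf.
rewrite /sq (_ : \int[mu]_(x in D) (1 ^+ 2) = fine (mu D)); last first.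
  by rewrite Rintegral_cst// expr1n mul1r.
by under eq_Rintegral do rewrite mul1r.
Qed.

Lemma L2_abs D f : measurable D -> L2 mu D f -> L2 mu D (fun x => `|f x|).
Proof.
move=> mD Lf; have mf := L2_meas mD Lf.
have [] // := @le_sq D (fun x => `|f x|) f mD Lf; first exact: measurableT_comp.
by move=> x _; rewrite normr_id.
Qed.

End L2toolkit.

(** * Measure-preserving maps and iterated integrals *)

(** The pushforward of [mu] on the same measurable structure, used to change
    variables along a measure-preserving map. *)
Definition image_measure d (X : measurableType d) (R : realType)
  (mu : {measure set X -> \bar R}) (phi : X -> X) (mphi : measurable_fun setT phi) :
  {measure set X -> \bar R}.
Proof. refine (pushforward mu phi : {measure set X -> \bar R}); exact: mphi. Defined.

Section MeasurePreserving.
Context d (X : measurableType d) (R : realType) (mu : {measure set X -> \bar R}).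
Variable phi : X -> X.
Hypothesis mphi : measurable_fun setT phi.
Hypothesis pphi : forall A, measurable A -> mu (phi @^-1` A) = mu A.

Lemma mp_integral (D : set X) (f : X -> \bar R) : measurable D -> measurable_fun D f ->
  (\int[mu]_(x in D) f x = \int[mu]_(x in phi @^-1` D) f (phi x))%E.
Proof.
move=> mD mf.
have mpD : measurable (phi @^-1` D) by rewrite -[X in measurable X]setTI; exact: mphi.
have ge0 (g : X -> \bar R) : measurable_fun D g -> (forall x, 0 <= g x)%E ->
  (\int[mu]_(x in D) g x = \int[mu]_(x in phi @^-1` D) g (phi x))%E.
  move=> mg g0.
  rewrite -(@ge0_integral_pushforward _ _ _ _ _ phi mphi mu D g mD mg) //.
  by apply: eq_measure_integral => A mA _; first [exact: (esym (pphi mA))|exact: (pphi mA)].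
rewrite integralE [RHS]integralE; congr (_ - _)%E.
- apply: (etrans (ge0 _ (measurable_funepos mf) _)) => //.
  by apply: eq_integral => x _; rewrite !funepos.unlock.
- apply: (etrans (ge0 _ (measurable_funeneg mf) _)) => //.
  by apply: eq_integral => x _; rewrite !funeneg.unlock.
Qed.

Lemma mp_Rintegral (D : set X) (f : X -> R) : measurable D -> measurable_fun D f ->
  \int[mu]_(x in D) f x = \int[mu]_(x in phi @^-1` D) f (phi x).
Proof.
by move=> mD mf; rewrite /Rintegral mp_integral//; exact/measurable_EFinP.
Qed.

Lemma mp_measurable (D : set X) (f : X -> R) : measurable D -> measurable_fun D f ->
  measurable_fun (phi @^-1` D) (f \o phi).
Proof.
move=> mD mf; apply: (measurable_comp mD) => //; last exact: measurable_funTS.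
by move=> _ [x Dx <-].
Qed.

Lemma mp_integrable (D : set X) (f : X -> R) : measurable D ->
  mu.-integrable D (EFin \o f) -> mu.-integrable (phi @^-1` D) (EFin \o (f \o phi)).
Proof.
move=> mD /integrableP[mf If]; apply/integrableP; split.
  by apply/measurable_EFinP; apply: mp_measurable => //; apply/measurable_EFinP.
move: If; rewrite mp_integral//; exact: measurableT_comp.
Qed.

End MeasurePreserving.

Section ProductIntegrals.
Context d1 d2 (T1 : measurableType d1) (T2 : measurableType d2) (R : realType).
Variable m1 : {sigma_finite_measure set T1 -> \bar R}.
Variable m2 : {sigma_finite_measure set T2 -> \bar R}.
Implicit Types (A : set T1) (B : set T2) (f : T1 * T2 -> R).

Lemma patchX A B f y : (fun x => (f \_ (A `*` B)) (x, y)) =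
  if y \in B then (fun x => f (x, y)) \_ A else fun=> 0.
Proof.
apply/funext => x; rewrite /patch; case: (boolP (y \in B)) => yB.
  have -> : ((x, y) \in A `*` B) = (x \in A) by apply/idP/idP => [/set_mem[/= ? _]|/set_mem ?]; apply/mem_set => //; split => //; exact: set_mem.
  by [].
by rewrite ifF//; apply/negbTE; apply: contra yB; rewrite !inE => -[].
Qed.

Lemma measurable_section2 A B f y : measurable A -> measurable B -> B y ->
  measurable_fun (A `*` B) f -> measurable_fun A (fun x => f (x, y)).
Proof.
move=> mA mB By /(measurable_restrictT _ (measurableX mA mB)) mf.
apply/(measurable_restrictT _ mA).
have := measurable_fun_pair1 y mf.
by rewrite patchX mem_set.
Qed.

Lemma integral_sectionE A B f y :
  fubini_G m1 (EFin \o f \_ (A `*` B)) y =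
  ((fun y => \int[m1]_(x in A) (f (x, y))%:E) \_ B)%E y.
Proof.
rewrite /fubini_G /patch; case: ifPn => yB.
  rewrite [RHS]integral_mkcond; apply: eq_integral => x _ /=.
  have := congr1 (fun h => h x) (patchX A B f y); rewrite yB /patch => ->.
  by case: ifP.
rewrite integral0_eq// => x _ /=.
by have := congr1 (fun h => h x) (patchX A B f y); rewrite (negbTE yB) /patch => ->.
Qed.

Lemma fubini_prod A B f : measurable A -> measurable B ->
  (m1 \x m2)%E.-integrable (A `*` B) (EFin \o f) ->
  [/\ {ae m2, forall y, B y -> m1.-integrable A (EFin \o (fun x => f (x, y)))},
     m2.-integrable B (EFin \o (fun y => \int[m1]_(x in A) f (x, y))) &
     \int[(m1 \x m2)%E]_(p in A `*` B) f p =
     \int[m2]_(y in B) \int[m1]_(x in A) f (x, y)].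
Proof.
move=> mA mB If; have mAB := measurableX mA mB.
have If' : (m1 \x m2)%E.-integrable setT (EFin \o f \_ (A `*` B)).
  by move/(integrable_mkcond _ mAB): If; apply: eq_integrable => // x _ /=; rewrite /patch; case: ifP.
have ae1 : {ae m2, forall y, B y -> m1.-integrable A (EFin \o (fun x => f (x, y)))}.
  have := ae_integrable2 If'; apply: filterS => y Iy By.
  apply/(integrable_mkcond _ mA); apply: eq_integrable Iy => // x _ /=.
  have := congr1 (fun h => h x) (patchX A B f y); rewrite mem_set//= => ->.
  by rewrite /patch; case: ifP.
have mG : measurable_fun B (fun y => \int[m1]_(x in A) (f (x, y))%:E)%E.
  apply/(measurable_restrictT _ mB); have := measurable_fubini_G If'.
  by apply: eq_measurable_fun => y _; rewrite integral_sectionE.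
have IG : m2.-integrable B (fun y => \int[m1]_(x in A) (f (x, y))%:E)%E.
  apply/(integrable_mkcond _ mB).
  have : m2.-integrable setT (fubini_G m1 (EFin \o f \_ (A `*` B))).
    apply/integrableP; split; first exact: (measurable_fubini_G If').
    have mf := measurable_int _ If'.
    apply: le_lt_trans ((integrable21ltyP _ _ mf).1 If').
    apply: ge0_le_integral => //.
    - by apply: measurableT_comp => //; exact: (measurable_fubini_G If').
    - apply: (measurable_fun_fubini_tonelli_G (abse \o (EFin \o f \_ (A `*` B)))) => //=.
      exact: measurableT_comp.
    - move=> y _; apply: le_abse_integral => //.
      exact: (measurable_fun_pair1 y mf).
  by apply: eq_integrable => // y _; rewrite integral_sectionE.
have aeE : ae_eq m2 B (fun y => \int[m1]_(x in A) (f (x, y))%:E)%E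
  (EFin \o (fun y => \int[m1]_(x in A) f (x, y))).
  apply: filterS ae1 => y Iy By /=; rewrite /Rintegral fineK//.
  by apply: integrable_fin_num => //; exact: Iy.
have mG' : measurable_fun B (EFin \o (fun y => \int[m1]_(x in A) f (x, y))).
  by apply/measurable_EFinP; apply: measurableT_comp => //; exact: measurable_fine.
split => //.
  apply/integrableP; split => //; move/integrableP: IG => [_]; apply: le_lt_trans.
  rewrite (@ae_eq_integral _ _ _ m2 B (fun y => `|\int[m1]_(x in A) (f (x, y))%:E|)%E)//; last 2 first.
  - exact: measurableT_comp.
  - by apply: filterS aeE => y + By => /(_ By) ->.
  exact: measurableT_comp.
rewrite [LHS]/Rintegral [RHS]/Rintegral; congr fine.
transitivity (\int[m2]_y fubini_G m1 (EFin \o f \_ (A `*` B)) y)%E.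
  rewrite integral21_prod_meas1// integral_mkcond; apply: eq_integral => p _ /=.
  by rewrite /patch; case: ifP.
transitivity (\int[m2]_(y in B) (\int[m1]_(x in A) (f (x, y))%:E))%E.
  by rewrite [RHS]integral_mkcond; apply: eq_integral => y _; exact: integral_sectionE.
exact: ae_eq_integral.
Qed.

(** Integrable sections with bounded integrals make the function integrable:
    Tonelli for the nonnegative function cut off outside [A x B]. *)
Lemma tonelli_integrable A B f (M : R) : measurable A -> measurable B -> (m2 B < +oo)%E ->
  measurable_fun (A `*` B) f -> (forall p, 0 <= f p) ->
  (forall y, B y -> m1.-integrable A (EFin \o (fun x => f (x, y))) /\
      \int[m1]_(x in A) f (x, y) <= M) ->
  (m1 \x m2)%E.-integrable (A `*` B) (EFin \o f).
Proof.
move=> mA mB fB mf f0 h; have mAB := measurableX mA mB.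
have mf' : measurable_fun setT (f \_ (A `*` B)) by apply/(measurable_restrictT _ mAB).
have mE : measurable_fun setT (EFin \o f \_ (A `*` B)) by exact/measurable_EFinP.
suff : (m1 \x m2)%E.-integrable setT (EFin \o f \_ (A `*` B)).
  move=> H; apply/(integrable_mkcond _ mAB); apply: eq_integrable H => // x _ /=.
  by rewrite /patch; case: ifP.
apply/(integrable21ltyP _ _ mE).
have f0' p : (0 <= (EFin \o f \_ (A `*` B)) p)%E.
  by rewrite /= lee_fin /patch; case: ifP.
under eq_integral do under eq_integral do rewrite (gee0_abs (f0' _)).
apply: (@le_lt_trans _ _ (\int[m2]_(y in B) M%:E)%E).
  rewrite [leRHS]integral_mkcond; apply: ge0_le_integral => //.
  - by move=> y _; apply: integral_ge0 => x _; exact: f0'.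
  - exact: (measurable_fun_fubini_tonelli_G _ mE).
  - apply/(measurable_restrictT _ mB); exact: measurable_cst.
  - move=> y _; have := integral_sectionE A B f y; rewrite /fubini_G => ->.
    rewrite /patch; case: ifPn => // /set_mem yB; have [Iy hM] := h _ yB.
    rewrite -(fineK (integrable_fin_num mA Iy)) lee_fin; exact: hM.
rewrite integral_cst//; case: (ltgtP M 0) => [M0|M0|->].
- by apply: le_lt_trans (ltry 0); apply: mule_le0_ge0 => //; rewrite lee_fin ltW.
- by rewrite lte_mul_pinfty// lee_fin ltW.
- by rewrite mul0e.
Qed.

End ProductIntegrals.

Section Plane.
Context (R : realType).
Local Notation mR := (measurableTypeR R).
Local Notation mP := (measurableTypeR R * measurableTypeR R)%type.
Local Notation leb1 := (lebesgue1 R).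
Local Notation leb2 := (lebesgue2 R).
Implicit Types (A B : set R) (D : set (R * R)).

Lemma leb2X A B : measurable (A : set mR) -> measurable (B : set mR) ->
  leb2 (A `*` B) = (leb1 A * leb1 B)%E.
Proof. by move=> mA mB; rewrite /lebesgue2 /= product_measure1E. Qed.

Definition pswap (p : R * R) := (p.2, p.1).

Lemma measurable_pswap : measurable_fun setT (pswap : mP -> mP).
Proof. by apply: measurable_fun_pair; [exact: measurable_snd|exact: measurable_fst]. Qed.

(** Both measures agree on products, hence everywhere by uniqueness of the
    product measure. *)
Lemma leb2_swap (D : set mP) : measurable D -> leb2 (pswap @^-1` D) = leb2 D.
Proof.
move=> mD; apply/esym.
apply: (@product_measure_unique _ _ mR mR R (@lebesgue_measure R) (@lebesgue_measure R)
   (image_measure leb2 measurable_pswap)) mD => A B mA mB.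
rewrite -[LHS]/(leb2 (pswap @^-1` (A `*` B))).
have -> : pswap @^-1` (A `*` B) = B `*` A by apply/seteqP; split => -[x y] /= [].
by rewrite -[LHS]/(leb2 (B `*` A)) leb2X// muleC.
Qed.

Definition vshift (c : R) (p : R * R) := (p.1, p.2 + c).

Lemma measurable_add (c : R) : measurable_fun setT (fun x : mR => x + c : mR).
Proof. exact: measurable_funD. Qed.

Lemma leb1_shift (c : R) (A : set mR) : measurable A ->
  leb1 ((fun x => x + c) @^-1` A) = leb1 A.
Proof.
move=> mA; apply/esym.
apply: (@lebesgue_measure_unique _ (image_measure leb1 (measurable_add c))) mA.
move=> _ [[a b] _ <-]; rewrite -[RHS]/(leb1 ((fun x => x + c) @^-1` _)) /=.
have -> : (fun x : R => x + c) @^-1` `]a, b] = `]a - c, b - c]%classic.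
  by apply/seteqP; split => x /=; rewrite !in_itv/= ltrBlDr lerBrDr.
rewrite -[RHS]/(lebesgue_measure _) !lebesgue_measure_itv /= !lte_fin ltrD2r.
case: ifP => // _; congr EFin; lra.
Qed.

Lemma measurable_vshift (c : R) : measurable_fun setT (vshift c : mP -> mP).
Proof.
apply: measurable_fun_pair; first exact: measurable_fst.
exact: (measurableT_comp (measurable_add c) measurable_snd).
Qed.

Lemma leb2_vshift (c : R) (D : set mP) : measurable D -> leb2 (vshift c @^-1` D) = leb2 D.
Proof.
move=> mD; apply/esym.
apply: (@product_measure_unique _ _ mR mR R (@lebesgue_measure R) (@lebesgue_measure R)
   (image_measure leb2 (measurable_vshift c))) mD => A B mA mB.
rewrite -[LHS]/(leb2 (vshift c @^-1` (A `*` B))).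
have -> : vshift c @^-1` (A `*` B) = A `*` ((fun x => x + c) @^-1` B).
  by apply/seteqP; split => -[x y] /= [].
rewrite -[LHS]/(leb2 (A `*` _)) leb2X//; last first.
  by rewrite -[X in measurable X]setTI; exact: measurable_add.
by congr (_ * _)%E; exact: leb1_shift.
Qed.

(** Open sets of the plane are countable unions of rational boxes. *)
Lemma open_measurable2 (U : set (R * R)) : open U -> measurable (U : set mP).
Proof.
move=> oU.
pose box (q : rat * rat * (rat * rat)) : set (R * R) :=
  `]ratr q.1.1, ratr q.1.2[ `*` `]ratr q.2.1, ratr q.2.2[.
have -> : U = \bigcup_(q in [set q | box q `<=` U]) box q.
  apply/seteqP; split => [[x y] Uxy|p [q qU]]; last exact: qU.
  have /nbhs_ballP[e /= e0 eU] : nbhs (x, y) U by exact: open_nbhs_nbhs.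
  have [q1 /[!in_itv]/= /andP[q11 q12]] : exists q : rat, ratr q \in `](x - e), x[ by apply: rat_in_itvoo; lra.
  have [q2 /[!in_itv]/= /andP[q21 q22]] : exists q : rat, ratr q \in `]x, (x + e)[ by apply: rat_in_itvoo; lra.
  have [q3 /[!in_itv]/= /andP[q31 q32]] : exists q : rat, ratr q \in `](y - e), y[ by apply: rat_in_itvoo; lra.
  have [q4 /[!in_itv]/= /andP[q41 q42]] : exists q : rat, ratr q \in `]y, (y + e)[ by apply: rat_in_itvoo; lra.
  exists ((q1, q2), (q3, q4)); last by split; rewrite /= in_itv/=; apply/andP.
  move=> [a b] [/=]; rewrite !in_itv/= => /andP[a1 a2] /andP[b1 b2]; apply: eU.
  by split; rewrite /= /ball/= ltr_norml; apply/andP; split; lra.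
rewrite bigcup_mkcond; apply: countable_bigcupT_measurable => // q.
case: ifP => _; last exact: measurable0.
by apply: measurableX; exact: measurable_itv.
Qed.

Lemma continuous_measurable2 (f : R * R -> R) : continuous f ->
  measurable_fun setT (f : mP -> mR).
Proof.
move=> /continuousP cf; apply: (measurability _ (RGenOpens.measurableE R)).
move=> _ [_ [a [b ->] <-]]; rewrite setTI; apply: open_measurable2.
exact/cf/interval_open.
Qed.

Lemma leb2_null_vline (c : R) : leb2 [set p | p.1 = c] = 0%E.
Proof.
have -> : [set p : R * R | p.1 = c] = [set c] `*` setT by apply/seteqP; split => -[x y] //= [].
by rewrite leb2X//= lebesgue_measure_set1 mul0e.
Qed.

Lemma leb2_null_hline (c : R) : leb2 [set p | p.2 = c] = 0%E.
Proof.
have -> : [set p : R * R | p.2 = c] = setT `*` [set c] by apply/seteqP; split => -[x y] //= [].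
by rewrite leb2X//= lebesgue_measure_set1 mule0.
Qed.

Lemma fubini_y A B (f : R * R -> R) : measurable (A : set mR) -> measurable (B : set mR) ->
  leb2.-integrable (A `*` B) (EFin \o f) ->
  [/\ {ae leb1, forall y, B y -> leb1.-integrable A (EFin \o (fun x => f (x, y)))},
     leb1.-integrable B (EFin \o (fun y => \int[leb1]_(x in A) f (x, y))) &
     \int[leb2]_(p in A `*` B) f p = \int[leb1]_(y in B) \int[leb1]_(x in A) f (x, y)].
Proof. by move=> mA mB If; apply: (@fubini_prod _ _ mR mR R lebesgue_measure lebesgue_measure). Qed.

Lemma swapX A B : pswap @^-1` (A `*` B) = B `*` A.
Proof. by apply/seteqP; split => -[x y] /= []. Qed.

Lemma Rint_swap (D : set mP) (f : mP -> R) : measurable D -> measurable_fun D f ->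
  \int[leb2]_(p in D) f p = \int[leb2]_(p in pswap @^-1` D) f (pswap p).
Proof. by apply: mp_Rintegral; [exact: measurable_pswap|exact: leb2_swap]. Qed.

Lemma integrable_swap (D : set mP) (f : mP -> R) : measurable D ->
  leb2.-integrable D (EFin \o f) -> leb2.-integrable (pswap @^-1` D) (EFin \o (f \o pswap)).
Proof. by apply: mp_integrable; [exact: measurable_pswap|exact: leb2_swap]. Qed.

Lemma fubini_x A B (f : R * R -> R) : measurable (A : set mR) -> measurable (B : set mR) ->
  leb2.-integrable (A `*` B) (EFin \o f) ->
  [/\ {ae leb1, forall x, A x -> leb1.-integrable B (EFin \o (fun y => f (x, y)))},
     leb1.-integrable A (EFin \o (fun x => \int[leb1]_(y in B) f (x, y))) &
     \int[leb2]_(p in A `*` B) f p = \int[leb1]_(x in A) \int[leb1]_(y in B) f (x, y)].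
Proof.
move=> mA mB If; have mAB := measurableX mA mB.
rewrite Rint_swap//; last by apply/measurable_EFinP; exact: measurable_int If.
have := integrable_swap mAB If; rewrite swapX => If'.
exact: (@fubini_y B A (f \o pswap)).
Qed.

End Plane.

(** * Functions of class C^1 *)

Section Calculus.
Context (R : realType).
Local Notation mR := (measurableTypeR R).
Local Notation mP := (measurableTypeR R * measurableTypeR R)%type.
Local Notation leb1 := (lebesgue1 R).
Local Notation leb2 := (lebesgue2 R).

(** A function together with its continuous derivative: carrying the derivative
    along avoids side conditions of derivability when integrating by parts. *)
Definition C1pair (a a' : R -> R) :=
  (forall x : R, is_derive x (1 : R) a (a' x)) /\ continuous a'.

Lemma C1pair_cont a a' : C1pair a a' -> continuous a.
Proof. by move=> [da _] x; apply: differentiable_continuous; apply/derivable1_diffP; case: (da x). Qed.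

Lemma C1pairM a a' b b' : C1pair a a' -> C1pair b b' ->
  C1pair (fun x => a x * b x) (fun x => a' x * b x + a x * b' x).
Proof.
move=> ha hb; have ca := C1pair_cont ha; have cb := C1pair_cont hb.
move: ha hb => [da ca'] [db cb']; split => x.
  have := is_deriveM (da x) (db x); rewrite /GRing.scale/= => h.
  by apply: (is_derive_eq h); rewrite addrC mulrC.
apply: (@continuousD _ R^o _ (fun x => a' x * b x) (fun x => a x * b' x)).
  by apply: continuousM; [exact: ca'|exact: cb].
by apply: continuousM; [exact: ca|exact: cb'].
Qed.

Lemma C1pairD a a' b b' : C1pair a a' -> C1pair b b' ->
  C1pair (fun x => a x + b x) (fun x => a' x + b' x).
Proof.
move=> [da ca'] [db cb']; split => x; first exact: is_deriveD.
by apply: (@continuousD _ R^o _ a' b'); [exact: ca'|exact: cb'].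
Qed.

Lemma C1pairZ (c : R) b b' : C1pair b b' ->
  C1pair (fun x => c * b x) (fun x => c * b' x).
Proof.
move=> [db cb']; split => x; first by have := is_deriveZ c (db x).
by apply: continuousM; [exact: cst_continuous|exact: cb'].
Qed.

Lemma C1pair_cst (c : R) : C1pair (fun=> c) (fun=> 0).
Proof. by split => x; [exact: is_derive_cst|exact: cst_continuous]. Qed.

Lemma C1pair_id : C1pair id (fun=> 1).
Proof. by split => x; [exact: is_derive_id|exact: cst_continuous]. Qed.

Lemma C1pair_eq a a' b b' : a =1 b -> a' =1 b' -> C1pair a a' -> C1pair b b'.
Proof. by move=> /funext -> /funext ->. Qed.

Lemma leb1_itv (i : interval R) : leb1 [set` i] =
  (if (i.1 < i.2)%E then ((i.2 : \bar R) - i.1)%E else 0%E).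
Proof. exact: lebesgue_measure_itv. Qed.

Lemma mu_oo (a b : R) : (leb1 `]a, b[%classic < +oo)%E.
Proof.
rewrite leb1_itv /=; case: ifP => _; last by rewrite ltry.
by rewrite -EFinB ltry.
Qed.

Lemma fine_mu_oo (a b : R) : a <= b -> fine (leb1 `]a, b[%classic) = b - a.
Proof.
move=> ab; rewrite leb1_itv /= lte_fin.
by case: ltP => // ba; apply/eqP; rewrite /= eq_sym subr_eq0 eq_le ba ab.
Qed.

Lemma cont_int_oo (f : R -> R) (a b : R) : continuous f ->
  leb1.-integrable `]a, b[ (EFin \o f).
Proof.
move=> cf; apply: (@integrableS _ _ _ _ (`[a, b]%classic : set mR)).
- exact: measurable_itv.
- exact: measurable_itv.
- exact: subset_itv_oo_cc.
- apply: continuous_compact_integrable; first exact: segment_compact.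
  exact: continuous_subspaceT.
Qed.

Lemma FTC_oo (F f : R -> R) (a b : R) : a < b -> C1pair F f ->
  \int[leb1]_(x in `]a, b[) f x = F b - F a.
Proof.
move=> ab hF; have cF := C1pair_cont hF; move: hF => [dF cf].
have -> : \int[leb1]_(x in `]a, b[) f x = \int[leb1]_(x in `[a, b]) f x.
  rewrite /lebesgue1 Rintegral_itv_bndo_bndc ?Rintegral_itv_obnd_cbnd//.
    apply: (@integrableS _ _ _ _ (`[a, b]%classic : set mR)).
    - exact: measurable_itv.
    - exact: measurable_itv.
    - exact: subset_itv_oc_cc.
    - apply: continuous_compact_integrable; first exact: segment_compact.
      exact: continuous_subspaceT.
  exact: cont_int_oo.
rewrite /Rintegral /lebesgue1 (@continuous_FTC2 _ f F a b)//.
- exact: continuous_subspaceT.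
- split.
  + by move=> x _; case: (dF x).
  + by apply: cvg_at_right_filter; exact: cF.
  + by apply: cvg_at_left_filter; exact: cF.
- by move=> x _; rewrite derive1E; case: (dF x).
Qed.

Lemma IBP1 (v v' a a' : R -> R) (x0 x1 : R) : x0 < x1 -> C1pair v v' -> C1pair a a' ->
  \int[leb1]_(x in `]x0, x1[) (v' x * a x + v x * a' x) = a x1 * v x1 - a x0 * v x0.
Proof. by move=> x01 hv ha; rewrite (FTC_oo x01 (C1pairM hv ha)) ![a _ * _]mulrC. Qed.

Lemma Ck_cont k (phi : R * R -> R) : Ck k phi -> continuous phi.
Proof. by case: k => [|k] []. Qed.

Lemma derive_slice_x (phi : R * R -> R) (x y : R) : derivable phi (x, y) (e1 R) ->
  is_derive x 1 (fun x => phi (x, y)) ('D_(e1 R) phi (x, y)).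
Proof.
have E : (fun h : R => h^-1 *: ((phi \o shift (x, y)) (h *: e1 R) - phi (x, y))) =
         (fun h => h^-1 *: (((fun x => phi (x, y)) \o shift x) (h *: 1) - phi (x, y))).
  apply/funext => h; rewrite /e1 /shift /=; congr (_ *: (phi _ - _)).
  by apply/pair_equal_spec; split => //=; rewrite scaler0 add0r.
by rewrite /derivable /derive E => h; apply: DeriveDef.
Qed.

Lemma derive_slice_y (phi : R * R -> R) (x y : R) : derivable phi (x, y) (e2 R) ->
  is_derive y 1 (fun y => phi (x, y)) ('D_(e2 R) phi (x, y)).
Proof.
have E : (fun h : R => h^-1 *: ((phi \o shift (x, y)) (h *: e2 R) - phi (x, y))) =
         (fun h => h^-1 *: (((fun y => phi (x, y)) \o shift y) (h *: 1) - phi (x, y))).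
  apply/funext => h; rewrite /e2 /shift /=; congr (_ *: (phi _ - _)).
  by apply/pair_equal_spec; split => //=; rewrite scaler0 add0r.
by rewrite /derivable /derive E => h; apply: DeriveDef.
Qed.

Lemma derive_slice_xE (phi : R * R -> R) (x y d : R) :
  is_derive x 1 (fun x => phi (x, y)) d -> is_derive (x, y) (e1 R) phi d.
Proof.
have E : (fun h : R => h^-1 *: ((phi \o shift (x, y)) (h *: e1 R) - phi (x, y))) =
         (fun h => h^-1 *: (((fun x => phi (x, y)) \o shift x) (h *: 1) - phi (x, y))).
  apply/funext => h; rewrite /e1 /shift /=; congr (_ *: (phi _ - _)).
  by apply/pair_equal_spec; split => //=; rewrite scaler0 add0r.
move=> [h1 h2]; split; first by rewrite /derivable E.
by rewrite /derive E.
Qed.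

Lemma derive_slice_yE (phi : R * R -> R) (x y d : R) :
  is_derive y 1 (fun y => phi (x, y)) d -> is_derive (x, y) (e2 R) phi d.
Proof.
have E : (fun h : R => h^-1 *: ((phi \o shift (x, y)) (h *: e2 R) - phi (x, y))) =
         (fun h => h^-1 *: (((fun y => phi (x, y)) \o shift y) (h *: 1) - phi (x, y))).
  apply/funext => h; rewrite /e2 /shift /=; congr (_ *: (phi _ - _)).
  by apply/pair_equal_spec; split => //=; rewrite scaler0 add0r.
move=> [h1 h2]; split; first by rewrite /derivable E.
by rewrite /derive E.
Qed.

Lemma continuous_pairl (y : R) : continuous (fun x : R => (x, y)).
Proof. by move=> x; apply: (@cvg_pair _ R R (nbhs x) (nbhs x) (nbhs y) _ _ _ (fun x : R => x) (fun=> y)); [exact: cvg_id|exact: cvg_cst]. Qed.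

Lemma continuous_pairr (x : R) : continuous (fun y : R => (x, y)).
Proof. by move=> y; apply: (@cvg_pair _ R R (nbhs y) (nbhs x) (nbhs y) _ _ _ (fun=> x) (fun y : R => y)); [exact: cvg_cst|exact: cvg_id]. Qed.

Lemma C1_slice_x (phi : R * R -> R) (y : R) : Ck 1 phi ->
  C1pair (fun x => phi (x, y)) (fun x => 'D_(e1 R) phi (x, y)).
Proof.
move=> [_ [d1 _ [c1 _] _]]; split => [x|]; first exact: derive_slice_x.
by move=> x; apply: (@continuous_comp R _ _ (fun x : R => (x, y)) (fun p : R * R => 'D_(e1 R) phi p) x (@continuous_pairl y x)); exact: c1.
Qed.

Lemma C1_slice_y (phi : R * R -> R) (x : R) : Ck 1 phi ->
  C1pair (fun y => phi (x, y)) (fun y => 'D_(e2 R) phi (x, y)).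
Proof.
move=> [_ [_ d2 _ [c2 _]]]; split => [y|]; first exact: derive_slice_y.
by move=> y; apply: (@continuous_comp R _ _ (fun y : R => (x, y)) (fun p : R * R => 'D_(e2 R) phi p) y (@continuous_pairr x y)); exact: c2.
Qed.

Lemma continuous_fst_comp (a : R -> R) : continuous a -> continuous (fun p : R * R => a p.1).
Proof. by move=> ca p; apply: continuous_comp; [exact: cvg_fst|exact: ca]. Qed.

Lemma continuous_snd_comp (a : R -> R) : continuous a -> continuous (fun p : R * R => a p.2).
Proof. by move=> ca p; apply: continuous_comp; [exact: cvg_snd|exact: ca]. Qed.

Lemma C1_tensor (a a' b b' : R -> R) : C1pair a a' -> C1pair b b' ->
  [/\ Ck 1 (fun p : R * R => a p.1 * b p.2),
      (fun p => 'D_(e1 R) (fun p : R * R => a p.1 * b p.2) p) = (fun p => a' p.1 * b p.2) &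
      (fun p => 'D_(e2 R) (fun p : R * R => a p.1 * b p.2) p) = (fun p => a p.1 * b' p.2)].
Proof.
move=> ha hb; have ca := C1pair_cont ha; have cb := C1pair_cont hb.
move: ha hb => [da ca'] [db cb'].
have d1 (p : R * R) : is_derive p (e1 R) (fun p : R * R => a p.1 * b p.2) (a' p.1 * b p.2).
  case: p => x y; apply: derive_slice_xE => /=.
  have := is_deriveM (da x) (is_derive_cst (b y) x 1); rewrite /GRing.scale/= => h.
  by apply: (is_derive_eq h); rewrite mulr0 add0r mulrC.
have d2 (p : R * R) : is_derive p (e2 R) (fun p : R * R => a p.1 * b p.2) (a p.1 * b' p.2).
  case: p => x y; apply: derive_slice_yE => /=.
  have := is_deriveM (is_derive_cst (a x) y 1) (db y); rewrite /GRing.scale/= => h.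
  by apply: (is_derive_eq h); rewrite mulr0 addr0.
have E1 : (fun p => 'D_(e1 R) (fun p : R * R => a p.1 * b p.2) p) = (fun p => a' p.1 * b p.2).
  by apply/funext => p; case: (d1 p).
have E2 : (fun p => 'D_(e2 R) (fun p : R * R => a p.1 * b p.2) p) = (fun p => a p.1 * b' p.2).
  by apply/funext => p; case: (d2 p).
have cM (f g : R -> R) : continuous f -> continuous g ->
    continuous (fun p : R * R => f p.1 * g p.2).
  move=> cf cg p; apply: continuousM; first exact: continuous_fst_comp.
  exact: continuous_snd_comp.
split => //; split; first exact: cM.
split.
- by move=> p; case: (d1 p).
- by move=> p; case: (d2 p).
- by rewrite E1; split => //; exact: cM.
- by rewrite E2; split => //; exact: cM.
Qed.

Lemma C1M (f g : R * R -> R) : Ck 1 f -> Ck 1 g ->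
  [/\ Ck 1 (fun p => f p * g p),
    (fun p => 'D_(e1 R) (fun p => f p * g p) p) =
      (fun p => f p * 'D_(e1 R) g p + 'D_(e1 R) f p * g p) &
    (fun p => 'D_(e2 R) (fun p => f p * g p) p) =
      (fun p => f p * 'D_(e2 R) g p + 'D_(e2 R) f p * g p)].
Proof.
move=> [cf [f1 f2 [cf1 _] [cf2 _]]] [cg [g1 g2 [cg1 _] [cg2 _]]].
have E e : (forall p, derivable f p e) -> (forall p, derivable g p e) ->
  (fun p => 'D_e (fun p => f p * g p) p) = (fun p => f p * 'D_e g p + 'D_e f p * g p).
  move=> df dg; apply/funext => p.
  by have := deriveM (df p) (dg p); rewrite /GRing.scale /= => ->; rewrite [g p * _]mulrC.
have E1 := E _ f1 g1; have E2 := E _ f2 g2.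
have cE (h1 h2 h3 h4 : R * R -> R) : continuous h1 -> continuous h2 -> continuous h3 ->
   continuous h4 -> continuous (fun p => h1 p * h2 p + h3 p * h4 p).
  move=> c1 c2 c3 c4 p.
  by apply: (@continuousD _ R^o _ (fun p => h1 p * h2 p) (fun p => h3 p * h4 p));
    apply: continuousM; [exact: c1|exact: c2|exact: c3|exact: c4].
have c0 : continuous (fun p : R * R => f p * g p).
  by move=> p; apply: continuousM; [exact: cf|exact: cg].
split; [|exact: E1|exact: E2]; split; first exact: c0.
split.
- by move=> p; apply: derivableM; [exact: f1|exact: g1].
- by move=> p; apply: derivableM; [exact: f2|exact: g2].
- by rewrite E1; split; [exact: cE|exact: I].
- by rewrite E2; split; [exact: cE|exact: I].
Qed.

(** Fubini reduces the claim to integration by parts on horizontal segments; the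
    weight [b] depends on the other variable only and is merely measurable. *)
Lemma ibp_rect_x (phi : R * R -> R) (a a' b : R -> R) (x0 x1 : R) (J : set R) :
  x0 < x1 -> measurable (J : set mR) -> Ck 1 phi -> C1pair a a' ->
  leb2.-integrable (`]x0, x1[ `*` J)
    (EFin \o (fun p => ('D_(e1 R) phi p * a p.1 + phi p * a' p.1) * b p.2)) ->
  \int[leb2]_(p in `]x0, x1[ `*` J) (('D_(e1 R) phi p * a p.1 + phi p * a' p.1) * b p.2)
  = \int[leb1]_(y in J) ((a x1 * phi (x1, y) - a x0 * phi (x0, y)) * b y).
Proof.
move=> x01 mJ hphi ha I.
have [_ _ ->] := fubini_y (measurable_itv _) mJ I.
apply: eq_Rintegral => y _ /=; rewrite RintegralZr//; last first.
  apply: cont_int_oo; exact: (C1pairM (C1_slice_x y hphi) ha).2.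
by rewrite (IBP1 x01 (C1_slice_x y hphi) ha).
Qed.

Lemma ibp_rect_y (phi : R * R -> R) (a a' b : R -> R) (y0 y1 : R) (J : set R) :
  y0 < y1 -> measurable (J : set mR) -> Ck 1 phi -> C1pair a a' ->
  leb2.-integrable (J `*` `]y0, y1[)
    (EFin \o (fun p => ('D_(e2 R) phi p * a p.2 + phi p * a' p.2) * b p.1)) ->
  \int[leb2]_(p in J `*` `]y0, y1[) (('D_(e2 R) phi p * a p.2 + phi p * a' p.2) * b p.1)
  = \int[leb1]_(x in J) ((a y1 * phi (x, y1) - a y0 * phi (x, y0)) * b x).
Proof.
move=> x01 mJ hphi ha I.
have [_ _ ->] := fubini_x mJ (measurable_itv _) I.
apply: eq_Rintegral => y _ /=; rewrite RintegralZr//; last first.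
  apply: cont_int_oo; exact: (C1pairM (C1_slice_y y hphi) ha).2.
by rewrite (IBP1 x01 (C1_slice_y y hphi) ha).
Qed.

End Calculus.

(** * Traces on vertical and horizontal segments *)

Lemma ae_imp2 d (X : measurableType d) (R : realType) (mu : {measure set X -> \bar R})
    (P Q S : X -> Prop) : (forall x, P x -> Q x -> S x) ->
  {ae mu, forall x, P x} -> {ae mu, forall x, Q x} -> {ae mu, forall x, S x}.
Proof. exact: filterS2. Qed.

Lemma ae_imp d (X : measurableType d) (R : realType) (mu : {measure set X -> \bar R})
    (P S : X -> Prop) : (forall x, P x -> S x) ->
  {ae mu, forall x, P x} -> {ae mu, forall x, S x}.
Proof. exact: filterS. Qed.

Lemma near_and_ex (P Q : nat -> Prop) : (\forall n \near \oo, P n) ->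
  (\forall n \near \oo, Q n) -> exists n, P n /\ Q n.
Proof.
move=> [N _ hN] [M _ hM]; exists (maxn N M); split; [apply: hN|apply: hM] => /=.
  exact: leq_maxl.
exact: leq_maxr.
Qed.

Lemma L2_ae d (X : measurableType d) (R : realType) (mu : {measure set X -> \bar R})
    (D : set X) (f g : X -> R) : measurable D -> measurable_fun D f -> L2 mu D g ->
  {ae mu, forall x, D x -> f x = g x} -> L2 mu D f /\ sq mu D f = sq mu D g.
Proof.
move=> mD mf Lg fg; have Ig := L2_sqr_int mD Lg; have mg := L2_meas mD Lg.
have aeE : ae_eq mu D (EFin \o (fun x => f x ^+ 2)) (EFin \o (fun x => g x ^+ 2)).
  by apply: ae_imp fg => x h Dx /=; rewrite h.
have m2 (h : X -> R) : measurable_fun D h -> measurable_fun D (EFin \o (fun x => h x ^+ 2)).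
  by move=> mh; apply/measurable_EFinP; exact: measurable_funX.
have E := ae_eq_integral _ _ mD (m2 _ mf) (m2 _ mg) aeE.
split; last by rewrite /sq /Rintegral E.
apply/L2P => //; split => //; apply/integrableP; split; first exact: m2.
under eq_integral do rewrite gee0_abs ?lee_fin ?sqr_ge0//.
by rewrite E; exact: integrable_lty.
Qed.

Lemma sq_subset d (X : measurableType d) (R : realType) (mu : {measure set X -> \bar R})
    (D E : set X) (f : X -> R) : measurable D -> measurable E -> E `<=` D ->
  L2 mu D f -> sq mu E f <= sq mu D f.
Proof.
move=> mD mE ED Lf; have If := L2_sqr_int mD Lf.
apply: fine_le.
- apply: integrable_fin_num => //; exact: integrableS If.
- exact: integrable_fin_num.
- apply: ge0_subset_integral => //; first by case/integrableP: If.
  by move=> x _; rewrite lee_fin sqr_ge0.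
Qed.

Lemma cvge0_small (R : realType) (f : nat -> \bar R) : (forall n, 0 <= f n)%E ->
  (forall e : R, 0 < e -> \forall n \near \oo, (f n <= e%:E)%E) ->
  f n @[n --> \oo] --> 0%E.
Proof.
move=> f0 h; apply/fine_cvgP; split.
  have := h 1 ltr01; apply: filterS => n fn.
  by rewrite ge0_fin_numE// (le_lt_trans fn)// ltry.
apply/cvgrPdist_le => e e0; have := h e e0; apply: filterS => n fn /=.
rewrite sub0r normrN ger0_norm ?fine_ge0//.
have fin : f n \is a fin_num by rewrite ge0_fin_numE// (le_lt_trans fn)// ltry.
by rewrite -lee_fin fineK.
Qed.

Section TraceTheory.
Context (R : realType).
Local Notation mR := (measurableTypeR R).
Local Notation mP := (measurableTypeR R * measurableTypeR R)%type.
Local Notation leb1 := (lebesgue1 R).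
Local Notation leb2 := (lebesgue2 R).
Implicit Types (D : set mP) (w : jet R).

Lemma eq0_small (A K : R) : 0 <= K -> (forall e, 0 < e -> `|A| <= e * K) -> A = 0.
Proof.
move=> K0 h; apply/eqP; apply: contraT => A0.
have A1 : 0 < `|A| by rewrite normr_gt0.
have K1 : 0 < K + 1 by lra.
have := h (`|A| / (K + 1)) (divr_gt0 A1 K1).
have -> : `|A| / (K + 1) * K = `|A| - `|A| / (K + 1) by field; lra.
have := divr_gt0 A1 K1; lra.
Qed.

Definition L2jet D w :=
  [/\ L2 leb2 D w, L2 leb2 D (jdx w) & L2 leb2 D (jdy w)].

Lemma H1_L2jet D w : H1 D w -> L2jet D w.
Proof. by move=> [? [? ?] _ _]; split. Qed.

Lemma cvge_near (T : Type) (F : set_system T) (f : T -> \bar R) (e : R) :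
  f x @[x --> F] --> 0%E -> 0 < e -> \forall x \near F, (f x < e%:E)%E.
Proof.
move=> h e0; have := h [set x | (x < e%:E)%E]; apply.
apply: open_nbhs_nbhs; split; last by rewrite /= lte_fin.
exact: open_ereal_lt_ereal.
Qed.

Lemma L2norm_ge0 d (X : measurableType d) (mu : {measure set X -> \bar R}) E f :
  (0 <= L2norm mu E f)%E.
Proof. exact: Lnorm_ge0. Qed.

Lemma H1norm_lt D w (e : R) : (H1norm D w < e%:E)%E ->
  [/\ (L2norm leb2 D w < e%:E)%E, (L2norm leb2 D (jdx w) < e%:E)%E &
      (L2norm leb2 D (jdy w) < e%:E)%E].
Proof.
rewrite /H1norm => h.
have h1 := L2norm_ge0 leb2 D w; have h2 := L2norm_ge0 leb2 D (jdx w).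
have h3 := L2norm_ge0 leb2 D (jdy w).
split; apply: le_lt_trans h.
- by rewrite -addeA leeDl// adde_ge0.
- by rewrite addeAC leeDr// adde_ge0.
- by rewrite leeDr// adde_ge0.
Qed.

Lemma Ck_meas D (phi : R * R -> R) : Ck 1 phi ->
  [/\ measurable_fun D phi, measurable_fun D (fun p => 'D_(e1 R) phi p) &
      measurable_fun D (fun p => 'D_(e2 R) phi p)].
Proof.
move=> [c0 [_ _ [c1 _] [c2 _]]].
split; apply: measurable_funTS; [exact: (continuous_measurable2 c0)|
  exact: (continuous_measurable2 c1)|exact: (continuous_measurable2 c2)].
Qed.

Definition C1_close D (phi : R * R -> R) w (e : R) :=
  [/\ Ck 1 phi, L2jet D (jet_of phi),
      L2jet D (jet_sub (jet_of phi) w) &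
      [/\ sq leb2 D (jet_sub (jet_of phi) w) <= e ^+ 2,
          sq leb2 D (jdx (jet_sub (jet_of phi) w)) <= e ^+ 2 &
          sq leb2 D (jdy (jet_sub (jet_of phi) w)) <= e ^+ 2]].

Lemma H1norm_C1_close D w (phi : R * R -> R) (e : R) : measurable D -> L2jet D w ->
  Ck 1 phi -> (H1norm D (jet_sub (jet_of phi) w) < e%:E)%E -> C1_close D phi w e.
Proof.
move=> mD [w0 w1 w2] hphi /H1norm_lt[h0 h1 h2].
have [m0 m1 m2] := Ck_meas D hphi.
have mw0 := L2_meas mD w0; have mw1 := L2_meas mD w1; have mw2 := L2_meas mD w2.
have [|l0 s0] := L2norm_lt mD _ h0; first exact: measurable_funB.
have [|l1 s1] := L2norm_lt mD _ h1; first exact: measurable_funB.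
have [|l2 s2] := L2norm_lt mD _ h2; first exact: measurable_funB.
split => //; last by split; exact: ltW.
by split; [apply: L2_eq (L2D mD l0 w0)|apply: L2_eq (L2D mD l1 w1)|apply: L2_eq (L2D mD l2 w2)];
  move=> x _ /=; rewrite subrK.
Qed.

(** The weak divergence of [(q1, q2)] tested against [w], when [q0] is that
    divergence. *)
Definition functional D (q0 q1 q2 : R * R -> R) w : R :=
  \int[leb2]_(p in D) (w p * q0 p + jdx w p * q1 p + jdy w p * q2 p).

Lemma functional_split D q0 q1 q2 w : measurable D ->
  L2 leb2 D q0 -> L2 leb2 D q1 -> L2 leb2 D q2 -> L2jet D w ->
  functional D q0 q1 q2 w = \int[leb2]_(p in D) (w p * q0 p) +
    \int[leb2]_(p in D) (jdx w p * q1 p) + \int[leb2]_(p in D) (jdy w p * q2 p).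
Proof.
move=> mD L0 L1 L2' [w0 w1 w2]; rewrite /functional RintegralD//; last 2 first.
- by apply: rintD => //; exact: L2_mul_int.
- exact: L2_mul_int.
by rewrite RintegralD//; exact: L2_mul_int.
Qed.

Lemma functional_bound D q0 q1 q2 w (e : R) : measurable D -> 0 <= e ->
  L2 leb2 D q0 -> L2 leb2 D q1 -> L2 leb2 D q2 -> L2jet D w ->
  [/\ sq leb2 D w <= e ^+ 2, sq leb2 D (jdx w) <= e ^+ 2 & sq leb2 D (jdy w) <= e ^+ 2] ->
  `|functional D q0 q1 q2 w| <=
    e * (Num.sqrt (sq leb2 D q0) + Num.sqrt (sq leb2 D q1) + Num.sqrt (sq leb2 D q2)).
Proof.
move=> mD e0 L0 L1 L2' Lw [s0 s1 s2]; rewrite functional_split//.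
move: Lw => [w0 w1 w2].
have H f q : L2 leb2 D f -> L2 leb2 D q -> sq leb2 D f <= e ^+ 2 ->
    `|\int[leb2]_(p in D) (f p * q p)| <= e * Num.sqrt (sq leb2 D q).
  move=> Lf Lq sf; apply: (le_trans (cauchy_schwarz_norm mD Lf Lq)).
  rewrite ler_wpM2r ?sqrtr_ge0// -(ger0_norm e0) -sqrtr_sqr ler_sqrt ?sqr_ge0//.
rewrite !mulrDr; apply: (le_trans (ler_normD _ _)); apply: lerD; last exact: H.
by apply: (le_trans (ler_normD _ _)); apply: lerD; exact: H.
Qed.

(** Both sides are continuous for the convergence that defines the trace, so an
    integration by parts that is known for C^1 functions extends to every jet
    that has a trace. *)
Lemma trace_functional D (c : R -> R * R) (J : set R) w g q0 q1 q2 (b : R -> R) :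
  measurable D -> measurable (J : set mR) -> continuous c -> L2jet D w ->
  L2 leb2 D q0 -> L2 leb2 D q1 -> L2 leb2 D q2 -> L2 leb1 J b ->
  is_trace D c J w g ->
  (forall phi, Ck 1 phi -> L2jet D (jet_of phi) -> L2 leb1 J (phi \o c) ->
    functional D q0 q1 q2 (jet_of phi) = \int[leb1]_(s in J) (b s * phi (c s))) ->
  functional D q0 q1 q2 w = \int[leb1]_(s in J) (b s * g s).
Proof.
move=> mD mJ cc Lw L0 L1 L2' Lb [Lg [phi [C1phi cvD cvJ]]] H.
apply/eqP; rewrite -subr_eq0; apply/eqP.
set K := (Num.sqrt (sq leb2 D q0) + Num.sqrt (sq leb2 D q1) + Num.sqrt (sq leb2 D q2))
  + Num.sqrt (sq leb1 J b).
apply: (@eq0_small _ K); first by rewrite /K !addr_ge0// sqrtr_ge0.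
move=> e e0.
have [n [nD nJ]] : exists n, (H1norm D (jet_sub (jet_of (phi n)) w) < e%:E)%E /\
    (L2norm leb1 J (fun s => phi n (c s) - g s)%R < e%:E)%E.
  exact: (near_and_ex (cvge_near cvD e0) (cvge_near cvJ e0)).
have mphic : measurable_fun J (phi n \o c).
  apply: measurable_funTS; apply: continuous_measurable_fun => x.
  by apply: continuous_comp; [exact: cc|exact: (Ck_cont (C1phi n))].
have [|lJ sJ] := L2norm_lt mJ _ nJ.
  by apply: measurable_funB => //; exact: L2_meas Lg.
have LphiJ : L2 leb1 J (phi n \o c).
  by apply: L2_eq (L2D mJ lJ Lg) => x _ /=; rewrite subrK.
have [_ Lphi Lsub close] := H1norm_C1_close mD Lw (C1phi n) nD.
have e0' := ltW e0.
have E1 : functional D q0 q1 q2 w =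
    functional D q0 q1 q2 (jet_of (phi n)) - functional D q0 q1 q2 (jet_sub (jet_of (phi n)) w).
  rewrite !functional_split//.
  move: Lw Lphi Lsub => [w0 w1 w2] [p0 p1 p2] [l0 l1 l2].
  have B f f' q : L2 leb2 D f -> L2 leb2 D f' -> L2 leb2 D q ->
      \int[leb2]_(p in D) ((f p - f' p) * q p) =
      \int[leb2]_(p in D) (f p * q p) - \int[leb2]_(p in D) (f' p * q p).
    move=> Lf Lf' Lq; rewrite -RintegralB//; [|exact: L2_mul_int..].
    by apply: eq_Rintegral => p _; rewrite mulrBl.
  by rewrite !B//; lra.
have E2 : \int[leb1]_(s in J) (b s * g s) =
    \int[leb1]_(s in J) (b s * phi n (c s)) - \int[leb1]_(s in J) ((phi n (c s) - g s) * b s).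
  rewrite -RintegralB//; [|exact: (L2_mul_int mJ Lb LphiJ)|exact: (L2_mul_int mJ lJ Lb)].
  by apply: eq_Rintegral => s _; lra.
rewrite E1 E2 (H _ (C1phi n) Lphi LphiJ).
set T0 := \int[leb1]_(s in J) (b s * phi n (c s)).
have -> (x y : R) : T0 - x - (T0 - y) = y - x by lra.
apply: (le_trans (ler_normB _ _)); rewrite addrC /K mulrDr; apply: lerD.
  exact: functional_bound.
apply: (le_trans (cauchy_schwarz_norm mJ lJ Lb)).
rewrite ler_wpM2r ?sqrtr_ge0// -(ger0_norm e0') -sqrtr_sqr ler_sqrt ?sqr_ge0//.
exact: ltW.
Qed.

Lemma rect_fin (a b c d : R) : (leb2 (`]a, b[ `*` `]c, d[) < +oo)%E.
Proof.
rewrite leb2X; [|exact: measurable_itv|exact: measurable_itv].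
by rewrite lte_mul_pinfty ?mu_oo// ge0_fin_numE ?mu_oo.
Qed.

(** Cauchy-Schwarz on each segment, then Fubini. *)
Lemma section_L2 (x0 x1 : R) (J : set R) (h : R * R -> R) : x0 <= x1 ->
  measurable (J : set mR) -> (leb1 J < +oo)%E ->
  L2 leb2 (`]x0, x1[ `*` J) h ->
  [/\ L2 leb1 J (fun y => \int[leb1]_(x in `]x0, x1[) h (x, y)),
      sq leb1 J (fun y => \int[leb1]_(x in `]x0, x1[) h (x, y)) <=
       (x1 - x0) * sq leb2 (`]x0, x1[ `*` J) h &
      \int[leb1]_(y in J) \int[leb1]_(x in `]x0, x1[) h (x, y) =
       \int[leb2]_(p in `]x0, x1[ `*` J) h p].
Proof.
move=> x01 mJ fJ Lh; have mI : measurable (`]x0, x1[%classic : set mR) by exact: measurable_itv.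
have mIJ := measurableX mI mJ.
have fIJ : (leb2 (`]x0, x1[ `*` J) < +oo)%E.
  by rewrite leb2X//; rewrite lte_mul_pinfty ?mu_oo// ge0_fin_numE ?mu_oo.
have Ih := L2_int mIJ fIJ Lh; have Ih2 := L2_sqr_int mIJ Lh.
have [ae1 I1 E1] := fubini_y mI mJ Ih; have [ae2 I2 E2] := fubini_y mI mJ Ih2.
set G := fun y => _ in I1 *.
have mG : measurable_fun J G by apply/measurable_EFinP; exact: measurable_int I1.
have IZ : leb1.-integrable J (EFin \o (fun y => (x1 - x0) * \int[leb1]_(x in `]x0, x1[) h (x, y) ^+ 2)).
  exact: rintZ.
have aeb : {ae leb1, forall y, J y ->
   (G y) ^+ 2 <= (x1 - x0) * \int[leb1]_(x in `]x0, x1[) h (x, y) ^+ 2}.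
  apply: ae_imp2 ae1 ae2 => y a1 a2 Jy.
  rewrite -(fine_mu_oo x01); apply: cauchy_schwarz1 => //; first exact: mu_oo.
  apply/L2P => //; split; last exact: a2.
  by apply/measurable_EFinP; exact: measurable_int (a1 Jy).
have pos y : 0 <= (x1 - x0) * \int[leb1]_(x in `]x0, x1[) h (x, y) ^+ 2.
  by rewrite mulr_ge0 ?subr_ge0//; apply: Rintegral_ge0 => x _; rewrite sqr_ge0.
have leE : (\int[leb1]_(y in J) (G y ^+ 2)%:E <=
   \int[leb1]_(y in J) ((x1 - x0) * \int[leb1]_(x in `]x0, x1[) h (x, y) ^+ 2)%:E)%E.
  apply: ae_ge0_le_integral => //.
  - by move=> y _; rewrite lee_fin sqr_ge0.
  - by apply/measurable_EFinP; apply: measurable_funX.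
  - by move=> y _; rewrite lee_fin.
  - exact: measurable_int IZ.
have IG2 : leb1.-integrable J (EFin \o (fun y => G y ^+ 2)).
  apply/integrableP; split; first by apply/measurable_EFinP; apply: measurable_funX.
  under eq_integral do rewrite gee0_abs ?lee_fin ?sqr_ge0//.
  by apply: (le_lt_trans leE); exact: integrable_lty.
split => //; first by apply/L2P.
rewrite /sq E2 -RintegralZl//; apply: fine_le => //; exact: integrable_fin_num.
Qed.

Lemma L2_swap D (h : mP -> R) : measurable D -> L2 leb2 D h ->
  L2 leb2 (pswap (R:=R) @^-1` D) (h \o pswap (R:=R)) /\
  sq leb2 (pswap (R:=R) @^-1` D) (h \o pswap (R:=R)) = sq leb2 D h.
Proof.
move=> mD Lh.
have mS : measurable (pswap (R:=R) @^-1` D : set mP).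
  by rewrite -[X in measurable X]setTI; exact: measurable_pswap.
have mh := L2_meas mD Lh; have Ih := L2_sqr_int mD Lh.
split.
  apply/L2P => //; split; last exact: (integrable_swap mD Ih).
  exact: (mp_measurable (@measurable_pswap R)).
by rewrite /sq [RHS]Rint_swap//; apply: measurable_funX.
Qed.

Lemma theta_bound (m k x0 x1 : R) :
  (forall x, x \in `]x0, x1[ -> `|m * x + k| <= `|m| * (`|x0| + `|x1|) + `|k|) /\
  measurable_fun setT (fun p : mP => m * p.1 + k).
Proof.
split => [x|].
  rewrite in_itv/= => /andP[a b].
  apply: (le_trans (ler_normD _ _)); rewrite lerD2r normrM ler_wpM2l//.
  have := ler_norm (- x0); rewrite normrN; have := ler_norm x1.
  by have := normr_ge0 x0; have := normr_ge0 x1; rewrite ler_norml; lra.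
apply: continuous_measurable2.
apply: (@continuous_fst_comp _ (fun x => m * x + k)) => x.
by apply: (@continuousD _ R^o _ (fun x : R => m * x) (fun=> k));
  [exact: mulrl_continuous|exact: cst_continuous].
Qed.

(** The integrand is the derivative in [x] of the product of [w] and the affine
    function [m x + k]. *)
Lemma jet_sections (x0 x1 : R) (J : set R) D w (m k : R) :
  measurable D -> measurable (J : set mR) -> `]x0, x1[ `*` J `<=` D ->
  L2jet D w -> L2 leb2 (`]x0, x1[ `*` J)
    (fun p => m * w p + (m * p.1 + k) * jdx w p).
Proof.
move=> mD mJ sD [w0 w1 _].
have mI : measurable (`]x0, x1[%classic : set mR) by exact: measurable_itv.
have mIJ := measurableX mI mJ; have [bt mt] := theta_bound m k x0 x1.
apply: L2D => //; first by apply: L2Z => //; exact: L2_sub w0.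
apply: (L2_bmul mIJ _ _ (L2_sub mD mIJ sD w1)); first exact: measurable_funTS.
by move=> [x y] [/= hx _]; exact: bt.
Qed.

(** The trace of [w] on one vertical side of the rectangle [(x0, x1) x J] is the
    integral over horizontal segments of the derivative of [theta w], the affine
    function [theta] being 1 on that side and 0 on the opposite one (up to the
    sign coming from the orientation). This gives the existence of the trace. *)
Lemma trace_exists_x (x0 x1 c : R) (J : set R) D w (m k : R) (phi : nat -> R * R -> R) :
  x0 < x1 -> measurable D -> measurable (J : set mR) -> (leb1 J < +oo)%E ->
  `]x0, x1[ `*` J `<=` D -> L2jet D w ->
  (forall v : R -> R, (m * x1 + k) * v x1 - (m * x0 + k) * v x0 = v c) ->
  (forall n, Ck 1 (phi n)) ->
  H1norm D (jet_sub (jet_of (phi n)) w) @[n --> \oo] --> 0%E ->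
  let g y := \int[leb1]_(x in `]x0, x1[) (m * w (x, y) + (m * x + k) * jdx w (x, y)) in
  is_trace D (vsegment c) J w g /\
  \int[leb1]_(y in J) g y =
    \int[leb2]_(p in `]x0, x1[ `*` J) (m * w p + (m * p.1 + k) * jdx w p).
Proof.
move=> x01 mD mJ fJ sD Lw Hc C1phi cv g.
have [Lg _ Eg] := section_L2 (ltW x01) mJ fJ (jet_sections m k mD mJ sD Lw).
have mI : measurable (`]x0, x1[%classic : set mR) by exact: measurable_itv.
have mIJ := measurableX mI mJ.
have fIJ : (leb2 (`]x0, x1[ `*` J) < +oo)%E.
  by rewrite leb2X//; rewrite lte_mul_pinfty ?mu_oo// ge0_fin_numE ?mu_oo.
have C1t : C1pair (fun x : R => m * x + k) (fun=> m).
  apply: C1pair_eq (C1pairD (C1pairZ m (C1pair_id R)) (C1pair_cst k)) => x //=.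
  by rewrite mulr1 addr0.
split=> //; split; first exact: Lg.
exists phi; split => //.
have key n e : 0 < e -> (H1norm D (jet_sub (jet_of (phi n)) w) < e%:E)%E ->
    (L2norm leb1 J (fun s => phi n (vsegment c s) - g s)%R <=
      (Num.sqrt ((x1 - x0) * (2 * m ^+ 2 + 2 * (`|m| * (`|x0| + `|x1|) + `|k|) ^+ 2)) * e)%:E)%E.
  move=> e0 /(H1norm_C1_close mD Lw (C1phi n))[_ Lphi Lsub [s0 s1 _]].
  set M := _ + `|k|.
  have Hn := jet_sections m k mD mJ sD Lsub.
  have [Ln sn _] := section_L2 (ltW x01) mJ fJ Hn.
  have aeE : {ae leb1, forall y, J y ->
     \int[leb1]_(x in `]x0, x1[) (m * jet_sub (jet_of (phi n)) w (x, y) +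
        (m * x + k) * jdx (jet_sub (jet_of (phi n)) w) (x, y)) =
     phi n (vsegment c y) - g y}.
    have [ae1 _ _] := fubini_y mI mJ (L2_int mIJ fIJ (jet_sections m k mD mJ sD Lw)).
    apply: ae_imp ae1 => y Iw Jy.
    have hC := C1pairM C1t (C1_slice_x y (C1phi n)).
    have := FTC_oo x01 hC; rewrite /= (Hc (fun x => phi n (x, y))) => E.
    rewrite -[phi n _]/(phi n (c, y)) -E /g -RintegralB//; last exact: Iw.
      by apply: eq_Rintegral => x _ /=; rewrite /vsegment; lra.
    exact: cont_int_oo hC.2.
  have [|L' s'] := L2_ae mJ _ Ln (ae_imp (fun y h Jy => esym (h Jy)) aeE).
    apply: measurable_funB; last exact: L2_meas Lg.
    apply: measurable_funTS; apply: continuous_measurable_fun => y.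
    apply: (@continuous_comp R _ _ (fun y : R => (c, y)) (phi n) y (@continuous_pairr R c y)).
    exact: (Ck_cont (C1phi n)).
  apply: sq_L2norm => //; first by rewrite mulr_ge0 ?sqrtr_ge0// ltW.
  rewrite s' (le_trans sn)// exprMn sqr_sqrtr; last first.
    by rewrite mulr_ge0 ?subr_ge0 ?(ltW x01)// addr_ge0// mulr_ge0// sqr_ge0.
  rewrite -mulrA ler_wpM2l ?subr_ge0 ?(ltW x01)//.
  move: Lsub => [l0 l1 _].
  have l0' := L2_sub mD mIJ sD l0; have l1' := L2_sub mD mIJ sD l1.
  have [bt mt] := theta_bound m k x0 x1.
  have l1'' : L2 leb2 (`]x0, x1[ `*` J) (fun p => (m * p.1 + k) * jdx (jet_sub (jet_of (phi n)) w) p).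
    apply: (@L2_bmul _ _ _ _ _ (fun p : mP => m * p.1 + k) _ M) => //.
      exact: measurable_funTS.
    by move=> [x y] [/= hx _]; exact: bt.
  apply: (le_trans (sqD_le mIJ (L2Z m mIJ l0') l1'')).
  rewrite sqZ//.
  have sq1 : sq leb2 (`]x0, x1[ `*` J) (fun p => (m * p.1 + k) * jdx (jet_sub (jet_of (phi n)) w) p)
     <= M ^+ 2 * sq leb2 (`]x0, x1[ `*` J) (jdx (jet_sub (jet_of (phi n)) w)).
    rewrite -sqZ//.
    have [] // := le_sq mIJ (L2Z M mIJ l1') (L2_meas mIJ l1'').
    move=> [x y] [/= hx _]; rewrite !normrM ler_wpM2r// (le_trans (bt _ hx))//; exact: ler_norm.
  have sub0 := sq_subset mD mIJ sD l0; have sub1 := sq_subset mD mIJ sD l1.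
  have m2 := sqr_ge0 m; have M2 := sqr_ge0 M.
  have := ler_wpM2l m2 (le_trans sub0 s0); have := ler_wpM2l M2 (le_trans sub1 s1).
  move: sq1; clear; set a := sq _ _ _; set b := sq _ _ _; set d := sq _ _ _ => *; lra.
set K := Num.sqrt _ in key.
apply: cvge0_small => [n|d d0]; first exact: L2norm_ge0.
have K0 : 0 <= K by exact: sqrtr_ge0.
have e0 : 0 < d / (K + 1) by rewrite divr_gt0//; lra.
have := cvge_near cv e0; apply: filterS => n hn.
apply: (le_trans (key n _ e0 hn)); rewrite lee_fin mulrA ler_pdivrMr; last lra.
by rewrite mulrC ler_pM2l//; lra.
Qed.

(** The reflection exchanging the coordinates carries the results on vertical
    segments to horizontal ones. *)
Definition jswap w : jet R :=
  Jet (w \o pswap (R:=R)) (jdy w \o pswap (R:=R)) (jdx w \o pswap (R:=R)).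

Lemma Ck1_pswap (phi : R * R -> R) : Ck 1 phi ->
  Ck 1 (phi \o pswap (R:=R)) /\ jet_of (phi \o pswap (R:=R)) = jswap (jet_of phi).
Proof.
move=> [c0 [d1 d2 [c1 _] [c2 _]]].
have cs : continuous (pswap (R:=R)).
  by move=> p; apply: (@cvg_pair _ R R (nbhs p) (nbhs p.2) (nbhs p.1) _ _ _ snd fst);
    [exact: cvg_snd|exact: cvg_fst].
have h1 (p : R * R) : is_derive p (e1 R) (phi \o pswap (R:=R)) ('D_(e2 R) phi (pswap p)).
  by case: p => x y; apply: derive_slice_xE; exact: (derive_slice_y (d2 (y, x))).
have h2 (p : R * R) : is_derive p (e2 R) (phi \o pswap (R:=R)) ('D_(e1 R) phi (pswap p)).
  by case: p => x y; apply: derive_slice_yE; exact: (derive_slice_x (d1 (y, x))).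
have E1 : (fun p => 'D_(e1 R) (phi \o pswap (R:=R)) p) = (fun p => 'D_(e2 R) phi (pswap p)).
  by apply/funext => p; case: (h1 p).
have E2 : (fun p => 'D_(e2 R) (phi \o pswap (R:=R)) p) = (fun p => 'D_(e1 R) phi (pswap p)).
  by apply/funext => p; case: (h2 p).
split; last exact: (f_equal2 (Jet (phi \o pswap (R:=R))) E1 E2).
have cc (f : R * R -> R) : continuous f -> continuous (fun p => f (pswap p)).
  by move=> cf p; apply: (@continuous_comp _ _ _ (pswap (R:=R)) f p (cs p)); exact: cf.
split; first exact: cc c0.
split; first by move=> p; case: (h1 p).
- by move=> p; case: (h2 p).
- by rewrite E1; split; [exact: cc c2|exact: I].
- by rewrite E2; split; [exact: cc c1|exact: I].
Qed.

Lemma L2norm_pswap D (f : mP -> R) : measurable D -> measurable_fun D f ->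
  L2norm leb2 (pswap (R:=R) @^-1` D) (f \o pswap (R:=R)) = L2norm leb2 D f.
Proof.
move=> mD mf.
have mS : measurable (pswap (R:=R) @^-1` D : set mP).
  by rewrite -[X in measurable X]setTI; exact: measurable_pswap.
rewrite !L2normE//; congr (_ `^ _)%E.
rewrite [RHS](mp_integral (@measurable_pswap R) (@leb2_swap R) mD)//.
by apply/measurable_EFinP; exact: measurable_funX.
Qed.

Lemma is_trace_pswap D (c : R) (J : set R) w g : measurable D -> L2jet D w ->
  is_trace (pswap (R:=R) @^-1` D) (vsegment c) J (jswap w) g ->
  is_trace D (hsegment c) J w g.
Proof.
move=> mD [w0 w1 w2] [Lg [phi [C1phi cvD cvJ]]]; split => //.
exists (fun n => phi n \o pswap (R:=R)); split.
- by move=> n; case: (Ck1_pswap (C1phi n)).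
- rewrite (_ : (fun n => _) = (fun n => H1norm (pswap (R:=R) @^-1` D) (jet_sub (jet_of (phi n)) (jswap w))))//.
  apply/funext => n; have [_ ->] := Ck1_pswap (C1phi n).
  have [m0 m1 m2] := Ck_meas D (Ck1_pswap (C1phi n)).1.
  have [C1s Es] := Ck1_pswap (C1phi n).
  have E1 : (fun p => 'D_(e1 R) (phi n \o pswap (R:=R)) p) = (fun p => 'D_(e2 R) (phi n) (pswap p)).
    exact: (congr1 (@jdx R) Es).
  have E2 : (fun p => 'D_(e2 R) (phi n \o pswap (R:=R)) p) = (fun p => 'D_(e1 R) (phi n) (pswap p)).
    exact: (congr1 (@jdy R) Es).
  have K (f h : mP -> R) : measurable_fun D (f \o pswap (R:=R)) -> measurable_fun D h ->
     L2norm leb2 D (fun p => f (pswap p) - h p) =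
     L2norm leb2 (pswap (R:=R) @^-1` D) (fun p => f p - h (pswap p)).
    move=> mf mh; rewrite -L2norm_pswap//; last exact: measurable_funB.
    by congr (L2norm _ _ _); apply/funext => -[x y].
  rewrite /H1norm -!addeA; congr (_ + _)%E; last rewrite addeC; [|congr (_ + _)%E].
  + by apply: K => //; exact: L2_meas w0.
  + by apply: K; [rewrite E2 in m2; exact: m2|exact: L2_meas w2].
  + by apply: K; [rewrite E1 in m1; exact: m1|exact: L2_meas w1].
- exact: cvJ.
Qed.

Lemma trace_exists_y (y0 y1 c : R) (J : set R) D w (m k : R) (phi : nat -> R * R -> R) :
  y0 < y1 -> measurable D -> measurable (J : set mR) -> (leb1 J < +oo)%E ->
  J `*` `]y0, y1[ `<=` D -> L2jet D w ->
  (forall v : R -> R, (m * y1 + k) * v y1 - (m * y0 + k) * v y0 = v c) ->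
  (forall n, Ck 1 (phi n)) ->
  H1norm D (jet_sub (jet_of (phi n)) w) @[n --> \oo] --> 0%E ->
  let g x := \int[leb1]_(y in `]y0, y1[) (m * w (x, y) + (m * y + k) * jdy w (x, y)) in
  is_trace D (hsegment c) J w g /\
  \int[leb1]_(x in J) g x =
    \int[leb2]_(p in J `*` `]y0, y1[) (m * w p + (m * p.2 + k) * jdy w p).
Proof.
move=> y01 mD mJ fJ sD Lw Hc C1phi cv g.
have mS : measurable (pswap (R:=R) @^-1` D : set mP).
  by rewrite -[X in measurable X]setTI; exact: measurable_pswap.
have mI : measurable (`]y0, y1[%classic : set mR) by exact: measurable_itv.
have mJI := measurableX mJ mI.
have sS : `]y0, y1[ `*` J `<=` pswap (R:=R) @^-1` D.
  by move=> [x y] [hx hy]; apply: sD; split.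
have Ls : L2jet (pswap (R:=R) @^-1` D) (jswap w).
  by move: Lw => [w0 w1 w2]; split; [exact: (L2_swap mD w0).1|exact: (L2_swap mD w2).1|
    exact: (L2_swap mD w1).1].
have C1s n := (Ck1_pswap (C1phi n)).1.
have cvs : H1norm (pswap (R:=R) @^-1` D) (jet_sub (jet_of (phi n \o pswap (R:=R))) (jswap w))
    @[n --> \oo] --> 0%E.
  rewrite (_ : (fun n => _) = (fun n => H1norm D (jet_sub (jet_of (phi n)) w)))//.
  apply/funext => n; have [_ ->] := Ck1_pswap (C1phi n).
  have [m0 m1 m2] := Ck_meas D (C1phi n); move: Lw => [w0 w1 w2].
  have K (f h : mP -> R) : measurable_fun D f -> L2 leb2 D h ->
     L2norm leb2 (pswap (R:=R) @^-1` D) (fun p => f (pswap p) - h (pswap p)) =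
     L2norm leb2 D (fun p => f p - h p).
    move=> mf /(L2_meas mD) mh; apply: (L2norm_pswap mD (f := fun p => f p - h p)).
    exact: measurable_funB.
  rewrite /H1norm -!addeA; congr (_ + _)%E; last rewrite addeC; [|congr (_ + _)%E].
  + exact: (K _ _ m0 w0).
  + exact: (K _ _ m1 w1).
  + exact: (K _ _ m2 w2).
have [T E] := trace_exists_x y01 mS mJ fJ sS Ls Hc C1s cvs.
split; first exact: is_trace_pswap T.
rewrite [RHS]Rint_swap//; last first.
  move: Lw => [w0 _ w2]; apply: measurable_funD.
    by apply: measurable_funM => //; exact: (measurable_funS mD sD (L2_meas mD w0)).
  apply: measurable_funM; last exact: (measurable_funS mD sD (L2_meas mD w2)).
  apply: measurable_funTS.
  exact: (measurableT_comp (theta_bound m k y0 y1).2 (@measurable_pswap R)).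
by rewrite swapX; exact: E.
Qed.

End TraceTheory.

(** * The cell and the macroscopic domain *)

Lemma Rint_split d (X : measurableType d) (R : realType) (mu : {measure set X -> \bar R})
    (D A B : set X) (f : X -> R) :
  measurable D -> measurable A -> measurable B -> A `<=` D -> B `<=` D ->
  [disjoint A & B] -> mu (D `\` (A `|` B)) = 0%E -> mu.-integrable D (EFin \o f) ->
  \int[mu]_(x in D) f x = \int[mu]_(x in A) f x + \int[mu]_(x in B) f x.
Proof.
move=> mD mA mB AD BD AB null If; have mAB := measurableU _ _ mA mB.
have ABD : A `|` B `<=` D by move=> x [/AD|/BD].
rewrite -Rintegral_setU//; last exact: integrableS If.
rewrite {1}/Rintegral (negligible_integral (measurableD mD mAB) mD If null).
by congr (fine (integral _ _ _)); rewrite setDD setIC; exact/setIidPl.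
Qed.

Section Geometry.
Context (R : realType).
Local Notation mR := (measurableTypeR R).
Local Notation mP := (measurableTypeR R * measurableTypeR R)%type.
Local Notation leb1 := (lebesgue1 R).
Local Notation leb2 := (lebesgue2 R).
Local Notation Y := (`]- 2^-1, 2^-1[%classic : set R).

Lemma OmegaE : @Omega R = `]-1, 1[ `*` `]- 2^-1, 2^-1[.
Proof.
by apply/seteqP; split => -[x y]; rewrite /Omega /= !in_itv/=.
Qed.

Lemma Omega_minusE : @Omega_minus R = `]-1, 0[ `*` `]- 2^-1, 2^-1[.
Proof.
rewrite /Omega_minus OmegaE; apply/seteqP; split => -[x y]; rewrite /= !in_itv/=.
  by move=> [[/andP[-> _] ->] ->].
by move=> [/andP[h1 h2] ->]; rewrite h1 h2 (lt_trans h2 ltr01).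
Qed.

Lemma Omega_plusE : @Omega_plus R = `]0, 1[ `*` `]- 2^-1, 2^-1[.
Proof.
rewrite /Omega_plus OmegaE; apply/seteqP; split => -[x y]; rewrite /= !in_itv/=.
  by move=> [[/andP[_ ->] ->] ->].
by move=> [/andP[h1 h2] ->]; rewrite h1 h2 (lt_trans _ h1)// ltrN10.
Qed.

Lemma measurable_rect (a b c d : R) : measurable (`]a, b[ `*` `]c, d[ : set mP).
Proof. by apply: measurableX; exact: measurable_itv. Qed.

Lemma measurable_Omega : measurable (@Omega R : set mP).
Proof. by rewrite OmegaE; exact: measurable_rect. Qed.

Lemma measurable_Omega_minus : measurable (@Omega_minus R : set mP).
Proof. by rewrite Omega_minusE; exact: measurable_rect. Qed.

Lemma measurable_Omega_plus : measurable (@Omega_plus R : set mP).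
Proof. by rewrite Omega_plusE; exact: measurable_rect. Qed.

Lemma Omega_fin (D : set mP) : measurable D -> D `<=` @Omega R -> (leb2 D < +oo)%E.
Proof.
move=> mD DO; apply: (@le_lt_trans _ _ (leb2 (@Omega R))).
  by apply: le_measure; rewrite ?inE//; exact: measurable_Omega.
by rewrite OmegaE; exact: rect_fin.
Qed.

Lemma cont_bounded_Omega (f : R * R -> R) : continuous f ->
  exists2 M, 0 <= M & forall p, Omega p -> `|f p| <= M.
Proof.
move=> cf.
have cK : compact (`[-1, 1]%classic `*` `[- 2^-1, 2^-1]%classic : set (R * R)).
  by apply: compact_setX; exact: segment_compact.
have := continuous_compact (continuous_subspaceT cf) cK.
move=> /compact_bounded[M [_ hM]]; exists (`|M| + 1); first by rewrite addr_ge0.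
move=> [x y]; rewrite OmegaE => -[/= hx hy]; apply: (hM (`|M| + 1)).
  by rewrite (le_lt_trans (ler_norm M))// ltrDl.
by exists (x, y) => //; split; exact: subset_itv_oo_cc.
Qed.

Lemma cont_L2 (D : set mP) (f : R * R -> R) : measurable D -> D `<=` @Omega R ->
  continuous f -> L2 leb2 D f.
Proof.
move=> mD DO cf; have [M _ hM] := cont_bounded_Omega cf.
apply: (@L2_bounded _ _ _ _ _ _ M) => //; first exact: Omega_fin.
  by apply: measurable_funTS; exact: continuous_measurable2.
by move=> p /DO; exact: hM.
Qed.

Lemma C1_L2jet (D : set mP) (phi : R * R -> R) : measurable D -> D `<=` @Omega R ->
  Ck 1 phi -> L2jet D (jet_of phi).
Proof.
move=> mD DO [c0 [_ _ [c1 _] [c2 _]]].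
by split; [exact: cont_L2 c0|exact: cont_L2 c1|exact: cont_L2 c2].
Qed.

Lemma itvN11 : (-1 : R) < 1. Proof. lra. Qed.
Lemma itvNhh : (- 2^-1 : R) < 2^-1. Proof. lra. Qed.

Lemma derive_supp (K : set (R * R)) (f : R * R -> R) e :
  compact K -> (forall p, ~ K p -> f p = 0) -> forall p, ~ K p -> 'D_e f p = 0.
Proof.
move=> cK f0 p Kp.
have oK : open (~` K) by apply: closed_openC; apply: compact_closed => //; exact: norm_hausdorff.
have := near_eq_derive (g := cst 0) (f := f) (a := p) e; rewrite derive_cst; apply.
by apply: filterS (open_nbhs_nbhs (conj oK Kp)) => q /f0.
Qed.

(** The support lies in [D], which can therefore be replaced by the rectangle
    [Omega] whatever the shape of [D]. *)
Lemma supp_integral0 (K D : set (R * R)) (f : R * R -> R) : compact K -> K `<=` D ->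
  measurable (D : set mP) ->
  D `<=` @Omega R -> Ck 1 f -> (forall p, ~ K p -> f p = 0) ->
  \int[leb2]_(p in D) 'D_(e1 R) f p = 0 /\ \int[leb2]_(p in D) 'D_(e2 R) f p = 0.
Proof.
move=> cK KD mD DO C1f f0; have mO := measurable_Omega.
have [L0 L1 L2'] := C1_L2jet mO (fun p h => h) C1f.
have fO := Omega_fin mO (fun p h => h).
have E e : L2 leb2 Omega ('D_e f) ->
   \int[leb2]_(p in D) 'D_e f p = \int[leb2]_(p in Omega) 'D_e f p.
  move=> Le; have -> : \int[leb2]_(p in D) 'D_e f p = \int[leb2]_(p in Omega `&` D) 'D_e f p.
    by rewrite (setIidr DO).
  rewrite Rintegral_mkcondr; apply: eq_Rintegral => p _; rewrite patchE.
  case: ifPn => // /negP pD; rewrite (derive_supp e cK f0)// => /KD Dp.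
  by apply: pD; exact/mem_set.
have out (x y : R) : ~ Omega (x, y) -> f (x, y) = 0 by move=> h; apply: f0 => /KD /DO.
have mI (a b : R) : measurable (`]a, b[%classic : set mR) by exact: measurable_itv.
split.
- have I := L2_int mO fO L1; rewrite (E _ L1); rewrite OmegaE in I; rewrite OmegaE.
  have := ibp_rect_x (phi := f) (b := fun=> 1) itvN11 (mI (- 2^-1) 2^-1) C1f (C1pair_cst (1 : R)).
  rewrite (_ : (fun p => _) = 'D_(e1 R) f); last by apply/funext => p; rewrite !mulr1 mulr0 addr0.
  move=> /(_ I) ->; rewrite (_ : (fun y => _) = fun=> 0).
    by rewrite Rintegral_cst// mul0r.
  by apply/funext => y; rewrite !out ?mulr0 ?subrr ?mul0r// /Omega /= ltxx => -[]; rewrite ?andbF.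
- have I := L2_int mO fO L2'; rewrite (E _ L2'); rewrite OmegaE in I; rewrite OmegaE.
  have := ibp_rect_y (phi := f) (b := fun=> 1) itvNhh (mI (-1) 1) C1f (C1pair_cst (1 : R)).
  rewrite (_ : (fun p => _) = 'D_(e2 R) f); last by apply/funext => p; rewrite !mulr1 mulr0 addr0.
  move=> /(_ I) ->; rewrite (_ : (fun y => _) = fun=> 0).
    by rewrite Rintegral_cst// mul0r.
  by apply/funext => y; rewrite !out ?mulr0 ?subrr ?mul0r// /Omega /= ltxx => -[] _; rewrite ?andbF.
Qed.

(** The product with a test function is again C^1 with compact support, and the
    integral of its derivatives vanishes. *)
Lemma H1_of_C1 (D : set mP) (phi : R * R -> R) : measurable D -> D `<=` @Omega R ->
  Ck 1 phi -> H1 D (jet_of phi).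
Proof.
move=> mD DO C1phi; have [l0 l1 l2] := C1_L2jet mD DO C1phi.
have WP psi : test_function D psi ->
    (\int[leb2]_(p in D) (phi p * 'D_(e1 R) psi p) = - (\int[leb2]_(p in D) ('D_(e1 R) phi p * psi p))) /\
    (\int[leb2]_(p in D) (phi p * 'D_(e2 R) psi p) = - (\int[leb2]_(p in D) ('D_(e2 R) phi p * psi p))).
  move=> [/(_ 1%N) C1psi [K [cK KD psi0]]].
  have [m0 m1 m2] := C1_L2jet mD DO C1psi.
  have [C1f E1 E2] := C1M C1phi C1psi.
  have [] := supp_integral0 cK KD mD DO C1f.
    by move=> p /psi0 ->; rewrite mulr0.
  rewrite E1 E2 => i1 i2; split.
  - have := i1; rewrite RintegralD//; first by move/eqP; rewrite addr_eq0 => /eqP.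
      exact: (L2_mul_int mD l0 m1).
    exact: (L2_mul_int mD l1 m0).
  - have := i2; rewrite RintegralD//; first by move/eqP; rewrite addr_eq0 => /eqP.
      exact: (L2_mul_int mD l0 m2).
    exact: (L2_mul_int mD l2 m0).
split; [exact: l0|by split|by move=> psi /WP[h _]; exact: h|by move=> psi /WP[_ h]; exact: h].
Qed.

Lemma L2norm_sub0 d (X : measurableType d) (mu : {measure set X -> \bar R}) (D : set X)
  (f : X -> R) : measurable D -> L2norm mu D (fun p => f p - f p) = 0%E.
Proof.
move=> mD; rewrite L2normE// (_ : (fun x => _) = fun=> 0%E).
  by rewrite integral0 [LHS]poweR_EFin powR0// invr_eq0 pnatr_eq0.
by apply/funext => x; rewrite subrr expr0n.
Qed.

Lemma is_trace_C1 (D : set mP) (c : R -> R * R) (J : set R) (phi : R * R -> R) :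
  measurable D -> measurable (J : set mR) -> Ck 1 phi -> L2 leb1 J (phi \o c) ->
  is_trace D c J (jet_of phi) (phi \o c).
Proof.
move=> mD mJ C1phi Lc; split => //; exists (fun=> phi); split => //.
- rewrite (_ : (fun n => _) = fun=> 0%E); first exact: cvg_cst.
  by apply/funext => n; rewrite /H1norm /= !L2norm_sub0// !adde0.
- rewrite (_ : (fun n => _) = fun=> 0%E); first exact: cvg_cst.
  by apply/funext => n; rewrite /= L2norm_sub0.
Qed.

Section Cell.
Variables (alpha eps : R).
Hypotheses (a0 : 0 < alpha) (a1 : alpha < 1) (eps0 : 0 < eps) (eps1 : eps < 1).

(** The heights at which the line [x = 0] is not covered by the crack. *)
Definition gap : set R := [set y | alpha * eps / 2 < `|y| < eps / 2].
Definition cell_left : set (R * R) := `]-1, 0[ `*` gap.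
Definition cell_right : set (R * R) := `]0, 1[ `*` `]- (eps / 2), eps / 2[.
Local Notation D := (crack_cell alpha eps).
Local Notation k := (alpha * eps / 2).
Local Notation h := (eps / 2).

Lemma k_lt_h : 0 < k /\ k < h.
Proof.
have ae : 0 < alpha * eps by rewrite mulr_gt0.
have : alpha * eps < 1 * eps by rewrite ltr_pM2r.
by rewrite mul1r => *; split; lra.
Qed.

Lemma gapE : gap = `]- h, - k[%classic `|` `]k, h[%classic.
Proof.
have [k0 kh] := k_lt_h.
apply/seteqP; split => y; rewrite /gap /= !in_itv/=.
  have [y0|y0] := leP 0 y; first by rewrite ger0_norm//; right.
  rewrite ltr0_norm//.
  by move=> /andP[y1 y2]; left; apply/andP; split; lra.
case=> /andP[y1 y2].
  by rewrite ltr0_norm; [apply/andP; split; lra|lra].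
by rewrite gtr0_norm; [apply/andP; split; lra|lra].
Qed.

Lemma measurable_gap : measurable (gap : set mR).
Proof. by rewrite gapE; apply: measurableU; exact: measurable_itv. Qed.

Lemma measurable_cell_left : measurable (cell_left : set mP).
Proof. by apply: measurableX; [exact: measurable_itv|exact: measurable_gap]. Qed.

Lemma measurable_cell_right : measurable (cell_right : set mP).
Proof. exact: measurable_rect. Qed.

Lemma crack_cellE : D = [set p | [/\ -1 < p.1, p.1 < 1, `|p.2| < h & p.1 <= 0 -> k < `|p.2|] ].
Proof.
have [k0 kh] := k_lt_h.
apply/seteqP; split => -[x y]; rewrite /crack_cell /=.
  move=> [[/andP[x1 x2] y2] nC]; split => // x0.
  rewrite ltNge; apply/negP => yk; apply: nC; split => //.
  by rewrite x0 andbT ltW.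
move=> [x1 x2 y2 H]; split; first by rewrite x1 x2.
by move=> [/andP[_ x0] yk]; have := H x0; rewrite ltNge yk.
Qed.

Lemma cell_left_sub : cell_left `<=` D.
Proof.
move=> [x y]; rewrite crack_cellE /cell_left /gap /= !in_itv/= => -[/andP[x1 x2] /andP[y1 y2]].
by split => //; rewrite (lt_trans x2 ltr01).
Qed.

Lemma cell_right_sub : cell_right `<=` D.
Proof.
move=> [x y]; rewrite crack_cellE /cell_right /= !in_itv/= => -[/andP[x1 x2] /andP[y1 y2]].
split => //; [by rewrite (lt_trans _ x1)// ltrN10|by rewrite ltr_norml y1 y2|].
by rewrite leNgt x1.
Qed.

Lemma measurable_cell : measurable (D : set mP).
Proof.
apply: measurableD.
  have -> : [set p : R * R | -1 < p.1 < 1 /\ `|p.2| < h] = `]-1, 1[ `*` `]- h, h[.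
    by apply/seteqP; split => -[x y] /=; rewrite !in_itv/= ltr_norml.
  exact: measurable_rect.
have -> : [set p : R * R | -1 <= p.1 <= 0 /\ `|p.2| <= k] = `[-1, 0] `*` `[- k, k].
  by apply/seteqP; split => -[x y] /=; rewrite !in_itv/= ler_norml.
by apply: measurableX; exact: measurable_itv.
Qed.

Lemma cell_Omega : D `<=` @Omega R.
Proof.
move=> [x y]; rewrite crack_cellE => -[/= x1 x2 y2 _]; split; rewrite /= ?x1//.
move: y2; rewrite ltr_norml => /andP[y3 y4].
have eh : eps / 2 < 2^-1 by move: eps1; lra.
by rewrite (lt_trans y4 eh) andbT (lt_trans _ y3)// ltrN2.
Qed.

Lemma cell_fin : (leb2 D < +oo)%E.
Proof. by apply: Omega_fin; [exact: measurable_cell|exact: cell_Omega]. Qed.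

(** The interface inside the cell is contained in a vertical line, a null
    set. *)
Lemma cell_split (f : mP -> R) : leb2.-integrable D (EFin \o f) ->
  \int[leb2]_(p in D) f p =
  \int[leb2]_(p in cell_left) f p + \int[leb2]_(p in cell_right) f p.
Proof.
move=> If; apply: Rint_split => //.
- exact: measurable_cell.
- exact: measurable_cell_left.
- exact: measurable_cell_right.
- exact: cell_left_sub.
- exact: cell_right_sub.
- apply/disj_setPS => -[x y] [] [/= + _] [/= + _]; rewrite !in_itv/=.
  by move=> /andP[_ h1] /andP[h2 _]; have := lt_trans h1 h2; rewrite ltxx.
- apply: (subset_measure0 _ _ _ (leb2_null_vline 0)).
  + apply: measurableD; first exact: measurable_cell.
    by apply: measurableU; [exact: measurable_cell_left|exact: measurable_cell_right].
  + rewrite (_ : [set p : R * R | p.1 = 0] = [set 0] `*` setT).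
      by apply: measurableX.
    by apply/seteqP; split => -[x y] //= [].
  + move=> [x y] [inD nU] /=; apply/eqP; apply: contra_notT nU => /= x0.
    move: inD; rewrite crack_cellE /= => -[x1 x2 y1 H].
    move: x0; rewrite neq_lt => /orP[h1|h1]; [left|right]; split => /=; rewrite ?in_itv/=.
    * by rewrite x1.
    * by rewrite /gap /= y1 andbT H// ltW.
    * by rewrite h1.
    * by rewrite -ltr_norml.
Qed.

Lemma gap_measure : leb1 gap = ((1 - alpha) * eps)%:E.
Proof.
have [k0 kh] := k_lt_h.
rewrite gapE measureU; [|exact: measurable_itv|exact: measurable_itv|]; last first.
  apply/seteqP; split => // y /=; rewrite !in_itv/= => -[/andP[_ h1] /andP[h2 _]]; lra.
have := leb1_itv `]- h, - k[; have := leb1_itv `]k, h[; rewrite /= !lte_fin ltrN2 kh => E1 E2.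
rewrite [X in (X + _)%E]E2 [X in (_ + X)%E]E1 -!EFinB -EFinD; congr EFin; lra.
Qed.

End Cell.

End Geometry.

(** * Profiles and their boundary layers *)

Section Profiles.
Context (R : realType).
Local Notation mR := (measurableTypeR R).
Local Notation mP := (measurableTypeR R * measurableTypeR R)%type.
Local Notation leb1 := (lebesgue1 R).
Local Notation leb2 := (lebesgue2 R).

Definition splice (f g : R -> R) (x : R) := if x <= 0 then f x else g x.

Lemma splice_near (f g : R -> R) (x : R) : x != 0 ->
  (x < 0 /\ {near x, f =1 splice f g}) \/ (0 < x /\ {near x, g =1 splice f g}).
Proof.
rewrite neq_lt => /orP[x0|x0]; [left|right]; split => //.
- have : \forall z \near x, z < 0 by apply: open_nbhs_nbhs; split; [exact: open_lt|].
  by apply: filterS => z z0; rewrite /splice ltW.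
- have : \forall z \near x, 0 < z by apply: open_nbhs_nbhs; split; [exact: open_gt|].
  by apply: filterS => z z0; rewrite /splice leNgt z0.
Qed.

Lemma splice_derive (f f' g g' : R -> R) : (forall x : R, is_derive x (1 : R) f (f' x)) ->
  (forall x : R, is_derive x (1 : R) g (g' x)) -> f 0 = g 0 -> f' 0 = g' 0 ->
  forall x : R, is_derive x (1 : R) (splice f g) (splice f' g' x).
Proof.
move=> df dg fg0 fg1 x; have [->|x0] := eqVneq x 0; last first.
  have [[xl H]|[xl H]] := splice_near f g x0.
  - have -> : splice f' g' x = f' x by rewrite /splice ltW.
    have [d1 d2] := df x; split; first exact: near_eq_derivable H d1.
    by rewrite -d2; apply/esym; apply: near_eq_derive.
  - have -> : splice f' g' x = g' x by rewrite /splice leNgt xl.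
    have [d1 d2] := dg x; split; first exact: near_eq_derivable H d1.
    by rewrite -d2; apply/esym; apply: near_eq_derive.
suff H : (fun h : R => h^-1 *: ((splice f g \o shift 0) (h *: 1) - splice f g 0)) @ 0^' --> splice f' g' 0.
  by split; [apply/cvg_ex; exists (splice f' g' 0)|exact/cvg_lim].
have g00 : splice f g 0 = f 0 by rewrite /splice lexx.
have g01 : splice f' g' 0 = f' 0 by rewrite /splice lexx.
have Hf : (fun h : R => h^-1 *: ((f \o shift 0) (h *: 1) - f 0)) @ 0^' --> splice f' g' 0.
  by rewrite g01; have [d1 d2] := df 0; rewrite -d2; exact: d1.
have Hg : (fun h : R => h^-1 *: ((g \o shift 0) (h *: 1) - g 0)) @ 0^' --> splice f' g' 0.
  by rewrite g01 fg1; have [d1 d2] := dg 0; rewrite -d2; exact: d1.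
move=> A nA.
have hA : \forall h \near 0^', A (h^-1 *: ((f \o shift 0) (h *: (1 : R)) - f 0)) := Hf A nA.
have hB : \forall h \near 0^', A (h^-1 *: ((g \o shift 0) (h *: (1 : R)) - g 0)) := Hg A nA.
apply: filterS2 hA hB => h hf hg /=; rewrite g00 /splice.
by case: ifPn => _; [exact: hf|rewrite fg0; exact: hg].
Qed.

Lemma splice_cont (f g : R -> R) : continuous f -> continuous g -> f 0 = g 0 ->
  continuous (splice f g).
Proof.
move=> cf cg fg0 x A nA.
have [x0|x0] := eqVneq x 0.
  have nf : nbhs (f x) A by move: nA; rewrite x0 /splice lexx.
  have ng : nbhs (g x) A by rewrite x0 -fg0 -{1}x0.
  have hA : \forall z \near x, A (f z) := cf x A nf.
  have hB : \forall z \near x, A (g z) := cg x A ng.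
  by apply: filterS2 hA hB => z ? ? /=; rewrite /splice; case: ifP.
have [[xl H]|[xl H]] := splice_near f g x0.
  have nf : nbhs (f x) A by move: nA; rewrite /splice ltW.
  have hA : \forall z \near x, A (f z) := cf x A nf.
  by apply: filterS2 hA H => z h1 h2; rewrite /= -h2.
have ng : nbhs (g x) A by move: nA; rewrite /splice leNgt xl.
have hA : \forall z \near x, A (g z) := cg x A ng.
by apply: filterS2 hA H => z h1 h2; rewrite /= -h2.
Qed.

Lemma C1pair_splice (f f' g g' : R -> R) : C1pair f f' -> C1pair g g' ->
  f 0 = g 0 -> f' 0 = g' 0 -> C1pair (splice f g) (splice f' g').
Proof.
move=> [df cf] [dg cg] h0 h1; split; first exact: splice_derive.
exact: splice_cont.
Qed.

Lemma C1pairX (a a' : R -> R) n : C1pair a a' ->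
  C1pair (fun x => a x ^+ n.+1) (fun x => n.+1%:R * a x ^+ n * a' x).
Proof.
move=> ha; elim: n => [|n IH].
  by apply: C1pair_eq ha => x /=; rewrite ?expr1 ?expr0 ?mulr1 ?mul1r.
apply: C1pair_eq (C1pairM IH ha) => x /=; first by rewrite [RHS]exprSr.
by rewrite -[in RHS]natr1 !exprSr; ring.
Qed.

Lemma C1pair_1mx : C1pair (fun x : R => 1 - x) (fun=> -1).
Proof.
apply: C1pair_eq (C1pairD (C1pair_cst (1 : R)) (C1pairZ (-1) (C1pair_id R))) => x /=.
  by rewrite mulN1r.
by rewrite add0r mulr1.
Qed.

Lemma int_pow (n : nat) : \int[leb1]_(x in `]0, 1[) (1 - x) ^+ n = n.+1%:R^-1.
Proof.
have n0 : n.+1%:R != 0 :> R by rewrite pnatr_eq0.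
have H : C1pair (fun x : R => - n.+1%:R^-1 * (1 - x) ^+ n.+1) (fun x => (1 - x) ^+ n).
  apply: C1pair_eq (C1pairZ (- n.+1%:R^-1) (C1pairX n C1pair_1mx)) => x //=.
  by rewrite mulrA mulrA mulNr mulVf// mulN1r mulrN1 opprK.
by rewrite (FTC_oo ltr01 H) subrr expr0n /= subr0 expr1n mulr0 mulr1 sub0r opprK.
Qed.

(** The derivative [(1 - x) ^ n] is 1 at 0 and concentrates there as [n] grows,
    while the function itself stays below [1 / (n + 1)] on [0, 1]: adding a
    multiple changes the slope at 0 at a small cost. *)
Definition layer (n : nat) (x : R) := (1 - (1 - x) ^+ n.+1) / n.+1%:R.

Lemma C1pair_layer n : C1pair (layer n) (fun x => (1 - x) ^+ n).
Proof.
have n0 : n.+1%:R != 0 :> R by rewrite pnatr_eq0.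
have := C1pairD (C1pair_cst n.+1%:R^-1) (C1pairZ (- n.+1%:R^-1) (C1pairX n C1pair_1mx)).
apply: C1pair_eq => x; rewrite /layer.
  by rewrite mulNr mulrBl mul1r mulrC.
by rewrite add0r mulrA mulrA mulNr mulVf// mulN1r mulrN1 opprK.
Qed.

Lemma layer0 n : layer n 0 = 0.
Proof. by rewrite /layer subr0 expr1n subrr mul0r. Qed.

Lemma layer_bound n x : 0 <= x <= 1 -> 0 <= layer n x <= n.+1%:R^-1.
Proof.
move=> /andP[x0 x1]; have n0 : 0 < n.+1%:R :> R by rewrite ltr0n.
have p0 : 0 <= (1 - x) ^+ n.+1 by rewrite exprn_ge0// subr_ge0.
have p1 : (1 - x) ^+ n.+1 <= 1 by rewrite exprn_ile1//; lra.
rewrite /layer divr_ge0 ?subr_ge0 ?(ltW n0)//=.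
by rewrite ler_pdivrMr// mulVf ?gt_eqF// gerBl.
Qed.

(** A profile: [f] on the cracked side, [g] on the other one. The conditions are
    those under which [splice f g] is a test function of the homogenized problem
    with no boundary flux and with the flux transmission condition. *)
Record profile (alpha : R) := Profile {
  pf : R -> R; pf1 : R -> R; pf2 : R -> R;
  pg : R -> R; pg1 : R -> R; pg2 : R -> R;
  C1_f : C1pair pf pf1; C1_f1 : C1pair pf1 pf2;
  C1_g : C1pair pg pg1; C1_g1 : C1pair pg1 pg2;
  fg0 : pf 0 = pg 0;
  f1N1 : pf1 (-1) = 0; g11 : pg1 1 = 0;
  flux0 : pg1 0 = (1 - alpha) * pf1 0 }.

Section Test.
Variables (alpha : R) (P : profile alpha) (n : nat).
Let c := pf1 P 0.

(** The slope of [pg] at 0 is [(1 - alpha) c] and that of [pf] is [c]; the layer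
    supplies the missing [alpha c], so that the function is C^1 across the
    interface. *)
Definition ptest := splice (pf P) (fun x => pg P x + alpha * c * layer n x).
Definition ptest1 := splice (pf1 P) (fun x => pg1 P x + alpha * c * (1 - x) ^+ n).

Lemma C1_ptest : C1pair ptest ptest1.
Proof.
apply: C1pair_splice.
- exact: C1_f.
- by apply: C1pairD; [exact: C1_g|apply: C1pairZ; exact: C1pair_layer].
- by rewrite layer0 mulr0 addr0; exact: fg0.
- by rewrite subr0 expr1n mulr1 flux0 -/c; ring.
Qed.

Lemma ptest_diff x : 0 <= alpha <= 1 -> x <= 1 ->
  `|ptest x - splice (pf P) (pg P) x| <= `|c| / n.+1%:R.
Proof.
move=> /andP[a0 a1] x1; rewrite /ptest /splice; case: ifPn => x0.
  by rewrite subrr normr0 mulr_ge0// invr_ge0.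
have /andP[l0 l1] : 0 <= layer n x <= n.+1%:R^-1.
  by apply: layer_bound; rewrite x1 andbT ltW// ltNge.
rewrite addrC addKr 2!normrM (ger0_norm l0) (ger0_norm a0).
apply: ler_pM => //; first exact: mulr_ge0.
exact: ler_piMl.
Qed.

End Test.
End Profiles.

(** * The cracked cell *)

Lemma rint_abs d (X : measurableType d) (R : realType) (mu : {measure set X -> \bar R})
  (D : set X) (f : X -> R) : mu.-integrable D (EFin \o f) ->
  mu.-integrable D (EFin \o (fun x => `|f x|)).
Proof. exact: integrable_abse. Qed.

Lemma leb1_oo (R : realType) (a b : R) : a <= b -> lebesgue1 R `]a, b[%classic = (b - a)%:E.
Proof.
move=> ab; rewrite -(fine_mu_oo ab) fineK// ge0_fin_numE ?mu_oo//.
Qed.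

Section Arithmetic.
Variable R : realType.
Implicit Types (x y m h k K A B C : R).

Lemma itvN10_norm x : x \in `]-1, 0[ -> `|x| <= 1.
Proof. by rewrite in_itv/= ler_norml => /andP[? ?]; apply/andP; split; lra. Qed.

Lemma norm_max0 x y : 0 <= y -> x <= y -> `|Num.max x 0| <= y.
Proof. by move=> y0 xy; rewrite ger0_norm ?le_max ?lexx ?orbT// ge_max xy. Qed.

Lemma norm_min0 x y : 0 <= y -> - y <= x -> `|Num.min x 0| <= y.
Proof.
move=> y0 xy; rewrite ler0_norm ?ge_min ?lexx ?orbT// lerNl le_min xy.
by rewrite oppr_le0.
Qed.

Lemma itv01_norm x : x \in `]0, 1[ -> `|x + -1| <= 1.
Proof. by rewrite in_itv/= ler_norml => /andP[? ?]; apply/andP; split; lra. Qed.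

Lemma cutoff_top m h k y : m * (h - k) = 1 -> 0 < m -> y \in `]k, h[ ->
  `|m * y + - (h * m)| <= 1.
Proof.
move=> mE m0; rewrite in_itv/= => /andP[y0 y1].
have y0' := ler_wpM2l (ltW m0) (ltW y0); have y1' := ler_wpM2l (ltW m0) (ltW y1).
by move: mE y0' y1'; rewrite mulrBr ler_norml (mulrC h) => *; apply/andP; split; lra.
Qed.

Lemma cutoff_bottom m h k y : m * (h - k) = 1 -> 0 < m -> y \in `]- h, - k[ ->
  `|m * y + h * m| <= 1.
Proof.
move=> mE m0; rewrite in_itv/= => /andP[y0 y1].
have y0' := ler_wpM2l (ltW m0) (ltW y0); have y1' := ler_wpM2l (ltW m0) (ltW y1).
by move: mE y0' y1'; rewrite mulrBr !mulrN ler_norml (mulrC h) => *; apply/andP; split; lra.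
Qed.

Lemma young3 K A B C : 4 * K * (A + B + C) <=
  24 * K ^+ 2 + 2^-1 * (A ^+ 2 + B ^+ 2 + C ^+ 2).
Proof.
have := sqr_ge0 (A - 4 * K); have := sqr_ge0 (B - 4 * K); have := sqr_ge0 (C - 4 * K).
by rewrite !sqrrB; lra.
Qed.

Lemma energy_arith (e K S I x1 x2 x3 x4 A s0 s1 s2 : R) :
  x1 <= K * S -> x2 <= K * S -> x3 <= K * S -> x4 <= K * S ->
  4 * K * S <= 24 * K ^+ 2 * A + (s0 + s1 + s2) / 2 -> K ^+ 2 * A <= K ^+ 2 * (2 * e) ->
  I + (s1 + s2) = x1 + (x2 + x3) + x4 -> I + (s1 + s2) / 2 <= s0 / 2 + 48 * K ^+ 2 * e.
Proof. move=> *; lra. Qed.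

End Arithmetic.

Section Cracked.
Context (R : realType).
Local Notation mR := (measurableTypeR R).
Local Notation mP := (measurableTypeR R * measurableTypeR R)%type.
Local Notation leb1 := (lebesgue1 R).
Local Notation leb2 := (lebesgue2 R).
Variables (alpha beta eps : R).
Hypotheses (b0 : 0 <= beta) (ba : beta < alpha) (a1 : alpha < 1).
Hypotheses (eps0 : 0 < eps) (eps1 : eps < 1).
Ltac slra := generalize b0 ba a1 eps0 eps1; lra.
Local Notation D := (crack_cell alpha eps).
Local Notation k := (alpha * eps / 2).
Local Notation h := (eps / 2).
Local Notation cgap := (gap alpha eps).
Local Notation cleft := (cell_left alpha eps).
Local Notation cright := (cell_right eps).

Let a0 : 0 < alpha. Proof. exact: le_lt_trans ba. Qed.
Let kh : 0 < k /\ k < h. Proof. exact: k_lt_h. Qed.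
Let mD : measurable (D : set mP). Proof. exact: measurable_cell. Qed.
Let DO : D `<=` @Omega R. Proof. exact: cell_Omega. Qed.
Let fD : (leb2 D < +oo)%E. Proof. exact: cell_fin. Qed.

(** The weak equation at a fixed time. The test function may be any periodic jet
    of H^1, in particular the solution itself. *)
Definition cell_weak (ut : R * R -> R) (w : jet R) : Prop :=
  forall (phi : jet R) (g1 gtop gbot gb : R -> R),
    H1 D phi -> periodic_y D `]-1, 1[%classic eps phi ->
    is_trace D (vsegment (-1)) cgap phi g1 ->
    is_trace D (hsegment k) `]-1, 0[%classic phi gtop ->
    is_trace D (hsegment (- k)) `]-1, 0[%classic phi gbot ->
    is_trace D (vsegment 0) [set y | `|y| < k] phi gb ->
    heat_form D ut w phi =
      \int[leb1]_(y in cgap) g1 y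
      + (alpha - beta) / 2 * eps *
        (\int[leb1]_(x in `]-1, 0[) gtop x + \int[leb1]_(x in `]-1, 0[) gbot x)
      + beta / alpha * \int[leb1]_(y in [set y | `|y| < k]) gb y.

Lemma bottomE : [set y : R | `|y| < k] = `]- k, k[%classic.
Proof. by apply/seteqP; split => y /=; rewrite in_itv/= ltr_norml. Qed.

Lemma gap_fin : (leb1 cgap < +oo)%E.
Proof. by rewrite gap_measure// ltry. Qed.

Lemma cont_L2_itv (f : R -> R) (a b : R) : continuous f -> L2 leb1 `]a, b[ f.
Proof.
move=> cf; have mI : measurable (`]a, b[%classic : set mR) by exact: measurable_itv.
apply/L2P => //; split.
  by apply: measurable_funTS; exact: continuous_measurable_fun.
apply: cont_int_oo => x; apply: (@continuous_comp _ _ _ f (fun y => y ^+ 2)); first exact: cf.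
exact: exprn_continuous.
Qed.

Lemma cell_area : fine (leb2 D) <= 2 * eps.
Proof.
have E : leb2 (`]-1, 1[ `*` `]- h, h[) = (2 * eps)%:E.
  rewrite leb2X; [|exact: measurable_itv..].
  by rewrite !leb1_oo ?lerN10; [rewrite -EFinM; congr EFin; slra|slra..].
have sub : D `<=` `]-1, 1[ `*` `]- h, h[.
  move=> [x y]; rewrite crack_cellE// => -[/= x1 x2 y1 _].
  by split; rewrite /= in_itv/= ?x1// -ltr_norml.
rewrite -[leRHS]/(fine (2 * eps)%:E) -E; apply: fine_le.
- by rewrite ge0_fin_numE.
- by rewrite E.
- by apply: le_measure; rewrite ?inE//; exact: measurable_rect.
Qed.

(** * The energy inequality *)
Section Energy.
Variables (ut : R * R -> R) (w : jet R).
Hypotheses (H1w : H1 D w) (Lut : L2 leb2 D ut).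
Hypotheses (perw : periodic_y D `]-1, 1[%classic eps w) (weakw : cell_weak ut w).

Let Lw : L2jet D w. Proof. exact: H1_L2jet. Qed.
Let K0 : R := (1 - alpha)^-1.
Let S := \int[leb2]_(p in D) (`|w p| + `|jdx w p| + `|jdy w p|).

Let iabs : [/\ leb2.-integrable D (EFin \o (fun p => `|w p|)),
  leb2.-integrable D (EFin \o (fun p => `|jdx w p|)) &
  leb2.-integrable D (EFin \o (fun p => `|jdy w p|))].
Proof. by move: Lw => [w0 w1 w2]; split; apply: L2_int => //; exact: L2_abs. Qed.

Let iS : leb2.-integrable D (EFin \o (fun p => `|w p| + `|jdx w p| + `|jdy w p|)).
Proof. by move: iabs => [i0 i1 i2]; apply: rintD => //; exact: rintD. Qed.

(* every boundary term is an integral of this kind over a part [E] of the cell,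
   by the formula for the trace *)
Let term_bound (E : set mP) (c : R) (F : R * R -> R) : measurable E -> E `<=` D ->
  leb2.-integrable E (EFin \o F) ->
  (forall p, E p -> `|c * F p| <= K0 * (`|w p| + `|jdx w p| + `|jdy w p|)) ->
  `|c * \int[leb2]_(p in E) F p| <= K0 * S.
Proof.
move=> mE ED iF bF; rewrite -RintegralZl//.
have icF : leb2.-integrable E (EFin \o (fun p => c * F p)) by exact: rintZ.
have iSE := integrableS mD mE ED iS.
apply: (le_trans (le_normr_Rintegral mE icF)).
apply: (@le_trans _ _ (\int[leb2]_(p in E) (K0 * (`|w p| + `|jdx w p| + `|jdy w p|)))).
  apply: le_Rintegral => //; last exact: rintZ.
  exact: rint_abs.
rewrite RintegralZl// ler_wpM2l ?invr_ge0 ?subr_ge0 ?(ltW a1)//.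
apply: fine_le.
- exact: integrable_fin_num.
- exact: integrable_fin_num.
- apply: ge0_subset_integral => //; first by case/integrableP: iS.
Qed.

Let K01 : 1 <= K0.
Proof. by rewrite /K0 -[leLHS]invr1 lef_pV2 ?posrE ?ltr01 ?subr_gt0//; slra. Qed.

Let bnd2 (c m t A B X : R) : `|c * m| <= K0 -> `|c * t| <= K0 -> `|A| + `|B| <= X ->
  `|c * (m * A + t * B)| <= K0 * X.
Proof.
move=> h1 h2 h3; rewrite mulrDr !mulrA; apply: (le_trans (ler_normD _ _)).
rewrite [`|c * m * A|]normrM [`|c * t * B|]normrM.
apply: (@le_trans _ _ (K0 * `|A| + K0 * `|B|)); first by apply: lerD; exact: ler_wpM2r.
by rewrite -mulrDr ler_wpM2l// (le_trans ler01 K01).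
Qed.

Let K0_gt0 : 0 < K0. Proof. by rewrite invr_gt0 subr_gt0. Qed.

Let c2 := (alpha - beta) / 2 * eps.

Let ab1 : 0 <= (alpha - beta) / 2 <= 1. Proof. by slra. Qed.

Let c2p : 0 <= c2 <= 1.
Proof.
case/andP: ab1 => h1 h2; rewrite /c2 mulr_ge0 ?(ltW eps0)//=.
by rewrite mulr_ile1 ?(ltW eps0) ?(ltW eps1).
Qed.

(* the slope of a cutoff across a gap is of order [1 / eps]; the factor [eps] of
   the flux on the horizontal sides compensates it *)
Let c2m_bound (m : R) : m * (h - k) = 1 -> `|c2 * m| <= K0.
Proof.
move=> mE; have -> : c2 * m = (alpha - beta) * K0.
  have q : 1 - alpha != 0 by rewrite gt_eqF// subr_gt0.
  have : m * (1 - alpha) * eps = 2.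
    by transitivity (2 * (m * (h - k))); [field|rewrite mE mulr1].
  move=> qe; apply: (mulIf q); rewrite /K0 /c2.
  transitivity ((alpha - beta) / 2 * (m * (1 - alpha) * eps)); first ring.
  by rewrite qe; field.
rewrite normrM (ger0_norm (ltW K0_gt0)) ger_pMl ?K0_gt0//.
by rewrite ger0_norm; slra.
Qed.

Let jet_sections_y (y0 y1 m q : R) : `]-1, 0[ `*` `]y0, y1[ `<=` D ->
  leb2.-integrable (`]-1, 0[ `*` `]y0, y1[)
    (EFin \o (fun p => m * w p + (m * p.2 + q) * jdy w p)).
Proof.
move=> sD; have mE := @measurable_rect R (-1) 0 y0 y1.
have fE := rect_fin (-1) 0 y0 y1; move: Lw => [w0 _ w2].
have [bt mt] := theta_bound m q y0 y1.
apply: L2_int => //; apply: L2D => //; first by apply: L2Z => //; exact: L2_sub w0.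
apply: (L2_bmul (b := fun p : mP => m * p.2 + q) mE _ _ (L2_sub mD mE sD w2)).
  apply: measurable_funTS; exact: (measurableT_comp mt (@measurable_pswap R)).
by move=> [x y] [/= _ hy]; exact: bt.
Qed.

(** The equation is tested with the solution. Each trace on the boundary is
    written as an integral over an adjacent rectangle, which bounds the boundary
    terms by the integral of [|w| + |grad w|]; Young absorbs half of the squared
    gradient, and the remaining constant is multiplied by the area of the
    cell. *)
Lemma energy : \int[leb2]_(p in D) (ut p * w p) + (sq leb2 D (jdx w) + sq leb2 D (jdy w)) / 2
  <= sq leb2 D w / 2 + 48 * K0 ^+ 2 * eps.
Proof.
have [k0 k1] := kh.
have [gp [[_ [phi [C1phi cv _]]] _]] := perw.
have mI (a b : R) : measurable (`]a, b[%classic : set mR) by exact: measurable_itv.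
have mg : measurable (cgap : set mR) by exact: measurable_gap.
have mb : measurable ([set y | `|y| < k] : set mR) by rewrite bottomE.
have fb : (leb1 [set y | (`|y| < k)%R] < +oo)%E by rewrite bottomE mu_oo.
have hk : 0 < h - k by rewrite subr_gt0.
have [m [mE m0]] : exists m, m * (h - k) = 1 /\ 0 < m.
  by exists (h - k)^-1; rewrite invr_gt0 mulVf// gt_eqF.
have sL : `]-1, 0[ `*` cgap `<=` D by exact: cell_left_sub.
have sT : `]-1, 0[ `*` `]k, h[ `<=` D.
  by move=> [x y] [hx hy]; apply: sL; split => //; rewrite gapE//; right.
have sB : `]-1, 0[ `*` `]- h, - k[ `<=` D.
  by move=> [x y] [hx hy]; apply: sL; split => //; rewrite gapE//; left.
have sC : `]0, 1[ `*` [set y | `|y| < k] `<=` D.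
  move=> [x y] [/= hx hy]; apply: cell_right_sub => //; split => //=.
  by move: hy; rewrite in_itv/= ltr_norml => /andP[? ?]; apply/andP; split; lra.
have [T1 E1] := @trace_exists_x R (-1) 0 (-1) cgap D w 1 0 phi (ltrN10 R) mD mg gap_fin sL Lw
   ltac:(by move=> v; ring) C1phi cv.
have [T2 E2] := @trace_exists_y R k h k `]-1, 0[%classic D w m (- (h * m)) phi k1 mD (mI _ _) (mu_oo _ _) sT Lw
   ltac:(move=> v; transitivity (m * (h - k) * v k); [ring|by rewrite mE mul1r]) C1phi cv.
have [T3 E3] := @trace_exists_y R (- h) (- k) (- k) `]-1, 0[%classic D w m (h * m) phi
   ltac:(by rewrite ltrN2) mD (mI _ _) (mu_oo _ _) sB Lw
   ltac:(move=> v; transitivity (m * (h - k) * v (- k)); [ring|by rewrite mE mul1r]) C1phi cv.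
have [T4 E4] := @trace_exists_x R 0 1 0 [set y | `|y| < k] D w 1 (-1) phi ltr01 mD mb fb sC Lw
   ltac:(by move=> v; ring) C1phi cv.
have := weakw H1w perw T1 T2 T3 T4; rewrite E1 E2 E3 E4 /heat_form.
move: (Lw) => [w0 w1 w2].
rewrite RintegralD//; [|exact: L2_mul_int..].
have sqE f : \int[leb2]_(p in D) (f p * f p) = sq leb2 D f by [].
rewrite (sqE (jdx w)) (sqE (jdy w)).
have mL : measurable (`]-1, 0[ `*` cgap : set mP) by apply: measurableX.
have mC : measurable (`]0, 1[ `*` [set y | `|y| < k] : set mP) by apply: measurableX.
have fO (E : set mP) : measurable E -> E `<=` D -> (leb2 E < +oo)%E.
  by move=> mE' ED; apply: Omega_fin => // p /ED/DO.
have K1 := K01; have K0p := K0_gt0.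
have XA p : `|w p| + `|jdx w p| <= `|w p| + `|jdx w p| + `|jdy w p| by rewrite lerDl.
have XB p : `|w p| + `|jdy w p| <= `|w p| + `|jdx w p| + `|jdy w p| by rewrite addrAC lerDl.
have c2m := c2m_bound mE.
have B1 : `|1 * \int[leb2]_(p in `]-1, 0[ `*` cgap) (1 * w p + (1 * p.1 + 0) * jdx w p)| <= K0 * S.
  apply: (term_bound mL sL); first exact: (L2_int mL (fO _ mL sL) (jet_sections 1 0 mD mg sL Lw)).
  move=> [x y] [/= hx _]; apply: (bnd2 _ _ (XA _)); first by rewrite mulr1 normr1.
  rewrite mul1r mul1r addr0; apply: (le_trans _ K1).
  exact: itvN10_norm.
have B2 : `|c2 * \int[leb2]_(p in `]-1, 0[ `*` `]k, h[) (m * w p + (m * p.2 + - (h * m)) * jdy w p)| <= K0 * S.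
  apply: (term_bound (@measurable_rect R (-1) 0 k h) sT (jet_sections_y m (- (h * m)) sT)).
  move=> [x y] [/= _ hy]; apply: (bnd2 c2m _ (XB _)).
  apply: (le_trans _ K1); rewrite normrM mulr_ile1//.
    by case/andP: c2p => ? ?; rewrite ger0_norm.
  exact: cutoff_top hy.
have B3 : `|c2 * \int[leb2]_(p in `]-1, 0[ `*` `]- h, - k[) (m * w p + (m * p.2 + h * m) * jdy w p)| <= K0 * S.
  apply: (term_bound (@measurable_rect R (-1) 0 (- h) (- k)) sB (jet_sections_y m (h * m) sB)).
  move=> [x y] [/= _ hy]; apply: (bnd2 c2m _ (XB _)).
  apply: (le_trans _ K1); rewrite normrM mulr_ile1//.
    by case/andP: c2p => ? ?; rewrite ger0_norm.
  exact: cutoff_bottom hy.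
have B4 : `|beta / alpha * \int[leb2]_(p in `]0, 1[ `*` [set y | `|y| < k]) (1 * w p + (1 * p.1 + -1) * jdx w p)| <= K0 * S.
  have bap : 0 <= beta / alpha <= 1.
    by rewrite divr_ge0 ?(ltW a0)//= ler_pdivrMr// mul1r ltW.
  move: bap => /andP[ba0 ba1].
  apply: (term_bound mC sC); first exact: (L2_int mC (fO _ mC sC) (jet_sections 1 (-1) mD mb sC Lw)).
  move=> [x y] [/= hx _]; apply: (bnd2 _ _ (XA _)).
    by rewrite mulr1 ger0_norm// (le_trans ba1).
  apply: (le_trans _ K1); rewrite normrM mulr_ile1//; first by rewrite ger0_norm.
  by rewrite mul1r; exact: itv01_norm.
set I1 := \int[leb2]_(p in `]-1, 0[ `*` cgap) _ in B1 *.
set I2 := \int[leb2]_(p in `]-1, 0[ `*` `]k, h[) _ in B2 *.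
set I3 := \int[leb2]_(p in `]-1, 0[ `*` `]- h, - k[) _ in B3 *.
set I4 := \int[leb2]_(p in `]0, 1[ `*` _) _ in B4 *.
rewrite -/c2.
have SB : 4 * K0 * S <= 24 * K0 ^+ 2 * fine (leb2 D) +
    (sq leb2 D w + sq leb2 D (jdx w) + sq leb2 D (jdy w)) / 2.
  have q0 := L2_sqr_int mD w0; have q1 := L2_sqr_int mD w1; have q2 := L2_sqr_int mD w2.
  have qs : leb2.-integrable D (EFin \o (fun p => w p ^+ 2 + jdx w p ^+ 2 + jdy w p ^+ 2)).
    by apply: rintD => //; exact: rintD.
  rewrite -Rintegral_cst// /sq -!RintegralD//; last exact: rintD.
  rewrite [X in _ <= _ + X]mulrC /S -!RintegralZl// -RintegralD//; last 2 first.
    - by apply: L2_int => //; exact: L2_cst.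
    - exact: rintZ.
  apply: le_Rintegral => //; first exact: rintZ.
    apply: rintD => //; last exact: rintZ.
    by apply: L2_int => //; exact: L2_cst.
  move=> p _; rewrite -(real_normK (num_real (w p))) -(real_normK (num_real (jdx w p))).
  rewrite -(real_normK (num_real (jdy w p))).
  exact: young3.
have area := ler_wpM2l (sqr_ge0 K0) cell_area.
move: B1 B2 B3 B4; rewrite mul1r !ler_norml mulrDr.
move=> /andP[_ B1] /andP[_ B2] /andP[_ B3] /andP[_ B4] E.
exact: energy_arith B1 B2 B3 B4 SB area E.
Qed.

End Energy.

(** * The flux field *)
Section Flux.
(** The deviation of the indicator of the gap from its mean over a section;
    [pot] is its primitive vanishing at both ends of the section. *)
Definition dens (y : R) : R := \1_cgap y - (1 - alpha).
Definition pot (y : R) : R := - (1 - alpha) * y + Num.max (y - k) 0 + Num.min (y + k) 0.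

Lemma C1pair_affine (m q : R) : C1pair (fun y : R => m * y + q) (fun=> m).
Proof.
apply: C1pair_eq (C1pairD (C1pairZ m (C1pair_id R)) (C1pair_cst q)) => x //=.
by rewrite mulr1 addr0.
Qed.

Lemma measurable_pot : measurable_fun setT (pot : mR -> mR).
Proof.
apply: measurable_funD; first apply: measurable_funD.
- exact: measurable_funM.
- by apply: measurable_maxr => //; exact: measurable_funB.
- by apply: measurable_minr => //; exact: measurable_funD.
Qed.

Lemma measurable_dens : measurable_fun setT (dens : mR -> mR).
Proof.
apply: measurable_funB => //.
by apply: measurable_indic; exact: measurable_gap.
Qed.

Lemma dens_bound y : `|dens y| <= 1 /\ `|dens y - alpha| <= 1.
Proof.
rewrite /dens indicE; case: (_ \in _) => /=; rewrite !ler_norml; split; apply/andP; split; slra.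
Qed.

Lemma pot_bound (y : R) : y \in `]- h, h[ -> `|pot y| <= 2 * eps.
Proof.
rewrite in_itv/= => /andP[y0 y1]; have [k0 k1] := kh.
have aux (x m1 m2 : R) : `|x| <= h -> `|m1| <= h -> `|m2| <= h -> `|x + m1 + m2| <= 2 * eps.
  rewrite !ler_norml => /andP[? ?] /andP[? ?] /andP[? ?]; apply/andP; split; slra.
apply: aux.
- rewrite normrM (_ : `|- (1 - alpha)| = 1 - alpha); last by rewrite normrN gtr0_norm ?subr_gt0.
  have yh : `|y| <= h by rewrite ler_norml !ltW.
  apply: (le_trans _ yh); rewrite ler_piMl//; slra.
- by apply: norm_max0; slra.
- by apply: norm_min0; slra.
Qed.

(** The vertical component of the field compensates, on each vertical section,
    the jump of the horizontal one. *)
Lemma vertical_flux (v v' : R -> R) : C1pair v v' ->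
  \int[leb1]_(y in `]- h, h[) (v' y * pot y + v y * dens y) = 0.
Proof.
move=> hv; have cv := C1pair_cont hv; have [k0 k1] := kh.
have mI (a b : R) : measurable (`]a, b[%classic : set mR) by exact: measurable_itv.
have Lv := cont_L2_itv (- h) h cv; have Lv' := cont_L2_itv (- h) h hv.2.
set F := fun y => v' y * pot y + v y * dens y.
have IF : leb1.-integrable `]- h, h[ (EFin \o F).
  have Lp : L2 leb1 `]- h, h[ (fun y => pot y * v' y).
    apply: (L2_bmul (mI (- h) h) _ _ Lv'); first exact: (measurable_funTS measurable_pot).
    by move=> y hy; exact: pot_bound.
  have Ld : L2 leb1 `]- h, h[ (fun y => dens y * v y).
    apply: (L2_bmul (mI (- h) h) _ _ Lv); first exact: (measurable_funTS measurable_dens).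
    by move=> y _; exact: (dens_bound y).1.
  have := L2_int (mI (- h) h) (mu_oo _ _) (L2D (mI (- h) h) Lp Ld).
  by apply: eq_integrable => // y _; rewrite /F /= mulrC [dens y * _]mulrC.
have [hk1 hk2 hk3] : [/\ - h < - k, - k < k & - k < h] by split; slra.
have s23 : (`]- k, h[%classic : set mR) `<=` `]- h, h[.
  by move=> y /=; rewrite !in_itv/= => /andP[y0 ->]; rewrite (lt_trans hk1 y0).
have n1 (a b c : R) : measurable (`]a, b[%classic : set mR) -> a < c -> c < b ->
   leb1 (`]a, b[ `\` (`]a, c[ `|` `]c, b[)) = 0%E.
  move=> mab ac cb; have null : leb1 [set c] = 0%E by exact: lebesgue_measure_set1.
  apply: (subset_measure0 _ _ _ null).
  - by apply: measurableD => //; apply: measurableU.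
  - exact: measurable_set1.
  - move=> y [/=]; rewrite !in_itv/= => /andP[y0 y1] /not_orP[]; rewrite y0 y1 andbT /=.
    by move=> /negP h1 /negP h2; apply/eqP; rewrite eq_le leNgt (leNgt c) h1 h2.
have sub1 (a b c : R) : a < c -> c < b -> (`]a, c[%classic : set mR) `<=` `]a, b[.
  by move=> ac cb y /=; rewrite !in_itv/= => /andP[-> y1]; exact: lt_trans cb.
have sub2 (a b c : R) : a < c -> c < b -> (`]c, b[%classic : set mR) `<=` `]a, b[.
  by move=> ac cb y /=; rewrite !in_itv/= => /andP[y1 ->]; rewrite (lt_trans ac).
have dj (a b c : R) : [disjoint (`]a, c[%classic : set mR) & (`]c, b[%classic : set mR)].
  apply/disj_setPS => y /=; rewrite !in_itv/= => -[/andP[_ h1] /andP[h2 _]].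
  by have := lt_trans h1 h2; rewrite ltxx.
rewrite (Rint_split (mI (- h) h) (mI (- h) (- k)) (mI (- k) h) (sub1 _ _ _ hk1 hk3)
  (sub2 _ _ _ hk1 hk3) (dj _ _ _) (n1 _ _ _ (mI (- h) h) hk1 hk3) IF).
have IF2 := integrableS (mI (- h) h) (mI (- k) h) s23 IF.
rewrite (Rint_split (mI (- k) h) (mI (- k) k) (mI k h) (sub1 _ _ _ hk2 k1)
  (sub2 _ _ _ hk2 k1) (dj _ _ _) (n1 _ _ _ (mI (- k) h) hk2 k1) IF2).
have piece (a b m q : R) : a < b -> {in `]a, b[, forall y, pot y = m * y + q /\ dens y = m} ->
  \int[leb1]_(y in `]a, b[) F y = (m * b + q) * v b - (m * a + q) * v a.
  move=> ab E; rewrite -(IBP1 ab hv (C1pair_affine m q)).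
  by apply: eq_Rintegral => y /set_mem /= /E[e1 e2]; rewrite /F e1 e2.
rewrite (piece (- h) (- k) alpha (alpha * h))//; last first.
  move=> y; rewrite in_itv/= => /andP[y0 y1]; rewrite /pot /dens indicE mem_set; last first.
    by rewrite gapE//; left; rewrite /= in_itv/= y0.
  have e1 : Num.max (y - k) 0 = 0 by apply: max_r; slra.
  have e2 : Num.min (y + k) 0 = y + k by apply: min_l; slra.
  by rewrite e1 e2; split; rewrite ?mulr1n; slra.
rewrite (piece (- k) k (- (1 - alpha)) 0)//; last first.
  move=> y; rewrite in_itv/= => /andP[y0 y1]; rewrite /pot /dens indicE memNset; last first.
    by rewrite /gap /= => /andP[+ _]; rewrite ltNge ler_norml !ltW.
  have e1 : Num.max (y - k) 0 = 0 by apply: max_r; slra.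
  have e2 : Num.min (y + k) 0 = 0 by apply: min_r; slra.
  by rewrite e1 e2; split; rewrite ?mulr0n; slra.
rewrite (piece k h alpha (- (alpha * h)))//; last first.
  move=> y; rewrite in_itv/= => /andP[y0 y1]; rewrite /pot /dens indicE mem_set; last first.
    by rewrite gapE//; right; rewrite /= in_itv/= y0.
  have e1 : Num.max (y - k) 0 = y - k by apply: max_l; slra.
  have e2 : Num.min (y + k) 0 = 0 by apply: min_r; slra.
  by rewrite e1 e2; split; rewrite ?mulr1n; slra.
by field.
Qed.

Lemma right_int (a : R -> R) : continuous a ->
  \int[leb2]_(p in cright) a p.1 = eps * \int[leb1]_(x in `]0, 1[) a x.
Proof.
move=> ca; have mI (c d : R) : measurable (`]c, d[%classic : set mR) by exact: measurable_itv.
have cr : cright `<=` @Omega R by move=> p /cell_right_sub -/(_ alpha a0 a1 eps0)/DO.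
have Ia : leb2.-integrable cright (EFin \o (fun p => a p.1)).
  apply: L2_int; [exact: measurable_cell_right| |].
    by apply: Omega_fin => //; exact: measurable_cell_right.
  by apply: cont_L2 => //; [exact: measurable_cell_right|exact: continuous_fst_comp].
have [_ _ ->] := fubini_x (mI _ _) (mI _ _) Ia.
rewrite -RintegralZl//; last exact: cont_int_oo.
apply: eq_Rintegral => x _ /=; rewrite Rintegral_cst// fine_mu_oo; last slra.
by rewrite [RHS]mulrC; congr (_ * _); field.
Qed.

Lemma right_section (F : R * R -> R) : leb2.-integrable cright (EFin \o F) ->
  (forall x, x \in `]0, 1[ -> \int[leb1]_(y in `]- h, h[) F (x, y) = 0) ->
  \int[leb2]_(p in cright) F p = 0.
Proof.
move=> IF H; have mI (a b : R) : measurable (`]a, b[%classic : set mR) by exact: measurable_itv.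
have [_ _ ->] := fubini_x (mI _ _) (mI _ _) IF.
rewrite (@eq_Rintegral _ _ _ _ _ (fun=> 0)); first by rewrite Rintegral_cst// mul0r.
by move=> x /set_mem /= hx; exact: H.
Qed.

End Flux.

End Cracked.

(** * Moments of the cracked solution *)

Lemma Rint_indic d (X : measurableType d) (R : realType) (mu : {measure set X -> \bar R})
    (D E : set X) (f : X -> R) : E `<=` D ->
  \int[mu]_(x in E) f x = \int[mu]_(x in D) (\1_E x * f x).
Proof.
move=> ED; rewrite Rintegral_mkcond [RHS]Rintegral_mkcond; apply: eq_Rintegral => x _.
rewrite !patchE indicE; case: ifPn => xE; last by rewrite mul0r; case: ifP.
by rewrite mul1r mem_set//; apply: ED; exact: set_mem.
Qed.

(** Here [s1] and [s2] are the squared norms of the two remainders of the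
    field. *)
Lemma moment_arith (R : realType) (m : nat) (eps c s1 s2 A B x y : R) :
  1 <= eps * m.+1%:R <= 2 -> 0 < eps ->
  s1 <= c ^+ 2 * (eps / (m.*2.+2).+1%:R) ->
  s2 <= (c * m.+1%:R * (2 * eps)) ^+ 2 * (eps / (m.*2).+1%:R) ->
  x ^+ 2 <= A * s1 -> y ^+ 2 <= B * s2 -> 0 <= A -> 0 <= B ->
  (x + y) ^+ 2 <= 16 * c ^+ 2 * eps ^+ 2 * (A + B).
Proof.
move=> /andP[m1 m2] e0 hs1 hs2 hx hy A0 B0.
set M : R := m.+1%:R in m1 m2 hs2.
have M1 : 1 <= M by rewrite /M ler1n.
have M0 : 0 < M by rewrite (lt_le_trans ltr01).
have E1 : (m.*2.+2).+1%:R = 2 * M + 1 :> R.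
  by rewrite /M -muln2 -!natr1 natrM -natr1; ring.
have E2 : (m.*2).+1%:R = 2 * M - 1 :> R.
  by rewrite /M -muln2 -!natr1 natrM; ring.
rewrite E1 in hs1; rewrite E2 in hs2.
have t1 : eps / (2 * M + 1) <= eps ^+ 2 / 2.
  rewrite ler_pdivrMr; last lra.
  have := ler_wpM2l (ltW e0) m1; have := ltW e0; rewrite expr2; nra.
have t2 : M ^+ 2 * (eps * (eps / (2 * M - 1))) * eps <= 2 * eps ^+ 2.
  have q : M / (2 * M - 1) <= 1 by rewrite ler_pdivrMr; lra.
  have e2 : 0 <= eps ^+ 2 by exact: sqr_ge0.
  have -> : M ^+ 2 * (eps * (eps / (2 * M - 1))) * eps = (M / (2 * M - 1)) * (eps * M) * eps ^+ 2.
    by ring.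
  apply: ler_wpM2r => //; apply: le_trans m2; rewrite ger_pMl//; lra.
have c2 : 0 <= c ^+ 2 by exact: sqr_ge0.
have u1 : s1 <= c ^+ 2 * (eps ^+ 2 / 2) by apply: (le_trans hs1); exact: ler_wpM2l.
have u2 : s2 <= c ^+ 2 * (8 * eps ^+ 2).
  apply: (le_trans hs2).
  have -> : (c * M * (2 * eps)) ^+ 2 * (eps / (2 * M - 1)) =
     c ^+ 2 * (4 * (M ^+ 2 * (eps * (eps / (2 * M - 1))) * eps)) by ring.
  apply: ler_wpM2l => //; lra.
have v1 := ler_wpM2l A0 u1; have v2 := ler_wpM2l B0 u2.
have w1 := le_trans hx v1; have w2 := le_trans hy v2.
have w3 := sqr_ge0 (x - y); have e2 : 0 <= c ^+ 2 * eps ^+ 2 by rewrite mulr_ge0 ?sqr_ge0.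
have := mulr_ge0 A0 e2; have := mulr_ge0 B0 e2.
move: w1 w2 w3; rewrite sqrrB sqrrD.
have -> : A * (c ^+ 2 * (eps ^+ 2 / 2)) = (A * (c ^+ 2 * eps ^+ 2)) / 2 by ring.
have -> : B * (c ^+ 2 * (8 * eps ^+ 2)) = 8 * (B * (c ^+ 2 * eps ^+ 2)) by ring.
have -> : 16 * c ^+ 2 * eps ^+ 2 * (A + B) = 16 * (A * (c ^+ 2 * eps ^+ 2)) + 16 * (B * (c ^+ 2 * eps ^+ 2)) by ring.
move: (A * _) (B * _) (x ^+ 2) (y ^+ 2) => p q r s; lra.
Qed.

Section CrackedMoment.
Context (R : realType).
Local Notation mR := (measurableTypeR R).
Local Notation mP := (measurableTypeR R * measurableTypeR R)%type.
Local Notation leb1 := (lebesgue1 R).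
Local Notation leb2 := (lebesgue2 R).
Variables (alpha beta eps : R).
Hypotheses (b0 : 0 <= beta) (ba : beta < alpha) (a1 : alpha < 1).
Hypotheses (eps0 : 0 < eps) (eps1 : eps < 1).
Ltac slra := generalize b0 ba a1 eps0 eps1; lra.
Local Notation D := (crack_cell alpha eps).
Local Notation k := (alpha * eps / 2).
Local Notation h := (eps / 2).
Local Notation cgap := (gap alpha eps).
Local Notation cleft := (cell_left alpha eps).
Local Notation cright := (cell_right eps).
Local Notation dens := (dens alpha eps).
Local Notation pot := (pot alpha eps).

Let a0 : 0 < alpha. Proof. exact: le_lt_trans ba. Qed.
Let kh : 0 < k /\ k < h. Proof. exact: k_lt_h. Qed.
Let mD : measurable (D : set mP). Proof. exact: measurable_cell. Qed.
Let DO : D `<=` @Omega R. Proof. exact: cell_Omega. Qed.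
Let fD : (leb2 D < +oo)%E. Proof. exact: cell_fin. Qed.
Let gap_fin := gap_fin b0 ba a1 eps0.
Let dens_bound := dens_bound b0 ba a1 eps0 eps1.
Let pot_bound := fun y => @pot_bound R alpha beta eps b0 ba a1 eps0 eps1 y.
Let measurable_dens : measurable_fun setT (dens : mR -> mR).
Proof. exact: measurable_dens b0 ba a1 eps0. Qed.
Let measurable_pot : measurable_fun setT (pot : mR -> mR).
Proof. exact: measurable_pot. Qed.
Let mI (a b : R) : measurable (`]a, b[%classic : set mR).
Proof. exact: measurable_itv. Qed.
Section Moment.
Variables (ut : R * R -> R) (w : jet R).
Hypotheses (H1w : H1 D w) (Lut : L2 leb2 D ut).
Hypotheses (perw : periodic_y D `]-1, 1[%classic eps w) (weakw : cell_weak alpha beta eps ut w).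
Variables (P : profile alpha) (m : nat).
Let c := pf1 P 0.
Let Lw : L2jet D w. Proof. exact: H1_L2jet. Qed.

(** The boundary data tested against the profile, for one cell and divided by
    [eps]; the same number is the load in the homogenized problem. *)
Definition profile_load : R := (1 - alpha) * pf P (-1)
  + (alpha - beta) * \int[leb1]_(x in `]-1, 0[) pf P x + beta * pf P 0.

Let phi (p : R * R) := ptest P m.+1 p.1 * 1.

Let phiC : [/\ Ck 1 phi, (fun p => 'D_(e1 R) phi p) = (fun p => ptest1 P m.+1 p.1 * 1) &
  (fun p => 'D_(e2 R) phi p) = (fun p => ptest P m.+1 p.1 * 0)].
Proof. exact: C1_tensor (C1_ptest P m.+1) (C1pair_cst 1). Qed.

Lemma ptest_left (x : R) : x <= 0 -> ptest P m.+1 x = pf P x.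
Proof. by rewrite /ptest /splice => ->. Qed.

(* the test function depends on [x] only, hence each boundary integral is
   explicit *)
Let test_identity : \int[leb2]_(p in D) (ut p * ptest P m.+1 p.1) =
  eps * profile_load - \int[leb2]_(p in D) (jdx w p * ptest1 P m.+1 p.1).
Proof.
have [C1phi E1 E2] := phiC; have [k0 k1] := kh.
have ct := C1pair_cont (C1_ptest P m.+1).
have mg : measurable (cgap : set mR) by exact: measurable_gap.
have mb : measurable ([set y | `|y| < k] : set mR) by rewrite bottomE.
have fb : (leb1 [set y | (`|y| < k)%R] < +oo)%E by rewrite bottomE mu_oo.
have H1phi := H1_of_C1 mD DO C1phi.
have Lh (q a b : R) : L2 leb1 `]a, b[ (phi \o hsegment q).
  by apply: cont_L2_itv => x; apply: continuousM; [exact: ct|exact: cst_continuous].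
have perphi : periodic_y D `]-1, 1[%classic eps (jet_of phi).
  exists (fun x => ptest P m.+1 x * 1); split.
    by apply: (is_trace_C1 (c := hsegment h) mD (mI (-1) 1) C1phi); exact: Lh.
  by apply: (is_trace_C1 (c := hsegment (- h)) mD (mI (-1) 1) C1phi); exact: Lh.
have Lv (q : R) (J : set mR) : measurable J -> (leb1 J < +oo)%E -> L2 leb1 J (phi \o vsegment q).
  by move=> mJ fJ; apply: (L2_eq (f := fun=> phi (q, 0))) => //; exact: L2_cst.
have t1 := is_trace_C1 (c := vsegment (-1)) mD mg C1phi (Lv _ _ mg gap_fin).
have t2 := is_trace_C1 (c := hsegment k) mD (mI (-1) 0) C1phi (Lh _ _ _).
have t3 := is_trace_C1 (c := hsegment (- k)) mD (mI (-1) 0) C1phi (Lh _ _ _).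
have t4 := is_trace_C1 (c := vsegment 0) mD mb C1phi (Lv _ _ mb fb).
have := weakw H1phi perphi t1 t2 t3 t4; rewrite /heat_form.
have -> : \int[leb2]_(p in D) (ut p * jet_of phi p) = \int[leb2]_(p in D) (ut p * ptest P m.+1 p.1).
  by apply: eq_Rintegral => p _; rewrite /= /phi mulr1.
have -> : \int[leb2]_(p in D) (jdx w p * jdx (jet_of phi) p + jdy w p * jdy (jet_of phi) p) =
    \int[leb2]_(p in D) (jdx w p * ptest1 P m.+1 p.1).
  apply: eq_Rintegral => p _; rewrite /=.
  have := congr1 (fun f => f p) E1; have := congr1 (fun f => f p) E2; rewrite /= => -> ->.
  by rewrite mulr1 mulr0 mulr0 addr0.
move=> E; apply/eqP; rewrite -subr_eq opprK; apply/eqP; rewrite E.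
have -> : \int[leb1]_(y in cgap) (phi \o vsegment (-1)) y = pf P (-1) * ((1 - alpha) * eps).
  rewrite (@eq_Rintegral _ _ _ _ _ (fun=> pf P (-1))).
    by rewrite Rintegral_cst// gap_measure.
  by move=> y _; rewrite /= /phi /= mulr1 ptest_left// lerN10.
have Ef : \int[leb1]_(x in `]-1, 0[) (ptest P m.+1 x * 1) = \int[leb1]_(x in `]-1, 0[) pf P x.
  apply: eq_Rintegral => x /set_mem /=; rewrite in_itv/= => /andP[_ x0].
  by rewrite mulr1 ptest_left// ltW.
rewrite (Ef : \int[leb1]_(x in `]-1, 0[) (phi \o hsegment k) x = _).
have -> : \int[leb1]_(y in [set y | `|y| < k]) (phi \o vsegment 0) y = pf P 0 * (alpha * eps).
  rewrite (@eq_Rintegral _ _ _ _ _ (fun=> pf P 0)); last first.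
    by move=> y _; rewrite /= /phi /= mulr1 ptest_left.
  rewrite Rintegral_cst// bottomE fine_mu_oo/=; last first.
    by apply: (@le_trans _ _ 0); rewrite ?oppr_le0 ltW.
  by congr (_ * _); field.
rewrite /profile_load; field; slra.
Qed.

(* the part of the slope at 0 that is concentrated in the layer *)
Let kap (x : R) := c * (1 - x) ^+ m.+1.
Let kap1 (x : R) := - (c * m.+1%:R * (1 - x) ^+ m).

Let C1kap : C1pair kap kap1.
Proof.
apply: C1pair_eq (C1pairZ c (C1pairX m (C1pair_1mx R))) => x //.
by rewrite /kap1; ring.
Qed.

(* A field [(q1, q2)] whose divergence is the second derivative [q0] of the
   profile, without normal component on the crack and on the outer sides. On the
   left it is the gradient of the profile. On the right, the horizontal
   component at [x = 0] is [c] on the gap and 0 on the bottom of the crack; the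
   mean over a section is [pg1], and the deviation is transported vertically
   within the layer. *)
Let q0 (p : R * R) := splice (pf2 P) (pg2 P) p.1.
Let q1 (p : R * R) := if p.1 <= 0 then pf1 P p.1 else pg1 P p.1 + dens p.2 * kap p.1.
Let q2 (p : R * R) := if p.1 <= 0 then 0 else - (kap1 p.1 * pot p.2).

Let mN : measurable ([set p : R * R | p.1 <= 0] : set mP).
Proof.
have -> : [set p : R * R | p.1 <= 0] = `]-oo, 0]%classic `*` setT.
  by apply/seteqP; split => -[x y] /=; rewrite in_itv/= => // -[].
by apply: measurableX.
Qed.

Let L2_half (a b : mP -> R) : L2 leb2 D a -> L2 leb2 D b ->
  L2 leb2 D (fun p => if p.1 <= 0 then a p else b p).
Proof.
move=> La Lb; pose N := [set p : R * R | p.1 <= 0] : set mP.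
have mi : measurable_fun D (\1_N : mP -> R) by exact: measurable_indic.
have La' : L2 leb2 D (fun p => \1_N p * a p).
  apply: (@L2_bmul _ _ _ _ _ (\1_N : mP -> R) a 1) => // p _.
  by rewrite indicE; case: (_ \in _); rewrite ?normr1 ?normr0.
have Lb' : L2 leb2 D (fun p => (1 - \1_N p) * b p).
  apply: (@L2_bmul _ _ _ _ _ (fun p : mP => 1 - \1_N p) b 1) => //.
    exact: measurable_funB.
  by move=> p _; rewrite indicE; case: (_ \in _); rewrite ?subrr ?subr0 ?normr1 ?normr0.
apply: L2_eq (L2D mD La' Lb') => p _; rewrite indicE /N.
have [p0|p0] := boolP (p.1 <= 0).
  by rewrite mem_set//= subrr mul1r mul0r addr0.
by rewrite memNset/= ?subr0 ?mul0r ?mul1r ?add0r//; exact/negP.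
Qed.

Let cfst (a : R -> R) : continuous a -> L2 leb2 D (fun p => a p.1).
Proof. by move=> ca; apply: cont_L2 => //; exact: continuous_fst_comp. Qed.

Let ckap := C1pair_cont C1kap.

Let Lq0 : L2 leb2 D q0.
Proof. by apply: L2_half; apply: cfst; [exact: (C1_f1 P).2|exact: (C1_g1 P).2]. Qed.

Let mdens2 : measurable_fun D (fun p : mP => dens p.2).
Proof. by apply: measurable_funTS; exact: (measurableT_comp measurable_dens measurable_snd). Qed.

Let mpot2 : measurable_fun D (fun p : mP => pot p.2).
Proof. by apply: measurable_funTS; exact: (measurableT_comp measurable_pot measurable_snd). Qed.

Let D_snd p : D p -> p.2 \in `]- h, h[.
Proof. by case: p => x y; rewrite crack_cellE// => -[/= _ _ + _]; rewrite in_itv/= -ltr_norml. Qed.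

Let Lq1 : L2 leb2 D q1.
Proof.
apply: L2_half; first by apply: cfst; exact: (C1pair_cont (C1_f1 P)).
apply: L2D => //; first by apply: cfst; exact: (C1pair_cont (C1_g1 P)).
apply: (@L2_bmul _ _ _ _ _ (fun p : mP => dens p.2) (fun p : mP => kap p.1) 1) => //.
  by move=> p _; exact: (dens_bound _).1.
exact: cfst.
Qed.

Let Lq2 : L2 leb2 D q2.
Proof.
apply: L2_half; first exact: L2_cst.
have : L2 leb2 D (fun p => -1 * (pot p.2 * kap1 p.1)).
  apply: L2Z => //.
  apply: (@L2_bmul _ _ _ _ _ (fun p : mP => pot p.2) (fun p : mP => kap1 p.1) (2 * eps)) => //.
    by move=> p /D_snd; exact: pot_bound.
  by apply: cfst; exact: C1kap.2.
by apply: L2_eq => p _; rewrite mulN1r mulrC.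
Qed.

Let mL : measurable (cleft : set mP). Proof. exact: measurable_cell_left. Qed.
Let mC : measurable (cright : set mP). Proof. exact: measurable_cell_right. Qed.
Let sL : cleft `<=` D. Proof. exact: cell_left_sub. Qed.
Let sC : cright `<=` D. Proof. exact: cell_right_sub. Qed.

Let left_neg p : cleft p -> p.1 <= 0.
Proof. by move=> [/= + _]; rewrite in_itv/= => /andP[_ /ltW]. Qed.

Let right_pos p : cright p -> (p.1 <= 0) = false.
Proof. by move=> [/= + _]; rewrite in_itv/= => /andP[p0 _]; rewrite leNgt p0. Qed.

(* integration by parts in [x] on both parts: the gap terms at [x = 0] cancel *)
Let flux_C1 (psi : R * R -> R) : Ck 1 psi -> functional D q0 q1 q2 (jet_of psi) = 0.
Proof.
move=> C1psi; have Lpsi := C1_L2jet mD DO C1psi; move: (Lpsi) => [l0 l1 l2].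
have mg : measurable (cgap : set mR) by exact: measurable_gap.
have [k0 k1] := kh.
have fin (E : set mP) : measurable E -> E `<=` D -> (leb2 E < +oo)%E.
  by move=> mE' ED; apply: Omega_fin => // p /ED/DO.
have IF : leb2.-integrable D (EFin \o (fun p => jet_of psi p * q0 p +
    jdx (jet_of psi) p * q1 p + jdy (jet_of psi) p * q2 p)).
  by apply: rintD => //; [apply: rintD => //; exact: L2_mul_int|exact: L2_mul_int].
rewrite /functional cell_split//.
pose v0 y := psi (0, y).
have cv0 : continuous v0 := C1pair_cont (C1_slice_y 0 C1psi).
have cpsi : continuous psi := Ck_cont C1psi.
have [_ [_ _ [cpx _] [cpy _]]] := C1psi.
have cmul (f : R * R -> R) (a : R -> R) : continuous f -> continuous a ->
    continuous (fun p : R * R => f p * a p.1).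
  by move=> cf ca p; apply: continuousM; [exact: cf|exact: continuous_fst_comp].
have E1 : \int[leb2]_(p in cleft) (jet_of psi p * q0 p + jdx (jet_of psi) p * q1 p +
    jdy (jet_of psi) p * q2 p) = c * \int[leb1]_(y in cgap) v0 y.
  transitivity (\int[leb2]_(p in cleft)
      (('D_(e1 R) psi p * pf1 P p.1 + psi p * pf2 P p.1) * 1)).
    apply: eq_Rintegral => p /set_mem/left_neg p0.
    by rewrite /q0 /q1 /q2 /splice p0 /= mulr0 addr0 mulr1 addrC.
  rewrite (ibp_rect_x (b := fun=> 1) (ltrN10 R) mg C1psi (C1_f1 P)); last first.
    apply: L2_int => //; first exact: fin.
    apply: (L2_sub mD) => //.
    have Lf : L2 leb2 D (fun p => 'D_(e1 R) psi p * pf1 P p.1 + psi p * pf2 P p.1).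
      have b1 := C1pair_cont (C1_f1 P); have b2 := (C1_f1 P).2.
      exact: (L2D mD (cont_L2 mD DO (cmul _ _ cpx b1)) (cont_L2 mD DO (cmul _ _ cpsi b2))).
    by apply: L2_eq Lf => p _; rewrite mulr1.
  rewrite -RintegralZl//; last first.
    apply: (integrableS (mI (- h) h) mg _ (cont_int_oo _ _ cv0)).
    by move=> y /andP[_ y1]; rewrite /= in_itv/= -ltr_norml.
  by apply: eq_Rintegral => y _; rewrite f1N1 mul0r subr0 mulr1.
rewrite E1; pose I0 := \int[leb1]_(y in `]- h, h[) v0 y.
pose F1 p := ('D_(e1 R) psi p * pg1 P p.1 + psi p * pg2 P p.1) * 1.
pose F2 (p : R * R) := ('D_(e1 R) psi p * kap p.1 + psi p * kap1 p.1) * dens p.2.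
pose F3 (p : R * R) := kap1 p.1 * ('D_(e2 R) psi p * pot p.2 + psi p * dens p.2).
have fC : (leb2 cright < +oo)%E by exact: fin.
have CO : cright `<=` @Omega R by move=> p /sC/DO.
have cL2 f : continuous f -> L2 leb2 cright f by exact: cont_L2.
have cg1 := C1pair_cont (C1_g1 P); have cg2 := (C1_g1 P).2.
have ck1 := C1kap.2.
have cD (f g : R * R -> R) : continuous f -> continuous g -> L2 leb2 cright (fun p => f p + g p).
  by move=> cf cg; exact: (L2D mC (cL2 _ cf) (cL2 _ cg)).
have L1 : L2 leb2 cright F1.
  by apply: L2_eq (cD _ _ (cmul _ _ cpx cg1) (cmul _ _ cpsi cg2)) => p _; rewrite /F1 mulr1.
have Ldens (f : R * R -> R) : L2 leb2 cright f -> L2 leb2 cright (fun p => dens p.2 * f p).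
  apply: (@L2_bmul _ _ _ _ _ (fun p : mP => dens p.2) f 1) => //.
  - exact: measurable_funS mdens2.
  - by move=> p _; exact: (dens_bound _).1.
have Lpot (f : R * R -> R) : L2 leb2 cright f -> L2 leb2 cright (fun p => pot p.2 * f p).
  apply: (@L2_bmul _ _ _ _ _ (fun p : mP => pot p.2) f (2 * eps)) => //.
  - exact: measurable_funS mpot2.
  - by move=> p /sC /D_snd; exact: pot_bound.
have L2' : L2 leb2 cright F2.
  apply: L2_eq (Ldens _ (cD _ _ (cmul _ _ cpx ckap) (cmul _ _ cpsi ck1))) => p _.
  by rewrite /F2 mulrC.
have L3 : L2 leb2 cright F3.
  apply: L2_eq (L2D mC (Lpot _ (cL2 _ (cmul _ _ cpy ck1))) (Ldens _ (cL2 _ (cmul _ _ cpsi ck1)))).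
  by move=> p _; rewrite /F3; ring.
have -> : \int[leb2]_(p in cright) (jet_of psi p * q0 p + jdx (jet_of psi) p * q1 p +
    jdy (jet_of psi) p * q2 p) = \int[leb2]_(p in cright) (F1 p + F2 p - F3 p).
  apply: eq_Rintegral => p /set_mem/right_pos p0.
  by rewrite /q0 /q1 /q2 /splice p0 /F1 /F2 /F3 /=; ring.
have i1 := L2_int mC fC L1; have i2 := L2_int mC fC L2'; have i3 := L2_int mC fC L3.
rewrite RintegralB//; last exact: rintD.
rewrite RintegralD// (right_section i3); last first.
  move=> x hx; rewrite /F3 /= RintegralZl//; last first.
    have Lp : L2 leb1 `]- h, h[ (fun y => pot y * 'D_(e2 R) psi (x, y)).
      apply: (L2_bmul (mI (- h) h) _ _ (cont_L2_itv _ _ (C1_slice_y x C1psi).2)).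
        exact: (measurable_funTS measurable_pot).
      by move=> y hy; exact: pot_bound.
    have Ld : L2 leb1 `]- h, h[ (fun y => dens y * psi (x, y)).
      apply: (L2_bmul (mI (- h) h) _ _ (cont_L2_itv _ _ (C1pair_cont (C1_slice_y x C1psi)))).
        exact: (measurable_funTS measurable_dens).
      by move=> y _; exact: (dens_bound y).1.
    have := L2_int (mI (- h) h) (mu_oo _ _) (L2D (mI (- h) h) Lp Ld).
    by apply: eq_integrable => // y _; rewrite /= mulrC [dens y * _]mulrC.
  by rewrite (vertical_flux b0 ba a1 eps0 eps1 (C1_slice_y x C1psi)) mulr0.
rewrite (ibp_rect_x (b := fun=> 1) ltr01 (mI (- h) h) C1psi (C1_g1 P) i1).
rewrite (ibp_rect_x ltr01 (mI (- h) h) C1psi C1kap i2).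
have iv : leb1.-integrable `]- h, h[ (EFin \o v0) by exact: cont_int_oo.
have gsub : (cgap : set mR) `<=` `]- h, h[.
  by move=> y /andP[_ y1]; rewrite /= in_itv/= -ltr_norml.
have -> : \int[leb1]_(y in `]- h, h[) ((pg1 P 1 * psi (1, y) - pg1 P 0 * psi (0, y)) * 1) =
    - (1 - alpha) * c * I0.
  rewrite /I0 -RintegralZl//; apply: eq_Rintegral => y _.
  by rewrite g11 flux0 mul0r sub0r mulr1 !mulNr.
have idv : leb1.-integrable `]- h, h[ (EFin \o (fun y => \1_cgap y * v0 y)).
  apply: (L2_int (mI (- h) h) (mu_oo _ _)).
  apply: (@L2_bmul _ _ _ _ _ (\1_cgap : mR -> R) v0 1) => //.
    by move=> y _; rewrite indicE; case: (_ \in _); rewrite ?normr1 ?normr0.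
  exact: cont_L2_itv.
have -> : \int[leb1]_(y in `]- h, h[) ((kap 1 * psi (1, y) - kap 0 * psi (0, y)) * dens y) =
    - c * (\int[leb1]_(y in cgap) v0 y) + c * (1 - alpha) * I0.
  have -> : \int[leb1]_(y in cgap) v0 y = \int[leb1]_(y in `]- h, h[) (\1_cgap y * v0 y).
    exact: Rint_indic.
  rewrite /I0 -!RintegralZl// -RintegralD//; [|exact: rintZ..].
  apply: eq_Rintegral => y _.
  by rewrite /kap /dens /v0 subrr subr0 expr1n expr0n/=; ring.
by ring.
Qed.

(* periodicity supplies the smooth approximations of [w], and the identity
   passes to the limit *)
Let flux_zero : functional D q0 q1 q2 w = 0.
Proof.
have [g [tr _]] := perw.
have Lz : L2 leb1 `]-1, 1[ (fun=> 0 : R) by apply: L2_cst => //; exact: mu_oo.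
rewrite (trace_functional mD (mI (-1) 1) _ Lw Lq0 Lq1 Lq2 Lz tr).
- by rewrite (@eq_Rintegral _ _ _ _ _ (fun=> 0)) ?Rintegral_cst ?mul0r// => s _; rewrite mul0r.
- by exact: continuous_pairl.
- move=> psi C1psi _ _; rewrite flux_C1//.
  by rewrite (@eq_Rintegral _ _ _ _ _ (fun=> 0)) ?Rintegral_cst ?mul0r// => s _; rewrite mul0r.
Qed.

Let r1 (p : R * R) := q1 p - ptest1 P m.+1 p.1.

Let Lt1 : L2 leb2 D (fun p => ptest1 P m.+1 p.1).
Proof. by apply: cfst; exact: (C1_ptest P m.+1).2. Qed.

Let Lr1 : L2 leb2 D r1. Proof. exact: L2B. Qed.

(** The identity for the field, subtracted from the equation tested with
    [ptest], replaces the gradient of [ptest] by the second derivative of the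
    profile, at the cost of the difference between the field and that
    gradient. *)
Lemma moment_split : \int[leb2]_(p in D) (ut p * ptest P m.+1 p.1) =
  \int[leb2]_(p in D) (w p * splice (pf2 P) (pg2 P) p.1) + eps * profile_load
  + (\int[leb2]_(p in D) (jdx w p * r1 p) + \int[leb2]_(p in D) (jdy w p * q2 p)).
Proof.
have [l0 l1 l2] := Lw.
have := flux_zero; rewrite functional_split// test_identity.
have -> : \int[leb2]_(p in D) (jdx w p * r1 p) =
  \int[leb2]_(p in D) (jdx w p * q1 p) - \int[leb2]_(p in D) (jdx w p * ptest1 P m.+1 p.1).
  rewrite -RintegralB//; [|exact: L2_mul_int..].
  by apply: eq_Rintegral => p _; rewrite /r1 mulrBr.
move=> E; apply/eqP; rewrite -subr_eq0 -oppr_eq0 -[eqbRHS]E; apply/eqP; rewrite /q0; ring.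
Qed.

Let pow_int n : \int[leb2]_(p in cright) (1 - p.1) ^+ n = eps / n.+1%:R.
Proof.
rewrite (@right_int _ _ _ _ b0 ba a1 eps0 eps1 (fun x => (1 - x) ^+ n)) ?int_pow//.
by case: n => [x|n]; [rewrite (_ : (fun _ => _) = cst 1); [exact: cst_continuous|apply/funext => z; rewrite expr0]|exact: C1pair_cont (C1pairX n (C1pair_1mx R))].
Qed.

(* both remainders vanish on the left part, and decrease like a power on the right *)
Let sq_right (F : R * R -> R) (M : R) n : L2 leb2 D F -> 0 <= M ->
  (forall p, p.1 <= 0 -> F p = 0) ->
  (forall p, cright p -> F p ^+ 2 <= M * (1 - p.1) ^+ n) -> sq leb2 D F <= M * (eps / n.+1%:R).
Proof.
move=> LF M0 F0 FM; have iF := L2_sqr_int mD LF.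
rewrite /sq cell_split// (@eq_Rintegral _ _ _ _ _ (fun=> 0)); last first.
  by move=> p /set_mem/left_neg p0; rewrite F0// expr0n.
rewrite Rintegral_cst// mul0r add0r -pow_int -RintegralZl//; last first.
  apply: L2_int => //.
    by apply: Omega_fin => // p /sC/DO.
  apply: cont_L2 => //; first by move=> p /sC/DO.
  apply: (@continuous_fst_comp _ (fun x => (1 - x) ^+ n)).
  by case: (n) => [x|l]; [rewrite (_ : (fun _ => _) = cst 1); [exact: cst_continuous|apply/funext => z; rewrite expr0]|exact: C1pair_cont (C1pairX l (C1pair_1mx R))].
apply: le_Rintegral => //.
- exact: (integrableS mD mC sC iF).
- apply: rintZ => //.
  apply: L2_int => //.
    by apply: Omega_fin => // p /sC/DO.
  apply: cont_L2 => //; first by move=> p /sC/DO.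
  apply: (@continuous_fst_comp _ (fun x => (1 - x) ^+ n)).
  by case: (n) => [x|l]; [rewrite (_ : (fun _ => _) = cst 1); [exact: cst_continuous|apply/funext => z; rewrite expr0]|exact: C1pair_cont (C1pairX l (C1pair_1mx R))].
Qed.

(** The differences [r1] and [q2] live in the layer: they are bounded by [c]
    times a power of [1 - x] with an exponent of order [1 / eps], since in [q2]
    the factor [m + 1] of [kap1] is compensated by the bound of [pot]. Their
    squared norms on the cell are thus of order [eps ^ 2], and Cauchy-Schwarz
    concludes. *)
Lemma moment_cracked : 1 <= eps * m.+1%:R <= 2 -> exists err,
  \int[leb2]_(p in D) (ut p * ptest P m.+1 p.1) =
  \int[leb2]_(p in D) (w p * splice (pf2 P) (pg2 P) p.1) + eps * profile_load + err /\
  err ^+ 2 <= 16 * c ^+ 2 * eps ^+ 2 * (sq leb2 D (jdx w) + sq leb2 D (jdy w)).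
Proof.
move=> hm; have [l0 l1 l2] := Lw; eexists; split; first exact: moment_split.
have S1 : sq leb2 D r1 <= c ^+ 2 * (eps / (m.*2.+2).+1%:R).
  apply: sq_right => //; first exact: sqr_ge0.
    by move=> p p0; rewrite /r1 /q1 /ptest1 /splice p0 subrr.
  move=> p hp; rewrite /r1 /q1 /ptest1 /splice (right_pos hp) /kap.
  have -> : pg1 P p.1 + dens p.2 * (c * (1 - p.1) ^+ m.+1) -
    (pg1 P p.1 + alpha * pf1 P 0 * (1 - p.1) ^+ m.+1) = (dens p.2 - alpha) * (c * (1 - p.1) ^+ m.+1).
    by rewrite /c; ring.
  rewrite exprMn [(c * _) ^+ 2]exprMn -exprM muln2 doubleS.
  have p0 : 0 <= 1 - p.1.
    by case: hp => /=; rewrite in_itv/= subr_ge0 => /andP[_ /ltW].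
  rewrite ler_piMl//; first by rewrite mulr_ge0 ?sqr_ge0 ?exprn_ge0.
  by rewrite -real_normK ?num_real// expr_le1//; exact: (dens_bound _).2.
have S2 : sq leb2 D q2 <= (c * m.+1%:R * (2 * eps)) ^+ 2 * (eps / (m.*2).+1%:R).
  apply: sq_right => //; first exact: sqr_ge0.
    by move=> p p0; rewrite /q2 p0.
  move=> p hp; rewrite /q2 (right_pos hp) /kap1.
  have -> : - (- (c * m.+1%:R * (1 - p.1) ^+ m) * pot p.2) =
    (c * m.+1%:R * pot p.2) * (1 - p.1) ^+ m by ring.
  rewrite exprMn -exprM muln2.
  have p0 : 0 <= 1 - p.1.
    by case: hp => /=; rewrite in_itv/= subr_ge0 => /andP[_ /ltW].
  rewrite ler_wpM2r ?exprn_ge0// exprMn [leRHS]exprMn ler_wpM2l ?sqr_ge0//.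
  rewrite -real_normK ?num_real// lerXn2r ?nnegrE//; first by slra.
  by apply: pot_bound; apply: D_snd; exact: sC.
have CS1 := cauchy_schwarz mD l1 Lr1; have CS2 := cauchy_schwarz mD l2 Lq2.
have := moment_arith hm eps0 S1 S2 CS1 CS2 (sq_ge0 _ _ _) (sq_ge0 _ _ _).
exact.
Qed.

End Moment.

End CrackedMoment.

(** * Moments of the homogenized solution *)

Lemma hom_arith (R : realType) (t1 x1 y1 t2 x2 y2 w1 w2 z1 z2 F c a G : R) :
  t1 + x1 + y1 + (t2 + x2 + y2) = F -> w1 + x1 = c * (a * G) -> w2 + x2 = - (a * c) * G ->
  z1 + y1 = 0 -> z2 + y2 = 0 -> t1 + t2 = (w1 + w2) + (z1 + z2) + F.
Proof. by move=> *; lra. Qed.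

Section HomogenizedMoment.
Context (R : realType).
Local Notation mR := (measurableTypeR R).
Local Notation mP := (measurableTypeR R * measurableTypeR R)%type.
Local Notation leb1 := (lebesgue1 R).
Local Notation leb2 := (lebesgue2 R).
Local Notation Y := (`]- 2^-1, 2^-1[%classic : set R).
Local Notation ip D f g := (\int[leb2]_(p in D) (f p * g p)).

Let mI (a b : R) : measurable (`]a, b[%classic : set mR).
Proof. exact: measurable_itv. Qed.

Lemma continuous_tensor (a b : R -> R) : continuous a -> continuous b ->
  continuous (fun p : R * R => a p.1 * b p.2).
Proof.
move=> ca cb p; apply: continuousM; [exact: continuous_fst_comp|exact: continuous_snd_comp].
Qed.

Lemma L2_tensor (D : set mP) (a b : R -> R) : measurable D -> D `<=` @Omega R ->
  continuous a -> continuous b -> L2 leb2 D (fun p => a p.1 * b p.2).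
Proof. by move=> mD DO ca cb; apply: cont_L2 => //; exact: continuous_tensor. Qed.

Section Strip.
Variables (x0 x1 : R) (w : jet R).
Hypothesis x01 : x0 < x1.
Local Notation D := (`]x0, x1[ `*` Y).
Hypothesis DO : D `<=` @Omega R.
Hypothesis Lw : L2jet D w.

Let mD : measurable (D : set mP). Proof. exact: measurable_rect. Qed.
Let LT (a b : R -> R) : continuous a -> continuous b -> L2 leb2 D (fun p => a p.1 * b p.2).
Proof. exact: L2_tensor. Qed.
Let L0 : L2 leb2 D (fun=> 0). Proof. by apply: L2_cst => //; exact: rect_fin. Qed.

Let functional_xE (q0 q1 : R * R -> R) v : L2 leb2 D q0 -> L2 leb2 D q1 -> L2jet D v ->
  functional D q0 q1 (fun=> 0) v = ip D v q0 + ip D (jdx v) q1.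
Proof.
move=> L2q0 L2q1 Lv; rewrite functional_split//.
rewrite [X in _ + _ + X](@eq_Rintegral _ _ _ _ _ (fun=> 0)); first by rewrite Rintegral_cst// mul0r addr0.
by move=> p _; rewrite mulr0.
Qed.

Let functional_yE (q0 q2 : R * R -> R) v : L2 leb2 D q0 -> L2 leb2 D q2 -> L2jet D v ->
  functional D q0 (fun=> 0) q2 v = ip D v q0 + ip D (jdy v) q2.
Proof.
move=> L2q0 L2q2 Lv; rewrite functional_split//.
rewrite [X in _ + X + _](@eq_Rintegral _ _ _ _ _ (fun=> 0)); first by rewrite Rintegral_cst// mul0r addr0.
by move=> p _; rewrite mulr0.
Qed.

(** The boundary values of [a] select one vertical side [c], with the sign [s]
    of the outward normal. *)
Lemma strip_ibp_x (c s : R) (a a' b g : R -> R) : C1pair a a' -> continuous b ->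
  (forall v : R -> R, a x1 * v x1 - a x0 * v x0 = s * v c) ->
  is_trace D (vsegment c) Y w g ->
  ip D w (fun p => a' p.1 * b p.2) + ip D (jdx w) (fun p => a p.1 * b p.2) =
  s * \int[leb1]_(y in Y) (b y * g y).
Proof.
move=> ha cb ends tr; have ca := C1pair_cont ha; have ca' := ha.2.
have L1 := LT ca' cb; have L2' := LT ca cb.
have Lb : L2 leb1 Y b by exact: cont_L2_itv.
rewrite -functional_xE//.
rewrite (trace_functional (b := fun y => s * b y) (c := vsegment c) (g := g) (J := Y))//.
- rewrite -RintegralZl//; first by apply: eq_Rintegral => y _; rewrite mulrA.
  by apply: L2_mul_int => //; case: tr.
- exact: continuous_pairr.
- exact: L2Z.
- move=> phi C1phi Lphi _; rewrite /functional.
  transitivity (\int[leb2]_(p in D) (('D_(e1 R) phi p * a p.1 + phi p * a' p.1) * b p.2)).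
    by apply: eq_Rintegral => p _ /=; ring.
  rewrite ibp_rect_x//.
    apply: eq_Rintegral => y _; rewrite (ends (fun x => phi (x, y))) /vsegment /=; ring.
  have [l0 l1 _] := Lphi.
  have i0 := L2_mul_int mD l0 L1; have i1 := L2_mul_int mD l1 L2'.
  apply: eq_integrable (rintD mD i0 i1) => // p _ /=; congr EFin; ring.
Qed.

Lemma strip_ibp_y (a b b1 b2 : R -> R) : continuous a -> C1pair b b1 -> C1pair b1 b2 ->
  b1 (2^-1) = b1 (- 2^-1) -> periodic_y D `]x0, x1[%classic 1 w ->
  ip D w (fun p => a p.1 * b2 p.2) + ip D (jdy w) (fun p => a p.1 * b1 p.2) = 0.
Proof.
move=> ca hb hb1 per [g []]; rewrite div1r => trt trb.
have La : L2 leb1 `]x0, x1[ a by exact: cont_L2_itv.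
have Lg : L2 leb1 `]x0, x1[ g by case: trt.
(* an affine cutoff selects one of the two horizontal sides *)
have side (m q c s : R) : is_trace D (hsegment c) `]x0, x1[%classic w g ->
    (forall v : R -> R, (m * 2^-1 + q) * b1 2^-1 * v 2^-1
       - (m * - 2^-1 + q) * b1 (- 2^-1) * v (- 2^-1) = s * v c) ->
    ip D w (fun p => a p.1 * (m * b1 p.2 + (m * p.2 + q) * b2 p.2)) +
    ip D (jdy w) (fun p => a p.1 * ((m * p.2 + q) * b1 p.2)) =
    s * \int[leb1]_(x in `]x0, x1[) (a x * g x).
  move=> tr ends; have hc := C1pairM (C1pair_affine m q) hb1.
  have L1 := LT ca hc.2; have L2' := LT ca (C1pair_cont hc).
  rewrite -functional_yE//.
  rewrite (trace_functional (b := fun x => s * a x) (c := hsegment c) (g := g) (J := `]x0, x1[%classic))//.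
  - rewrite -RintegralZl//; first by apply: eq_Rintegral => y _; rewrite mulrA.
    exact: L2_mul_int.
  - exact: continuous_pairl.
  - exact: L2Z.
  - move=> phi C1phi Lphi _; rewrite /functional.
    transitivity (\int[leb2]_(p in D) (('D_(e2 R) phi p * ((m * p.2 + q) * b1 p.2) +
        phi p * (m * b1 p.2 + (m * p.2 + q) * b2 p.2)) * a p.1)).
      by apply: eq_Rintegral => p _ /=; ring.
    rewrite (ibp_rect_y (itvNhh R) (mI x0 x1) C1phi hc).
      apply: eq_Rintegral => x _; rewrite (ends (fun y => phi (x, y))) /hsegment /=; ring.
    have [l0 _ l2] := Lphi.
    have i0 := L2_mul_int mD l0 L1; have i1 := L2_mul_int mD l2 L2'.
    apply: eq_integrable (rintD mD i0 i1) => // p _ /=; congr EFin; ring.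
have T := side 1 2^-1 2^-1 (b1 2^-1) trt ltac:(by move=> v; field).
have B := side (-1) 2^-1 (- 2^-1) (- b1 2^-1) trb ltac:(by move=> v; rewrite -per; field).
have cb1 := C1pair_cont hb1; have cb2 := hb1.2.
have [w0 _ w2] := Lw.
have caff (m q : R) : continuous (fun y : R => m * y + q) := C1pair_cont (C1pair_affine m q).
have LL (m q : R) : L2 leb2 D (fun p => a p.1 * (m * b1 p.2 + (m * p.2 + q) * b2 p.2)) /\
    L2 leb2 D (fun p => a p.1 * ((m * p.2 + q) * b1 p.2)).
  split; first exact: (LT ca (C1pairM (C1pair_affine m q) hb1).2).
  exact: (LT ca (C1pair_cont (C1pairM (C1pair_affine m q) hb1))).
have E1 : ip D w (fun p => a p.1 * b2 p.2) =
    ip D w (fun p => a p.1 * (1 * b1 p.2 + (1 * p.2 + 2^-1) * b2 p.2)) +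
    ip D w (fun p => a p.1 * (-1 * b1 p.2 + (-1 * p.2 + 2^-1) * b2 p.2)).
  rewrite -RintegralD//; [|exact: L2_mul_int (LL _ _).1..].
  by apply: eq_Rintegral => p _; field.
have E2 : ip D (jdy w) (fun p => a p.1 * b1 p.2) =
    ip D (jdy w) (fun p => a p.1 * ((1 * p.2 + 2^-1) * b1 p.2)) +
    ip D (jdy w) (fun p => a p.1 * ((-1 * p.2 + 2^-1) * b1 p.2)).
  rewrite -RintegralD//; [|exact: L2_mul_int (LL _ _).2..].
  by apply: eq_Rintegral => p _; field.
by rewrite E1 E2 addrACA T B mulNr subrr.
Qed.

End Strip.

Definition hom_weak (alpha beta : R) (umt upt : R * R -> R) (wm wp : jet R) :=
  forall (phi : jet R) (gl g0 : R -> R),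
    H1 Omega phi -> periodic_y Omega `]-1, 1[%classic 1 phi ->
    is_trace Omega (vsegment (-1)) Y phi gl ->
    is_trace Omega (vsegment 0) Y phi g0 ->
    heat_form Omega_minus umt wm phi + heat_form Omega_plus upt wp phi =
      (alpha - beta) * \int[leb2]_(p in Omega_minus) phi p
      + (1 - alpha) * \int[leb1]_(y in Y) gl y
      + beta * \int[leb1]_(y in Y) g0 y.

Section Static.
Variables (alpha beta : R) (umt upt : R * R -> R) (wm wp : jet R).
Hypotheses (a0 : 0 <= alpha) (a1 : alpha <= 1).
Hypotheses (Lm : L2jet Omega_minus wm) (Lp : L2jet Omega_plus wp).
Hypotheses (Lmt : L2 leb2 Omega_minus umt) (Lpt : L2 leb2 Omega_plus upt).
Hypotheses (perm : periodic_y Omega_minus `]-1, 0[%classic 1 wm)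
  (perp : periodic_y Omega_plus `]0, 1[%classic 1 wp).
Hypothesis trans : exists g : R -> R,
  is_trace Omega_plus (vsegment 0) Y wp g /\
  is_trace Omega_minus (vsegment 0) Y wm (fun y => (1 - alpha) * g y).
Hypothesis weak : hom_weak alpha beta umt upt wm wp.
Variables (P : profile alpha) (b b1 b2 : R -> R).
Hypotheses (hb : C1pair b b1) (hb1 : C1pair b1 b2).
Hypotheses (per0 : b (2^-1) = b (- 2^-1)) (per1 : b1 (2^-1) = b1 (- 2^-1)).
Let c := pf1 P 0.
Let cb := C1pair_cont hb.
Let cb1 := C1pair_cont hb1.
Let cb2 := hb1.2.
Local Notation OM := (@Omega_minus R).
Local Notation OP := (@Omega_plus R).
Let mM : measurable (OM : set mP). Proof. exact: measurable_Omega_minus. Qed.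
Let mPl : measurable (OP : set mP). Proof. exact: measurable_Omega_plus. Qed.
Let MO : OM `<=` @Omega R. Proof. by move=> p []. Qed.
Let PO : OP `<=` @Omega R. Proof. by move=> p []. Qed.
Local Notation Ib := (\int[leb1]_(y in Y) b y).

(* a profile with its layer is C^1 on the plane, hence admissible as a test
   function for every exponent of the layer *)
Let weak_N n :
  ip OM umt (fun p => pf P p.1 * b p.2) + ip OM (jdx wm) (fun p => pf1 P p.1 * b p.2)
  + ip OM (jdy wm) (fun p => pf P p.1 * b1 p.2)
  + (ip OP upt (fun p => (pg P p.1 + alpha * c * layer n p.1) * b p.2)
  + ip OP (jdx wp) (fun p => (pg1 P p.1 + alpha * c * (1 - p.1) ^+ n) * b p.2)
  + ip OP (jdy wp) (fun p => (pg P p.1 + alpha * c * layer n p.1) * b1 p.2)) =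
  profile_load beta P * Ib.
Proof.
have hT := C1_ptest P n.
have [C1phi E1 E2] := C1_tensor hT hb.
set phi := fun p : R * R => _ in C1phi E1 E2.
have ct := C1pair_cont hT.
have mO : measurable (@Omega R : set mP) by exact: measurable_Omega.
have H1phi := H1_of_C1 mO (fun=> id) C1phi.
have Lh (q x y : R) : L2 leb1 `]x, y[ (phi \o hsegment q).
  by apply: cont_L2_itv => z; apply: continuousM; [exact: ct|exact: cst_continuous].
have Lv (q : R) : L2 leb1 Y (phi \o vsegment q).
  exact: cont_L2_itv (C1pair_cont (C1pairZ (ptest P n q) hb)).
have perphi : periodic_y Omega `]-1, 1[%classic 1 (jet_of phi).
  exists (phi \o hsegment (1 / 2)); split.
    by apply: (is_trace_C1 mO (mI (-1) 1) C1phi); exact: Lh.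
  have -> : phi \o hsegment (1 / 2) = phi \o hsegment (- (1 / 2)).
    by apply/funext => x; rewrite /phi /= div1r per0.
  by apply: (is_trace_C1 mO (mI (-1) 1) C1phi); exact: Lh.
have t1 := is_trace_C1 (c := vsegment (-1)) mO (mI _ _) C1phi (Lv _).
have t0 := is_trace_C1 (c := vsegment 0) mO (mI _ _) C1phi (Lv _).
have := weak H1phi perphi t1 t0.
have ib : leb1.-integrable Y (EFin \o b) by exact: cont_int_oo.
have vl (q : R) : q <= 0 -> \int[leb1]_(y in Y) (phi \o vsegment q) y = pf P q * Ib.
  move=> q0; rewrite -RintegralZl//; apply: eq_Rintegral => y _.
  by rewrite /phi /= /ptest /splice q0.
have D1 p : 'D_(e1 R) phi p = ptest1 P n p.1 * b p.2 by have := congr1 (fun f => f p) E1.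
have D2 p : 'D_(e2 R) phi p = ptest P n p.1 * b1 p.2 by have := congr1 (fun f => f p) E2.
have hf (D0 : set mP) ut0 w0 (q0 q1 q2 : R * R -> R) : measurable D0 -> D0 `<=` @Omega R ->
    L2jet D0 w0 ->
    (forall p, D0 p -> [/\ phi p = q0 p, 'D_(e1 R) phi p = q1 p & 'D_(e2 R) phi p = q2 p]) ->
    heat_form D0 ut0 w0 (jet_of phi) = ip D0 ut0 q0 + ip D0 (jdx w0) q1 + ip D0 (jdy w0) q2.
  move=> mD0 D0O [_ w1 w2] Eq; have [_ l1 l2] := C1_L2jet mD0 D0O C1phi.
  rewrite /heat_form RintegralD//; [|exact: L2_mul_int..].
  rewrite addrA; congr (_ + _ + _); apply: eq_Rintegral => p /set_mem /Eq[e0 e1 e2].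
  - by rewrite -e0.
  - by rewrite -e1.
  - by rewrite -e2.
have aM p : OM p -> p.1 <= 0 by move=> [_ /= /ltW].
have aP p : OP p -> (p.1 <= 0) = false by move=> [_ /= p0]; rewrite leNgt p0.
rewrite (hf OM umt wm (fun p => pf P p.1 * b p.2) (fun p => pf1 P p.1 * b p.2)
   (fun p => pf P p.1 * b1 p.2) mM MO Lm); last first.
  by move=> p /aM p0; rewrite D1 D2 /phi /ptest /ptest1 /splice p0.
rewrite (hf OP upt wp (fun p => (pg P p.1 + alpha * c * layer n p.1) * b p.2)
   (fun p => (pg1 P p.1 + alpha * c * (1 - p.1) ^+ n) * b p.2)
   (fun p => (pg P p.1 + alpha * c * layer n p.1) * b1 p.2) mPl PO Lp); last first.
  by move=> p /aP p0; rewrite D1 D2 /phi /ptest /ptest1 /splice p0.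
move=> ->.
rewrite vl ?lerN10// vl//.
have -> : \int[leb2]_(p in OM) jet_of phi p = (\int[leb1]_(x in `]-1, 0[) pf P x) * Ib.
  have cf := C1pair_cont (C1_f P).
  have iphi : leb2.-integrable OM (EFin \o (fun p => pf P p.1 * b p.2)).
    by apply: L2_int => //; [exact: Omega_fin|exact: L2_tensor].
  transitivity (\int[leb2]_(p in OM) (pf P p.1 * b p.2)).
    by apply: eq_Rintegral => p /set_mem/aM p0; rewrite /= /phi /ptest /splice p0.
  rewrite Omega_minusE in iphi *; have [_ _ ->] := fubini_x (mI _ _) (mI _ _) iphi.
  rewrite mulrC -RintegralZl//; last exact: cont_int_oo.
  by apply: eq_Rintegral => x _; rewrite /= RintegralZl// mulrC.
by rewrite /profile_load; ring.
Qed.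

Let LT (D : set mP) (f h : R -> R) : measurable D -> D `<=` @Omega R ->
  continuous f -> continuous h -> L2 leb2 D (fun p => f p.1 * h p.2).
Proof. exact: L2_tensor. Qed.

Let clay n : continuous (layer n : R -> R). Proof. exact: C1pair_cont (C1pair_layer R n). Qed.
Let cpow n : continuous (fun x : R => (1 - x) ^+ n). Proof. exact: (C1pair_layer R n).2. Qed.

Let err n := ip OP upt (fun p => layer n p.1 * b p.2)
  + ip OP (jdx wp) (fun p => (1 - p.1) ^+ n * b p.2)
  + ip OP (jdy wp) (fun p => layer n p.1 * b1 p.2).

Let lhs := ip OM umt (fun p => pf P p.1 * b p.2) + ip OM (jdx wm) (fun p => pf1 P p.1 * b p.2)
  + ip OM (jdy wm) (fun p => pf P p.1 * b1 p.2)
  + (ip OP upt (fun p => pg P p.1 * b p.2) + ip OP (jdx wp) (fun p => pg1 P p.1 * b p.2)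
  + ip OP (jdy wp) (fun p => pg P p.1 * b1 p.2)).

Let lhs_err n : lhs + alpha * c * err n = profile_load beta P * Ib.
Proof.
have split3 (h : R * R -> R) (f l v : R -> R) : L2 leb2 OP h -> continuous f -> continuous l ->
    continuous v ->
    ip OP h (fun p => (f p.1 + alpha * c * l p.1) * v p.2) =
    ip OP h (fun p => f p.1 * v p.2) + alpha * c * ip OP h (fun p => l p.1 * v p.2).
  move=> Lh cf cl cv; have i1 := L2_mul_int mPl Lh (LT mPl PO cf cv).
  have i2 := L2_mul_int mPl Lh (LT mPl PO cl cv).
  rewrite -RintegralZl// -RintegralD//; last exact: rintZ.
  by apply: eq_Rintegral => p _; ring.
have cg := C1pair_cont (C1_g P); have cg1 := C1pair_cont (C1_g1 P).
have [_ w1 w2] := Lp.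
rewrite -(weak_N n) (split3 upt (pg P) (layer n) b)// (split3 (jdx wp) (pg1 P) (fun x => (1 - x) ^+ n) b)//.
by rewrite (split3 (jdy wp) (pg P) (layer n) b1)// /lhs /err; ring.
Qed.

Let err_bound : exists2 K, 0 <= K & forall n e, 0 < e -> (n.+1%:R)^-1 <= e ^+ 2 -> `|err n| <= e * K.
Proof.
have [Mb Mb0 bM] := cont_bounded_Omega (continuous_tensor (@cst_continuous _ _ (1 : R)) cb).
have [Mb1 Mb10 b1M] := cont_bounded_Omega (continuous_tensor (@cst_continuous _ _ (1 : R)) cb1).
pose M := Mb + Mb1.
have M0 : 0 <= M by exact: addr_ge0.
have bM' p : OP p -> `|b p.2| <= M.
  by move=> [/bM + _]; rewrite /cst mul1r => h; apply: (le_trans h); rewrite lerDl.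
have b1M' p : OP p -> `|b1 p.2| <= M.
  by move=> [/b1M + _]; rewrite /cst mul1r => h; apply: (le_trans h); rewrite lerDr.
have area : fine (leb2 OP) = 1.
  rewrite Omega_plusE leb2X// !leb1_oo// ?ltW//; last by rewrite -subr_gt0; lra.
  by rewrite -EFinM /=; lra.
have fP : (leb2 OP < +oo)%E by exact: Omega_fin.
have pos p : OP p -> 0 <= p.1 <= 1.
  by move=> [[/andP[_ p1] _] /= p0]; rewrite !ltW.
have [_ w1 w2] := Lp.
exists (M * (Num.sqrt (sq leb2 OP upt) + Num.sqrt (sq leb2 OP (jdx wp)) + Num.sqrt (sq leb2 OP (jdy wp)))).
  by rewrite mulr_ge0// !addr_ge0 ?sqrtr_ge0.
move=> n e e0 ne.
have n0 : 0 <= (n.+1%:R : R)^-1 by rewrite invr_ge0.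
have lay (v : R -> R) : continuous v -> (forall p, OP p -> `|v p.2| <= M) ->
    sq leb2 OP (fun p => layer n p.1 * v p.2) <= (M * e) ^+ 2.
  move=> cv vM; rewrite -[leRHS]mulr1 -area -Rintegral_cst//.
  apply: le_Rintegral => //.
  - exact: (L2_sqr_int mPl (LT mPl PO (@clay n) cv)).
  - by apply: L2_int => //; exact: L2_cst.
  move=> p hp; have hv := vM p hp; have /layer_bound l01 := pos p hp.
  move: (l01 n) => /andP[l0 l1].
  have B1 : v p.2 ^+ 2 <= M ^+ 2 by rewrite -real_normK ?num_real// lerXn2r ?nnegrE.
  have B2 : layer n p.1 ^+ 2 <= e ^+ 2.
    apply: (le_trans _ ne); rewrite expr2 -[leRHS]mulr1; apply: ler_pM => //.
    by apply: (le_trans l1); rewrite invf_le1 ?ler1n// ltr0n.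
  by rewrite [leLHS]exprMn [leRHS]exprMn mulrC; apply: ler_pM; rewrite ?sqr_ge0.
have pw : sq leb2 OP (fun p => (1 - p.1) ^+ n * b p.2) <= (M * e) ^+ 2.
  apply: (@le_trans _ _ (\int[leb2]_(p in OP) (M ^+ 2 * (1 - p.1) ^+ n.*2))).
    apply: le_Rintegral => //.
    - exact: (L2_sqr_int mPl (LT mPl PO (@cpow n) cb)).
    - apply: rintZ => //; apply: L2_int => //; apply: cont_L2 => //.
      exact: continuous_fst_comp (@cpow _).
    move=> p hp; rewrite mulrC !exprMn -exprM muln2; have := bM' p hp; have /andP[p0 p1] := pos p hp.
    move=> hv; apply: ler_wpM2r; first by rewrite exprn_ge0// subr_ge0.
    by rewrite -real_normK ?num_real// lerXn2r ?nnegrE.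
  rewrite RintegralZl//; last first.
    by apply: L2_int => //; apply: cont_L2 => //; exact: continuous_fst_comp (@cpow _).
  rewrite exprMn ler_wpM2l ?sqr_ge0//; apply: le_trans ne.
  have ip1 : leb2.-integrable OP (EFin \o (fun p => (1 - p.1) ^+ n.*2)).
    by apply: L2_int => //; apply: cont_L2 => //; exact: continuous_fst_comp (@cpow _).
  rewrite Omega_plusE in ip1 *; have [_ _ ->] := fubini_y (mI _ _) (mI _ _) ip1.
  rewrite (@eq_Rintegral _ _ _ _ _ (fun=> n.*2.+1%:R^-1)); last by move=> y _; exact: int_pow.
  rewrite Rintegral_cst// fine_mu_oo; last by rewrite ltW// itvNhh.
  rewrite (_ : 2^-1 - - 2^-1 = 1 :> R); last by field.
  by rewrite mulr1 lef_pV2 ?posrE ?ltr0n// ler_nat ltnS -addnn leq_addr.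
have Me0 : 0 <= M * e by rewrite mulr_ge0// ltW.
have rt x : x <= (M * e) ^+ 2 -> Num.sqrt x <= M * e.
  by move=> h; rewrite -(ger0_norm Me0) -sqrtr_sqr ler_wsqrtr.
have one (h q : R * R -> R) : L2 leb2 OP h -> L2 leb2 OP q -> sq leb2 OP q <= (M * e) ^+ 2 ->
    `|ip OP h q| <= e * (M * Num.sqrt (sq leb2 OP h)).
  move=> Lh Lq hq; apply: (le_trans (cauchy_schwarz_norm mPl Lh Lq)).
  by rewrite mulrA (mulrC e) [leRHS]mulrC ler_wpM2l ?sqrtr_ge0// rt.
rewrite !mulrDr; apply: (le_trans (ler_normD _ _)); apply: lerD.
  apply: (le_trans (ler_normD _ _)); apply: lerD.
    by apply: one => //; [exact: LT|exact: lay].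
  by apply: one => //; exact: LT (@cpow n) cb.
by apply: one => //; [exact: LT|exact: lay].
Qed.

(* as the exponent grows, the layer and its derivative vanish in L^2 *)
Let lhsE : lhs = profile_load beta P * Ib.
Proof.
have [K K0 HK] := err_bound.
apply/eqP; rewrite -subr_eq0; apply/eqP.
apply: (@eq0_small _ _ (`|alpha * c| * K)); first by rewrite mulr_ge0.
move=> e e0; pose n := Num.truncn ((e ^+ 2)^-1).
have e20 : 0 < e ^+ 2 by rewrite exprn_gt0.
have hn : (n.+1%:R)^-1 <= e ^+ 2.
  rewrite invf_ple ?posrE// ?ltr0n// ltW// /n.
  by apply: Num.Theory.truncnS_gt.
have := lhs_err n => /eqP; rewrite eq_sym addrC -subr_eq => /eqP E.
rewrite -normrN opprB E normrM mulrCA ler_wpM2l//.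
exact: HK.
Qed.

(** Integrating by parts once more on each side, the traces at 0 give [c (1 -
    alpha) u(0+)] from the left and the opposite from the right, by the flux
    condition of the profile; periodicity removes the terms at the horizontal
    sides. *)
Lemma hom_moment :
  ip OM umt (fun p => pf P p.1 * b p.2) + ip OP upt (fun p => pg P p.1 * b p.2) =
  (ip OM wm (fun p => pf2 P p.1 * b p.2) + ip OP wp (fun p => pg2 P p.1 * b p.2)) +
  (ip OM wm (fun p => pf P p.1 * b2 p.2) + ip OP wp (fun p => pg P p.1 * b2 p.2)) +
  profile_load beta P * Ib.
Proof.
have [g [trp trm]] := trans.
have DM := Omega_minusE R; have DP := Omega_plusE R.
have MO' := MO; have PO' := PO; have Lm' := Lm; have Lp' := Lp.
have perm' := perm; have perp' := perp; have E := lhsE.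
rewrite /lhs in E; rewrite DM in E trm MO' Lm' perm' *; rewrite DP in E trp PO' Lp' perp' *.
have X1 := strip_ibp_x (c := 0) (s := c) (ltrN10 R) MO' Lm' (C1_f1 P) cb
  ltac:(by move=> v; rewrite f1N1 mul0r subr0) trm.
have X2 := strip_ibp_x (c := 0) (s := - ((1 - alpha) * c)) ltr01 PO' Lp' (C1_g1 P) cb
  ltac:(by move=> v; rewrite g11 mul0r sub0r flux0 mulNr) trp.
have Y1 := strip_ibp_y MO' Lm' (C1pair_cont (C1_f P)) hb hb1 per1 perm'.
have Y2 := strip_ibp_y PO' Lp' (C1pair_cont (C1_g P)) hb hb1 per1 perp'.
have Lg : L2 leb1 Y g by case: trp.
have Eg : \int[leb1]_(y in Y) (b y * ((1 - alpha) * g y)) = (1 - alpha) * \int[leb1]_(y in Y) (b y * g y).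
  rewrite -RintegralZl//; last by apply: L2_mul_int => //; exact: cont_L2_itv.
  by apply: eq_Rintegral => y _; ring.
rewrite Eg in X1.
exact: hom_arith E X1 X2 Y1 Y2.
Qed.

End Static.
End HomogenizedMoment.

(** * Derivatives in time *)

Section Evolution.
Context (R : realType).
Implicit Types (T : R) (F G : R -> R).

(** Continuity up to the ends and a derivative inside: what the mean value
    theorem requires. *)
Definition evolves T F F' := {within `[0, T], continuous F} /\
  forall t, 0 < t < T -> is_derive t (1 : R) F (F' t).

Lemma evolvesD T F F' G G' : evolves T F F' -> evolves T G G' ->
  evolves T (fun t => F t + G t) (fun t => F' t + G' t).
Proof.
move=> [cF dF] [cG dG]; split; first exact: within_continuousD.
by move=> t ht; have ? := dF t ht; have ? := dG t ht; exact: is_deriveD.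
Qed.

Lemma within_cst (A : set R) (c : R) : {within A, continuous (fun=> c : R)}.
Proof. by apply: continuous_subspaceT => x; exact: cst_continuous. Qed.

Lemma within_continuousM (A : set R) F G : {within A, continuous F} ->
  {within A, continuous G} -> {within A, continuous (fun t => F t * G t)}.
Proof. move=> cF cG x; exact: (@continuousM R (subspace A) F G x (cF x) (cG x)). Qed.

Lemma evolvesM T F F' G G' : evolves T F F' -> evolves T G G' ->
  evolves T (fun t => F t * G t) (fun t => F t * G' t + G t * F' t).
Proof.
move=> [cF dF] [cG dG]; split; first exact: within_continuousM.
by move=> t ht; have ? := dF t ht; have ? := dG t ht; exact: is_deriveM.
Qed.

Lemma evolves_C1 T F F' : (forall t : R, is_derive t (1 : R) F (F' t)) -> evolves T F F'.
Proof.
move=> dF; split=> [|t _ //]; apply: continuous_subspaceT => t.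
by apply: differentiable_continuous; apply/derivable1_diffP; case: (dF t).
Qed.

Lemma evolvesZ T (c : R) F F' : evolves T F F' ->
  evolves T (fun t => c * F t) (fun t => c * F' t).
Proof.
move=> [cF dF]; split; first by apply: within_continuousM => //; exact: within_cst.
by move=> t ht; have ? := dF t ht; exact: is_deriveZ.
Qed.

Lemma evolves_eq T F F' G G' : evolves T F F' -> F =1 G -> (forall t, 0 < t < T -> F' t = G' t) ->
  evolves T G G'.
Proof.
move=> [cF dF] /funext <- E; split=> // t ht; apply: is_derive_eq (dF t ht) _; exact: E.
Qed.

Lemma evolves_nincr T F F' : evolves T F F' -> (forall t, 0 < t < T -> F' t <= 0) ->
  forall t, 0 <= t <= T -> F t <= F 0.
Proof.
move=> [cF dF] F0 t /andP[t0 tT].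
apply: (@ler0_derive1_nincr _ F 0 T) => //.
- by move=> x; rewrite in_itv/= => /dF [].
- by move=> x; rewrite in_itv/= => hx; rewrite derive1E; case: (dF x hx) => _ ->; exact: F0.
Qed.

Lemma gronwall T F F' (K h : R) : evolves T F F' -> 0 <= K -> 0 <= h -> 0 <= F 0 ->
  (forall t, 0 < t < T -> F' t <= K * F t + h) ->
  forall t, 0 <= t <= T -> F t <= expR (K * T) * (F 0 + h * T).
Proof.
move=> eF K0 h0 F0 HF t /andP[t0 tT].
have eE : evolves T (fun t => expR (- K * t)) (fun t => - K * expR (- K * t)).
  apply: evolves_C1 => s.
  have -> : (fun t => expR (- K * t)) = expR \o (fun t => - K * t) by [].
  have d1 : is_derive s (1 : R) (fun t => - K * t) (- K).
    by have := (C1pairZ (- K) (C1pair_id R)).1 s; rewrite mulr1.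
  have d2 := is_derive_expR (- K * s).
  apply: (is_derive_eq (is_derive1_comp d2 d1)); by rewrite /GRing.scale/= mulrC.
have e1 : evolves T (fun t => - h * t) (fun=> - h).
  apply: evolves_C1 => s.
  by have := (C1pairZ (- h) (C1pair_id R)).1 s; rewrite mulr1.
have := evolves_nincr (evolvesD (evolvesM eE eF) e1) _ (t := t); rewrite t0 tT.
rewrite !mulr0 expR0 mul1r addr0 => H.
have {}H : expR (- K * t) * F t + - h * t <= F 0.
  apply: H => // s hs; have /andP[s0 _] := hs.
  have E1 : expR (- K * s) <= 1.
    by rewrite -expR0 ler_expR mulNr oppr_le0 mulr_ge0// ltW.
  have E0 := expR_gt0 (- K * s).
  have := ler_wpM2l (ltW E0) (HF s hs); have := ler_wpM2r h0 E1.
  by move: (expR _) => q; rewrite mulrDr mul1r; move: (q * h) => r *; lra.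
have H2 : F t <= expR (K * t) * (F 0 + h * t).
  have := ler_wpM2l (ltW (expR_gt0 (K * t))) H.
  rewrite mulrDr mulrA -expRD mulNr subrr expR0 mul1r mulrDr; lra.
apply: (le_trans H2); apply: ler_pM; rewrite ?expR_ge0//.
- by rewrite addr_ge0// mulr_ge0.
- by rewrite ler_expR ler_wpM2l.
- by rewrite lerD2l ler_wpM2l.
Qed.

Lemma is_derive_eps F (t d : R) : (forall e, 0 < e -> exists2 r, 0 < r &
    forall s, s != t -> `|s - t| < r -> `|(F s - F t) / (s - t) - d| <= e) ->
  is_derive t (1 : R) F d.
Proof.
move=> H.
suff C : (fun h : R => h^-1 *: ((F \o shift t) (h *: 1) - F t)) @ 0^' --> d.
  by split; [apply/cvg_ex; exists d|exact/cvg_lim].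
apply/cvgrPdist_le => e e0; have [r r0 Hr] := H e e0.
have h1 : \forall h \near (0 : R)^', `|h| < r.
  by apply: nbhs_dnbhs; apply/nbhs_ballP; exists r => //= y; rewrite /ball/= sub0r normrN.
have h2 : \forall h \near (0 : R)^', h != 0 by exact: nbhs_dnbhs_neq.
apply: filterS2 h1 h2 => h hr h0 /=.
have := Hr (h + t); rewrite addrK -subr_eq0 addrK => /(_ h0 hr).
by rewrite distrC /GRing.scale/= mulr1 mulrC.
Qed.

Lemma within_eps (A : set R) F : (forall t, A t -> forall e, 0 < e -> exists2 r, 0 < r &
    forall s, A s -> `|s - t| < r -> `|F s - F t| <= e) -> {within A, continuous F}.
Proof.
move=> H; apply/subspace_continuousP => t At; apply/cvgrPdist_le => e e0.
have [r r0 Hr] := H t At e e0; rewrite near_withinE; apply/nbhs_ballP; exists r => //= s.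
rewrite /ball/= => hs As; rewrite distrC; apply: Hr => //; by rewrite distrC.
Qed.

Lemma within_near (A : set R) (t : R) (P : R -> Prop) : (\forall s \near within A (nbhs t), P s) ->
  exists2 r, 0 < r & forall s, A s -> `|s - t| < r -> P s.
Proof.
rewrite near_withinE => /nbhs_ballP[r /= r0 H]; exists r => // s As hs.
by apply: H => //; rewrite /ball/= distrC.
Qed.

End Evolution.

Section EvolutionIntegrals.
Context (R : realType).
Local Notation mP := (measurableTypeR R * measurableTypeR R)%type.
Local Notation leb2 := (lebesgue2 R).
Local Notation ip D f g := (\int[leb2]_(p in D) (f p * g p)).
Variables (D : set mP) (T : R) (u : R -> jet R) (ut : R -> R * R -> R).
Hypothesis mD : measurable D.
Hypothesis T0 : 0 < T.
Hypothesis ev : evolution_class D T u ut.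

Let Lu t : 0 <= t <= T -> L2 leb2 D (u t).
Proof. by move=> ht; case: ev => /(_ t ht)[[]]. Qed.

Let Lut t : 0 <= t <= T -> L2 leb2 D (ut t).
Proof. by move=> ht; case: ev => /(_ t ht)[]. Qed.

Let close t e : 0 <= t <= T -> 0 < e -> exists2 r, 0 < r &
  forall s, 0 <= s <= T -> `|s - t| < r -> sq leb2 D (fun p => u s p - u t p) <= e ^+ 2.
Proof.
move=> ht e0; have [_ /(_ t ht) cv _ _ _] := ev.
have [r r0 Hr] := within_near (cvge_near cv e0).
exists r => // s hs sr; have := Hr s; rewrite /= in_itv/= => /(_ hs sr)/H1norm_lt[h0 _ _].
have Lsub : L2 leb2 D (fun p => u s p - u t p) by apply: L2B => //; exact: Lu.
by have [_ /ltW] := L2norm_lt mD (L2_meas mD Lsub) h0.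
Qed.

Let quot_close t e : 0 < t < T -> 0 < e -> exists2 r, 0 < r &
  forall s, s != t -> `|s - t| < r -> [/\ 0 <= s <= T,
   L2 leb2 D (fun p => (u s p - u t p) / (s - t) - ut t p) &
   sq leb2 D (fun p => (u s p - u t p) / (s - t) - ut t p) <= e ^+ 2].
Proof.
move=> /andP[t0 tT] e0; have ht : 0 <= t <= T by rewrite !ltW.
have [_ _ _ /(_ t ht) cv _] := ev.
have [r r0 Hr] := within_near (cvge_near cv e0).
exists (Num.min r (Num.min t (T - t))); first by rewrite !lt_min r0 t0 subr_gt0.
move=> s st; rewrite !lt_min => /and3P[sr s1 s2].
have hs : 0 <= s <= T.
  by move: s1 s2; rewrite !ltr_norml => /andP[? ?] /andP[? ?]; apply/andP; split; lra.
have Lq : L2 leb2 D (fun p => (u s p - u t p) / (s - t) - ut t p).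
  apply: L2B => //; last exact: Lut.
  have : L2 leb2 D (fun p => (s - t)^-1 * (u s p - u t p)).
    by apply: L2Z => //; apply: L2B => //; exact: Lu.
  by apply: L2_eq => p _; rewrite mulrC.
split => //; have := Hr s; rewrite /= in_itv/= => /(_ _ sr) h0.
have st' : s <> t by apply/eqP.
have {}h0 := h0 (conj hs st').
by have [_ /ltW] := L2norm_lt mD (L2_meas mD Lq) h0.
Qed.

Let sqrt_le (x e : R) : 0 <= e -> x <= e ^+ 2 -> Num.sqrt x <= e.
Proof. by move=> e0 h; rewrite -(ger0_norm e0) -sqrtr_sqr ler_wsqrtr. Qed.

(* a positive [e'] with [e' * K <= e] *)
Let shrink (e K : R) : 0 < e -> 0 <= K -> exists2 e', 0 < e' & e' * K <= e.
Proof.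
move=> e0 K0; exists (e / (K + 1)); first by rewrite divr_gt0// ltr_wpDl.
rewrite -mulrA ger_pMr// mulrC ler_pdivrMr ?ltr_wpDl// mul1r lerDl//.
Qed.

Lemma evolves_ip (phi : R * R -> R) : L2 leb2 D phi ->
  evolves T (fun t => ip D (u t) phi) (fun t => ip D (ut t) phi).
Proof.
move=> Lphi; have S0 := sqrtr_ge0 (sq leb2 D phi).
split.
  apply: within_eps => t; rewrite /= in_itv/= => ht e e0.
  have [e' e'0 He] := shrink e0 S0; have [r r0 Hr] := close ht e'0.
  exists r => // s; rewrite /= in_itv/= => hs sr.
  have Ls : L2 leb2 D (fun p => u s p - u t p) by apply: L2B => //; exact: Lu.
  have -> : ip D (u s) phi - ip D (u t) phi = \int[leb2]_(p in D) ((u s p - u t p) * phi p).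
    rewrite -RintegralB//; [|exact: L2_mul_int (Lu hs) Lphi|exact: L2_mul_int (Lu ht) Lphi].
    by apply: eq_Rintegral => p _; rewrite mulrBl.
  apply: (le_trans (cauchy_schwarz_norm mD Ls Lphi)); apply: le_trans He.
  by rewrite ler_wpM2r//; apply: sqrt_le; [exact: ltW|exact: Hr].
move=> t ht; have ht' : 0 <= t <= T by case/andP: ht => *; rewrite !ltW.
apply: is_derive_eps => e e0.
have [e' e'0 He] := shrink e0 S0; have [r r0 Hr] := quot_close ht e'0.
exists r => // s st sr; have [hs Lq Hq] := Hr s st sr.
have -> : (ip D (u s) phi - ip D (u t) phi) / (s - t) - ip D (ut t) phi =
   \int[leb2]_(p in D) (((u s p - u t p) / (s - t) - ut t p) * phi p).
  have i1 := L2_mul_int mD (Lu hs) Lphi; have i2 := L2_mul_int mD (Lu ht') Lphi.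
  have i3 := L2_mul_int mD (Lut ht') Lphi.
  rewrite -RintegralB// mulrC -RintegralZl//; last exact: rintB.
  rewrite -RintegralB//; last by apply: rintZ => //; exact: rintB.
  by apply: eq_Rintegral => p _; ring.
apply: (le_trans (cauchy_schwarz_norm mD Lq Lphi)); apply: le_trans He.
by rewrite ler_wpM2r//; apply: sqrt_le => //; exact: ltW.
Qed.

(** The difference quotient of the square is the pairing of the difference
    quotient of [u] with [u s + u t]. *)
Lemma evolves_sq : evolves T (fun t => sq leb2 D (u t)) (fun t => 2 * ip D (ut t) (u t)).
Proof.
have expand s t : 0 <= s <= T -> 0 <= t <= T -> sq leb2 D (u s) - sq leb2 D (u t) =
    2 * ip D (fun p => u s p - u t p) (u t) + sq leb2 D (fun p => u s p - u t p).
  move=> hs ht; have Ls := Lu hs; have Lt := Lu ht.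
  have Lst : L2 leb2 D (fun p => u s p - u t p) by exact: L2B.
  have i1 := L2_sqr_int mD Ls; have i2 := L2_sqr_int mD Lt.
  have i3 := L2_mul_int mD Lst Lt; have i4 := L2_sqr_int mD Lst.
  rewrite /sq -RintegralB// -RintegralZl// -RintegralD//; last exact: rintZ.
  by apply: eq_Rintegral => p _; ring.
split.
  apply: within_eps => t; rewrite /= in_itv/= => ht e e0.
  pose K := 2 * Num.sqrt (sq leb2 D (u t)) + 1.
  have K0 : 0 <= K by rewrite addr_ge0// mulr_ge0// sqrtr_ge0.
  have [e' e'0 He] := shrink e0 K0.
  have m0 : 0 < Num.min e' 1 by rewrite lt_min e'0 ltr01.
  have [r r0 Hr] := close ht m0.
  exists r => // s; rewrite /= in_itv/= => hs sr.
  have Ls : L2 leb2 D (fun p => u s p - u t p) by apply: L2B => //; exact: Lu.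
  have H := Hr s hs sr; have me : Num.min e' 1 <= e' by rewrite ge_min lexx.
  have m1 : Num.min e' 1 <= 1 by rewrite ge_min lexx orbT.
  have H1 : sq leb2 D (fun p => u s p - u t p) <= e'.
    apply: (le_trans H); rewrite expr2; apply: le_trans me.
    by rewrite ler_piMl// ltW.
  have H2 : Num.sqrt (sq leb2 D (fun p => u s p - u t p)) <= e'.
    by apply: le_trans me; apply: sqrt_le => //; exact: ltW.
  have cs := cauchy_schwarz_norm mD Ls (Lu ht).
  rewrite expand//; apply: (le_trans (ler_normD _ _)); apply: le_trans He.
  rewrite normrM (@ger0_norm _ 2)// (ger0_norm (sq_ge0 _ _ _)) /K mulrDr mulr1 mulrCA.
  apply: lerD => //; rewrite ler_wpM2l//.
  by apply: (le_trans cs); rewrite ler_wpM2r ?sqrtr_ge0.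
move=> t ht; have ht' : 0 <= t <= T by case/andP: ht => *; rewrite !ltW.
apply: is_derive_eps => e e0.
pose K := 2 * Num.sqrt (sq leb2 D (u t)) + (2 + 2 * sq leb2 D (ut t)).
have K0 : 0 <= K by rewrite !addr_ge0// mulr_ge0// ?sqrtr_ge0 ?sq_ge0.
have [e' e'0 He] := shrink e0 K0.
have m0 : 0 < Num.min e' 1 by rewrite lt_min e'0 ltr01.
have [r r0 Hr] := quot_close ht m0.
exists (Num.min r e'); first by rewrite lt_min r0.
move=> s st; rewrite lt_min => /andP[sr se]; have [hs Lq Hq] := Hr s st sr.
have me : Num.min e' 1 <= e' by rewrite ge_min lexx.
have m1 : Num.min e' 1 <= 1 by rewrite ge_min lexx orbT.
set q := (fun p => (u s p - u t p) / (s - t) - ut t p) in Lq Hq.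
have Lt := Lu ht'; have Ltt := Lut ht'.
have st0 : s - t != 0 by rewrite subr_eq0.
have Lst : L2 leb2 D (fun p => u s p - u t p) by apply: L2B => //; exact: Lu.
have Lqt : L2 leb2 D (fun p => q p + ut t p) by exact: L2D.
have E1 : ip D (fun p => u s p - u t p) (u t) = (s - t) * (ip D q (u t) + ip D (ut t) (u t)).
  have i1 := L2_mul_int mD Lq Lt; have i2 := L2_mul_int mD Ltt Lt.
  rewrite -RintegralD// -RintegralZl//; last exact: rintD.
  by apply: eq_Rintegral => p _; rewrite /q; field.
have E2 : sq leb2 D (fun p => u s p - u t p) = (s - t) ^+ 2 * sq leb2 D (fun p => q p + ut t p).
  by rewrite -sqZ//; apply: sq_eq => p _; rewrite /q; field.
rewrite expand// E1 E2.
have -> : (2 * ((s - t) * (ip D q (u t) + ip D (ut t) (u t))) +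
     (s - t) ^+ 2 * sq leb2 D (fun p => q p + ut t p)) / (s - t) - 2 * ip D (ut t) (u t) =
   2 * ip D q (u t) + (s - t) * sq leb2 D (fun p => q p + ut t p) by field.
apply: (le_trans (ler_normD _ _)); apply: le_trans He.
rewrite normrM [`|(s - t) * _|]normrM (@ger0_norm _ 2)// (ger0_norm (sq_ge0 _ _ _)).
rewrite /K [e' * _]mulrDr [e' * (2 * _)]mulrCA; apply: lerD.
  rewrite ler_wpM2l//; apply: (le_trans (cauchy_schwarz_norm mD Lq Lt)).
  rewrite ler_wpM2r ?sqrtr_ge0//; apply: le_trans me; apply: sqrt_le => //; exact: ltW.
apply: ler_pM => //; first exact: sq_ge0.
- exact: ltW.
- apply: (le_trans (sqD_le mD Lq Ltt)); rewrite lerD2r ler_piMr//.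
  apply: (le_trans Hq); rewrite expr_le1//; exact: ltW.
Qed.

End EvolutionIntegrals.

(** * Powers of sines and cosines *)

Section Harmonics.
Context (R : realType).
Local Notation mR := (measurableTypeR R).
Local Notation leb1 := (lebesgue1 R).
Local Notation Y := (`]- 2^-1, 2^-1[%classic : set R).
Implicit Types (k x z : R) (j i : nat).

Definition hpow1 k (a b : R -> R) j x := j%:R * k * (a x ^+ j.-1 * b x).
Definition hpow2 k (a : R -> R) j x :=
  k ^+ 2 * (j%:R * (j%:R - 1) * a x ^+ j.-2 - j%:R ^+ 2 * a x ^+ j).

(** The second derivative of [a ^ j] involves [a ^ (j - 2) b ^ 2], and [b ^ 2 =
    1 - a ^ 2] leaves only powers of [a]. *)
Lemma harmonic_power k (a b : R -> R) j :
  C1pair a (fun x => k * b x) -> C1pair b (fun x => - k * a x) ->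
  (forall x, a x ^+ 2 + b x ^+ 2 = 1) ->
  C1pair (fun x => a x ^+ j) (hpow1 k a b j) /\ C1pair (hpow1 k a b j) (hpow2 k a j).
Proof.
move=> ha hb ab; case: j => [|[|n]].
- split.
    apply: C1pair_eq (C1pair_cst (1 : R)) => x; first by rewrite expr0.
    by rewrite /hpow1 mul0r mul0r.
  apply: C1pair_eq (C1pair_cst (0 : R)) => x; first by rewrite /hpow1 mul0r mul0r.
  by rewrite /hpow2 expr0n /= !mul0r subrr mulr0.
- split.
    apply: C1pair_eq ha => x; first by rewrite expr1.
    by rewrite /hpow1 expr0 !mul1r.
  apply: C1pair_eq (C1pairZ k hb) => x; first by rewrite /hpow1 expr0 !mul1r.
  by rewrite /hpow2 expr0 expr1 subrr mulr0 mul0r sub0r expr1n mul1r; ring.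
- split.
    apply: C1pair_eq (C1pairX n.+1 ha) => x //.
    by rewrite /hpow1 /=; ring.
  apply: C1pair_eq (C1pairZ (n.+2%:R * k) (C1pairM (C1pairX n ha) hb)) => x //.
  rewrite /hpow2 /=.
  have -> : n.+1%:R * a x ^+ n * (k * b x) * b x + a x ^+ n.+1 * (- k * a x) =
    k * (n.+1%:R * a x ^+ n * b x ^+ 2 - a x ^+ n.+2) by rewrite !exprS; ring.
  have -> : b x ^+ 2 = 1 - a x ^+ 2 by rewrite -(ab x); ring.
  by rewrite -!natr1 !exprS; ring.
Qed.

(** * The profiles in the direction transverse to the interface *)
Definition kap : R := pi / 2.
(** The frequency is the one for which the slope vanishes at [-1] and at [1]. *)
Definition sn x : R := sin (kap * x).

Let C1sin k : C1pair (fun x => sin (k * x)) (fun x => k * cos (k * x)) /\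
  C1pair (fun x => cos (k * x)) (fun x => - k * sin (k * x)).
Proof.
have dk (x : R) : is_derive x (1 : R) (fun x => k * x) k.
  by have := (C1pairZ k (C1pair_id R)).1 x; rewrite mulr1.
have ck : continuous (fun x => k * x) by exact: C1pair_cont (C1pairZ k (C1pair_id R)).
have cs : continuous (fun x => sin (k * x)).
  by move=> x; apply: continuous_comp; [exact: ck|exact: continuous_sin].
have cc : continuous (fun x => cos (k * x)).
  by move=> x; apply: continuous_comp; [exact: ck|exact: continuous_cos].
split; split.
- move=> x; apply: (is_derive_eq (is_derive1_comp (is_derive_sin (k * x)) (dk x))).
  by rewrite mulrC.
- by move=> x; apply: continuousM; [exact: cst_continuous|exact: cc].
- move=> x; apply: (is_derive_eq (is_derive1_comp (is_derive_cos (k * x)) (dk x))).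
  by rewrite mulrC mulrN mulNr.
- move=> x; apply: (@continuousM _ _ (fun=> - k) (fun x => sin (k * x))); last exact: cs.
  exact: cst_continuous.
Qed.

Let sin2Dcos2 (x : R) : sin x ^+ 2 + cos x ^+ 2 = 1.
Proof. by rewrite addrC cos2Dsin2. Qed.

Let snP j := harmonic_power j (C1sin kap).1 (C1sin kap).2 (fun x => sin2Dcos2 (kap * x)).

Section Sine.
Variable alpha : R.
(** On the right of the interface, odd powers of the sine carry the factor
    required by the flux condition; even powers have zero slope at 0 and must be
    continuous there. *)
Definition sigma j : R := if odd j then 1 - alpha else 1.
Definition sn1 := hpow1 kap sn (fun x => cos (kap * x)).
Definition sn2 := hpow2 kap sn.

Lemma sn0 : sn 0 = 0. Proof. by rewrite /sn mulr0 sin0. Qed.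

Let sine_fg0 j : sn 0 ^+ j = sigma j * sn 0 ^+ j.
Proof. by rewrite sn0 expr0n /sigma; case: j => [|j] /=; rewrite ?mulr1// mulr0. Qed.

Let sine_f1 j : sn1 j (-1) = 0.
Proof. by rewrite /sn1 /hpow1 mulrN1 cosN /kap cos_pihalf !mulr0. Qed.

Let sine_g1 j : sigma j * sn1 j 1 = 0.
Proof. by rewrite /sn1 /hpow1 mulr1 /kap cos_pihalf !mulr0. Qed.

Let sine_flux j : sigma j * sn1 j 0 = (1 - alpha) * sn1 j 0.
Proof.
rewrite /sn1 /hpow1 sn0 /sigma; case: j => [|[|j]] /=; rewrite ?mul0r ?mulr0//.
by rewrite exprS !mul0r !mulr0.
Qed.

Definition sine_profile j : profile alpha := @Profile R alpha
  (fun x => sn x ^+ j) (sn1 j) (sn2 j)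
  (fun x => sigma j * sn x ^+ j) (fun x => sigma j * sn1 j x) (fun x => sigma j * sn2 j x)
  (snP j).1 (snP j).2 (C1pairZ _ (snP j).1) (C1pairZ _ (snP j).2)
  (sine_fg0 j) (sine_f1 j) (sine_g1 j) (sine_flux j).

Lemma sigma_sub2 j : (1 < j)%N -> sigma j.-2 = sigma j.
Proof. by case: j => [|[|j]]//= _; rewrite /sigma /= negbK. Qed.

Lemma sn_norm x : `|sn x| <= 1.
Proof. by rewrite ler_norml sin_geN1 sin_le1. Qed.

Definition psi j : R -> R := splice (pf (sine_profile j)) (pg (sine_profile j)).

Lemma pf2E j x : pf2 (sine_profile j) x = kap ^+ 2 *
  (j%:R * (j%:R - 1) * pf (sine_profile j.-2) x - j%:R ^+ 2 * pf (sine_profile j) x).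
Proof. by []. Qed.

Lemma pg2E j x : pg2 (sine_profile j) x = kap ^+ 2 *
  (j%:R * (j%:R - 1) * pg (sine_profile j.-2) x - j%:R ^+ 2 * pg (sine_profile j) x).
Proof.
rewrite /= /sn2 /hpow2; case: j => [|[|j]].
- by rewrite !mul0r expr0n /= !mul0r subrr !mulr0.
- by rewrite subrr mulr0 !mul0r !sub0r; ring.
- by rewrite (@sigma_sub2 j.+2)//; ring.
Qed.

Lemma psi2E j x : splice (pf2 (sine_profile j)) (pg2 (sine_profile j)) x =
  kap ^+ 2 * (j%:R * (j%:R - 1) * psi j.-2 x - j%:R ^+ 2 * psi j x).
Proof. by rewrite /psi /splice; case: ifP => _; [rewrite pf2E|rewrite pg2E]. Qed.

Lemma psi_norm j x : 0 <= alpha <= 1 -> `|psi j x| <= 1.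
Proof.
move=> /andP[a0 a1]; have h : `|sn x ^+ j| <= 1 by rewrite normrX exprn_ile1// sn_norm.
rewrite /psi /splice /=; case: ifP => // _; rewrite normrM mulr_ile1// /sigma.
by case: odd; rewrite ?normr1// ger0_norm; lra.
Qed.

Lemma continuous_psi j : continuous (psi j).
Proof.
apply: splice_cont; [exact: C1pair_cont (C1_f _)|exact: C1pair_cont (C1_g _)|exact: fg0].
Qed.

End Sine.

(** * The periodic factors along the interface *)
Definition cs z x : R := cos (2 * pi * (x - z)).
Definition cs1 z := hpow1 (2 * pi) (cs z) (fun x => - sin (2 * pi * (x - z))).
Definition cs2 z := hpow2 (2 * pi) (cs z).

Let C1shift k z (a a' : R -> R) : C1pair a a' -> C1pair (fun x => a (x - z)) (fun x => a' (x - z)).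
Proof.
move=> [da ca]; have ct : continuous (fun x : R => x - z).
  by move=> x; apply: continuousB; [exact: cvg_id|exact: cst_continuous].
split; last by move=> x; apply: continuous_comp; [exact: ct|exact: ca].
move=> x; have d1 : is_derive x (1 : R) (fun x => x - z) 1.
  apply: is_derive_eq; by rewrite subr0.
by have := @is_derive1_comp R a (fun x => x - z) x _ _ (da (x - z)) d1; rewrite mulr1.
Qed.

Lemma csP z i : C1pair (fun x => cs z x ^+ i) (cs1 z i) /\ C1pair (cs1 z i) (cs2 z i).
Proof.
have [h1 h2] := C1sin (2 * pi).
apply: harmonic_power.
- apply: C1pair_eq (C1shift 0 z h2) => x //; by rewrite mulrN mulNr.
- apply: C1pair_eq (C1pairZ (-1) (C1shift 0 z h1)) => x; first by rewrite mulN1r.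
  by rewrite /cs mulN1r mulNr.
- by move=> x; rewrite /cs sqrrN cos2Dsin2.
Qed.

Let half_period z : 2 * pi * (2^-1 - z) = 2 * pi * (- 2^-1 - z) + pi *+ 2 :> R.
Proof. by rewrite -mulr_natl; field. Qed.

Lemma cs_period z i : cs z (2^-1) ^+ i = cs z (- 2^-1) ^+ i /\ cs1 z i (2^-1) = cs1 z i (- 2^-1).
Proof.
have E : cs z (2^-1) = cs z (- 2^-1) by rewrite /cs half_period cosD2pi.
by split; [rewrite E|rewrite /cs1 /hpow1 E half_period sinD2pi].
Qed.

Lemma cs_norm z x : `|cs z x| <= 1.
Proof. by rewrite ler_norml cos_geN1 cos_le1. Qed.

Lemma continuous_cs z i : continuous (fun x => cs z x ^+ i).
Proof. exact: C1pair_cont (csP z i).1. Qed.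

Definition ecs z i : R := \int[leb1]_(y in Y) cs z y ^+ i.

(** The second derivative of a periodic function has mean zero. *)
Lemma ecs_rec z i : i%:R * (i%:R - 1) * ecs z i.-2 = i%:R ^+ 2 * ecs z i.
Proof.
have := FTC_oo (itvNhh R) (csP z i).2; rewrite (cs_period z i).2 subrr /cs2 /hpow2.
have ic n : leb1.-integrable Y (EFin \o (fun x => cs z x ^+ n)).
  exact: cont_int_oo (@continuous_cs z n).
have mY : measurable (Y : set mR) by exact: measurable_itv.
rewrite RintegralZl//; last by apply: rintB => //; exact: rintZ.
rewrite RintegralB//; [|exact: rintZ..]; rewrite !RintegralZl// => /eqP.
rewrite mulf_eq0 expf_eq0 /= mulf_eq0 pnatr_eq0 /= gt_eqF ?pi_gt0//= subr_eq0.
by move/eqP.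
Qed.

Lemma ecs_norm z i : `|ecs z i| <= 1.
Proof.
have mY : measurable (Y : set mR) by exact: measurable_itv.
have ic := cont_int_oo (- 2^-1) 2^-1 (@continuous_cs z i).
apply: (le_trans (le_normr_Rintegral mY ic)).
apply: (@le_trans _ _ (\int[leb1]_(y in Y) 1)).
  apply: le_Rintegral => //; first exact: rint_abs.
    exact: cont_int_oo (@cst_continuous _ _ _).
  by move=> y _; rewrite normrX exprn_ile1// cs_norm.
rewrite Rintegral_cst// fine_mu_oo; last by rewrite ltW// itvNhh.
by rewrite mul1r; lra.
Qed.

End Harmonics.

(** * Differential equations for the cracked moments *)

Section Arithmetic.
Variable R : realType.

(** The cross term with [err / eps] is bounded by Young, and the squared error,
    of order [eps ^ 2 G], is absorbed by the dissipation [- G] in the derivative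
    of the energy [y]. *)
Lemma square_derivative (X dX rho lam e err eps c G y dy L eta : R) :
  dX = - lam * X + rho + e * (eps^-1 * err) -> 0 <= lam -> `|rho| <= eta -> `|e| <= 1 -> 0 < eps ->
  err ^+ 2 <= 16 * c ^+ 2 * eps ^+ 2 * G -> dy <= y + L - G -> 0 <= y ->
  (X * dX + X * dX) + 16 * c ^+ 2 * dy <=
  2 * (X * X + 16 * c ^+ 2 * y) + (eta ^+ 2 + 16 * c ^+ 2 * L).
Proof.
move=> -> lam0 hrho he eps0 herr hdy y0.
have c0 : 0 <= 16 * c ^+ 2 by rewrite mulr_ge0// sqr_ge0.
have H1 : (e * (eps^-1 * err)) ^+ 2 <= 16 * c ^+ 2 * G.
  rewrite exprMn; apply: (@le_trans _ _ ((eps^-1 * err) ^+ 2)).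
    by rewrite ler_piMl ?sqr_ge0// -real_normK ?num_real// expr_le1.
  rewrite exprMn; apply: (le_trans (ler_wpM2l (sqr_ge0 _) herr)).
  rewrite le_eqVlt; apply/orP; left; apply/eqP; field; exact: lt0r_neq0.
have H2 : rho ^+ 2 <= eta ^+ 2.
  by rewrite -real_normK ?num_real// lerXn2r ?nnegrE// (le_trans _ hrho).
have H3 := ler_wpM2l c0 hdy; have H4 := mulr_ge0 c0 y0.
have H5 := mulr_ge0 lam0 (sqr_ge0 X).
have H6 := sqr_ge0 (X - rho); have H7 := sqr_ge0 (X - e * (eps^-1 * err)).
move: H1 H2 H3 H4 H5 H6 H7; set q := e * _; set C := 16 * c ^+ 2.
rewrite !sqrrB !mulrDr !mulrN; move: (q ^+ 2) (rho ^+ 2) (eta ^+ 2) => q2 r2 n2.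
have -> : X * (- lam * X) = - (lam * X ^+ 2) by ring.
rewrite expr2; move: (X * X) => g; move: (lam * _) (C * G) (C * dy) (C * y) (C * L) => *; lra.
Qed.

Lemma step_arith (N0 M0 N1 M1 X0 X1 X2 m0 m1 m2 k p jj j2 ii i2 e e' E L : R) :
  X1 = e * M1 - m1 -> X0 = e * M0 - m0 -> X2 = e' * M1 - m2 -> ii * e' = i2 * e ->
  e * (k * (jj * N0 - j2 * N1) + L + E) - (k * (jj * m0 - j2 * m1) + p * (ii * m2 - i2 * m1) + L * e) =
  - (k * j2 + p * i2) * X1 +
  (k * (jj * X0) + p * (ii * X2) + e * (k * (jj * (N0 - M0) - j2 * (N1 - M1)))) + e * E.
Proof.
move=> -> -> -> h.
have -> : p * (ii * (e' * M1 - m2)) = p * (i2 * e * M1 - ii * m2) by rewrite mulrBr mulrA h.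
by ring.
Qed.

Lemma rho_bound (k p jj j2 ii X0 X2 d0 d1 e A1 A2 B : R) : 0 <= k -> 0 <= p -> 0 <= jj -> 0 <= j2 ->
  `|e| <= 1 -> jj * `|X0| <= A1 -> `|ii| * `|X2| <= A2 -> `|d0| <= B -> `|d1| <= B ->
  `|k * (jj * X0) + p * (ii * X2) + e * (k * (jj * d0 - j2 * d1))| <=
  k * A1 + p * A2 + k * (jj + j2) * B.
Proof.
move=> k0 p0 jj0 j20 he h0 h2 hd0 hd1.
apply: (le_trans (ler_normD _ _)); apply: lerD.
  apply: (le_trans (ler_normD _ _)); apply: lerD.
    by rewrite !normrM (ger0_norm k0) (ger0_norm jj0) ler_wpM2l.
  by rewrite !normrM (ger0_norm p0) ler_wpM2l.
rewrite normrM; apply: (@le_trans _ _ (1 * `|k * (jj * d0 - j2 * d1)|)); first exact: ler_wpM2r.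
rewrite mul1r normrM ger0_norm// -mulrA ler_wpM2l//.
apply: (le_trans (ler_normB _ _)); rewrite mulrDl; apply: lerD.
  by rewrite normrM ger0_norm// ler_wpM2l.
by rewrite normrM ger0_norm// ler_wpM2l.
Qed.

End Arithmetic.

Section MomentODE.
Context (R : realType).
Local Notation mR := (measurableTypeR R).
Local Notation mP := (measurableTypeR R * measurableTypeR R)%type.
Local Notation leb1 := (lebesgue1 R).
Local Notation leb2 := (lebesgue2 R).
Local Notation Y := (`]- 2^-1, 2^-1[%classic : set R).
Local Notation ip D f g := (\int[leb2]_(p in D) (f p * g p)).
Variables (alpha beta eps T : R).
Hypotheses (b0 : 0 <= beta) (ba : beta < alpha) (a1 : alpha < 1).
Hypotheses (eps0 : 0 < eps) (eps1 : eps < 1) (T0 : 0 < T).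
Local Notation D := (crack_cell alpha eps).
Variables (w : R -> jet R) (ut : R -> R * R -> R).
Hypothesis evw : evolution_class D T w ut.
Hypothesis perw : forall t, 0 <= t -> periodic_y D `]-1, 1[%classic eps (w t).
Hypothesis weakw : forall t, 0 <= t -> cell_weak alpha beta eps (ut t) (w t).

Let a0 : 0 < alpha. Proof. exact: le_lt_trans ba. Qed.
Let a01 : 0 <= alpha <= 1. Proof. by rewrite !ltW. Qed.
Let mD : measurable (D : set mP). Proof. exact: measurable_cell. Qed.
Let DO : D `<=` @Omega R. Proof. exact: cell_Omega. Qed.
Let fD : (leb2 D < +oo)%E. Proof. exact: cell_fin. Qed.

Definition source : R := 96 * ((1 - alpha)^-1) ^+ 2 * eps.
Lemma source_ge0 : 0 <= source.
Proof. by rewrite /source; apply: mulr_ge0; [apply: mulr_ge0 => //; exact: sqr_ge0|exact: ltW]. Qed.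

Let y t := sq leb2 D (w t).
Let G t := sq leb2 D (jdx (w t)) + sq leb2 D (jdy (w t)).

Let H1w t : 0 <= t <= T -> H1 D (w t).
Proof. by move=> ht; case: evw => /(_ t ht)[]. Qed.
Let Lw t : 0 <= t <= T -> L2 leb2 D (w t).
Proof. by move=> ht; case: (H1w ht). Qed.
Let Lut t : 0 <= t <= T -> L2 leb2 D (ut t).
Proof. by move=> ht; case: evw => /(_ t ht)[]. Qed.

Let itv_cc t : 0 < t < T -> 0 <= t <= T. Proof. by case/andP => *; rewrite !ltW. Qed.

Let dy_le t : 0 < t < T -> 2 * ip D (ut t) (w t) <= y t + source - G t.
Proof.
move=> ht; have /andP[t0 _] := ht.
have := energy b0 ba a1 eps0 eps1 (H1w (itv_cc ht)) (perw (ltW t0)) (weakw (ltW t0)).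
rewrite /source /y /G; move: (ip _ _ _) (sq _ _ _) (sq _ _ _) (sq _ _ _) => p q r s.
move: (_ ^+ 2) => v; lra.
Qed.

Lemma energy_decay t : 0 <= t <= T ->
  sq leb2 D (w t) <= expR T * (sq leb2 D (w 0) + source * T).
Proof.
move=> ht; rewrite -[T in expR T]mul1r.
apply: (gronwall (evolves_sq mD evw)) => //; rewrite ?sq_ge0//.
  exact: source_ge0.
move=> s hs; rewrite mul1r; apply: (le_trans (dy_le hs)).
by rewrite gerBl /G addr_ge0// sq_ge0.
Qed.

Variable m : nat.
Hypothesis hm : 1 <= eps * m.+1%:R <= 2.

(** The moments are those of the test function with its layer, for which the
    weak equation applies, and those of the profile itself, which enter the
    right-hand side of the differential equation. *)
Definition moment_test j t := eps^-1 * ip D (w t) (fun p => ptest (sine_profile alpha j) m.+1 p.1).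
Definition moment_raw j t := eps^-1 * ip D (w t) (fun p => psi alpha j p.1).

Let cfst (a : R -> R) : continuous a -> L2 leb2 D (fun p => a p.1).
Proof. by move=> ca; apply: cont_L2 => //; exact: continuous_fst_comp. Qed.

Definition slope j : R := pf1 (sine_profile alpha j) 0.

Let Ltest j : L2 leb2 D (fun p => ptest (sine_profile alpha j) m.+1 p.1).
Proof. by apply: cfst; exact: C1pair_cont (C1_ptest _ _). Qed.

Let Lpsi j : L2 leb2 D (fun p => psi alpha j p.1).
Proof. by apply: cfst; exact: continuous_psi. Qed.

Lemma moment_raw_close j t : 0 <= t <= T ->
  (moment_raw j t - moment_test j t) ^+ 2 <= 2 * slope j ^+ 2 * eps * sq leb2 D (w t).
Proof.
move=> ht; have Ld : L2 leb2 D (fun p => psi alpha j p.1 - ptest (sine_profile alpha j) m.+1 p.1).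
  exact: L2B.
rewrite /moment_raw /moment_test -mulrBr.
have -> : ip D (w t) (fun p => psi alpha j p.1) -
    ip D (w t) (fun p => ptest (sine_profile alpha j) m.+1 p.1) =
    ip D (w t) (fun p => psi alpha j p.1 - ptest (sine_profile alpha j) m.+1 p.1).
  rewrite -RintegralB//; [|exact: L2_mul_int (Lw ht) (Lpsi _)|exact: L2_mul_int (Lw ht) (Ltest _)].
  by apply: eq_Rintegral => p _; rewrite mulrBr.
have M1 : (m.+2%:R)^-1 <= eps.
  rewrite invf_ple ?posrE// ?ltr0n//; case/andP: hm => h1 _.
  apply: (@le_trans _ _ m.+1%:R); last by rewrite ler_nat.
  by rewrite -div1r ler_pdivrMr// mulrC.
have B : sq leb2 D (fun p => psi alpha j p.1 - ptest (sine_profile alpha j) m.+1 p.1) <=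
    (slope j * eps) ^+ 2 * (2 * eps).
  apply: (@le_trans _ _ ((slope j * eps) ^+ 2 * fine (leb2 D))); last first.
    by rewrite ler_wpM2l ?sqr_ge0//; exact: cell_area b0 ba a1 eps0 eps1.
  rewrite -Rintegral_cst//; apply: le_Rintegral => //.
  - exact: L2_sqr_int.
  - by apply: L2_int => //; exact: L2_cst.
  move=> p Dp; rewrite -real_normK ?num_real// -[leRHS]real_normK ?num_real//.
  rewrite lerXn2r ?nnegrE// distrC [leRHS]normrM (gtr0_norm eps0).
  have p1 : p.1 <= 1 by move: Dp => /DO [/andP[_ /ltW]].
  apply: (le_trans (ptest_diff (sine_profile alpha j) m.+1 a01 p1)).
  by rewrite -/(slope j) ler_wpM2l.
have cs := cauchy_schwarz mD (Lw ht) Ld.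
rewrite exprMn; apply: (le_trans (ler_wpM2l (sqr_ge0 _) (le_trans cs (ler_wpM2l (sq_ge0 _ _ _) B)))).
rewrite le_eqVlt; apply/orP; left; apply/eqP; field; exact: lt0r_neq0.
Qed.

Lemma moment_test_ode j : exists2 err : R -> R,
  evolves T (moment_test j) (fun t => kap R ^+ 2 *
    (j%:R * (j%:R - 1) * moment_raw j.-2 t - j%:R ^+ 2 * moment_raw j t)
    + profile_load beta (sine_profile alpha j) + eps^-1 * err t) &
  forall t, 0 < t < T -> err t ^+ 2 <= 16 * slope j ^+ 2 * eps ^+ 2 * G t.
Proof.
have H t : exists err, 0 < t < T ->
    ip D (ut t) (fun p => ptest (sine_profile alpha j) m.+1 p.1) =
    ip D (w t) (fun p => splice (pf2 (sine_profile alpha j)) (pg2 (sine_profile alpha j)) p.1) +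
      eps * profile_load beta (sine_profile alpha j) + err /\
    err ^+ 2 <= 16 * slope j ^+ 2 * eps ^+ 2 * G t.
  have [ht|ht] := boolP (0 < t < T); last by exists 0.
  have /andP[t0 _] := ht.
  have [err He] := moment_cracked b0 ba a1 eps0 eps1 (H1w (itv_cc ht))
    (perw (ltW t0)) (weakw (ltW t0)) (sine_profile alpha j) hm.
  by exists err.
have [err Herr] := choice H; exists err; last first.
  by move=> t ht; case: (Herr t ht).
have ev := evolvesZ eps^-1 (evolves_ip mD evw (Ltest j)).
apply: evolves_eq ev _ _ => // t ht.
have [Et _] := Herr t ht; rewrite Et.
have -> : ip D (w t) (fun p => splice (pf2 (sine_profile alpha j)) (pg2 (sine_profile alpha j)) p.1) =
   kap R ^+ 2 * (j%:R * (j%:R - 1) * ip D (w t) (fun p => psi alpha j.-2 p.1)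
     - j%:R ^+ 2 * ip D (w t) (fun p => psi alpha j p.1)).
  have i1 := L2_mul_int mD (Lw (itv_cc ht)) (Lpsi j).
  have i2 := L2_mul_int mD (Lw (itv_cc ht)) (Lpsi j.-2).
  rewrite -!RintegralZl// -RintegralB//; [|exact: rintZ..].
  rewrite -RintegralZl//; last by apply: rintB => //; exact: rintZ.
  by apply: eq_Rintegral => p _; rewrite psi2E; ring.
rewrite /moment_raw; field; exact: lt0r_neq0.
Qed.

(** * Comparison with the homogenized moments *)
Section Comparison.
Local Notation OM := (@Omega_minus R).
Local Notation OP := (@Omega_plus R).
Variables (wm wp : R -> jet R) (umt upt : R -> R * R -> R).
Hypothesis evm : evolution_class OM T wm umt.
Hypothesis evp : evolution_class OP T wp upt.
Hypothesis perm : forall t, 0 <= t -> periodic_y OM `]-1, 0[%classic 1 (wm t).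
Hypothesis perp : forall t, 0 <= t -> periodic_y OP `]0, 1[%classic 1 (wp t).
Hypothesis trans : forall t, 0 <= t -> exists g : R -> R,
  is_trace OP (vsegment 0) Y (wp t) g /\
  is_trace OM (vsegment 0) Y (wm t) (fun y => (1 - alpha) * g y).
Hypothesis weakh : forall t, 0 <= t -> hom_weak alpha beta (umt t) (upt t) (wm t) (wp t).
Variable z : R.
Let mM : measurable (OM : set mP). Proof. exact: measurable_Omega_minus. Qed.
Let mPl : measurable (OP : set mP). Proof. exact: measurable_Omega_plus. Qed.
Let MO : OM `<=` @Omega R. Proof. by move=> p []. Qed.
Let PO : OP `<=` @Omega R. Proof. by move=> p []. Qed.
Local Notation P j := (sine_profile alpha j).

Definition hmoment j i t := ip OM (wm t) (fun p => pf (P j) p.1 * cs z p.2 ^+ i) +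
  ip OP (wp t) (fun p => pg (P j) p.1 * cs z p.2 ^+ i).

Let LT (E : set mP) (f h : R -> R) : measurable E -> E `<=` @Omega R ->
  continuous f -> continuous h -> L2 leb2 E (fun p => f p.1 * h p.2).
Proof. exact: L2_tensor. Qed.

Let Lm t : 0 <= t <= T -> L2jet OM (wm t).
Proof. by move=> ht; case: evm => /(_ t ht)[/H1_L2jet]. Qed.
Let Lp t : 0 <= t <= T -> L2jet OP (wp t).
Proof. by move=> ht; case: evp => /(_ t ht)[/H1_L2jet]. Qed.

Lemma hmoment_ode j i : evolves T (hmoment j i) (fun t =>
  kap R ^+ 2 * (j%:R * (j%:R - 1) * hmoment j.-2 i t - j%:R ^+ 2 * hmoment j i t) +
  (2 * pi) ^+ 2 * (i%:R * (i%:R - 1) * hmoment j i.-2 t - i%:R ^+ 2 * hmoment j i t) +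
  profile_load beta (P j) * ecs z i).
Proof.
have cf l : continuous (pf (P l)) by exact: C1pair_cont (C1_f _).
have cg l : continuous (pg (P l)) by exact: C1pair_cont (C1_g _).
have cc l : continuous (fun x => cs z x ^+ l) by exact: continuous_cs.
have ev := evolvesD (evolves_ip mM evm (LT mM MO (cf j) (cc i)))
  (evolves_ip mPl evp (LT mPl PO (cg j) (cc i))).
apply: evolves_eq ev _ _ => // t ht; have /andP[t0 _] := ht; have ht' := itv_cc ht.
have [hb hb1] := csP z i; have [p0 p1] := cs_period z i.
have Lmt : L2 leb2 OM (umt t) by case: evm => /(_ t ht')[].
have Lpt : L2 leb2 OP (upt t) by case: evp => /(_ t ht')[].
rewrite (hom_moment (Lm ht') (Lp ht') Lpt (perm (ltW t0)) (perp (ltW t0)) (trans (ltW t0))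
  (weakh (ltW t0)) (P j) hb hb1 p0 p1).
have [l0 _ _] := Lm ht'; have [q0 _ _] := Lp ht'.
have im l n := L2_mul_int mM l0 (LT mM MO (cf l) (cc n)).
have ipl l n := L2_mul_int mPl q0 (LT mPl PO (cg l) (cc n)).
have lin (E : set mP) (h F2 F0 F1 : R * R -> R) (k c0 c1 : R) : measurable E ->
    L2 leb2 E h -> L2 leb2 E F0 -> L2 leb2 E F1 ->
    (forall p, F2 p = k * (c0 * F0 p - c1 * F1 p)) ->
    ip E h F2 = k * (c0 * ip E h F0 - c1 * ip E h F1).
  move=> mE Lh LF0 LF1 HF; have i1 := L2_mul_int mE Lh LF0; have i2 := L2_mul_int mE Lh LF1.
  rewrite -!RintegralZl// -RintegralB//; [|exact: rintZ..].
  rewrite -RintegralZl//; last by apply: rintB => //; exact: rintZ.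
  by apply: eq_Rintegral => p _; rewrite HF; ring.
rewrite (lin OM (wm t) (fun p => pf2 (P j) p.1 * cs z p.2 ^+ i) _ _ (kap R ^+ 2) (j%:R * (j%:R - 1)) (j%:R ^+ 2) mM l0
  (LT mM MO (cf j.-2) (cc i)) (LT mM MO (cf j) (cc i))); last by move=> p; rewrite pf2E; ring.
rewrite (lin OP (wp t) (fun p => pg2 (P j) p.1 * cs z p.2 ^+ i) _ _ (kap R ^+ 2) (j%:R * (j%:R - 1)) (j%:R ^+ 2) mPl q0
  (LT mPl PO (cg j.-2) (cc i)) (LT mPl PO (cg j) (cc i))); last by move=> p; rewrite pg2E; ring.
rewrite (lin OM (wm t) (fun p => pf (P j) p.1 * cs2 z i p.2) _ _ ((2 * pi) ^+ 2) (i%:R * (i%:R - 1)) (i%:R ^+ 2) mM l0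
  (LT mM MO (cf j) (cc i.-2)) (LT mM MO (cf j) (cc i))); last by move=> p; rewrite /cs2 /hpow2; ring.
rewrite (lin OP (wp t) (fun p => pg (P j) p.1 * cs2 z i p.2) _ _ ((2 * pi) ^+ 2) (i%:R * (i%:R - 1)) (i%:R ^+ 2) mPl q0
  (LT mPl PO (cg j) (cc i.-2)) (LT mPl PO (cg j) (cc i))); last by move=> p; rewrite /cs2 /hpow2; ring.
by rewrite /hmoment -/(ecs z i); ring.
Qed.

Definition moment_error j i t := ecs z i * moment_test j t - hmoment j i t.

(** The squared error and a multiple of the energy satisfy together a linear
    differential inequality, whose source involves the errors of lower exponents
    and the effect of the layer. *)
Lemma moment_step j i (A1 A2 B : R) :
  (forall t, 0 < t < T -> j%:R * (j%:R - 1) * `|moment_error j.-2 i t| <= A1) ->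
  (forall t, 0 < t < T -> `|i%:R * (i%:R - 1)| * `|moment_error j i.-2 t| <= A2) ->
  (forall t, 0 < t < T -> `|moment_raw j.-2 t - moment_test j.-2 t| <= B) ->
  (forall t, 0 < t < T -> `|moment_raw j t - moment_test j t| <= B) ->
  let eta := kap R ^+ 2 * A1 + (2 * pi) ^+ 2 * A2 +
    kap R ^+ 2 * (j%:R * (j%:R - 1) + j%:R ^+ 2) * B in
  forall t, 0 <= t <= T -> moment_error j i t ^+ 2 <=
    expR (2 * T) * (moment_error j i 0 ^+ 2 + 16 * slope j ^+ 2 * sq leb2 D (w 0) +
      (eta ^+ 2 + 16 * slope j ^+ 2 * source) * T).
Proof.
move=> h1 h2 h3 h4 eta t ht.
have [err eM herr] := moment_test_ode j.
have eX := evolvesD (evolvesZ (ecs z i) eM) (evolvesZ (-1) (hmoment_ode j i)).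
have {}eX := evolves_eq eX (G := moment_error j i) (G' := _) ltac:(by move=> s; rewrite mulN1r) (fun _ _ => erefl).
have eh := evolvesD (evolvesM eX eX) (evolvesZ (16 * slope j ^+ 2) (evolves_sq mD evw)).
have C0 : 0 <= 16 * slope j ^+ 2 by rewrite mulr_ge0// sqr_ge0.
have source0 := source_ge0.
have jj0 : 0 <= j%:R * (j%:R - 1) :> R.
  by case: (j) => [|l]; rewrite ?mul0r// -natr1 addrK mulr_ge0// ?ler0n// addr_ge0.
have := gronwall eh (K := 2) (h := eta ^+ 2 + 16 * slope j ^+ 2 * source) _ _ _ _ ht.
rewrite -expr2 => H; apply: (le_trans _ (H _ _ _ _)).
- by rewrite -expr2 lerDl mulr_ge0// sq_ge0.
- by [].
- by rewrite addr_ge0 ?sqr_ge0// mulr_ge0.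
- by rewrite addr_ge0 ?sqr_ge0// mulr_ge0// sq_ge0.
move=> s hs /=.
apply: (square_derivative (rho := kap R ^+ 2 * (j%:R * (j%:R - 1) * moment_error j.-2 i s) +
    (2 * pi) ^+ 2 * (i%:R * (i%:R - 1) * moment_error j i.-2 s) +
    ecs z i * (kap R ^+ 2 * (j%:R * (j%:R - 1) * (moment_raw j.-2 s - moment_test j.-2 s)
      - j%:R ^+ 2 * (moment_raw j s - moment_test j s))))
    (lam := kap R ^+ 2 * j%:R ^+ 2 + (2 * pi) ^+ 2 * i%:R ^+ 2) (e := ecs z i) (eps := eps)
    (err := err s) (G := G s)).
- rewrite mulN1r; apply: step_arith => //; exact: ecs_rec.
- by rewrite addr_ge0// mulr_ge0// sqr_ge0.
- apply: rho_bound; rewrite ?sqr_ge0 ?ecs_norm ?h1 ?h2 ?h3 ?h4//.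
- exact: ecs_norm.
- by [].
- exact: herr.
- exact: dy_le.
- exact: sq_ge0.
Qed.

End Comparison.
End MomentODE.

(** * Weakly bounded sequences are bounded *)
Section GlidingHump.

Lemma cs_step (R : realType) (A B a s v : R) : 0 <= A -> 0 <= B -> 0 < a -> s ^+ 2 <= A * B ->
  (s + v) ^+ 2 <= (A + a) * (B + v ^+ 2 / a).
Proof.
move=> A0 B0 a0 sAB; have an : a != 0 by rewrite gt_eqF.
have v0 : 0 <= v ^+ 2 / a by rewrite divr_ge0 ?sqr_ge0// ltW.
have p0 : 0 <= A * (v ^+ 2 / a) by exact: mulr_ge0.
have q0 : 0 <= a * B by rewrite mulr_ge0// ltW.
have H : 2 * (s * v) <= A * (v ^+ 2 / a) + a * B.
  apply: (le_trans (ler_norm _)); rewrite -(ger0_norm (addr_ge0 p0 q0)) -ler_sqr ?nnegrE//.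
  rewrite !real_normK ?num_real//.
  have h1 : (s * v) ^+ 2 <= A * (v ^+ 2 / a) * (a * B).
    rewrite exprMn (_ : A * _ * _ = A * B * v ^+ 2); last by field.
    by rewrite ler_wpM2r ?sqr_ge0.
  have := sqr_ge0 (A * (v ^+ 2 / a) - a * B).
  move: h1; rewrite sqrrB sqrrD exprMn; move: (_ * (a * B)) => g; rewrite -mulr_natr.
  move: ((s * v) ^+ 2) ((a * B) ^+ 2) ((A * _) ^+ 2) => x y z; lra.
rewrite sqrrD mulrDl !mulrDr (_ : a * (v ^+ 2 / a) = v ^+ 2); last by field.
by move: sAB H; rewrite -mulr_natr; move: (s * v) (A * B) (a * B) (s ^+ 2) (A * _) (v ^+ 2) => *; lra.
Qed.

Lemma geo3 (R : realType) n : (3 / 2) * ((3^-1 : R) ^+ n - 3^-1 ^+ n.+1) = 3^-1 ^+ n.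
Proof. by rewrite exprS; field. Qed.

Lemma pow3_small (R : realType) (e : R) : 0 < e -> exists N, (3^-1 : R) ^+ N <= e.
Proof.
move=> e0; have : (3^-1 : R) ^+ n @[n --> \oo] --> (0 : R).
  by apply: cvg_expr; rewrite ger0_norm// invf_lt1// ltr1n.
move/cvgrPdist_le => /(_ e e0)[N _ /(_ N (leqnn N))] /=.
by rewrite sub0r normrN ger0_norm ?exprn_ge0//; exists N.
Qed.

Lemma hump_arith (R : realType) (A B F G c q s : R) : G = A + B + F ->
  `|A| <= c * (q / 4) -> `|B| <= c * (q - s) / 2 -> q * c <= `|F| -> 0 < c * s ->
  q * c / 4 <= `|G|.
Proof.
rewrite mulrBr (mulrC q c) mulrA; move: (c * q) (c * s) => u v -> h1 h2 h3 v0.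
have := ler_normD (A + B + F) (- (A + B)); rewrite (_ : A + B + F + - (A + B) = F); last ring.
have := ler_normD A B; rewrite normrN; lra.
Qed.

Context d (X : measurableType d) (R : realType) (mu : {measure set X -> \bar R}).
Variable D : set X.
Hypothesis mD : measurable D.
Local Notation sq := (sq mu D).
Local Notation L2 := (L2 mu D).
Local Notation r := (3^-1 : R).

Let r0 : 0 < r. Proof. by rewrite invr_gt0. Qed.
Let rn0 n : 0 < r ^+ n. Proof. by rewrite exprn_gt0. Qed.

(** With the weights [3 ^ n], the series of the squares of the increments is
    integrable, hence finite almost everywhere, and Cauchy-Schwarz then bounds
    the increments pointwise by the tail of a geometric series. *)
Lemma L2_cauchy (G : nat -> X -> R) : (forall n, L2 (G n)) ->
  (forall n, sq (fun x => G n.+1 x - G n x) <= r ^+ n * r ^+ n) ->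
  exists2 g, L2 g & forall N, sq (fun x => g x - G N x) <= (9 / 4) * r ^+ N.
Proof.
move=> LG HG.
pose dd n x := (G n.+1 x - G n x) ^+ 2 / r ^+ n.
have dd0 n x : 0 <= dd n x by rewrite /dd divr_ge0 ?sqr_ge0// ltW.
have Ldiff n : L2 (fun x => G n.+1 x - G n x) by exact: L2B.
have idd n : mu.-integrable D (EFin \o dd n).
  have := rintZ (r ^+ n)^-1 mD (L2_sqr_int mD (Ldiff n)).
  by apply: eq_integrable => // x _; rewrite /dd /= mulrC.
have Idd n : \int[mu]_(x in D) dd n x <= r ^+ n.
  rewrite (_ : \int[mu]_(x in D) dd n x = (r ^+ n)^-1 * sq (fun x => G n.+1 x - G n x)).
    rewrite mulrC ler_pdivrMr//; exact: HG.
  rewrite !sqE -RintegralZl//; last exact: L2_sqr_int.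
  by apply: eq_Rintegral => x _; rewrite mulrC.
pose W x : \bar R := (\sum_(0 <= n <oo) (dd n x)%:E)%E.
have S0 (k : nat) : (0 <= (3 / 2) * (1 - r ^+ k) <= 3 / 2)%R.
  have : r ^+ k <= 1 by rewrite exprn_ile1 ?ltW// invf_lt1// ltr1n.
  by have := rn0 k; move: (r ^+ k) => q *; apply/andP; split; lra.
have mW : measurable_fun D W.
  apply: ge0_emeasurable_sum => [n x _ _|n _]; first by rewrite lee_fin.
  by case/integrableP: (idd n).
have W0 x : (0 <= W x)%E by apply: nneseries_ge0 => n _ _; rewrite lee_fin.
have IW : (\int[mu]_(x in D) W x <= (3 / 2)%:E)%E.
  rewrite integral_nneseries//; last 2 first.
    - by move=> n; case/integrableP: (idd n).
    - by move=> n x _; rewrite lee_fin.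
  have fE n : (\int[mu]_(x in D) (dd n x)%:E = (\int[mu]_(x in D) dd n x)%:E)%E.
    by rewrite fineK//; exact: (integrable_fin_num mD (idd n)).
  apply: lime_le.
    by apply: is_cvg_nneseries => n _ _; apply: integral_ge0 => x _; rewrite lee_fin.
  apply: nearW => N; apply: (@le_trans _ _ (\sum_(0 <= n < N) (r ^+ n)%:E)%E).
    by apply: lee_sum => n _; rewrite fE lee_fin.
  rewrite sumEFin lee_fin; apply: (@le_trans _ _ ((3 / 2) * (1 - r ^+ N))).
    elim: N => [|N IH]; first by rewrite big_nil expr0 subrr mulr0.
    rewrite big_nat_recr//=; apply: (le_trans (lerD IH (lexx _))).
    by rewrite -[X in _ + X <= _]geo3; move: (r ^+ N) (r ^+ N.+1) => *; lra.
  by case/andP: (S0 N).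
have iW : mu.-integrable D W.
  apply/integrableP; split => //; under eq_integral do rewrite gee0_abs//.
  exact: le_lt_trans IW (ltry _).
pose E := D `&` [set x | (W x < +oo)%E].
have mE : measurable E by exact: emeasurable_fun_infty_o.
have ED : E `<=` D by move=> x [].
have finW x : E x -> W x \is a fin_num by move=> [_ h]; rewrite ge0_fin_numE.
have aeE : {ae mu, forall x, D x -> E x}.
  apply: ae_imp (integrable_ae mD iW) => x H Dx; split => //=.
  by rewrite -ge0_fin_numE// H.
have tail N k x : (G (N + k)%N x - G N x) ^+ 2 <=
    (3 / 2) * (r ^+ N - r ^+ (N + k)%N) * \sum_(0 <= n < N + k) dd n x.
  elim: k => [|k IH]; first by rewrite addn0 !subrr expr0n /= mulr0 mul0r.
  have A0 : 0 <= (3 / 2) * (r ^+ N - r ^+ (N + k)%N).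
    rewrite mulr_ge0 ?divr_ge0// subr_ge0 ler_wiXn2l ?leq_addr// ?ltW//.
    by rewrite invf_lt1// ltr1n.
  have B0 : 0 <= \sum_(0 <= n < N + k) dd n x by apply: sumr_ge0 => n _.
  rewrite addnS big_nat_recr//=.
  have -> : G (N + k).+1 x - G N x = (G (N + k)%N x - G N x) + (G (N + k).+1 x - G (N + k)%N x) by ring.
  apply: (le_trans (cs_step _ A0 B0 (rn0 (N + k)) IH)).
  rewrite le_eqVlt; apply/orP; left; apply/eqP; congr (_ * _).
  by rewrite -[X in _ + X = _]geo3; ring.
have tailW N k x : E x -> (G (N + k)%N x - G N x) ^+ 2 <= (3 / 2) * r ^+ N * fine (W x).
  move=> Ex; apply: (le_trans (tail N k x)).
  have B0 : 0 <= \sum_(0 <= n < N + k) dd n x by apply: sumr_ge0 => n _.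
  apply: ler_pM => //.
  - rewrite mulr_ge0 ?divr_ge0// subr_ge0 ler_wiXn2l ?leq_addr// ?ltW//.
    by rewrite invf_lt1// ltr1n.
  - by rewrite ler_wpM2l ?divr_ge0// gerBl ltW.
  - rewrite -lee_fin fineK ?finW// -sumEFin.
    by apply: nneseries_lim_ge => n _ _; rewrite lee_fin.
have cvgG x : E x -> cvgn (fun n => G n x).
  move=> Ex; apply: R_complete; apply: cauchy_exP => e e0.
  have w0 : 0 <= fine (W x) by exact: fine_ge0.
  pose K := (3 / 2) * fine (W x) + 1.
  have K0 : 0 < K by rewrite ltr_wpDl// mulr_ge0.
  have e20 : 0 < (e ^+ 2 / 2) / K by rewrite !divr_gt0 ?exprn_gt0.
  have [N HN] := pow3_small e20.
  exists (G N x); exists N => // n /= Nn; rewrite /ball /=.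
  have := tailW N (n - N)%N x Ex; rewrite subnKC// => H.
  rewrite distrC -(ger0_norm (ltW e0)) -ltr_sqr ?nnegrE// !real_normK ?num_real//.
  apply: (le_lt_trans H); apply: (@le_lt_trans _ _ (r ^+ N * K)).
    rewrite (_ : 3 / 2 * r ^+ N * fine (W x) = r ^+ N * (3 / 2 * fine (W x))); last by ring.
    by apply: ler_wpM2l; [exact: ltW|rewrite /K lerDl].
  apply: (@le_lt_trans _ _ (e ^+ 2 / 2)).
    by rewrite -ler_pdivlMr.
  by rewrite ltr_pdivrMr// ltr_pMr ?exprn_gt0// ltr1n.
pose g x := if x \in E then limn (fun n => G n x) else 0.
have gE x : E x -> G n x @[n --> \oo] --> g x.
  by move=> Ex; rewrite /g mem_set//; exact: cvgG.
have mg : measurable_fun D g.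
  apply: (@measurable_fun_cvg _ _ _ D (fun n x => \1_E x * G n x)).
    move=> n; apply: measurable_funM; first exact: measurable_indic.
    exact: L2_meas.
  move=> x Dx; rewrite /g; have [/set_mem xE|xE] := boolP (x \in E).
    have := gE x xE; rewrite /g mem_set// => H.
    by under eq_fun do rewrite indicE mem_set// mul1r.
  by under eq_fun do rewrite indicE (negbTE xE) mul0r; exact: cvg_cst.
have bound N : {ae mu, forall x, D x -> (g x - G N x) ^+ 2 <= (3 / 2) * r ^+ N * fine (W x)}.
  apply: ae_imp aeE => x H /H Ex.
  have c1 : (G n x - G N x) ^+ 2 @[n --> \oo] --> (g x - G N x) ^+ 2.
    have c2 : G n x - G N x @[n --> \oo] --> g x - G N x.
      by apply: cvgB; [exact: gE|exact: cvg_cst].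
    by rewrite expr2; under eq_fun do rewrite expr2; exact: cvgM.
  rewrite -(cvg_lim (@Rhausdorff R) c1); apply: limr_le; first by apply/cvg_ex; eexists; exact: c1.
  by exists N => // n /= Nn; have := tailW N (n - N)%N x Ex; rewrite subnKC.
have main N : L2 (fun x => g x - G N x) /\ sq (fun x => g x - G N x) <= (9 / 4) * r ^+ N.
  have c0 : 0 <= (3 / 2) * r ^+ N by rewrite mulr_ge0 ?divr_ge0// ltW.
  have msub : measurable_fun D (fun x => g x - G N x).
    by apply: measurable_funB => //; exact: L2_meas.
  have msq : measurable_fun D (fun x => ((g x - G N x) ^+ 2)%:E).
    by apply/measurable_EFinP; exact: measurable_funX.
  have I1 : (\int[mu]_(x in D) ((g x - G N x) ^+ 2)%:E <= ((9 / 4) * r ^+ N)%:E)%E.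
    apply: (@le_trans _ _ (\int[mu]_(x in D) (((3 / 2) * r ^+ N)%:E * W x))%E).
      apply: ae_ge0_le_integral => //.
      - by move=> x _; rewrite lee_fin sqr_ge0.
      - by move=> x _; rewrite mule_ge0.
      - by apply: emeasurable_funM => //; exact: measurable_cst.
      apply: ae_imp2 aeE (bound N) => x H1 H2 Dx.
      by rewrite -(fineK (finW x (H1 Dx))) -EFinM lee_fin; exact: H2.
    rewrite ge0_integralZl_EFin//; apply: (le_trans (lee_wpmul2l _ IW)); first by rewrite lee_fin.
    by rewrite -EFinM lee_fin le_eqVlt; apply/orP; left; apply/eqP; field.
  have fin1 : (\int[mu]_(x in D) ((g x - G N x) ^+ 2)%:E < +oo)%E by exact: le_lt_trans I1 (ltry _).
  have isq : mu.-integrable D (EFin \o (fun x => (g x - G N x) ^+ 2)).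
    apply/integrableP; split => //.
    by under eq_integral do rewrite /= ger0_norm ?sqr_ge0//.
  split; first by apply/L2P.
  rewrite -lee_fin sqE /Rintegral fineK//.
  by rewrite ge0_fin_numE//; apply: integral_ge0 => x _; rewrite lee_fin sqr_ge0.
exists g; last by move=> N; case: (main N).
have [H _] := main 0%N; have := L2D mD H (LG 0%N).
by apply: L2_eq => x _; rewrite subrK.
Qed.

Section Hump.
Variable f : nat -> X -> R.
Hypothesis Lf : forall n, L2 (f n).
Let c n := Num.sqrt (sq (f n)).
Hypothesis c0 : forall n, 0 < c n.
Local Notation ip a b := (\int[mu]_(x in D) (a x * b x)).

Let csq n : c n * c n = sq (f n).
Proof. by rewrite -expr2 sqr_sqrtr// sq_ge0. Qed.

(* each step adds a small multiple of [f n], with the sign that increases the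
   modulus of the pairing with [f n] *)
Let sgn (h : X -> R) n : R := if 0 <= ip (f n) h then 1 else -1.
Let incr (h : X -> R) n x := sgn h n * (r ^+ n / c n) * f n x.
Fixpoint hump_sum n : X -> R :=
  if n is n'.+1 then fun x => hump_sum n' x + incr (hump_sum n') n' x else fun=> 0.

Let Lincr h n : L2 (incr h n). Proof. exact: L2Z. Qed.

Hypothesis fin : (mu D < +oo)%E.

Let Lsum n : L2 (hump_sum n).
Proof. by elim: n => [|n IH] /=; [exact: L2_cst|exact: L2D]. Qed.

Let ip_incr h n m : ip (f m) (incr h n) = sgn h n * (r ^+ n / c n) * ip (f m) (f n).
Proof.
rewrite -RintegralZl//; last exact: L2_mul_int.
by apply: eq_Rintegral => x _; rewrite /incr; ring.
Qed.

Let ip_sum n m : ip (f m) (hump_sum n.+1) = ip (f m) (hump_sum n) + ip (f m) (incr (hump_sum n) n).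
Proof.
rewrite -RintegralD//; [|exact: L2_mul_int..].
by apply: eq_Rintegral => x _; rewrite /= mulrDr.
Qed.

Let sgn_norm h n : `|sgn h n| = 1. Proof. by rewrite /sgn; case: ifP; rewrite ?normrN1 ?normr1. Qed.

Let first n : r ^+ n * c n <= `|ip (f n) (hump_sum n.+1)|.
Proof.
rewrite ip_sum ip_incr.
have -> : ip (f n) (f n) = c n * c n by rewrite csq.
have -> : sgn (hump_sum n) n * (r ^+ n / c n) * (c n * c n) = sgn (hump_sum n) n * (r ^+ n * c n).
  by field; rewrite gt_eqF.
have p0 : 0 <= r ^+ n * c n by rewrite mulr_ge0// ltW.
rewrite /sgn; case: ifPn => h; first by rewrite mul1r ger0_norm ?addr_ge0// lerDr.
move: h; rewrite -ltNge => h; rewrite mulN1r ler0_norm; first by rewrite opprD opprK lerDr oppr_ge0 ltW.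
by rewrite subr_le0; apply: (le_trans (ltW h)).
Qed.

Let later n k : `|ip (f n) (hump_sum (n.+1 + k)%N) - ip (f n) (hump_sum n.+1)| <=
  c n * (r ^+ n - r ^+ (n + k)%N) / 2.
Proof.
elim: k => [|k IH]; first by rewrite !addn0 !subrr normr0 mulr0 mul0r.
rewrite !addnS ip_sum addrAC; apply: (le_trans (ler_normD _ _)).
apply: (le_trans (lerD IH (lexx _))).
have B : `|ip (f n) (incr (hump_sum (n.+1 + k)%N) (n.+1 + k)%N)| <= r ^+ (n + k).+1 * c n.
  rewrite ip_incr normrM normrM sgn_norm mul1r addSn ger0_norm; last first.
    by rewrite divr_ge0// ltW.
  have := cauchy_schwarz_norm mD (Lf n) (Lf (n + k).+1); rewrite -/(c n) -/(c (n + k).+1) => H.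
  apply: (le_trans (ler_wpM2l _ H)); first by rewrite divr_ge0// ltW.
  by rewrite le_eqVlt; apply/orP; left; apply/eqP; field; rewrite gt_eqF.
apply: (le_trans (lerD (lexx _) B)).
rewrite (_ : r ^+ (n + k) = 3 * r ^+ (n + k).+1); last by rewrite exprS mulrA divff ?mul1r.
by move: (r ^+ _) (r ^+ _) => p q; rewrite le_eqVlt; apply/orP; left; apply/eqP; field.
Qed.

(** The multiples [3 ^ -n / c n] decrease so fast that the terms added after the
    rank [n] undo at most half of the pairing with [f n] obtained at that
    rank. *)
Lemma hump : exists2 g, L2 g & forall n, r ^+ n * c n / 4 <= `|ip (f n) g|.
Proof.
have speed n : sq (fun x => hump_sum n.+1 x - hump_sum n x) <= r ^+ n * r ^+ n.
  rewrite (@sq_eq _ _ _ _ D _ (incr (hump_sum n) n)); last first.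
    by move=> x _; rewrite /= addrAC subrr add0r.
  rewrite sqZ// -csq 2!exprMn (_ : sgn _ _ ^+ 2 = 1); last first.
    by rewrite -real_normK ?num_real// sgn_norm expr1n.
  by rewrite le_eqVlt; apply/orP; left; apply/eqP; field; rewrite gt_eqF.
have [g Lg Hg] := L2_cauchy Lsum speed.
exists g => // n.
have e0 : 0 < r ^+ n / 4 by rewrite divr_gt0.
have [k Hk] : exists k, (9 / 4) * r ^+ k <= (r ^+ n / 4) ^+ 2.
  have q0 : 0 < (r ^+ n / 4) ^+ 2 / (9 / 4) by rewrite divr_gt0 ?exprn_gt0// divr_gt0.
  have [N h] := pow3_small q0.
  by exists N; rewrite mulrC -ler_pdivlMr// divr_gt0.
pose M := (n.+1 + k)%N.
have rM : r ^+ M <= r ^+ k by rewrite ler_wiXn2l ?leq_addl// ?ltW// invf_lt1// ltr1n.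
have T1 : `|ip (f n) (fun x => g x - hump_sum M x)| <= c n * (r ^+ n / 4).
  apply: (le_trans (cauchy_schwarz_norm mD (Lf n) (L2B mD Lg (Lsum M)))).
  rewrite -/(c n); apply: ler_wpM2l; first exact: ltW.
  rewrite -[leRHS](ger0_norm (ltW e0)) -sqrtr_sqr; apply: ler_wsqrtr.
  apply: (le_trans (Hg M)); apply: le_trans Hk; rewrite ler_wpM2l// divr_ge0//.
have E : ip (f n) g = ip (f n) (fun x => g x - hump_sum M x) +
    (ip (f n) (hump_sum M) - ip (f n) (hump_sum n.+1)) + ip (f n) (hump_sum n.+1).
  rewrite addrA subrK -RintegralD//; [|exact: (L2_mul_int mD (Lf n) (L2B mD Lg (Lsum M)))|exact: L2_mul_int].
  by apply: eq_Rintegral => x _; ring.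
have T2 := later n k; have T3 := first n; have pos := rn0 (n + k).
have := mulr_gt0 (c0 n) pos.
by move=> cs0; exact: (hump_arith E T1 T2 T3 cs0).
Qed.

End Hump.

Lemma right_near (P : R -> Prop) : (\forall e \near (0 : R)^'+, P e) ->
  exists2 e0, 0 < e0 & forall e, 0 < e < e0 -> P e.
Proof.
move=> H; have [e0 e00 He] := within_near H; exists e0 => // e /andP[ep ee].
by apply: He => //; rewrite subr0 gtr0_norm.
Qed.

(** If the norms were unbounded, a sequence of members with fast growing norms
    would have unbounded pairings with one function, built by the gliding hump,
    against the convergence of these pairings. *)
Lemma weak_bounded (f : R -> X -> R) : (mu D < +oo)%E ->
  (forall e, 0 < e < 1 -> L2 (f e)) ->
  (forall g, L2 g -> exists l : R, \int[mu]_(x in D) (f e x * g x) @[e --> 0^'+] --> l) ->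
  exists e0 C, [/\ 0 < e0, 0 <= C & forall e, 0 < e < e0 -> e < 1 -> sq (f e) <= C].
Proof.
move=> fin Lf Hf; apply: contrapT => nC.
have bad n : exists e, 0 < e < n.+1%:R^-1 /\ e < 1 /\ (4 * 3 ^+ n * n.+1%:R) ^+ 2 < sq (f e).
  apply: contrapT => H; apply: nC; exists (n.+1%:R^-1), ((4 * 3 ^+ n * n.+1%:R) ^+ 2); split.
  - by rewrite invr_gt0.
  - exact: sqr_ge0.
  - move=> e e0 e1; rewrite leNgt; apply/negP => lt; apply: H; exists e; split => //.
have [e He] := choice bad.
have e01 n : 0 < e n < 1 by case: (He n) => /andP[-> _] [-> _].
have big n : 4 * 3 ^+ n * n.+1%:R < Num.sqrt (sq (f (e n))).
  have [_ [_ H]] := He n.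
  have p0 : 0 <= 4 * 3 ^+ n * n.+1%:R :> R by rewrite !mulr_ge0// exprn_ge0.
  rewrite -[ltLHS](ger0_norm p0) -sqrtr_sqr ltr_sqrt//; apply: le_lt_trans H; exact: sqr_ge0.
have [||g Lg Hg] := @hump (fun n => f (e n)) _ _ fin.
- by move=> n; exact: Lf.
- move=> n; apply: le_lt_trans (big n); rewrite !mulr_ge0// exprn_ge0//.
have [l Hl] := Hf g Lg.
move/cvgrPdist_le: Hl => /(_ 1 ltr01)/right_near[e0 e00 Hl].
pose N := Num.truncn (`|l| + 1 + e0^-1).
have hN : `|l| + 1 + e0^-1 < N.+1%:R by exact: Num.Theory.truncnS_gt.
have i0 : 0 < e0^-1 by rewrite invr_gt0.
have [/andP[eN0 eN] _] := He N.
have eNe : e N < e0.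
  apply: (lt_trans eN); rewrite invf_plt ?posrE//.
  by apply: le_lt_trans hN; rewrite lerDr addr_ge0.
have := Hl (e N); rewrite eN0 eNe => /(_ isT) H1.
have H2 := Hg N.
have H3 : N.+1%:R <= r ^+ N * Num.sqrt (sq (f (e N))) / 4.
  rewrite ler_pdivlMr// -ler_pdivrMl ?exprn_gt0//.
  apply: (le_trans _ (ltW (big N))); rewrite exprVn invrK.
  by rewrite le_eqVlt; apply/orP; left; apply/eqP; ring.
have H4 := le_trans H3 H2.
have := ler_normB l (l - \int[mu]_(x in D) (f (e N) x * g x)).
rewrite opprB addrC subrK => H5.
move: H4 H5 H1 hN; move: (`|_|) (`|_|) (`|l|) => x y z; lra.
Qed.

End GlidingHump.

(** * Riemann sums *)

Lemma rint_sum d (X : measurableType d) (R : realType) (mu : {measure set X -> \bar R})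
    (D : set X) n (f : nat -> X -> R) : measurable D ->
  (forall k, mu.-integrable D (EFin \o f k)) ->
  mu.-integrable D (EFin \o (fun x => \sum_(k < n) f k x)) /\
  \int[mu]_(x in D) (\sum_(k < n) f k x) = \sum_(k < n) \int[mu]_(x in D) f k x.
Proof.
move=> mD If; elim: n => [|n [I1 I2]].
  have E : (fun x : X => \sum_(k < 0) f k x) = (fun=> 0) by apply/funext => x; rewrite big_ord0.
  rewrite E big_ord0; split; last by rewrite /Rintegral integral0.
  exact: integrable0.
have E : (fun x => \sum_(k < n.+1) f k x) = (fun x => \sum_(k < n) f k x + f n x).
  by apply/funext => x; rewrite big_ord_recr.
by rewrite E; split; [exact: rintD|rewrite RintegralD// I2 big_ord_recr].
Qed.

Lemma integrable_cut d (X : measurableType d) (R : realType) (mu : {measure set X -> \bar R})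
    (E : set X) (f : X -> R) : measurable E -> mu.-integrable E (EFin \o f) ->
  mu.-integrable setT (EFin \o (fun x => \1_E x * f x)).
Proof.
move=> mE; rewrite (integrable_mkcond _ mE); apply: eq_integrable => // x _.
rewrite /= patchE indicE; case: ifP => _; by rewrite ?mul1r ?mul0r.
Qed.

Lemma measurable_cut d (X : measurableType d) (R : realType) (E : set X) (f : X -> R) :
  measurable E -> measurable_fun E f -> measurable_fun setT (fun x => \1_E x * f x).
Proof.
move=> mE /(measurable_restrictT _ mE); apply: eq_measurable_fun => x _.
by rewrite patchE indicE; case: ifP => _; rewrite ?mul1r ?mul0r.
Qed.

Lemma nat_of_shift (z : int) (N : nat) : - N%:Z - 1 < z -> z < N%:Z + 1 ->
  exists2 n : nat, (n < N.*2.+1)%N & n%:Z = z + N%:Z.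
Proof. by move=> h1 h2; exists (absz (z + N%:Z)); lia. Qed.

Lemma shift_inj (z : int) (N n k : nat) : n%:Z = z + N%:Z -> z = k%:Z - N%:Z -> k = n.
Proof. by lia. Qed.

Section Riemann.
Context (R : realType).
Local Notation mR := (measurableTypeR R).
Local Notation leb1 := (lebesgue1 R).
Local Notation Y := (`]- 2^-1, 2^-1[%classic : set R).

Lemma Rint_oo_split (f : R -> R) (a c b : R) : a < c -> c < b ->
  leb1.-integrable `]a, b[ (EFin \o f) ->
  \int[leb1]_(x in `]a, b[) f x =
  \int[leb1]_(x in `]a, c[) f x + \int[leb1]_(x in `]c, b[) f x.
Proof.
move=> ac cb If.
have mI (x y : R) : measurable (`]x, y[%classic : set mR) by exact: measurable_itv.
apply: Rint_split => //.
- by move=> x /=; rewrite !in_itv/= => /andP[-> h]; exact: lt_trans cb.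
- by move=> x /=; rewrite !in_itv/= => /andP[h ->]; rewrite (lt_trans ac).
- apply/disj_setPS => y /=; rewrite !in_itv/= => -[/andP[_ h1] /andP[h2 _]].
  by have := lt_trans h1 h2; rewrite ltxx.
have null : leb1 [set c] = 0%E by exact: lebesgue_measure_set1.
apply: (subset_measure0 _ _ _ null).
- by apply: measurableD => //; apply: measurableU.
- exact: measurable_set1.
- move=> y [/=]; rewrite !in_itv/= => /andP[y0 y1] /not_orP[]; rewrite y0 y1 andbT /=.
  by move=> /negP h1 /negP h2; apply/eqP; rewrite eq_le leNgt (leNgt c) h1 h2.
Qed.

Variables (chi chi' : R -> R) (L M : R).
Hypotheses (C1chi : C1pair chi chi') (chiL : forall x, `|chi' x| <= L) (chiM : forall x, `|chi x| <= M).

Lemma lipschitz (a s : R) : a <= s -> `|chi s - chi a| <= L * (s - a).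
Proof.
rewrite le_eqVlt => /orP[/eqP ->|as_]; first by rewrite !subrr normr0 mulr0.
have mI : measurable (`]a, s[%classic : set mR) by exact: measurable_itv.
have ic : leb1.-integrable `]a, s[ (EFin \o chi') by exact: cont_int_oo C1chi.2.
rewrite -(FTC_oo as_ C1chi); apply: (le_trans (le_normr_Rintegral mI ic)).
apply: (@le_trans _ _ (\int[leb1]_(x in `]a, s[) L)).
  apply: le_Rintegral => //; first exact: rint_abs.
  exact: cont_int_oo (@cst_continuous _ _ _).
by rewrite Rintegral_cst// fine_mu_oo// ltW.
Qed.

Let cut (x : R) := \1_Y x * chi x.

(* a bound of the variation of [cut] on the left of [x] *)
Let V (x : R) : R := L * Num.max (- 2^-1) (Num.min x 2^-1)
  + M * (if - 2^-1 < x then 1 else 0) + M * (if 2^-1 <= x then 1 else 0).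

Let L0 : 0 <= L. Proof. exact: le_trans (normr_ge0 (chi' 0)) (chiL 0). Qed.
Let M0 : 0 <= M. Proof. exact: le_trans (normr_ge0 (chi 0)) (chiM 0). Qed.

Let cut_left x : x <= - 2^-1 -> cut x = 0 /\ V x = - L / 2.
Proof.
move=> x0; rewrite /cut indicE memNset ?mul0r; last by rewrite /= in_itv/= ltNge x0.
split=> //; rewrite /V [Num.min _ _]min_l; last by lra.
by rewrite max_l// ltNge x0 /= leNgt (_ : x < 2^-1) /=; [|lra]; rewrite !mulr0; lra.
Qed.

Let cut_mid x : - 2^-1 < x -> x < 2^-1 -> cut x = chi x /\ V x = L * x + M.
Proof.
move=> x0 x1; rewrite /cut indicE mem_set ?mul1r; last by rewrite /= in_itv/= x0 x1.
split=> //; rewrite /V [Num.min _ _]min_l; last by lra.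
rewrite max_r; last by lra.
by rewrite x0 leNgt x1 /= mulr0 mulr1 addr0.
Qed.

Let cut_right x : 2^-1 <= x -> cut x = 0 /\ V x = L / 2 + 2 * M.
Proof.
move=> x1; rewrite /cut indicE memNset ?mul0r; last first.
  by move=> /=; rewrite in_itv/= => /andP[_]; rewrite ltNge x1.
split=> //; rewrite /V [Num.min _ _]min_r// max_r; last by lra.
by rewrite x1 (_ : - 2^-1 < x); [rewrite !mulr1; lra|lra].
Qed.

Let cut_var a s : a <= s -> `|cut s - cut a| <= V s - V a.
Proof.
move=> as_; have LM := L0; have MM := M0.
have [a0|a0] := leP a (- 2^-1).
  have [-> ->] := cut_left a0.
  have [s0|s0] := leP s (- 2^-1); first by have [-> ->] := cut_left s0; rewrite !subrr normr0.
  have [s1|s1] := leP (2^-1) s.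
    by have [-> ->] := cut_right s1; rewrite subrr normr0; lra.
  have [-> ->] := cut_mid s0 s1; rewrite subr0; apply: (le_trans (chiM s)).
  have : 0 <= L * (s + 2^-1) by rewrite mulr_ge0//; lra.
  by rewrite mulrDr; lra.
have s0 : - 2^-1 < s by exact: lt_le_trans as_.
have [a1|a1] := leP (2^-1) a.
  have [-> ->] := cut_right a1; have [-> ->] := cut_right (le_trans a1 as_).
  by rewrite !subrr normr0.
have [-> ->] := cut_mid a0 a1.
have [s1|s1] := leP (2^-1) s.
  have [-> ->] := cut_right s1; rewrite sub0r normrN; apply: (le_trans (chiM a)).
  have : 0 <= L * (2^-1 - a) by rewrite mulr_ge0//; lra.
  by rewrite mulrBr; lra.
have [-> ->] := cut_mid s0 s1.
by apply: (le_trans (lipschitz as_)); rewrite mulrBr; lra.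
Qed.

Let Vmono a s : a <= s -> V a <= V s.
Proof. by move=> /cut_var h; rewrite -subr_ge0 (le_trans _ h). Qed.

Let Vrange x : - L / 2 <= V x <= L / 2 + 2 * M.
Proof.
have LM := L0; have MM := M0.
have [x0|x0] := leP x (- 2^-1); first by have [_ ->] := cut_left x0; apply/andP; split; lra.
have [x1|x1] := leP (2^-1) x; first by have [_ ->] := cut_right x1; apply/andP; split; lra.
have [_ ->] := cut_mid x0 x1.
have : 0 <= L * (x + 2^-1) by rewrite mulr_ge0//; lra.
have : 0 <= L * (2^-1 - x) by rewrite mulr_ge0//; lra.
by rewrite !(mulrDr, mulrN) => *; apply/andP; split; lra.
Qed.

Let icut (a b : R) : leb1.-integrable `]a, b[ (EFin \o cut).
Proof.
apply: (@bounded_integrable _ _ _ leb1 (`]a, b[%classic : set mR) cut M) => //.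
- by have [ab|ab] := ltP a b; [exact: mu_oo|rewrite set_itv_ge ?measure0// bnd_simp -leNgt].
- apply: measurable_funTS; apply: measurable_funM.
    by apply: measurable_indic; exact: measurable_itv.
  exact: continuous_measurable_fun (C1pair_cont C1chi).
- move=> x _; rewrite /cut indicE; case: (_ \in _); rewrite ?mul1r ?mul0r ?normr0//.
Qed.

Let cell_step (a e : R) : 0 < e ->
  `|e * cut a - \int[leb1]_(x in `]a, a + e[) cut x| <= e * (V (a + e) - V a).
Proof.
move=> e0; have ae : a < a + e by rewrite ltrDl.
have mI : measurable (`]a, a + e[%classic : set mR) by exact: measurable_itv.
have cstint (q : R) : leb1.-integrable `]a, a + e[ (EFin \o (fun=> q)).
  exact: cont_int_oo (@cst_continuous _ _ _).
have len : fine (leb1 `]a, a + e[%classic) = e by rewrite fine_mu_oo ?ltW//; ring.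
have -> : e * cut a = \int[leb1]_(x in `]a, a + e[) cut a by rewrite Rintegral_cst// len mulrC.
rewrite -RintegralB//.
apply: (le_trans (le_normr_Rintegral mI (rintB mI (cstint _) (icut _ _)))).
apply: (@le_trans _ _ (\int[leb1]_(x in `]a, a + e[) (V (a + e) - V a))); last first.
  by rewrite Rintegral_cst// len mulrC.
apply: le_Rintegral => //; first by apply: rint_abs; exact: rintB.
move=> x /=; rewrite in_itv/= => /andP[ax xe]; rewrite distrC.
apply: (le_trans (cut_var (ltW ax))); by rewrite lerD2r; apply: Vmono; exact: ltW.
Qed.

(* the errors of consecutive cells add up to the increment of [V] *)
Let sum_step (a e : R) n : 0 < e ->
  `|e * (\sum_(k < n) cut (a + k%:R * e)) - \int[leb1]_(x in `]a, a + n%:R * e[) cut x| <=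
  e * (V (a + n%:R * e) - V a).
Proof.
move=> e0; elim: n => [|n IH].
  by rewrite mul0r addr0 big_ord0 mulr0 set_itv_ge ?Rintegral_set0 ?subrr ?normr0 ?mulr0// bnd_simp ltxx.
have E : a + n.+1%:R * e = (a + n%:R * e) + e by rewrite -natr1; ring.
have st := cell_step (a + n%:R * e) e0.
have int : \int[leb1]_(x in `]a, a + n.+1%:R * e[) cut x =
    \int[leb1]_(x in `]a, a + n%:R * e[) cut x +
    \int[leb1]_(x in `]a + n%:R * e, a + n.+1%:R * e[) cut x.
  case: (n) => [|l].
    rewrite mul0r addr0 [X in _ = X + _](_ : _ = 0); first by rewrite add0r.
    by rewrite set_itv_ge ?Rintegral_set0// bnd_simp ltxx.
  apply: Rint_oo_split => //; first by rewrite ltrDl mulr_gt0.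
  by rewrite ltrD2l ltr_pM2r// ltr_nat.
rewrite int big_ord_recr /= mulrDr E.
rewrite opprD addrACA.
apply: (le_trans (ler_normD _ _)); apply: (le_trans (lerD IH st)).
by rewrite le_eqVlt; apply/orP; left; apply/eqP; ring.
Qed.

(** Riemann sums of a function that is smooth in [Y] and cut off outside: the
    error of each cell is controlled by the variation in it. *)
Lemma riemann_sum (a e : R) n : 0 < e -> a <= - 2^-1 -> 2^-1 <= a + n%:R * e ->
  `|e * (\sum_(k < n) \1_Y (a + k%:R * e) * chi (a + k%:R * e)) - \int[leb1]_(y in Y) chi y|
  <= e * (L + 2 * M).
Proof.
move=> e0 a0 an; have := sum_step a n e0; rewrite -Rint_indic; last first.
  by move=> x /=; rewrite !in_itv/= => /andP[x0 x1]; rewrite (le_lt_trans a0 x0) (lt_le_trans x1 an).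
move=> h; apply: (le_trans h); apply: ler_wpM2l; first exact: ltW.
have /andP[_ v1] := Vrange (a + n%:R * e); have /andP[v2 _] := Vrange a.
by move: (V _) (V _) v1 v2 => p q; lra.
Qed.

End Riemann.

(** * Unfolding of the periodic extension *)
Section Unfold.
Context (R : realType).
Local Notation mR := (measurableTypeR R).
Local Notation mP := (measurableTypeR R * measurableTypeR R)%type.
Local Notation leb1 := (lebesgue1 R).
Local Notation leb2 := (lebesgue2 R).
Local Notation Y := (`]- 2^-1, 2^-1[%classic : set R).
Variables (alpha eps : R).
Hypotheses (a0 : 0 < alpha) (a1 : alpha < 1) (eps0 : 0 < eps) (eps1 : eps < 1).
Local Notation D := (crack_cell alpha eps).
Let mD : measurable (D : set mP). Proof. exact: measurable_cell. Qed.
Let fD : (leb2 D < +oo)%E. Proof. exact: cell_fin. Qed.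
Let mO : measurable (@Omega R : set mP). Proof. exact: measurable_Omega. Qed.

(* the number of cells on each side that suffice to cover [Omega] *)
Definition ncell : nat := (Num.truncn eps^-1).+1.
Definition offset (k : nat) : R := (k%:R - ncell%:R) * eps.
Let N := ncell.

Lemma ncell_eps : 1 < ncell%:R * eps.
Proof.
rewrite -ltr_pdivrMr// div1r; exact: Num.Theory.truncnS_gt.
Qed.

Let inD (F : R * R -> R) p := \1_D p * F p.

Lemma extend_indic F p : extend alpha eps F p = inD F (reduce_y eps p).
Proof. by rewrite /extend /inD indicE; case: (_ \in _); rewrite ?mul1r ?mul0r. Qed.

Let floorP (z : int) (y : R) : `|y - z%:~R * eps| < eps / 2 -> Num.floor (y / eps + 2^-1) = z.
Proof.
rewrite ltr_norml => /andP[h1 h2]; apply: Num.Theory.floor_def; rewrite intrD.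
have e1 : y = (y / eps) * eps by field; exact: lt0r_neq0.
have h3 : (z%:~R - 2^-1) * eps < (y / eps) * eps by rewrite -e1; lra.
have h4 : (y / eps) * eps < (z%:~R + 2^-1) * eps by rewrite -e1; lra.
by move: h3 h4; rewrite !ltr_pM2r// => h3 h4; apply/andP; split; lra.
Qed.

(** At most one translate of the cell contains a given point. *)
Lemma extend_sum F p : Y p.2 ->
  extend alpha eps F p = \sum_(k < N.*2.+1) inD F (vshift (- offset k) p).
Proof.
rewrite /= in_itv/= => /andP[y0 y1]; rewrite extend_indic.
pose z := Num.floor (p.2 / eps + 2^-1).
have N1 := ncell_eps; have N0 : 1 < N%:R :> R.
  by apply: (lt_trans N1); rewrite gtr_pMr// ltr0n.
have e1 : p.2 = (p.2 / eps) * eps by field; exact: lt0r_neq0.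
have zle : z%:~R <= p.2 / eps + 2^-1 by exact: Num.Theory.floor_le.
have zgt : p.2 / eps + 2^-1 < z%:~R + 1.
  by have := Num.Theory.floorD1_gt (p.2 / eps + 2^-1); rewrite intrD.
have b1 : p.2 / eps < N%:R / 2 by rewrite -(ltr_pM2r eps0) -e1 mulrAC; lra.
have b2 : - (N%:R / 2) < p.2 / eps by rewrite -(ltr_pM2r eps0) -e1 mulNr mulrAC; lra.
have z1 : z%:~R < N%:R + 1 :> R by lra.
have z2 : - N%:R - 1 < z%:~R :> R by lra.
have [n0 n0lt n0E] : exists2 n : nat, (n < N.*2.+1)%N & n%:Z = z + N%:Z.
  by apply: nat_of_shift; rewrite -(ltr_int R) ?intrB ?intrN ?intrD.
have offE k : offset k = (k%:Z - N%:Z)%:~R * eps by rewrite /offset intrB.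
rewrite (bigD1 (Ordinal n0lt))//= big1 ?addr0.
  congr inD; rewrite /reduce_y /vshift; congr (_, _); rewrite -/z offE n0E addrK; ring.
move=> k kn; rewrite /inD indicE; have [/set_mem kD|] := boolP (_ \in _); last by rewrite mul0r.
exfalso; move/negP: kn; apply; apply/eqP/val_inj => /=.
move: kD; rewrite crack_cellE// => -[/= _ _ h _].
have : Num.floor (p.2 / eps + 2^-1) = k%:Z - N%:Z by apply: floorP; rewrite -offE.
exact: shift_inj n0E.
Qed.

Let vshiftK s p : vshift s (vshift (- s) p) = p :> R * R.
Proof. by rewrite /vshift /= subrK; case: p. Qed.

Let cutO (G : R * R -> R) p := \1_(@Omega R) p * G p.

Let count (p : R * R) (G : R * R -> R) := \sum_(k < N.*2.+1) cutO G (vshift (offset k) p).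

(* on [Omega], the product of the extension with [G] is a sum of translates *)
Let term F G s p := inD F p * cutO G (vshift s p).

Let extend_prod F G p :
  \1_(@Omega R) p * (extend alpha eps F p * G p) =
  \sum_(k < N.*2.+1) term F G (offset k) (vshift (- offset k) p).
Proof.
rewrite indicE; have [/set_mem pO|pO] := boolP (p \in _).
  rewrite mul1r extend_sum; last by case: pO => _ /= ?; rewrite in_itv/=.
  rewrite mulr_suml; apply: eq_bigr => k _; rewrite /term.
  by rewrite vshiftK /cutO indicE mem_set// mul1r.
rewrite mul0r big1// => k _; rewrite /term vshiftK.
by rewrite /cutO indicE (negbTE pO) mul0r mulr0.
Qed.

Let term_int (F G : R * R -> R) (M s : R) : leb2.-integrable D (EFin \o F) -> measurable_fun (@Omega R : set mP) G ->
  (forall p, Omega p -> `|G p| <= M) -> leb2.-integrable setT (EFin \o term F G s).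
Proof.
move=> iF mG GM; have mF : measurable_fun D F by apply/measurable_EFinP; case/integrableP: iF.
have iD := integrable_cut mD iF.
have mt : measurable_fun setT (fun p : mP => cutO G (vshift s p)).
  exact: (measurableT_comp (measurable_cut mO mG) (@measurable_vshift R s)).
have M0 : 0 <= M.
  have O0 : @Omega R (0, 0) by rewrite /Omega /=; split; apply/andP; split; lra.
  exact: le_trans (normr_ge0 _) (GM _ O0).
have iM := rintZ M measurableT (rint_abs iD).
apply: (le_integrable measurableT _ _ iM).
  by apply/measurable_EFinP; apply: measurable_funM => //; exact: measurable_cut.
move=> p _ /=; rewrite lee_fin /term normrM mulrC [leRHS]normrM normr_id (ger0_norm M0).
apply: ler_wpM2r => //; rewrite /cutO indicE; have [/set_mem h|_] := boolP (_ \in _).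
  by rewrite mul1r; exact: GM.
by rewrite mul0r normr0.
Qed.

(** Each translate is moved back to the cell, so that the other factor is summed
    over all its translates: this is [count]. *)
Lemma unfold_integral (F G : R * R -> R) (M : R) : leb2.-integrable D (EFin \o F) ->
  measurable_fun (@Omega R : set mP) G -> (forall p, Omega p -> `|G p| <= M) ->
  leb2.-integrable (@Omega R) (EFin \o (fun p => extend alpha eps F p * G p)) /\
  \int[leb2]_(p in @Omega R) (extend alpha eps F p * G p) =
  \int[leb2]_(p in D) (F p * count p G).
Proof.
move=> iF mG GM.
have it k := term_int (offset k) iF mG GM.
have mp s := @measurable_vshift R s.
have pp s A : measurable A -> leb2 (vshift s @^-1` A) = leb2 A by exact: leb2_vshift.
have its k : leb2.-integrable setT (EFin \o (fun p => term F G (offset k) (vshift (- offset k) p))).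
  have := mp_integrable (mp (- offset k)) (pp (- offset k)) measurableT (it k).
  by rewrite preimage_setT.
have Eext : (fun p => \1_(@Omega R) p * (extend alpha eps F p * G p)) =
    (fun p => \sum_(k < N.*2.+1) term F G (offset k) (vshift (- offset k) p)).
  by apply/funext => p; exact: extend_prod.
have [Is Ss] := rint_sum N.*2.+1 measurableT its.
split.
  rewrite (integrable_mkcond _ mO); apply: eq_integrable Is => // p _.
  rewrite /= -extend_prod patchE indicE; case: ifP => _; by rewrite ?mul1r ?mul0r.
rewrite (@Rint_indic _ _ _ leb2 setT)//.
rewrite [RHS](@Rint_indic _ _ _ leb2 setT)//.
transitivity (\int[leb2]_p \sum_(k < N.*2.+1) term F G (offset k) (vshift (- offset k) p)).
  by apply: eq_Rintegral => p _; rewrite -extend_prod.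
rewrite Ss.
have -> : \sum_(k < N.*2.+1) \int[leb2]_p term F G (offset k) (vshift (- offset k) p) =
    \sum_(k < N.*2.+1) \int[leb2]_p term F G (offset k) p.
  apply: eq_bigr => k _; have mt : measurable_fun setT (term F G (offset k)).
    by apply/measurable_EFinP; case/integrableP: (it k).
  by rewrite [RHS](mp_Rintegral (mp (- offset k)) (pp (- offset k)) measurableT mt) preimage_setT.
have [_ <-] := rint_sum N.*2.+1 measurableT it.
by apply: eq_Rintegral => p _; rewrite /term /count -mulr_sumr mulrA.
Qed.

(** For a product, the sum over the translates is a Riemann sum of [chi] with
    step [eps]. *)
Lemma count_bound p (a chi chi' : R -> R) (L M : R) : D p -> C1pair chi chi' ->
  (forall x, `|chi' x| <= L) -> (forall x, `|chi x| <= M) -> `|a p.1| <= 1 ->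
  `|eps * count p (fun q => a q.1 * chi q.2) - a p.1 * \int[leb1]_(y in Y) chi y|
   <= eps * (L + 2 * M).
Proof.
move=> Dp hchi chiL chiM a1'.
have pE : [/\ -1 < p.1, p.1 < 1, `|p.2| < eps / 2 & p.1 <= 0 -> alpha * eps / 2 < `|p.2|].
  by move: Dp; rewrite crack_cellE.
move: pE => [p0 p1 p2 _]; have N1 : 1 < N%:R * eps := ncell_eps.
have -> : count p (fun q => a q.1 * chi q.2) = a p.1 *
    \sum_(k < N.*2.+1) \1_Y (p.2 - N%:R * eps + k%:R * eps) * chi (p.2 - N%:R * eps + k%:R * eps).
  rewrite /count mulr_sumr; apply: eq_bigr => k _.
  have -> : p.2 - N%:R * eps + k%:R * eps = p.2 + offset k by rewrite /offset -/N; ring.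
  rewrite /cutO /vshift /=.
  have -> : \1_(@Omega R) (p.1, p.2 + offset k) = \1_Y (p.2 + offset k) :> R.
    rewrite !indicE; congr (_ _)%:R; apply/idP/idP => /set_mem h; apply/mem_set.
      by case: h => _ /=; rewrite in_itv.
    by move: h; rewrite /Omega/= in_itv/= p0 p1.
  by ring.
move: p2; rewrite ltr_norml => /andP[h1 h2].
have := @riemann_sum _ _ _ L M hchi chiL chiM (p.2 - N%:R * eps) eps N.*2.+1 eps0.
have -> : p.2 - N%:R * eps + N.*2.+1%:R * eps = p.2 + N%:R * eps + eps.
  by rewrite -natr1 -muln2 natrM; ring.
move: N1; move: (N%:R * eps) => Ne N1 /(_ ltac:(generalize eps1; lra) ltac:(generalize eps0; lra)).
set S := \sum_(_ < _) _; set I := \int[_]_(_ in _) _ => H.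
rewrite (_ : eps * (a p.1 * S) - a p.1 * I = a p.1 * (eps * S - I)); last by ring.
by rewrite normrM; apply: le_trans H; rewrite ler_piMl.
Qed.

Let measurable_extend F : measurable_fun D F ->
  measurable_fun (@Omega R : set mP) (extend alpha eps F).
Proof.
move=> mF.
have ms : measurable_fun (@Omega R : set mP)
    (fun p => \sum_(k < N.*2.+1) inD F (vshift (- offset k) p)).
  apply: measurable_funTS; apply: measurable_sum => k.
  exact: (measurableT_comp (measurable_cut mD mF) (@measurable_vshift R _)).
apply: eq_measurable_fun ms => p /set_mem[_ /= pY].
by rewrite extend_sum//= in_itv.
Qed.

Let C1one : C1pair (fun=> 1 : R) (fun=> 0 : R). Proof. exact: C1pair_cst. Qed.

Let IY : \int[leb1]_(y in Y) (1 : R) = 1.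
Proof. by rewrite Rintegral_cst ?mu_oo// fine_mu_oo ?ltW ?itvNhh// mul1r; field. Qed.

(** Unfolding with the constant 1 counts the translates that meet [Omega], about
    [1 / eps] of them. *)
Lemma extend_L2 F : L2 leb2 D F -> [/\ L2 leb2 (@Omega R) (extend alpha eps F),
  eps * sq leb2 (@Omega R) (extend alpha eps F) <= 3 * sq leb2 D F &
  eps < 4^-1 -> sq leb2 D F <= 2 * (eps * sq leb2 (@Omega R) (extend alpha eps F))].
Proof.
move=> LF; have iF2 := L2_sqr_int mD LF.
pose G (q : R * R) := 1 : R.
have mG : measurable_fun (@Omega R : set mP) G by exact: measurable_cst.
have GM p : Omega p -> `|G p| <= 1 by rewrite /G normr1.
have [I1 I2] := unfold_integral iF2 mG GM.
have E p : extend alpha eps F p ^+ 2 = extend alpha eps (fun p => F p ^+ 2) p * G p.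
  by rewrite /extend /G mulr1; case: (_ \in _); rewrite ?expr0n.
have LO : L2 leb2 (@Omega R) (extend alpha eps F).
  apply/L2P => //; split; first by apply: measurable_extend; exact: L2_meas LF.
  by apply: eq_integrable I1 => // p _; rewrite /= E.
have cb p : D p -> `|eps * count p G - 1| <= 2 * eps.
  move=> Dp; have := @count_bound p (fun=> 1) (fun=> 1) (fun=> 0) 0 1 Dp C1one.
  rewrite IY mul1r add0r mulr1 [eps * 2]mulrC normr1 normr0.
  by move=> /(_ (fun=> lexx _) (fun=> lexx _) (lexx _)).
have Ic : leb2.-integrable D (EFin \o (fun p => F p ^+ 2 * count p G)).
  pose B := eps^-1 * (1 + 2 * eps).
  have mc : measurable_fun D (fun p : mP => count p G).
    apply: measurable_funTS; apply: measurable_sum => k.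
    exact: (measurableT_comp (measurable_cut mO mG) (@measurable_vshift R _)).
  apply: (le_integrable mD _ _ (rintZ B mD iF2)).
    apply/measurable_EFinP; apply: measurable_funM => //.
    by apply: measurable_funX; exact: L2_meas LF.
  move=> p Dp; rewrite /= lee_fin normrM [leRHS]normrM mulrC ler_wpM2r//.
  have := cb p Dp; rewrite ler_norml => /andP[h1 h2].
  have i0 : 0 < eps^-1 by rewrite invr_gt0.
  have c0 : 0 <= count p G.
    by apply: sumr_ge0 => k _; rewrite /cutO /G mulr1 indicE; case: (_ \in _).
  rewrite ger0_norm// ger0_norm; last by rewrite mulr_ge0 ?ltW// addr_gt0// mulr_gt0.
  by rewrite /B -(ler_pM2l eps0) mulrA divff ?gt_eqF// mul1r; move: (eps * _) h2 => x; lra.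
have -> : eps * sq leb2 (@Omega R) (extend alpha eps F) =
    \int[leb2]_(p in D) (F p ^+ 2 * (eps * count p G)).
  rewrite /sq; have -> : \int[leb2]_(p in @Omega R) extend alpha eps F p ^+ 2 =
      \int[leb2]_(p in D) (F p ^+ 2 * count p G).
    by rewrite -I2; apply: eq_Rintegral => p _; exact: E.
  by rewrite -RintegralZl//; apply: eq_Rintegral => p _; ring.
have iFc : leb2.-integrable D (EFin \o (fun p => F p ^+ 2 * (eps * count p G))).
  by apply: eq_integrable (rintZ eps mD Ic) => // p _; rewrite /= mulrCA.
split => //.
- rewrite -RintegralZl//; apply: le_Rintegral => //; first exact: rintZ.
  move=> p /cb; rewrite ler_norml => /andP[_ h]; rewrite mulrC ler_wpM2r ?sqr_ge0//.
  by have e1 := eps1; move: h; move: (eps * _) => x h; lra.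
- move=> e4; rewrite -RintegralZl//; apply: le_Rintegral => //; first exact: rintZ.
  move=> p /cb; rewrite ler_norml => /andP[h _]; rewrite mulrCA ler_peMr ?sqr_ge0//.
  by move: h; move: (eps * _) => x h; lra.
Qed.

(** The pairing is unfolded, the Riemann sum replaced by the mean of [chi], and
    Cauchy-Schwarz bounds the error, the area of the cell being of order
    [eps]. *)
Lemma extend_tensor F (a chi chi' : R -> R) (L : R) : L2 leb2 D F -> continuous a ->
  (forall x, `|a x| <= 1) -> C1pair chi chi' -> (forall x, `|chi' x| <= L) ->
  (forall x, `|chi x| <= 1) ->
  (\int[leb2]_(p in @Omega R) (extend alpha eps F p * (a p.1 * chi p.2)) -
   (\int[leb1]_(y in Y) chi y) * (eps^-1 * \int[leb2]_(p in D) (F p * a p.1))) ^+ 2 <=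
  2 * (L + 2) ^+ 2 * eps * sq leb2 D F.
Proof.
move=> LF ca aM hchi chiL chiM; pose G (q : R * R) := a q.1 * chi q.2.
have iF := L2_int mD fD LF.
have cG : continuous G by exact: continuous_tensor ca (C1pair_cont hchi).
have mG : measurable_fun (@Omega R : set mP) G.
  by apply: measurable_funTS; exact: continuous_measurable2.
have GM p : Omega p -> `|G p| <= 1.
  by move=> _; rewrite /G normrM mulr_ile1.
have [I1 I2] := unfold_integral iF mG GM.
have DO : D `<=` @Omega R by exact: cell_Omega.
have La : L2 leb2 D (fun p => a p.1) by apply: cont_L2 => //; exact: continuous_fst_comp.
have cb p : D p -> `|eps * count p G - a p.1 * \int[leb1]_(y in Y) chi y| <= eps * (L + 2).
  by move=> Dp; have := @count_bound p a chi chi' L 1 Dp hchi chiL chiM (aM _); rewrite mulr1.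
set I := \int[leb1]_(y in Y) chi y in cb *.
have L0 : 0 <= L by exact: le_trans (normr_ge0 _) (chiL 0).
pose r p := eps * count p G - a p.1 * I.
have mc : measurable_fun D (fun p : mP => count p G).
  apply: measurable_funTS; apply: measurable_sum => k.
  exact: (measurableT_comp (measurable_cut mO mG) (@measurable_vshift R _)).
have Lr : L2 leb2 D r.
  apply: (L2_bounded (M := eps * (L + 2))) => //.
  apply: measurable_funB; first exact: measurable_funM.
  by apply: measurable_funM => //; exact: L2_meas La.
have Fr : \int[leb2]_(p in @Omega R) (extend alpha eps F p * G p) -
    I * (eps^-1 * \int[leb2]_(p in D) (F p * a p.1)) = eps^-1 * \int[leb2]_(p in D) (F p * r p).
  have i1 := L2_mul_int mD LF La; have i2 := L2_mul_int mD LF Lr.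
  have -> : \int[leb2]_(p in @Omega R) (extend alpha eps F p * G p) =
      \int[leb2]_(p in D) (eps^-1 * (F p * r p) + (eps^-1 * I) * (F p * a p.1)).
    rewrite I2; apply: eq_Rintegral => p _; rewrite /r; field; exact: lt0r_neq0.
  rewrite RintegralD//; [|exact: rintZ..]; rewrite !RintegralZl//; ring.
rewrite Fr; have cs := cauchy_schwarz mD LF Lr.
have Sr : sq leb2 D r <= (eps * (L + 2)) ^+ 2 * (2 * eps).
  apply: (@le_trans _ _ ((eps * (L + 2)) ^+ 2 * fine (leb2 D))); last first.
    by rewrite ler_wpM2l ?sqr_ge0//; exact: (cell_area (lexx 0) a0 a1 eps0 eps1).
  rewrite -Rintegral_cst//; apply: le_Rintegral => //.
  - exact: L2_sqr_int.
  - by apply: L2_int => //; exact: L2_cst.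
  move=> p Dp; rewrite -real_normK ?num_real// lerXn2r ?nnegrE//; last exact: cb.
  by apply: mulr_ge0; [exact: ltW|rewrite addr_ge0].
rewrite exprMn; apply: (le_trans (ler_wpM2l (sqr_ge0 _) (le_trans cs (ler_wpM2l (sq_ge0 _ _ _) Sr)))).
by rewrite le_eqVlt; apply/orP; left; apply/eqP; field; exact: lt0r_neq0.
Qed.

End Unfold.

(** * Quantities that vanish with the period *)

(** Convergence to 0 at [0+], with an explicit radius below which the estimate
    holds, so that finitely many ranges of [e] can be intersected. *)
Definition vanishes (R : realType) (F : R -> R) : Prop :=
  forall r, 0 < r -> exists2 e0, 0 < e0 & forall e, 0 < e < e0 -> `|F e| <= r.

Section Vanishes.
Variable R : realType.
Implicit Types F G : R -> R.

Lemma vanishes_le F G e1 : 0 < e1 -> (forall e, 0 < e < e1 -> `|F e| <= `|G e|) ->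
  vanishes G -> vanishes F.
Proof.
move=> e10 FG hG r r0; have [e0 e00 H] := hG r r0.
exists (Num.min e0 e1); first by rewrite lt_min e00.
move=> e /andP[ep]; rewrite lt_min => /andP[h1 h2].
by apply: (le_trans (FG e _)); rewrite ?ep//; apply: H; rewrite ep.
Qed.

Lemma vanishesD F G : vanishes F -> vanishes G -> vanishes (fun e => F e + G e).
Proof.
move=> hF hG r r0; have r2 : 0 < r / 2 by rewrite divr_gt0.
have [e0 e00 H0] := hF _ r2; have [e1 e10 H1] := hG _ r2.
exists (Num.min e0 e1); first by rewrite lt_min e00.
move=> e /andP[ep]; rewrite lt_min => /andP[h0 h1].
apply: (le_trans (ler_normD _ _)); rewrite [leRHS]splitr; apply: lerD.
  by apply: H0; rewrite ep.
by apply: H1; rewrite ep.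
Qed.

Lemma vanishesZ (c : R) F : vanishes F -> vanishes (fun e => c * F e).
Proof.
move=> hF r r0; have c1 : 0 < `|c| + 1 by rewrite ltr_wpDl.
have [e0 e00 H] := hF (r / (`|c| + 1)) (divr_gt0 r0 c1).
exists e0 => // e he; rewrite normrM.
apply: (@le_trans _ _ ((`|c| + 1) * (r / (`|c| + 1)))).
  by apply: ler_pM => //; [rewrite lerDl|exact: H].
by rewrite mulrCA divff ?mulr1// gt_eqF.
Qed.

Lemma vanishes0 : vanishes (fun=> 0 : R).
Proof. by move=> r r0; exists 1 => // e _; rewrite normr0 ltW. Qed.

Lemma vanishes_id : vanishes (fun e : R => e).
Proof. by move=> r r0; exists r => // e /andP[e0 er]; rewrite ger0_norm ltW. Qed.

Lemma vanishes_sqr F : vanishes (fun e => F e ^+ 2) -> vanishes F.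
Proof.
move=> H r r0; have [e0 e00 He] := H _ (exprn_gt0 2 r0); exists e0 => // e /He h.
rewrite -[leRHS](ger0_norm (ltW r0)) -ler_sqr ?nnegrE// !real_normK ?num_real//.
exact: le_trans (ler_norm _) h.
Qed.

Lemma vanishes_cvg F (l : R) : vanishes (fun e => F e - l) -> F e @[e --> 0^'+] --> l.
Proof.
move=> H; apply/cvgrPdist_le => r r0; have [e0 e00 He] := H r r0.
near=> e; rewrite distrC; apply: He; apply/andP; split; near: e.
  exact: nbhs_right_gt.
exact: nbhs_right_lt.
Unshelve. all: by end_near. Qed.

End Vanishes.

(** * Weak convergence of a bounded family, from test functions to L^2 *)
Section Good.
Import HBNNSimple.
Context d (X : measurableType d) (R : realType) (mu : {measure set X -> \bar R}).
Variable D : set X.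
Hypotheses (mD : measurable D) (fin : (mu D < +oo)%E).
Local Notation sq := (sq mu D).
Local Notation L2 := (L2 mu D).
Local Notation ip a b := (\int[mu]_(x in D) (a x * b x)).

Lemma L2_dominated (g : nat -> X -> R) (g0 H : X -> R) : (forall n, measurable_fun D (g n)) ->
  measurable_fun D g0 -> L2 H -> (forall n x, D x -> `|g n x - g0 x| <= H x) ->
  {ae mu, forall x, D x -> g n x @[n --> \oo] --> g0 x} ->
  forall r, 0 < r -> exists n, sq (fun x => g n x - g0 x) <= r.
Proof.
move=> mg mg0 LH gH gc r r0.
have mf n : measurable_fun D (fun x => ((g n x - g0 x) ^+ 2)%:E).
  by apply/measurable_EFinP; apply: measurable_funX; exact: measurable_funB.
have hc : {ae mu, forall x, D x -> ((g n x - g0 x) ^+ 2)%:E @[n --> \oo] --> 0%E}.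
  apply: ae_imp gc => x c Dx.
  have c2 : g n x - g0 x @[n --> \oo] --> (0 : R).
    by rewrite -(subrr (g0 x)); apply: cvgB; [exact: c|exact: cvg_cst].
  apply: cvg_EFin; first by apply: nearW.
  have c3 : (g n x - g0 x) * (g n x - g0 x) @[n --> \oo] --> (0 * 0 : R) by exact: cvgM.
  by rewrite mul0r in c3; apply: cvg_trans c3; apply: near_eq_cvg; apply: nearW.
have hb : {ae mu, forall x n, D x -> (`|((g n x - g0 x) ^+ 2)%:E| <= (H x ^+ 2)%:E)%E}.
  apply: aeW => x n Dx; rewrite gee0_abs ?lee_fin ?sqr_ge0//.
  have hx := gH n x Dx; rewrite -real_normK ?num_real// lerXn2r ?nnegrE//.
  exact: le_trans hx.
have [_ _] := dominated_convergence mD mf (measurable_cst _) hc (L2_sqr_int mD LH) hb.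
rewrite integral0 => cv.
have [N _ /(_ N (leqnn N)) /= lt] : \forall n \near \oo,
    (\int[mu]_(x in D) ((g n x - g0 x) ^+ 2)%:E < r%:E)%E by exact: cvge_near cv r0.
exists N; have f0 : (0 <= \int[mu]_(x in D) ((g N x - g0 x) ^+ 2)%:E)%E.
  by apply: integral_ge0 => x _; rewrite lee_fin sqr_ge0.
rewrite -lee_fin sqE /Rintegral fineK ?ltW// ge0_fin_numE//.
exact: lt_trans lt (ltry _).
Qed.

Variables (h : R -> X -> R) (e1 C : R).
Hypotheses (e10 : 0 < e1) (C0 : 0 <= C).
Hypothesis Lh : forall e, 0 < e < e1 -> L2 (h e) /\ sq (h e) <= C ^+ 2.

(** Here [h e] stands for the difference of the extension and the limit: a
    function is good if it cannot tell them apart. *)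
Definition good (g : X -> R) := L2 g /\ vanishes (fun e => ip (h e) g).

Lemma goodD f g : good f -> good g -> good (fun x => f x + g x).
Proof.
move=> [Lf vf] [Lg vg]; split; first exact: L2D.
apply: vanishes_le e10 _ (vanishesD vf vg) => e he; have [Le _] := Lh he.
rewrite -RintegralD//; [|exact: L2_mul_int..].
rewrite (_ : \int[mu]_(x in D) (h e x * (f x + g x)) = \int[mu]_(x in D) (h e x * f x + h e x * g x))//.
by apply: eq_Rintegral => x _; rewrite mulrDr.
Qed.

Lemma goodZ (c : R) f : good f -> good (fun x => c * f x).
Proof.
move=> [Lf vf]; split; first exact: L2Z.
apply: vanishes_le e10 _ (vanishesZ c vf) => e he; have [Le _] := Lh he.
rewrite -RintegralZl//; last exact: L2_mul_int.
rewrite (_ : \int[mu]_(x in D) (h e x * (c * f x)) = \int[mu]_(x in D) (c * (h e x * f x)))//.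
by apply: eq_Rintegral => x _; rewrite mulrCA.
Qed.

Lemma good_eq f g : {in D, f =1 g} -> good f -> good g.
Proof.
move=> fg [Lf vf]; split; first exact: L2_eq Lf.
apply: vanishes_le e10 _ vf => e he.
by rewrite (@eq_Rintegral _ _ _ mu D (fun x => h e x * f x))// => x xD; rewrite fg.
Qed.

Lemma good0 : good (fun=> 0).
Proof.
split; first exact: L2_cst.
apply: vanishes_le e10 _ (@vanishes0 R) => e he.
rewrite (@eq_Rintegral _ _ _ mu D (fun=> 0)); last by move=> x _; rewrite mulr0.
by rewrite Rintegral_cst// mul0r.
Qed.

Lemma good_sum n (c : nat -> R) (f : nat -> X -> R) : (forall k, good (f k)) ->
  good (fun x => \sum_(k < n) c k * f k x).
Proof.
move=> H; elim: n => [|n IH].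
  by apply: good_eq good0 => x _; rewrite big_ord0.
by apply: good_eq (goodD IH (goodZ (c n) (H n))) => x _; rewrite big_ord_recr.
Qed.

(** The family [h] is bounded, so the pairings with a function and with an
    approximation of it differ uniformly little. *)
Lemma good_limit g : L2 g ->
  (forall r, 0 < r -> exists2 f, good f & sq (fun x => f x - g x) <= r) -> good g.
Proof.
move=> Lg H; split => // r r0.
pose q := (r / 2 / (C + 1)) ^+ 2.
have C1 : 0 < C + 1 by rewrite ltr_wpDl.
have q0 : 0 < r / 2 / (C + 1) by rewrite !divr_gt0.
have [f [Lf vf] Hf] := H _ (exprn_gt0 2 q0).
have [e0 e00 He] := vf _ (divr_gt0 r0 (ltr0Sn R 1)).
exists (Num.min e0 e1); first by rewrite lt_min e00.
move=> e /andP[ep]; rewrite lt_min => /andP[h0 h1].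
have [Le Ce] : L2 (h e) /\ sq (h e) <= C ^+ 2 by apply: Lh; rewrite ep.
have Lfg : L2 (fun x => f x - g x) by exact: L2B.
have -> : ip (h e) g = ip (h e) f - ip (h e) (fun x => f x - g x).
  rewrite -RintegralB//; [|exact: L2_mul_int..].
  by apply: eq_Rintegral => x _; ring.
apply: (le_trans (ler_normB _ _)); rewrite [leRHS]splitr; apply: lerD.
  by apply: He; rewrite ep.
apply: (le_trans (cauchy_schwarz_norm mD Le Lfg)).
apply: (@le_trans _ _ (C * (r / 2 / (C + 1)))).
  apply: ler_pM; rewrite ?sqrtr_ge0//.
    by rewrite -[leRHS](ger0_norm C0) -sqrtr_sqr ler_wsqrtr.
  by rewrite -[leRHS](ger0_norm (ltW q0)) -sqrtr_sqr ler_wsqrtr.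
rewrite mulrCA ler_piMr//; first by rewrite divr_ge0// ltW.
by rewrite ler_pdivrMr// mul1r lerDl.
Qed.

Lemma good_dominated (g : nat -> X -> R) (g0 H : X -> R) : (forall n, good (g n)) ->
  measurable_fun D g0 -> L2 H -> (forall n x, D x -> `|g n x - g0 x| <= H x) ->
  {ae mu, forall x, D x -> g n x @[n --> \oo] --> g0 x} -> good g0.
Proof.
move=> gg mg0 LH gH gc; have mg n := L2_meas mD (gg n).1.
have Lg0 : L2 g0.
  have Ld : L2 (fun x => g 0%N x - g0 x).
    apply: (L2_le mD _ (L2_sqr_int mD LH)); first exact: measurable_funB.
    move=> x Dx; have hx := gH 0%N x Dx; rewrite -real_normK ?num_real// lerXn2r ?nnegrE//.
    exact: le_trans hx.
  by apply: L2_eq (L2B mD (gg 0%N).1 Ld) => x _; rewrite opprB addrC subrK.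
apply: good_limit => // r r0; have [n Hn] := L2_dominated mg mg0 LH gH gc r0.
by exists (g n).
Qed.

(** A class of sets that contains a generating family stable under intersection,
    and is itself stable under complements and countable disjoint unions, contains
    every measurable set. *)
Lemma good_indic (G : set (set X)) : @measurable _ X = <<s G >> -> setI_closed G ->
  good (fun=> 1) -> (forall A, G A -> good (\1_A)) -> forall A, measurable A -> good (\1_A).
Proof.
move=> mG GI g1 GG A0; rewrite mG.
apply: (@dynkin_induction _ X G (fun A => good (\1_A)) mG GI) => //.
- by apply: good_eq g1 => x _; rewrite indicT.
- move=> A mA gA; apply: good_eq (goodD g1 (goodZ (-1) gA)) => x _.
  by rewrite !indicE in_setC; case: (x \in A); rewrite ?mulr1 ?mulr0 ?addr0 ?subrr.
move=> F mF tF gF.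
have mU : measurable (\bigcup_k F k) by exact: bigcup_measurable.
have s1 n x : \sum_(k < n) 1 * \1_(F k) x = \1_(\bigcup_(k < n) F k) x :> R.
  elim: n => [|n IH]; first by rewrite big_ord0 bigcup_mkord big_ord0 indic0.
  rewrite big_ord_recr /= IH mul1r.
  have [/set_mem Fn|Fn] := boolP (x \in F n).
    have nU : x \notin \bigcup_(k < n) F k.
      apply/negP => /set_mem[k /= kn Fk].
      have kn' := tF k n I I (ex_intro _ x (conj Fk Fn)); by move: kn; rewrite kn' ltnn.
    rewrite !indicE (negbTE nU) (mem_set Fn) mem_set ?add0r//.
    by exists n => //=.
  rewrite !indicE (negbTE Fn) addr0; congr (_ _)%:R; apply/idP/idP => /set_mem[k /= kn Fk].
    by apply/mem_set; exists k => //=; exact: ltnW.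
  apply/mem_set; exists k => //=; rewrite ltn_neqAle -ltnS kn andbT.
  by apply/eqP => kE; move/negP: Fn; apply; apply/mem_set; rewrite -kE.
apply: (@good_dominated (fun n x => \sum_(k < n) 1 * \1_(F k) x) _ (fun=> 1)).
- by move=> n; exact: (good_sum n (fun=> 1) gF).
- exact: measurable_indic.
- by case: g1.
- move=> n x _; rewrite s1 !indicE; do 2 case: (_ \in _); rewrite ?subrr ?subr0 ?sub0r ?normrN ?normr1 ?normr0//.
apply: aeW => x _; under eq_fun do rewrite s1.
apply: cvg_near_cst; rewrite [X in \forall n \near _, _ = X]indicE.
have [/set_mem [k _ Fk]|xU] := boolP (x \in _).
  exists k.+1 => // n /= kn; rewrite indicE mem_set//; exists k => //.
exists 0%N => // n _ /=; rewrite indicE memNset// => -[k _ Fk].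
by move/negP: xU; apply; apply/mem_set; exists k.
Qed.

(** Simple functions approximate every function of L^2, by dominated
    convergence. *)
Lemma good_L2 : (forall A, measurable A -> good (\1_A)) -> forall g, L2 g -> good g.
Proof.
move=> gI; have gS (s : {nnsfun X >-> R}) : good (s : X -> R).
  have ms : measurable_fun setT (s : X -> R) by exact: measurable_funPT.
  have gseq (l : seq R) : good (fun x => \sum_(y <- l) y * \1_(s @^-1` [set y]) x).
    elim: l => [|y l IH]; first by apply: good_eq good0 => x _; rewrite big_nil.
    have my : measurable (s @^-1` [set y]).
      by rewrite -[X in measurable X]setTI; apply: ms => //; exact: measurable_set1.
    by apply: good_eq (goodD (goodZ y (gI _ my)) IH) => x _; rewrite big_cons.
  have E : {in D, (fun x => \sum_(y <- finmap.enum_fset (fset_set (range s))) y * \1_(s @^-1` [set y]) x) =1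
      (s : X -> R)}.
    by move=> x _; rewrite [RHS]fimfunE fsbig_finite//; exact: fimfunP.
  exact: good_eq E (gseq _).
have gP f : L2 f -> (forall x, 0 <= f x) -> good f.
  move=> Lf f0; have mf : measurable_fun D (EFin \o f) by apply/measurable_EFinP; exact: L2_meas Lf.
  have f0' x : D x -> (0 <= (EFin \o f) x)%E by rewrite lee_fin.
  pose s := nnsfun_approx mD mf.
  have sc x : D x -> s n x @[n --> \oo] --> f x.
    by move=> Dx; have := cvg_nnsfun_approx mD mf f0' Dx => /fine_cvgP[].
  have sle n x : D x -> s n x <= f x.
    move=> Dx; rewrite -(cvg_lim (@Rhausdorff R) (sc x Dx)).
    apply: (@nondecreasing_cvgn_le _ (fun n => s n x)).
      by move=> k l kl; have /lefP := nd_nnsfun_approx mD mf kl; exact.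
    by apply/cvg_ex; exists (f x); exact: sc.
  apply: (@good_dominated (fun n => s n) f f) => //; first exact: L2_meas Lf.
  - move=> n x Dx; rewrite distrC ger0_norm ?lerBlDr ?lerDl//.
    by rewrite subr_ge0; exact: sle.
  - by apply: aeW => x Dx; exact: sc.
move=> g Lg.
have mg := L2_meas mD Lg.
have part (s : R) : `|s| = 1 -> good (fun x => Num.max (s * g x) 0).
  move=> s1; apply: gP => [|x]; last by rewrite le_max lexx orbT.
  have [] // := le_sq (f := fun x => Num.max (s * g x) 0) mD Lg.
    apply: measurable_maxr => //; exact: measurable_funM.
  move=> x _; rewrite (_ : `|g x| = `|s * g x|); last by rewrite normrM s1 mul1r.
  by have [|neg] := leP 0 (s * g x); rewrite ?normr0.
apply: good_eq (goodD (part 1 (normr1 _)) (goodZ (-1) (part (-1) (normrN1 _)))) => x _.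
rewrite mul1r !mulN1r; have [g0|g0] := leP 0 (g x).
  by rewrite max_r ?oppr_le0// subr0.
by rewrite max_l ?oppr_ge0 ?ltW// add0r opprK.
Qed.

End Good.

(** * Polynomials that approximate a step *)

Section StepPolynomial.
Variable R : realType.
Implicit Types (r s : R).

Lemma bernoulli (x : R) n : -1 <= x -> 1 + n%:R * x <= (1 + x) ^+ n.
Proof.
move=> x1; elim: n => [|n IH]; first by rewrite expr0 mul0r addr0.
have sq0 : 0 <= n%:R * (x * x) by rewrite mulr_ge0 ?ler0n// -expr2 sqr_ge0.
have : (1 + n%:R * x) * (1 + x) <= (1 + x) ^+ n * (1 + x).
  by apply: ler_wpM2r => //; lra.
rewrite -exprSr; apply: le_trans; rewrite -natr1; lra.
Qed.

(** These are the polynomials of the classical proof of the Weierstrass theorem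
    by Bernoulli: below 1/2, [1 - (2 r) ^ n] bounds them from below; above 1/2,
    the inequality [(1 - x) (1 + x) <= 1] and Bernoulli bound them from above by
    [(2 r) ^ - n]. *)
Definition sharp n r : R := (1 - r ^+ n) ^+ (2 ^ n)%N.

Let pow2 n : ((2 ^ n)%N)%:R = 2 ^+ n :> R. Proof. by rewrite natrX. Qed.

Lemma sharp_range n r : 0 <= r <= 1 -> 0 <= sharp n r <= 1.
Proof.
move=> /andP[r0 r1]; have rn0 : 0 <= r ^+ n := exprn_ge0 _ r0.
have rn1 : r ^+ n <= 1 by exact: exprn_ile1.
by rewrite exprn_ge0 ?exprn_ile1//; rewrite ?subr_ge0// gerBl.
Qed.

Lemma sharp_lt r : 0 <= r -> r < 2^-1 -> sharp n r @[n --> \oo] --> (1 : R).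
Proof.
move=> r0 r1.
have c : (1 - (2 * r) ^+ n) @[n --> \oo] --> (1 - 0 : R).
  apply: cvgB; first exact: cvg_cst.
  by apply: cvg_expr; rewrite ger0_norm; lra.
rewrite subr0 in c; apply: squeeze_cvgr c (@cvg_cst _ _ _ _ _).
near=> n; have /andP[_ ->] : 0 <= sharp n r <= 1 by apply: sharp_range; lra.
have r1' : r ^+ n <= 1 by apply: exprn_ile1; lra.
rewrite andbT; apply: le_trans (bernoulli _ _); last by lra.
by rewrite pow2 mulrN exprMn.
Unshelve. all: by end_near.
Qed.

Lemma sharp_gt r : 2^-1 < r -> r <= 1 -> sharp n r @[n --> \oo] --> (0 : R).
Proof.
move=> r0 r1; have rp : 0 < r by lra.
have c : ((2 * r)^-1) ^+ n @[n --> \oo] --> (0 : R).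
  apply: cvg_expr; rewrite ger0_norm ?invr_ge0; last lra.
  by rewrite invf_lt1; lra.
apply: squeeze_cvgr (@cvg_cst _ _ _ _ _) c.
near=> n; have /andP[-> _] : 0 <= sharp n r <= 1 by apply: sharp_range; lra.
have rn0 : 0 < r ^+ n := exprn_gt0 _ rp.
have r1' : r ^+ n <= 1 by apply: exprn_ile1; lra.
have p0 : 0 < (2 * r) ^+ n by rewrite exprn_gt0// mulr_gt0.
have b : (2 * r) ^+ n <= (1 + r ^+ n) ^+ (2 ^ n)%N.
  apply: le_trans (bernoulli _ _); last by apply: le_trans (ltW rn0); lra.
  by rewrite pow2 exprMn lerDr.
have m : sharp n r * (1 + r ^+ n) ^+ (2 ^ n)%N <= 1.
  rewrite /sharp -exprMn; apply: exprn_ile1.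
    by apply: mulr_ge0; lra.
  by have := mulr_ge0 (ltW rn0) (ltW rn0); lra.
rewrite /= exprVn -[leRHS]mul1r ler_pdivlMr//; apply: le_trans m; apply: ler_wpM2l b.
by have /andP[] : 0 <= sharp n r <= 1 by apply: sharp_range; lra.
Unshelve. all: by end_near.
Qed.

(* the affine change of variable maps [-1, 1] into [0, 1] and [s0] to 1/2 *)
Definition step_poly (s0 : R) n : {poly R} :=
  (1 - ((2^-1 - s0 / 4)%:P + (4^-1)%:P * 'X) ^+ n) ^+ (2 ^ n)%N.

Lemma step_polyE s0 n s : (step_poly s0 n).[s] = sharp n (2^-1 - s0 / 4 + 4^-1 * s).
Proof. by rewrite /step_poly /sharp !(horner_exp, hornerE). Qed.

Lemma step_poly_range s0 n s : `|s0| <= 1 -> `|s| <= 1 -> 0 <= (step_poly s0 n).[s] <= 1.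
Proof.
by rewrite !ler_norml step_polyE => /andP[? ?] /andP[? ?]; apply: sharp_range; lra.
Qed.

Lemma step_poly_cvg s0 s : `|s0| <= 1 -> `|s| <= 1 -> s <> s0 ->
  (step_poly s0 n).[s] @[n --> \oo] --> (if s < s0 then 1 else 0 : R).
Proof.
rewrite !ler_norml => /andP[? ?] /andP[? ?] ss.
under eq_fun do rewrite step_polyE.
case: ifPn => [?|]; first by apply: sharp_lt; lra.
rewrite -leNgt le_eqVlt => /predU1P[/esym//|?]; apply: sharp_gt; lra.
Qed.

End StepPolynomial.

(** * From powers of a function to its level sets *)

Section Levels.
Context d (X : measurableType d) (R : realType) (mu : {measure set X -> \bar R}).
Variable D : set X.
Hypotheses (mD : measurable D) (fin : (mu D < +oo)%E).
Variables (h : R -> X -> R) (e1 C : R).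
Hypotheses (e10 : 0 < e1) (C0 : 0 <= C).
Hypothesis Lh : forall e, 0 < e < e1 -> L2 mu D (h e) /\ sq mu D (h e) <= C ^+ 2.
Local Notation good := (good mu D h).

(** The second term allows for the reflection that the profiles of odd degree
    produce on one side of the interface. *)
Lemma good_levels (A1 A2 q g0 : X -> R) (s0 : R) :
  (forall i, good (fun x => A1 x * q x ^+ i + A2 x * (- q x) ^+ i)) ->
  `|s0| <= 1 -> (forall x, D x -> `|q x| <= 1) ->
  (forall x, D x -> `|A1 x| <= 1 /\ `|A2 x| <= 1) ->
  measurable_fun D g0 -> (forall x, D x -> `|g0 x| <= 1) ->
  {ae mu, forall x, D x -> [/\ A1 x = 0 \/ q x <> s0, A2 x = 0 \/ - q x <> s0 &
    g0 x = A1 x * (if q x < s0 then 1 else 0) + A2 x * (if - q x < s0 then 1 else 0)]} ->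
  good g0.
Proof.
move=> gq s1 q1 A12 mg g1 lim.
have gp (p : {poly R}) : good (fun x => A1 x * p.[q x] + A2 x * p.[- q x]).
  have := good_sum mD fin e10 Lh (size p) (fun i => p`_i) gq.
  apply: (good_eq e10) => x _.
  rewrite !horner_coef !mulr_sumr -big_split/=; apply: eq_bigr => i _; ring.
apply: (good_dominated mD e10 C0 Lh (g := fun n x => A1 x * (step_poly s0 n).[q x] +
  A2 x * (step_poly s0 n).[- q x]) (H := fun=> 3)) => //.
- exact: L2_cst.
- move=> n x Dx; have [a1 a2] := A12 _ Dx; have [gx qx] := (g1 _ Dx, q1 _ Dx).
  have qx' : `|- q x| <= 1 by rewrite normrN.
  have bnd (a b : R) : `|a| <= 1 -> 0 <= b <= 1 -> `|a * b| <= 1.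
    by move=> a' /andP[b0 b']; rewrite normrM -[leRHS]mulr1 ler_pM// ger0_norm.
  have b1 := bnd _ _ a1 (step_poly_range n s1 qx).
  have b2 := bnd _ _ a2 (step_poly_range n s1 qx').
  by apply: le_trans (ler_normB _ _) _; have := ler_normD (A1 x * (step_poly s0 n).[q x]) (A2 x * (step_poly s0 n).[- q x]); lra.
- apply: filterS lim => x lx Dx; have [l1 l2 ->] := lx Dx.
  have qx := q1 _ Dx; have qx' : `|- q x| <= 1 by rewrite normrN.
  have term (a s : R) : `|s| <= 1 -> a = 0 \/ s <> s0 ->
      a * (step_poly s0 n).[s] @[n --> \oo] --> a * (if s < s0 then 1 else 0).
    move=> s' [->|ne]; first by under eq_fun do rewrite mul0r; rewrite mul0r; exact: cvg_cst.
    by apply: cvgMr; exact: step_poly_cvg.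
  by apply: cvgD; exact: term.
Qed.

End Levels.

(** * Density of the test functions *)

Section Density.
Context (R : realType).
Local Notation mR := (measurableTypeR R).
Local Notation mP := (measurableTypeR R * measurableTypeR R)%type.
Local Notation leb2 := (lebesgue2 R).
Implicit Types (x y z b c s : R).

(** Indicators of half-lines as real functions, the level sets that the step
    polynomials produce. *)
Definition ray c (x : R) : R := if x < c then 1 else 0.

Lemma ray_norm c x : `|ray c x| <= 1.
Proof. by rewrite /ray; case: ifP; rewrite ?normr1 ?normr0. Qed.

(** The left side is the combination of indicators that the odd and even
    profiles produce together; the second indicator is already known to be good
    when [c < 0]. *)
Lemma ray_reflect (k : R) c x : c < 0 -> x <> - c ->
  ray c x + k / 2 * (1 - ray (- c) x) =
  if x <= 0 then ray c x else (1 - k / 2) * ray c x + k / 2 * ray c (- x).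
Proof.
move=> c0 xc; rewrite /ray; have [x0|x0] := leP x 0.
  have -> : x < - c by rewrite (le_lt_trans x0)// oppr_gt0.
  by rewrite subrr mulr0 addr0.
rewrite [x < c]ltNge (le_trans (ltW c0) (ltW x0)) /= ltrNl.
by case: (ltgtP x (- c)) xc => // _ _; rewrite ?subrr ?subr0 ?mulr0 ?mulr1.
Qed.

Lemma measurable_ray c : measurable_fun setT (ray c : mR -> mR).
Proof.
rewrite (_ : ray c = \1_(`]-oo, c[%classic)); first exact: measurable_indic.
by apply/funext => x; rewrite /ray indicE mem_setE in_itv/=; case: (x < c).
Qed.

Let mfst : measurable_fun setT (fst : mP -> mR). Proof. exact: measurable_fst. Qed.
Let msnd : measurable_fun setT (snd : mP -> mR). Proof. exact: measurable_snd. Qed.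

Lemma sn_lt x c : `|x| <= 1 -> `|c| <= 1 -> (sn x < sn c) = (x < c).
Proof.
rewrite !ler_norml => /andP[x0 x1] /andP[c0 c1].
have k0 : 0 < kap R by rewrite divr_gt0 ?pi_gt0.
have I s : -1 <= s -> s <= 1 -> kap R * s \in `[- (pi / 2), pi / 2].
  move=> s0 s1; rewrite in_itv/= -/(kap R) -{1}[kap R]mulr1 -mulrN ler_pM2l// s0/=.
  by rewrite -{2}[kap R]mulr1 ler_pM2l.
by rewrite /sn (ltr_sin (I _ x0 x1) (I _ c0 c1)) ltr_pM2l.
Qed.

Lemma snN x : sn (- x) = - sn x :> R.
Proof. by rewrite /sn mulrN sinN. Qed.

Lemma ae_vline c : {ae leb2, forall p, p.1 <> c}.
Proof.
exists [set p | p.1 = c]; split; last by move=> p /= /contrapT.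
  have -> : [set p : R * R | p.1 = c] = [set c] `*` setT.
    by apply/seteqP; split => p /=; [|case].
  exact: measurableX.
exact: leb2_null_vline.
Qed.

Lemma ae_hline c : {ae leb2, forall p, p.2 <> c}.
Proof.
exists [set p | p.2 = c]; split; last by move=> p /= /contrapT.
  have -> : [set p : R * R | p.2 = c] = setT `*` [set c].
    by apply/seteqP; split => p /=; [|case].
  exact: measurableX.
exact: leb2_null_hline.
Qed.

(** The arc on which the cosine centred at the midpoint of [-1/2] and [b]
    exceeds its value at [b] is, up to a period, the interval between them. *)
Lemma cs_arc b y : `|b| < 2^-1 -> `|y| < 2^-1 -> y <> b ->
  cs ((b - 2^-1) / 2) y <> cs ((b - 2^-1) / 2) b /\
  (cs ((b - 2^-1) / 2) y < cs ((b - 2^-1) / 2) b) = (b < y).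
Proof.
rewrite !ltr_norml => /andP[b0 b1] /andP[y0 y1] yb.
have p0 : 0 < pi :> R by exact: pi_gt0.
pose d : R := (b + 2^-1) / 2.
have -> : cs ((b - 2^-1) / 2) b = cos (2 * pi * d).
  by rewrite /cs; congr (cos (_ * _)); rewrite /d; field.
pose t : R := y - (b - 2^-1) / 2.
have -> : cs ((b - 2^-1) / 2) y = cos (2 * pi * t) by [].
have I s : 0 <= s -> s <= 2^-1 -> 2 * pi * s \in `[0, pi :> R].
  move=> s0 s1; rewrite in_itv/= !mulr_ge0 ?(ltW p0)//=.
  have := ler_wpM2l (ltW p0) s1; lra.
have dI : 2 * pi * d \in `[0, pi :> R] by apply: I; rewrite /d; lra.
have reflect s : 0 <= s -> s <= 2^-1 -> cos (2 * pi * t) = cos (2 * pi * s) -> s <> d ->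
    (d < s) = (b < y) -> cos (2 * pi * t) <> cos (2 * pi * d) /\
    (cos (2 * pi * t) < cos (2 * pi * d)) = (b < y).
  move=> s0 s1 -> sd <-; have p2 : 0 < 2 * pi :> R by rewrite mulr_gt0.
  rewrite (ltr_cos dI (I _ s0 s1)) ltr_pM2l//; split => // E; apply: sd; apply/eqP.
  rewrite eq_le !leNgt -(ltr_pM2l p2 s d) -(ltr_pM2l p2 d s).
  by rewrite -(ltr_cos dI (I _ s0 s1)) -(ltr_cos (I _ s0 s1) dI) E ltxx.
have [t0|t0] := ltP t 0.
  by apply: (reflect (- t)); rewrite ?mulrN ?cosN//; rewrite /t /d in t0 *; lra.
have [t1|t1] := leP t 2^-1.
  apply: (reflect t) => //; rewrite /t /d in t0 t1 *; first by move=> E; apply: yb; lra.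
  by apply/idP/idP; lra.
apply: (reflect (1 - t)); rewrite /t /d in t0 t1 *; try lra.
- set u := y - _; have -> : 2 * pi * (1 - u) = - (2 * pi * u) + pi *+ 2.
    by rewrite -mulr_natl; ring.
  by rewrite cosD2pi cosN.
Qed.

Variables (alpha : R) (h : R -> R * R -> R) (e1 C : R).
Hypotheses (a0 : 0 < alpha) (a1 : alpha < 1) (e10 : 0 < e1) (C0 : 0 <= C).
Hypothesis Lh : forall e, 0 < e < e1 -> L2 leb2 (@Omega R) (h e) /\ sq leb2 (@Omega R) (h e) <= C ^+ 2.
Local Notation good := (good leb2 (@Omega R) h).
Hypothesis base : forall j i z, good (fun p => psi alpha j p.1 * cs z p.2 ^+ i).

Let mO : measurable (@Omega R : set mP). Proof. exact: measurable_Omega. Qed.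
Let fO : (leb2 (@Omega R) < +oo)%E. Proof. exact: (Omega_fin mO). Qed.

Let geq f g : (forall p, f p = g p) -> good f -> good g.
Proof. by move=> E; apply: (good_eq e10) => p _; exact: E. Qed.
Let gD f g : good f -> good g -> good (fun p => f p + g p).
Proof. exact: (goodD mO e10 Lh). Qed.
Let gZ c f : good f -> good (fun p => c * f p).
Proof. exact: (goodZ mO e10 Lh). Qed.

Let measurable_fstO (g : R -> R) : measurable_fun setT (g : mR -> mR) ->
  measurable_fun (@Omega R : set mP) (fun p : R * R => g p.1).
Proof.
by move=> mg; apply: measurable_funTS; exact: (measurableT_comp (f := g : mR -> mR) mg mfst).
Qed.

Let measurable_sndO (g : R -> R) : measurable_fun setT (g : mR -> mR) ->
  measurable_fun (@Omega R : set mP) (fun p : R * R => g p.2).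
Proof.
by move=> mg; apply: measurable_funTS; exact: (measurableT_comp (f := g : mR -> mR) mg msnd).
Qed.

(* [s] is increasing, so its level sets are half-lines; on the right the factor
   [1 - alpha] of the odd powers mixes each polynomial of [s] with its
   reflection, with weights [1 - alpha / 2] and [alpha / 2] *)
Let good_level_x (b : R -> R) c (g : R -> R) : continuous b -> (forall y, `|b y| <= 1) ->
  (forall j, good (fun p => psi alpha j p.1 * b p.2)) -> `|c| < 1 ->
  measurable_fun setT (g : mR -> mR) -> (forall x, `|g x| <= 1) ->
  (forall x, x <> c -> x <> - c -> g x = if x <= 0 then ray c x else
     (1 - alpha / 2) * ray c x + (alpha / 2) * ray c (- x)) ->
  good (fun p => g p.1 * b p.2).
Proof.
move=> cb b1 gb c1 mg g1 E.
pose A1 (p : R * R) := (if p.1 <= 0 then 1 else 1 - alpha / 2) * b p.2.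
pose A2 (p : R * R) := (if p.1 <= 0 then 0 else alpha / 2) * b p.2.
have bnd (x y : R) : 0 <= x <= 1 -> `|y| <= 1 -> `|x * y| <= 1.
  by move=> /andP[x0 x1] y1; rewrite normrM -[leRHS]mulr1 ler_pM// ger0_norm.
have sn1 x : `|x| <= 1 -> `|c| <= 1 -> sn x = sn c -> x = c.
  move=> x1 c1' sE; apply/eqP; rewrite eq_le !leNgt -(sn_lt x1 c1') -(sn_lt c1' x1) sE.
  by rewrite ltxx.
have Ox p : @Omega R p -> `|p.1| <= 1 by move=> [/andP[? ?] _]; rewrite ler_norml !ltW.
apply: (good_levels (A1 := A1) (A2 := A2) (q := fun p => sn p.1) (s0 := sn c) mO fO e10 C0 Lh).
- move=> i; apply: geq (gb i) => p; rewrite /A1 /A2 /psi /splice /= /sigma.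
  case: ifP => _; first by ring.
  rewrite (_ : (- sn p.1) ^+ i = (if odd i then -1 else 1) * sn p.1 ^+ i).
    by case: (odd i); field.
  by rewrite exprNn -signr_odd; case: (odd i).
- exact: sn_norm.
- by move=> p _; exact: sn_norm.
- move=> p _; rewrite /A1 /A2; have := b1 p.2.
  by case: ifP => _ b'; split; apply: bnd => //; generalize a0 a1; lra.
- apply: measurable_funM; first exact: measurable_fstO.
  apply: measurable_sndO; exact: continuous_measurable_fun.
- move=> p _; rewrite normrM -[leRHS]mulr1 ler_pM//.
apply: (ae_imp2 _ (ae_vline c) (ae_vline (- c))) => p pc pc' Op; split.
- by right=> /sn1 pE; apply: pc; apply: pE; rewrite ?Ox// ltW.
- right; rewrite -snN => /sn1 pE; apply: pc'; apply/eqP; rewrite -eqr_oppLR; apply/eqP.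
  by apply: pE; rewrite ?normrN ?Ox// ltW.
rewrite E// /A1 /A2 /ray -snN !sn_lt ?normrN ?Ox ?(ltW c1)//.
by case: ifP => _; ring.
Qed.

(* for [c >= 0] the reflected half-line covers the whole right side and only
   adds a constant; for [c < 0] it is removed by means of the case [- c] *)
Let good_ray_x (b : R -> R) c : continuous b -> (forall y, `|b y| <= 1) ->
  (forall j, good (fun p => psi alpha j p.1 * b p.2)) -> good (fun p => ray c p.1 * b p.2).
Proof.
move=> cb b1 gb.
have gb1 : good (fun p => b p.2).
  apply: geq (gb 0%N) => p; rewrite /psi /splice /= /sigma/=.
  by case: ifP; rewrite expr0 ?mulr1 mul1r.
have mcst (k : R) : measurable_fun setT (fun=> k : mR) by exact: measurable_cst.
have right c' : 0 <= c' < 1 -> good (fun p => ray c' p.1 * b p.2).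
  move=> /andP[c0 c1].
  have : good (fun p => (alpha / 2 + (1 - alpha / 2) * ray c' p.1) * b p.2).
    apply: (good_level_x (c := c') (g := fun x => alpha / 2 + (1 - alpha / 2) * ray c' x)) => //.
    - by rewrite ger0_norm.
    - apply: measurable_funD => //; apply: measurable_funM => //; exact: measurable_ray.
    - by move=> x; rewrite /ray; generalize a0 a1; case: ifP => _; rewrite ler_norml; lra.
    move=> x xc xc'; rewrite /ray; have [x0|x0] := leP x 0.
      have -> : x < c' by rewrite lt_neqAle (le_trans x0 c0) andbT; exact/eqP.
      by rewrite mulr1; field.
    by rewrite (_ : - x < c') ?mulr1 1?addrC// (lt_le_trans _ c0)// oppr_lt0.
  move=> G; apply: geq (gZ ((1 - alpha / 2)^-1) (gD G (gZ (- (alpha / 2)) gb1))) => p.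
  field; generalize a1; lra.
have [c1|c1] := leP 1 c.
  apply: (good_eq e10) gb1 => p; rewrite inE => -[/andP[_ p1] _].
  by rewrite /ray (lt_le_trans p1 c1) mul1r.
have [c0|c0] := leP 0 c; first by apply: right; rewrite c0.
have [cN|cN] := leP c (-1).
  apply: (good_eq e10) (gZ 0 gb1) => p; rewrite inE => -[/andP[p1 _] _].
  by rewrite /ray ltNge (le_trans cN (ltW p1)) /= !mul0r.
have cc : 0 <= - c < 1 by lra.
have : good (fun p => (ray c p.1 + (alpha / 2) * (1 - ray (- c) p.1)) * b p.2).
  apply: (good_level_x (c := c) (g := fun x => ray c x + (alpha / 2) * (1 - ray (- c) x))) => //.
  - by rewrite ltr_norml; lra.
  - apply: measurable_funD; first exact: measurable_ray.
    apply: measurable_funM => //; apply: measurable_funB => //; exact: measurable_ray.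
  - move=> x; rewrite /ray; generalize a0 a1.
    by case: ifP => h1; case: ifP => h2; rewrite ler_norml; lra.
  by move=> x _ xc'; exact: ray_reflect.
move=> G; apply: geq (gD G (gD (gZ (- (alpha / 2)) gb1) (gZ (alpha / 2) (right _ cc)))) => p.
ring.
Qed.

(* the same argument in [y], with the cosine whose level set is the required
   interval *)
Let good_corner c b : good (fun p => ray c p.1 * ray b p.2).
Proof.
have gz i z : good (fun p => ray c p.1 * cs z p.2 ^+ i).
  apply: (good_ray_x (b := fun y => cs z y ^+ i)) => [|y|j]; last exact: base.
    exact: continuous_cs.
  by rewrite normrX exprn_ile1// cs_norm.
have g1 : good (fun p => ray c p.1) by apply: geq (gz 0%N 0) => p; rewrite mulr1.
have [b1|b1] := leP (2^-1) b.
  apply: (good_eq e10) g1 => p; rewrite inE => -[_ /andP[_ p1]].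
  by rewrite [in RHS]/ray (lt_le_trans p1 b1) mulr1.
have [bN|bN] := leP b (- 2^-1).
  apply: (good_eq e10) (gZ 0 g1) => p; rewrite inE => -[_ /andP[p1 _]].
  by rewrite [ray b _]/ray ltNge (le_trans bN (ltW p1)) /= mul0r mulr0.
have bb : `|b| < 2^-1 by rewrite ltr_norml bN.
have : good (fun p => ray c p.1 * (1 - ray b p.2)).
  apply: (good_levels (A1 := fun p => ray c p.1) (A2 := fun=> 0) (q := fun p => cs ((b - 2^-1) / 2) p.2)
    (s0 := cs ((b - 2^-1) / 2) b) mO fO e10 C0 Lh).
  - by move=> i; apply: geq (gz i ((b - 2^-1) / 2)) => p; rewrite mul0r addr0.
  - exact: cs_norm.
  - by move=> p _; exact: cs_norm.
  - by move=> p _; rewrite ray_norm normr0.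
  - apply: measurable_funM; first by apply: measurable_fstO; exact: measurable_ray.
    apply: measurable_funB; first exact: measurable_cst.
    by apply: measurable_sndO; exact: measurable_ray.
  - move=> p _; rewrite normrM -[leRHS]mulr1 ler_pM ?ray_norm//.
    by rewrite /ray; case: ifP; rewrite ?subrr ?subr0 ?normr0 ?normr1.
  apply: (ae_imp _ (ae_hline b)) => p pb [_ /andP[p0 p1]].
  have pp : `|p.2| < 2^-1 by rewrite ltr_norml p0.
  have [ne lt] := cs_arc bb pp pb; split; [by right|by left|].
  rewrite lt mul0r addr0 [ray b _]/ray; congr (_ * _).
  by case: (ltgtP p.2 b) pb => //; rewrite ?subrr ?subr0.
move=> G; apply: geq (gD g1 (gZ (-1) G)) => p; ring.
Qed.

Definition corners : set (set mP) := [set A | exists c b, A = [set p | p.1 < c /\ p.2 < b]].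

Let corners_setI : setI_closed corners.
Proof.
move=> A B [c [b ->]] [c' [b' ->]]; exists (Num.min c c'), (Num.min b b').
apply/seteqP; split => p /=; rewrite !lt_min.
  by move=> [[-> ->] [-> ->]].
by move=> [/andP[-> ->] /andP[-> ->]].
Qed.

Lemma measurable_corners : @measurable _ mP = <<s corners >>.
Proof.
have strip (P : R * R -> Prop) (f : R * R -> R) :
    (forall n : nat, corners [set p | P p /\ f p < n%:R]) -> <<s corners >> [set p | P p].
  move=> cP; have -> : [set p | P p] = \bigcup_(n : nat) [set p | P p /\ f p < n%:R].
    apply/seteqP; split => [p Pp|p [n _ []]//].
    by exists (Num.truncn `|f p|).+1 => //; split => //; apply: le_lt_trans (ler_norm _) (truncnS_gt _).
  apply: (@bigcup_measurable _ (g_sigma_algebraType corners)) => n _.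
  exact: sub_sigma_algebra.
have m1 : measurable_fun setT (fst : g_sigma_algebraType corners -> mR).
  apply: (measurability _ (RGenInftyO.measurableE R)) => _ [_ [c ->] <-].
  rewrite setTI (_ : _ @^-1` _ = [set p : R * R | p.1 < c]); last first.
    by apply/seteqP; split => p /=; rewrite in_itv.
  by apply: (strip _ snd) => n; exists c, n%:R.
have m2 : measurable_fun setT (snd : g_sigma_algebraType corners -> mR).
  apply: (measurability _ (RGenInftyO.measurableE R)) => _ [_ [c ->] <-].
  rewrite setTI (_ : _ @^-1` _ = [set p : R * R | p.2 < c]); last first.
    by apply/seteqP; split => p /=; rewrite in_itv.
  apply: (strip _ fst) => n; exists n%:R, c.
  by apply/seteqP; split => p [].
rewrite measurable_prod_measurableType; apply/seteqP; split.
  apply: smallest_sub; first exact: smallest_sigma_algebra.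
  move=> _ [A mA [B mB <-]].
  rewrite (_ : A `*` B = fst @^-1` A `&` snd @^-1` B)//.
  apply: (@measurableI _ (g_sigma_algebraType corners)).
    by rewrite -[X in measurable X]setTI; exact: m1.
  by rewrite -[X in measurable X]setTI; exact: m2.
apply: smallest_sub; first exact: smallest_sigma_algebra.
move=> _ [c [b ->]]; apply: sub_sigma_algebra.
exists `]-oo, c[%classic; first exact: measurable_itv.
exists `]-oo, b[%classic; first exact: measurable_itv.
by apply/seteqP; split => p /=; rewrite !in_itv/=.
Qed.

(** The corners are stable under intersection and generate the Borel sets. *)
Lemma good_density g : L2 leb2 (@Omega R) g -> good g.
Proof.
apply: (good_L2 mO fO e10 C0 Lh) => A mA.
apply: (good_indic mO fO e10 C0 Lh measurable_corners corners_setI _ _ mA).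
  apply: (good_eq e10) (good_corner 1 1) => p; rewrite inE => -[/andP[_ p1] /andP[_ p2]].
  by rewrite /ray p1 (_ : p.2 < 1 = true) ?mulr1//; apply/idP; lra.
move=> _ [c [b ->]]; apply: geq (good_corner c b) => p.
rewrite indicE /ray; have [[pc pb]|np] := pselect (p.1 < c /\ p.2 < b).
  by rewrite pc pb mem_set ?mulr1.
rewrite memNset//; case: ifP; case: ifP => pb pc; rewrite ?mulr0 ?mul0r//.
by exfalso; apply: np.
Qed.

End Density.

(** * Uniform smallness of the moments *)

Lemma cvg_vanishes (R : realType) (F : R -> R) (l : R) :
  F e @[e --> 0^'+] --> l -> vanishes (fun e => F e - l).
Proof.
move=> /cvgrPdist_le Fl r r0; have [e0 e00 H] := right_near (Fl r r0).
by exists e0 => // e he; rewrite distrC; exact: H.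
Qed.

Lemma vanishes_abs (R : realType) (F : R -> R) : vanishes F -> vanishes (fun e => `|F e|).
Proof. by apply: (vanishes_le ltr01) => e _; rewrite normr_id. Qed.

Lemma vanishes_expr2 (R : realType) (F : R -> R) : vanishes F -> vanishes (fun e => F e ^+ 2).
Proof.
move=> vF r r0; have r1 : 0 < Num.min r 1 by rewrite lt_min r0 ltr01.
have [e0 e00 H] := vF _ r1.
exists e0 => // e he; have := H e he; rewrite le_min => /andP[h1 h2].
by rewrite normrX expr2 -[leRHS]mulr1 ler_pM.
Qed.

Section UniformlyVanishing.
Context (R : realType).
Variable T : R.
Implicit Types F G : R -> R -> R.

Definition uvanishes F := exists b e0, [/\ 0 < e0, vanishes b &
  forall e t, 0 < e < e0 -> 0 <= t <= T -> `|F e t| <= b e].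

Lemma uvanishesD F G : uvanishes F -> uvanishes G -> uvanishes (fun e t => F e t + G e t).
Proof.
move=> [b [e0 [e00 vb Fb]]] [b' [e1 [e10 vb' Gb]]].
exists (fun e => b e + b' e), (Num.min e0 e1); split.
- by rewrite lt_min e00.
- exact: vanishesD.
move=> e t /andP[ep]; rewrite lt_min => /andP[h0 h1] tT.
by apply: (le_trans (ler_normD _ _)); rewrite lerD ?Fb ?Gb ?ep.
Qed.

Lemma uvanishes_le F G e1 : 0 < e1 -> (forall e t, 0 < e < e1 -> 0 <= t <= T -> `|F e t| <= `|G e t|) ->
  uvanishes G -> uvanishes F.
Proof.
move=> e10 FG [b [e0 [e00 vb Gb]]]; exists b, (Num.min e0 e1); split=> //.
  by rewrite lt_min e00.
move=> e t /andP[ep]; rewrite lt_min => /andP[h0 h1] tT.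
by apply: (le_trans (FG _ _ _ tT)); rewrite ?Gb ?ep.
Qed.

Lemma uvanishes_sqr F (c : R -> R) e0 : 0 < e0 -> vanishes c ->
  (forall e t, 0 < e < e0 -> 0 <= t <= T -> F e t ^+ 2 <= c e) -> uvanishes F.
Proof.
move=> e00 vc Fc; exists (fun e => Num.sqrt `|c e|), e0; split=> //.
  apply: vanishes_sqr; apply: (vanishes_le e00) vc => e _.
  by rewrite sqr_sqrtr// normr_id.
move=> e t he tT; rewrite -ler_sqr ?nnegrE ?sqrtr_ge0// sqr_sqrtr// real_normK ?num_real//.
exact: le_trans (Fc _ _ he tT) (ler_norm _).
Qed.

Lemma uvanishes0 : uvanishes (fun _ _ => 0).
Proof.
exists (fun=> 0), 1; split=> //; first exact: vanishes0.
by move=> *; rewrite normr0.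
Qed.

Lemma uvanishesZ (c : R) F : uvanishes F -> uvanishes (fun e t => c * F e t).
Proof.
move=> [b [e0 [e00 vb Fb]]]; exists (fun e => `|c| * b e), e0; split=> //.
  exact: vanishesZ.
by move=> e t he tT; rewrite normrM ler_wpM2l// Fb.
Qed.

Lemma uvanishes_at F t : 0 <= t <= T -> uvanishes F -> vanishes (fun e => F e t).
Proof.
move=> tT [b [e0 [e00 vb Fb]]]; apply: (vanishes_le e00) vb => e he.
exact: le_trans (Fb _ _ he tT) (ler_norm _).
Qed.

End UniformlyVanishing.

Lemma L2_cut d (X : measurableType d) (R : realType) (mu : {measure set X -> \bar R})
    (D E : set X) (f : X -> R) : measurable D -> measurable E -> E `<=` D ->
  L2 mu E f -> L2 mu D (fun p => \1_E p * f p) /\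
  sq mu D (fun p => \1_E p * f p) = sq mu E f.
Proof.
move=> mD mE ED Lf; have mf := L2_meas mE Lf.
have sqE p : (\1_E p * f p) ^+ 2 = \1_E p * f p ^+ 2.
  by rewrite indicE; case: (p \in E); rewrite ?mul1r// !mul0r expr0n.
split.
  apply/(L2P _ _ mD); split; first by apply: measurable_funTS; exact: measurable_cut.
  apply: (integrableS measurableT mD) => //.
  under [X in _.-integrable _ X]eq_fun do rewrite /= sqE.
  exact: (integrable_cut (f := fun x => f x ^+ 2) mE (L2_sqr_int mE Lf)).
by rewrite /sq (Rint_indic _ _ ED); apply: eq_Rintegral => p _.
Qed.

Section Convergence.
Context (R : realType).
Local Notation mR := (measurableTypeR R).
Local Notation mP := (measurableTypeR R * measurableTypeR R)%type.
Local Notation leb1 := (lebesgue1 R).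
Local Notation leb2 := (lebesgue2 R).
Local Notation Y := (`]- 2^-1, 2^-1[%classic : set R).
Local Notation ip D f g := (\int[leb2]_(p in D) (f p * g p)).
Local Notation OM := (@Omega_minus R).
Local Notation OP := (@Omega_plus R).
Local Notation O := (@Omega R).

(** The exponent of the layer is chosen of order [1 / e], which makes its width
    of the order of the period. *)
Lemma resolution (e : R) : 0 < e -> e < 1 -> 1 <= e * (Num.truncn e^-1).+1%:R <= 2.
Proof.
move=> e0 e1; have l := truncnS_gt e^-1.
have u : (Num.truncn e^-1)%:R <= e^-1 by rewrite truncn_le invr_ge0 ltW.
apply/andP; split.
  by rewrite -[leLHS](mulfV (lt0r_neq0 e0)); apply: ler_wpM2l; exact: ltW.
rewrite -natr1 mulrDr mulr1.
have : e * (Num.truncn e^-1)%:R <= 1 by rewrite -[leRHS](mulfV (lt0r_neq0 e0)); apply: ler_wpM2l u; exact: ltW.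
lra.
Qed.

Lemma cs1_norm z i (x : R) : `|cs1 z i x| <= i%:R * (2 * pi).
Proof.
have p0 : 0 <= 2 * pi :> R by rewrite mulr_ge0 ?pi_ge0.
rewrite /cs1 /hpow1 normrM [leRHS]mulrC -[leRHS]mulr1 [_ * i%:R]mulrC ger0_norm ?mulr_ge0 ?pi_ge0//.
apply: ler_wpM2l; first by rewrite mulr_ge0.
rewrite normrM normrN normrX mulr_ile1//.
  by rewrite exprn_ile1// cs_norm.
by rewrite ler_norml sin_geN1 sin_le1.
Qed.

(** * Gluing functions across the interface *)

Let mO : measurable (O : set mP). Proof. exact: measurable_Omega. Qed.
Let mM : measurable (OM : set mP). Proof. exact: measurable_Omega_minus. Qed.
Let mPl : measurable (OP : set mP). Proof. exact: measurable_Omega_plus. Qed.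
Let MO : OM `<=` O. Proof. by move=> p []. Qed.
Let PO : OP `<=` O. Proof. by move=> p []. Qed.
Let fO : (leb2 O < +oo)%E. Proof. exact: (Omega_fin mO). Qed.

Let glue_cut f g : {in O, (fun p => \1_OM p * f p + \1_OP p * g p) =1 glue_x0 f g}.
Proof.
move=> p; rewrite inE => Op; rewrite /glue_x0 !indicE.
have [p0|p0|p0] := ltgtP p.1 0.
- by rewrite mem_set// memNset ?mul0r ?mul1r ?addr0// => -[_]/=; rewrite ltNge (ltW p0).
- by rewrite [_ \in OP]mem_set// memNset ?mul0r ?mul1r ?add0r// => -[_]/=; rewrite ltNge (ltW p0).
- by rewrite !memNset ?mul0r ?addr0// => -[_]/=; rewrite p0 ltxx.
Qed.

Lemma L2_glue f g : L2 leb2 OM f -> L2 leb2 OP g -> L2 leb2 O (glue_x0 f g) /\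
  sq leb2 O (glue_x0 f g) <= 2 * sq leb2 OM f + 2 * sq leb2 OP g.
Proof.
move=> Lf Lg; have [Lf' sf] := L2_cut mO mM MO Lf; have [Lg' sg] := L2_cut mO mPl PO Lg.
split; first by have LD := L2D mO Lf' Lg'; apply: L2_eq LD; exact: glue_cut.
by rewrite -(sq_eq leb2 (glue_cut f g)) -sf -sg; exact: sqD_le.
Qed.

Lemma ip_glue f g v : L2 leb2 OM f -> L2 leb2 OP g -> L2 leb2 O v ->
  ip O (glue_x0 f g) v = ip OM f v + ip OP g v.
Proof.
move=> Lf Lg Lv; have [Lf' _] := L2_cut mO mM MO Lf; have [Lg' _] := L2_cut mO mPl PO Lg.
rewrite (@Rint_indic _ _ _ leb2 O OM (fun p => f p * v p) MO).
rewrite (@Rint_indic _ _ _ leb2 O OP (fun p => g p * v p) PO) -RintegralD//.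
- apply: eq_Rintegral => p Op; rewrite -(glue_cut f g Op); ring.
- by have := L2_mul_int mO Lf' Lv; congr (_.-integrable _ _); apply/funext => p /=; rewrite mulrA.
- by have := L2_mul_int mO Lg' Lv; congr (_.-integrable _ _); apply/funext => p /=; rewrite mulrA.
Qed.

(** * The family of solutions *)

Variables (alpha beta T : R).
Hypotheses (b0 : 0 <= beta) (ba : beta < alpha) (a1 : alpha < 1) (T0 : 0 < T).
Variables (w : R -> R -> jet R) (ut : R -> R -> R * R -> R).
Local Notation D e := (crack_cell alpha e).
Hypothesis evw : forall e, 0 < e < 1 -> evolution_class (D e) T (w e) (ut e).
Hypothesis perw : forall e, 0 < e < 1 -> forall t, 0 <= t -> periodic_y (D e) `]-1, 1[%classic e (w e t).
Hypothesis weakw : forall e, 0 < e < 1 -> forall t, 0 <= t -> cell_weak alpha beta e (ut e t) (w e t).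
Variables (wm wp : R -> jet R) (umt upt : R -> R * R -> R).
Hypothesis evm : evolution_class OM T wm umt.
Hypothesis evp : evolution_class OP T wp upt.
Hypothesis perm : forall t, 0 <= t -> periodic_y OM `]-1, 0[%classic 1 (wm t).
Hypothesis perp : forall t, 0 <= t -> periodic_y OP `]0, 1[%classic 1 (wp t).
Hypothesis trans : forall t, 0 <= t -> exists g : R -> R,
  is_trace OP (vsegment 0) Y (wp t) g /\
  is_trace OM (vsegment 0) Y (wm t) (fun y => (1 - alpha) * g y).
Hypothesis weakh : forall t, 0 <= t -> hom_weak alpha beta (umt t) (upt t) (wm t) (wp t).
Local Notation ext e t := (extend alpha e (w e t)).
Local Notation u t := (glue_x0 (wm t) (wp t)).
Variable u0 : R * R -> R.
Hypothesis Lu0 : L2 leb2 O u0.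
Hypothesis init_weak : forall g : R * R -> R, L2 leb2 O g ->
  ip O (ext e 0) g @[e --> 0^'+] --> ip O u0 g.
Hypothesis init_glue : {ae leb2, forall p, O p -> u 0 p = u0 p}.

Let a0 : 0 < alpha. Proof. exact: le_lt_trans b0 ba. Qed.
Let a01 : 0 <= alpha <= 1. Proof. by rewrite !ltW. Qed.
Let T00 : 0 <= (0 : R) <= T. Proof. by rewrite lexx ltW. Qed.

Let Lw e t : 0 < e < 1 -> 0 <= t <= T -> L2 leb2 (D e) (w e t).
Proof. by move=> he tT; have [/(_ t tT)[[]]] := evw he. Qed.
Let Lwm t : 0 <= t <= T -> L2 leb2 OM (wm t).
Proof. by move=> tT; have [/(_ t tT)[[]]] := evm. Qed.
Let Lwp t : 0 <= t <= T -> L2 leb2 OP (wp t).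
Proof. by move=> tT; have [/(_ t tT)[[]]] := evp. Qed.

Let Lext e t : 0 < e < 1 -> 0 <= t <= T -> L2 leb2 O (ext e t).
Proof.
by move=> he tT; case/andP: (he) => e0 e1; have [] := extend_L2 a0 a1 e0 e1 (Lw he tT).
Qed.

(** The initial data are bounded in [L^2 (Omega)] because they converge weakly;
    by unfolding, the initial energy of one cell is O(e), and the energy
    inequality propagates this bound. *)
Lemma energy_uniform : exists e1 C, [/\ 0 < e1, e1 < 1, 0 <= C & forall e t,
  0 < e < e1 -> 0 <= t <= T -> sq leb2 (D e) (w e t) <= C * e].
Proof.
have [|g Lg|e0 [C [e00 C0 bnd]]] := weak_bounded mO (f := fun e => ext e 0) fO.
- by move=> e he; exact: Lext.
- by exists (ip O u0 g); exact: init_weak.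
pose s := 96 * ((1 - alpha)^-1) ^+ 2; have s0 : 0 <= s by rewrite mulr_ge0// sqr_ge0.
exists (Num.min e0 (1 / 5)), (expR T * (2 * C + s * T)); split.
- by rewrite lt_min e00/=; lra.
- by rewrite gt_min; apply/orP; right; lra.
- rewrite mulr_ge0 ?expR_ge0// addr_ge0//; first by rewrite mulr_ge0.
  by apply: mulr_ge0 => //; exact: ltW.
move=> e t /andP[ep]; rewrite lt_min => /andP[h0 h1] tT.
have e1 : e < 1 by lra.
have he : 0 < e < 1 by rewrite ep.
apply: (le_trans (energy_decay b0 ba a1 ep e1 (evw he) (perw he) (weakw he) tT)).
rewrite -[leRHS]mulrA; apply: ler_wpM2l; first exact: expR_ge0.
have [_ _ S] := extend_L2 a0 a1 ep e1 (Lw he T00).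
have eq : e < 4^-1 by lra.
have B : sq leb2 O (ext e 0) <= C by apply: bnd => //; rewrite ep.
have := ler_wpM2l (ltW ep) B; have := S eq; rewrite /source -/s.
rewrite mulrDl (mulrAC s); lra.
Qed.

Let M (e : R) := Num.truncn e^-1.
Let raw j : R -> R -> R := fun e t => moment_raw alpha e (w e) j t.
Let test j : R -> R -> R := fun e t => moment_test alpha e (w e) (M e) j t.

Let vanishes_const (c : R) : vanishes (fun e => c * e).
Proof. by apply: vanishesZ; exact: vanishes_id. Qed.

Lemma raw_test_uvanishes j : uvanishes T (fun e t => raw j e t - test j e t).
Proof.
have [e1 [C [e10 e11 C0 bnd]]] := energy_uniform.
apply: (uvanishes_sqr (c := fun e => (2 * slope alpha j ^+ 2 * C) * e) e10) => // e t he tT.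
case/andP: (he) => ep ee; have e1' := lt_trans ee e11; have hE : 0 < e < 1 by rewrite ep.
apply: (le_trans (moment_raw_close b0 ba a1 ep e1' (evw hE) (resolution ep e1') j tT)).
rewrite -[leLHS]mulrA -[leRHS]mulrA; apply: ler_wpM2l; first by rewrite mulr_ge0// sqr_ge0.
have B := bnd e t he tT; apply: (@le_trans _ _ (e * (C * e))).
  by apply: ler_wpM2l B; exact: ltW.
by rewrite -[leRHS]mul1r; apply: ler_wpM2r; [rewrite mulr_ge0// ltW|exact: ltW].
Qed.

Lemma raw_extend_uvanishes z j i : uvanishes T (fun e t =>
  ip O (ext e t) (fun p => psi alpha j p.1 * cs z p.2 ^+ i) - ecs z i * raw j e t).
Proof.
have [e1 [C [e10 e11 C0 bnd]]] := energy_uniform.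
pose L : R := i%:R * (2 * pi).
apply: (uvanishes_sqr (c := fun e => (2 * (L + 2) ^+ 2 * C) * e) e10) => // e t he tT.
case/andP: (he) => ep ee; have e1' := lt_trans ee e11; have hE : 0 < e < 1 by rewrite ep.
have nc y : `|cs z y ^+ i| <= 1 by rewrite normrX exprn_ile1// cs_norm.
apply: (le_trans (extend_tensor a0 a1 ep e1' (Lw hE tT) (@continuous_psi R alpha j)
  (fun x => psi_norm j x a01) (csP z i).1 (cs1_norm z i) nc)).
rewrite -[leLHS]mulrA -[leRHS]mulrA; apply: ler_wpM2l; first by rewrite mulr_ge0// sqr_ge0.
have B := bnd e t he tT; apply: (@le_trans _ _ (e * (C * e))).
  by apply: ler_wpM2l B; exact: ltW.
by rewrite -[leRHS]mul1r; apply: ler_wpM2r; [rewrite mulr_ge0// ltW|exact: ltW].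
Qed.

Let Ltest z j i (E : set mP) : measurable E -> E `<=` O ->
  L2 leb2 E (fun p => psi alpha j p.1 * cs z p.2 ^+ i).
Proof.
move=> mE EO; apply: (@L2_tensor R E (psi alpha j) (fun y => cs z y ^+ i)) => //.
  exact: continuous_psi.
exact: continuous_cs.
Qed.

Lemma ip_glue_hmoment z j i t : 0 <= t <= T ->
  ip O (u t) (fun p => psi alpha j p.1 * cs z p.2 ^+ i) = hmoment alpha wm wp z j i t.
Proof.
move=> tT; rewrite (ip_glue (Lwm tT) (Lwp tT) (Ltest _ _ _ mO _))//.
congr (_ + _); apply: eq_Rintegral => p; rewrite inE => -[_ /=]; rewrite /psi /splice.
  by move=> /ltW ->.
by rewrite ltNge => /negbTE ->.
Qed.

Let X z j i e t := moment_error alpha e (w e) (M e) wm wp z j i t.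

(** The three sources of error are the Riemann sum in [y], the layer, and the
    difference of the moments. *)
Lemma moment_error_decomp z j i e t : 0 < e < 1 -> 0 <= t <= T ->
  ip O (fun p => ext e t p - u t p) (fun p => psi alpha j p.1 * cs z p.2 ^+ i) =
  (ip O (ext e t) (fun p => psi alpha j p.1 * cs z p.2 ^+ i) - ecs z i * raw j e t)
  + ecs z i * (raw j e t - test j e t) + X z j i e t.
Proof.
move=> he tT.
have [Lu _] := L2_glue (Lwm tT) (Lwp tT).
have Lt := @Ltest z j i _ mO (fun _ => id).
have -> : ip O (fun p => ext e t p - u t p) (fun p => psi alpha j p.1 * cs z p.2 ^+ i) =
    ip O (ext e t) (fun p => psi alpha j p.1 * cs z p.2 ^+ i) -
    ip O (u t) (fun p => psi alpha j p.1 * cs z p.2 ^+ i).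
  rewrite -RintegralB//; [|exact: L2_mul_int (Lext he tT) Lt|exact: L2_mul_int Lu Lt].
  by apply: eq_Rintegral => p _; rewrite mulrBl.
by rewrite (ip_glue_hmoment _ _ _ tT) /X /moment_error /test; ring.
Qed.

Let ip_init g : L2 leb2 O g -> ip O (u 0) g = ip O u0 g.
Proof.
move=> Lg; have [Lu _] := L2_glue (Lwm T00) (Lwp T00).
have Ld := L2B mO Lu Lu0.
have [_ s0] : L2 leb2 O (fun p => u 0 p - u0 p) /\
    sq leb2 O (fun p => u 0 p - u0 p) = sq leb2 O (fun=> 0).
  apply: L2_ae => //; [exact: L2_meas Ld|exact: L2_cst|].
  by apply: (ae_imp _ init_glue) => p up Op; rewrite up// subrr.
have s1 : sq leb2 O (fun=> 0) = 0 by rewrite /sq /Rintegral expr0n integral0.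
have := cauchy_schwarz mO Ld Lg; rewrite s0 s1 mul0r => cs0.
have : ip O (fun p => u 0 p - u0 p) g = 0.
  by apply/eqP; rewrite -sqrf_eq0 eq_le cs0 sqr_ge0.
have -> : ip O (fun p => u 0 p - u0 p) g = ip O (u 0) g - ip O u0 g.
  rewrite -RintegralB//; [|exact: L2_mul_int Lu Lg|exact: L2_mul_int Lu0 Lg].
  by apply: eq_Rintegral => p _; rewrite mulrBl.
by move/eqP; rewrite subr_eq0 => /eqP.
Qed.

Lemma moment_error_initial z j i : vanishes (fun e => X z j i e 0).
Proof.
have Lt := @Ltest z j i _ mO (fun _ => id).
have v1 : vanishes (fun e => ip O (ext e 0) (fun p => psi alpha j p.1 * cs z p.2 ^+ i) -
    hmoment alpha wm wp z j i 0).
  rewrite -(ip_glue_hmoment z j i T00) ip_init//; exact: cvg_vanishes (init_weak Lt).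
have v2 := uvanishes_at T00 (raw_extend_uvanishes z j i).
have v3 := vanishesZ (- ecs z i) (uvanishes_at T00 (raw_test_uvanishes j)).
apply: (vanishes_le ltr01) (vanishesD (vanishesD v1 (vanishesZ (-1) v2)) v3) => e he.
by rewrite le_eqVlt; apply/orP; left; apply/eqP; congr (`| _ |); rewrite /X /moment_error /test; ring.
Qed.

(** Induction on both exponents: the error of exponents [(j, i)] is driven by
    those of [(j - 2, i)] and [(j, i - 2)], whose coefficients vanish when the
    exponent is at most 1. *)
Lemma moment_error_uvanishes z j i : uvanishes T (X z j i).
Proof.
elim/ltn_ind: j i => j IHj; elim/ltn_ind => i IHi.
have U1 : uvanishes T (fun e t => (j%:R * (j%:R - 1)) * X z j.-2 i e t).
  case: j IHj IHi => [|[|j]] IHj IHi.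
  - by apply: (uvanishes_le (G := fun _ _ => 0) ltr01) (uvanishes0 T) => *; rewrite !mul0r.
  - by apply: (uvanishes_le (G := fun _ _ => 0) ltr01) (uvanishes0 T) => *; rewrite subrr mulr0 mul0r.
  by apply: uvanishesZ; apply: IHj; rewrite ltnS ltnW.
have U2 : uvanishes T (fun e t => (i%:R * (i%:R - 1)) * X z j i.-2 e t).
  clear U1; case: i IHi => [|[|i]] IHi.
  - by apply: (uvanishes_le (G := fun _ _ => 0) ltr01) (uvanishes0 T) => *; rewrite !mul0r.
  - by apply: (uvanishes_le (G := fun _ _ => 0) ltr01) (uvanishes0 T) => *; rewrite subrr mulr0 mul0r.
  by apply: uvanishesZ; apply: IHi; rewrite ltnS ltnW.
have [A1 [eA [eA0 vA HA]]] := U1; have [A2 [eB [eB0 vB HB]]] := U2.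
have [B0 [eC [eC0 vC HC]]] := raw_test_uvanishes j.-2.
have [B1 [eD [eD0 vD HD]]] := raw_test_uvanishes j.
have [e1 [C [e10 e11 C0 bnd]]] := energy_uniform.
pose B e := `|B0 e| + `|B1 e|.
pose eta e := kap R ^+ 2 * A1 e + (2 * pi) ^+ 2 * A2 e +
    kap R ^+ 2 * (j%:R * (j%:R - 1) + j%:R ^+ 2) * B e.
pose K := 16 * slope alpha j ^+ 2.
pose bound e := expR (2 * T) * (X z j i e 0 ^+ 2 + K * C * e + T * (eta e ^+ 2) + T * (K * source alpha 1) * e).
have veta : vanishes eta.
  apply: vanishesD; first by apply: vanishesD; exact: vanishesZ.
  by apply: vanishesZ; apply: vanishesD; exact: vanishes_abs.
have vb : vanishes bound.
  apply: vanishesZ; apply: vanishesD => //; apply: vanishesD.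
    by apply: vanishesD => //; apply: vanishes_expr2; exact: moment_error_initial.
  by apply: vanishesZ; exact: vanishes_expr2.
pose e2 := Num.min e1 (Num.min (Num.min eA eB) (Num.min eC eD)).
have e20 : 0 < e2 by rewrite !lt_min e10 eA0 eB0 eC0 eD0.
apply: (uvanishes_sqr (c := bound) e20) => // e t /andP[ep].
rewrite !lt_min => /andP[h1 /andP[/andP[hA hB] /andP[hC hD]]] tT.
have e1' := lt_trans h1 e11; have hE : 0 < e < 1 by rewrite ep.
have oc s : 0 < s < T -> 0 <= s <= T by move=> /andP[s0 s1]; rewrite !ltW.
have := @moment_step R alpha beta e T b0 ba a1 ep e1' (w e) (ut e) (evw hE) (perw hE) (weakw hE)
  (M e) (resolution ep e1') wm wp umt upt evm evp perm perp trans weakh z j i (A1 e) (A2 e) (B e) _ _ _ _ t tT.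
move=> H; apply: le_trans (H _ _ _ _) _.
- move=> s /oc sT; have := HA e s; rewrite ep hA => /(_ isT sT).
  rewrite normrM ger0_norm//; case: (j) => [|j']; first by rewrite mul0r.
  by rewrite mulr_ge0// subr_ge0 ler1n.
- by move=> s /oc sT; have := HB e s; rewrite ep hB -normrM; exact.
- move=> s /oc sT; have := HC e s; rewrite ep hC => /(_ isT sT) /le_trans; apply.
  by rewrite (le_trans (ler_norm _))// lerDl.
- move=> s /oc sT; have := HD e s; rewrite ep hD => /(_ isT sT) /le_trans; apply.
  by rewrite (le_trans (ler_norm _))// lerDr.
rewrite /bound; apply: ler_wpM2l; first exact: expR_ge0.
have S : sq leb2 (D e) (w e 0) <= C * e by apply: bnd => //; rewrite ep.
have K0 : 0 <= K by rewrite mulr_ge0// sqr_ge0.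
have := ler_wpM2l K0 S; rewrite -/(eta e) -/K /source /X mulr1; lra.
Qed.

Lemma moments_uvanish z j i : uvanishes T (fun e t =>
  ip O (fun p => ext e t p - u t p) (fun p => psi alpha j p.1 * cs z p.2 ^+ i)).
Proof.
apply: (uvanishes_le ltr01) (uvanishesD (uvanishesD (raw_extend_uvanishes z j i)
  (uvanishesZ (ecs z i) (raw_test_uvanishes j))) (moment_error_uvanishes z j i)) => e t he tT.
by rewrite moment_error_decomp.
Qed.

Lemma difference_bounded : exists e1 C, [/\ 0 < e1, e1 < 1, 0 <= C & forall e t, 0 < e < e1 -> 0 <= t <= T ->
  L2 leb2 O (fun p => ext e t p - u t p) /\ sq leb2 O (fun p => ext e t p - u t p) <= C ^+ 2].
Proof.
have [e1 [C [e10 e11 C0 bnd]]] := energy_uniform.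
have sqb (E : set mP) (v : R -> jet R) vt : measurable E -> evolution_class E T v vt ->
    exists2 K, 0 <= K & forall t, 0 <= t <= T -> sq leb2 E (v t) <= K.
  move=> mE ev; have [cont _] := evolves_sq mE ev.
  have [c _ H] := EVT_max (ltW T0) cont.
  exists (sq leb2 E (v c)); first exact: sq_ge0.
  by move=> t tT; apply: H; rewrite in_itv.
have [Km Km0 Bm] := sqb _ _ _ mM evm; have [Kp Kp0 Bp] := sqb _ _ _ mPl evp.
pose K := 6 * C + 4 * Km + 4 * Kp.
have K0 : 0 <= K by rewrite !addr_ge0// mulr_ge0.
exists e1, (Num.sqrt K); split => //.
move=> e t he tT; case/andP: (he) => ep h1; have e1' := lt_trans h1 e11.
have hE : 0 < e < 1 by rewrite ep.
have [Lu su] := L2_glue (Lwm tT) (Lwp tT).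
have Le := Lext hE tT; split; first exact: L2B.
rewrite sqr_sqrtr//.
have LN := L2Z (-1) mO Lu.
have -> : sq leb2 O (fun p => ext e t p - u t p) = sq leb2 O (fun p => ext e t p + -1 * u t p).
  by apply: sq_eq => p _; rewrite mulN1r.
apply: le_trans (sqD_le mO Le LN) _; rewrite sqZ//.
have [_ S _] := extend_L2 a0 a1 ep e1' (Lw hE tT).
have S' : sq leb2 O (ext e t) <= 3 * C.
  rewrite -(ler_pM2l ep); apply: (le_trans S); have := bnd e t he tT; lra.
have := Bm t tT; have := Bp t tT; rewrite /K; lra.
Qed.

(** The difference of the extension and the limit is bounded and its moments
    vanish, so the density of the test functions applies. *)
Lemma pointwise_vanishes t g : 0 <= t <= T -> L2 leb2 O g ->
  vanishes (fun e => ip O (fun p => ext e t p - u t p) g).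
Proof.
move=> tT Lg; have [e1 [C [e10 e11 C0 bnd]]] := difference_bounded.
have Lh e : 0 < e < e1 -> L2 leb2 O (fun p => ext e t p - u t p) /\
  sq leb2 O (fun p => ext e t p - u t p) <= C ^+ 2 by move=> he; exact: bnd.
have [|_ //] := good_density (h := fun e p => ext e t p - u t p) a0 a1 e10 C0 Lh _ Lg.
move=> j i z; split; first exact: Ltest.
exact: uvanishes_at tT (moments_uvanish z j i).
Qed.

End Convergence.

(** * Integrals over space-time *)

(** Dominated convergence is a statement on sequences; a failure of the limit
    would give a sequence of parameters along which the integral stays away from
    0. *)
Lemma dominated_vanishes d (X : measurableType d) (R : realType) (mu : {measure set X -> \bar R})
    (D : set X) (phi : R -> X -> R) (H : X -> R) (e1 : R) : measurable D -> 0 < e1 ->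
  (forall e, 0 < e < e1 -> measurable_fun D (phi e)) -> mu.-integrable D (EFin \o H) ->
  {ae mu, forall x, D x -> (forall e, 0 < e < e1 -> `|phi e x| <= H x) /\ vanishes (phi^~ x)} ->
  vanishes (fun e => \int[mu]_(x in D) phi e x).
Proof.
move=> mD e10 mphi iH lim r r0; apply: contrapT => nv.
have bad n : exists e, 0 < e < Num.min e1 n.+1%:R^-1 /\ r < `|\int[mu]_(x in D) phi e x|.
  apply: contrapT => ne; apply: nv; exists (Num.min e1 n.+1%:R^-1).
    by rewrite lt_min e10 invr_gt0 ltr0n.
  by move=> e he; rewrite leNgt; apply/negP => lt; apply: ne; exists e.
have [e he] := choice bad.
have eR n : 0 < e n < e1 by have [] := he n; rewrite lt_min => /andP[-> /andP[-> _]].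
have mf n : measurable_fun D (fun x => (phi (e n) x)%:E).
  by apply/measurable_EFinP; exact: mphi.
have hc : {ae mu, forall x, D x -> (phi (e n) x)%:E @[n --> \oo] --> 0%E}.
  apply: ae_imp lim => x L Dx; have [_ v] := L Dx.
  apply: cvg_EFin; first by apply: nearW.
  apply/cvgrPdist_le => s s0; have [e0 e00 small] := v s s0.
  exists (Num.truncn e0^-1) => // n /= nN; rewrite sub0r normrN; apply: small.
  have [/andP[-> ]] := he n; rewrite lt_min => /andP[_ lt] _ /=.
  apply: (lt_trans lt); rewrite invf_plt ?posrE ?ltr0n//.
  apply: (lt_le_trans (truncnS_gt _)); by rewrite ler_nat ltnS.
have hb : {ae mu, forall x n, D x -> (`|(phi (e n) x)%:E| <= (EFin \o H) x)%E}.
  by apply: ae_imp lim => x L n Dx; have [B _] := L Dx; rewrite lee_fin; exact: B.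
have [_ _] := dominated_convergence mD mf (measurable_cst _) hc iH hb.
rewrite integral0 => cv.
have c : (\int[mu]_(x in D) phi (e n) x) @[n --> \oo] --> (0 : R) by exact: fine_cvg cv.
move/cvgrPdist_le: c => /(_ r r0)[N _ /(_ N (leqnn N))] /=.
rewrite sub0r normrN => le; have [_] := he N.
by rewrite ltNge => /negP; apply.
Qed.

(** A copy of the plane measure that carries the sigma-finite structure which
    Fubini over space-time requires. *)
Definition area (R : realType) :
    set (measurableTypeR R * measurableTypeR R)%type -> \bar R := lebesgue2 R.
HB.instance Definition _ (R : realType) := Measure.copy (@area R) (lebesgue2 R).

Lemma area_sigma_finite (R : realType) : sigma_finite setT (@area R).
Proof.
exists (fun n => `]- n%:R, n%:R[ `*` `]- n%:R, n%:R[); last first.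
  by move=> n; split; [exact: measurable_rect|exact: rect_fin].
apply/seteqP; split => // p _; exists (Num.truncn (`|p.1| + `|p.2|)).+1 => //.
have l := truncnS_gt (`|p.1| + `|p.2|).
have l1 : `|p.1| < (Num.truncn (`|p.1| + `|p.2|)).+1%:R by apply: le_lt_trans l; rewrite lerDl.
have l2 : `|p.2| < (Num.truncn (`|p.1| + `|p.2|)).+1%:R by apply: le_lt_trans l; rewrite lerDr.
by split; rewrite /= in_itv/= -ltr_norml.
Qed.

HB.instance Definition _ (R : realType) :=
  Measure_isSigmaFinite.Build _ _ _ (@area R) (@area_sigma_finite R).

Section SpaceTime.
Context (R : realType).
Local Notation mR := (measurableTypeR R).
Local Notation mP := (measurableTypeR R * measurableTypeR R)%type.
Local Notation mS := (measurableTypeR R * measurableTypeR R * measurableTypeR R)%type.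
Local Notation leb1 := (lebesgue1 R).
Local Notation leb2 := (lebesgue2 R).
Local Notation leb3 := (lebesgue_st R).
Local Notation O := (@Omega R).
Local Notation I T := (`[0, T]%classic : set R).
Local Notation ip D f g := (\int[leb2]_(p in D) (f p * g p)).

Let mO : measurable (O : set mP). Proof. exact: measurable_Omega. Qed.
Let fO : (leb2 O < +oo)%E. Proof. exact: (Omega_fin mO). Qed.
Let mI (T : R) : measurable (I T : set mR). Proof. exact: measurable_itv. Qed.
Let fI (T : R) : (leb1 (I T) < +oo)%E.
Proof. by rewrite /lebesgue1 /= lebesgue_measure_itv/=; case: ifP => // _; rewrite -EFinB ltry. Qed.

Lemma fubini_st (A : set mP) (B : set mR) (f : mS -> R) : measurable A -> measurable B ->
  leb3.-integrable (A `*` B) (EFin \o f) ->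
  [/\ {ae leb1, forall t, B t -> leb2.-integrable A (EFin \o (fun p => f (p, t)))},
     leb1.-integrable B (EFin \o (fun t => \int[leb2]_(p in A) f (p, t))) &
     \int[leb3]_(q in A `*` B) f q = \int[leb1]_(t in B) \int[leb2]_(p in A) f (p, t)].
Proof. by move=> mA mB If; exact: (@fubini_prod _ _ mP mR R (@area R) lebesgue_measure). Qed.

Lemma L2_st T (f : mS -> R) (M : R) : measurable_fun (O `*` I T) f ->
  (forall t, I T t -> L2 leb2 O (fun p => f (p, t)) /\ sq leb2 O (fun p => f (p, t)) <= M) ->
  L2 leb3 (O `*` I T) f.
Proof.
move=> mf Lf; have mOI := measurableX mO (mI T).
apply/(L2P _ _ mOI); split => //.
apply: (@tonelli_integrable _ _ mP mR R (@area R) lebesgue_measure O (I T) (fun q => f q ^+ 2) M) => //.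
- exact: fI.
- exact: measurable_funX.
- by move=> q; exact: sqr_ge0.
by move=> t It; have [Lt Mt] := Lf t It; split => //; exact: L2_sqr_int.
Qed.

(** Fubini for the square of [g]. *)
Lemma L2_sections T (g : mS -> R) : L2 leb3 (O `*` I T) g ->
  {ae leb1, forall t, I T t -> L2 leb2 O (fun p => g (p, t))} /\
  leb1.-integrable (I T) (EFin \o (fun t => sq leb2 O (fun p => g (p, t)))).
Proof.
move=> Lg; have mOI := measurableX mO (mI T).
have [ae it _] := fubini_st mO (mI T) (L2_sqr_int mOI Lg).
split => //; apply: ae_imp ae => t H It; apply/(L2P _ _ mO); split; last exact: H.
exact: measurable_section2 mO (mI T) It (L2_meas mOI Lg).
Qed.

Lemma cut_time (E : set mP) T (f : mS -> R) : measurable E -> measurable_fun (E `*` I T) f ->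
  measurable_fun setT (fun q : mS => \1_(E `*` I T) q * f q).
Proof. by move=> mE; apply: measurable_cut; apply: measurableX. Qed.

Variables (alpha T : R).
Hypotheses (a0 : 0 < alpha) (a1 : alpha < 1) (T0 : 0 < T).

Lemma measurable_extend_st e (w : R -> jet R) : 0 < e -> e < 1 ->
  measurable_fun (crack_cell alpha e `*` I T) (fun q : R * R * R => w q.2 q.1) ->
  measurable_fun (O `*` I T : set mS) (fun q => extend alpha e (w q.2) q.1).
Proof.
move=> e0 e1 mw; have mD : measurable (crack_cell alpha e : set mP) by exact: measurable_cell.
pose F (q : mS) := \1_(crack_cell alpha e `*` I T) q * w q.2 q.1.
have mF : measurable_fun setT F by exact: cut_time.
have ms : measurable_fun (O `*` I T : set mS)
    (fun q => \sum_(k < (ncell e).*2.+1) F (vshift (- offset e k) q.1, q.2)).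
  apply: measurable_funTS; apply: measurable_sum => k.
  apply: (measurableT_comp mF).
  apply/measurable_fun_pairP; split => /=.
    change (measurable_fun setT ((vshift (- offset e k) : mP -> mP) \o (fst : mS -> mP))).
    apply: measurableT_comp; [exact: measurable_vshift|exact: measurable_fst].
  exact: measurable_snd.
apply: eq_measurable_fun ms => q /set_mem[[_ /= qY] It].
rewrite (extend_sum a0 a1 e0 e1) ?in_itv//; apply: eq_bigr => k _; rewrite /F !indicE.
rewrite /=; congr (_ * _); congr (nat_of_bool _)%:R; apply/idP/idP => /set_mem.
  by move=> [/= /mem_set].
by move=> Dk; apply/mem_set; split.
Qed.

Lemma measurable_glue_st (wm wp : R -> jet R) :
  measurable_fun (@Omega_minus R `*` I T) (fun q : R * R * R => wm q.2 q.1) ->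
  measurable_fun (@Omega_plus R `*` I T) (fun q : R * R * R => wp q.2 q.1) ->
  measurable_fun (O `*` I T : set mS) (fun q => glue_x0 (wm q.2) (wp q.2) q.1).
Proof.
move=> mm mp.
have m : measurable_fun (O `*` I T : set mS) (fun q : mS =>
    \1_(@Omega_minus R `*` I T) q * wm q.2 q.1 + \1_(@Omega_plus R `*` I T) q * wp q.2 q.1).
  apply: measurable_funD; apply: measurable_funTS; apply: cut_time => //.
    exact: measurable_Omega_minus.
  exact: measurable_Omega_plus.
apply: eq_measurable_fun m => q /set_mem[Oq It]; rewrite /glue_x0 !indicE.
have [q0|q0|q0] := ltgtP q.1.1 0.
- rewrite mem_set// memNset ?mul0r ?mul1r ?addr0// => -[[_ /=]].
  by rewrite ltNge (ltW q0).
- rewrite [_ \in @Omega_plus R `*` _]mem_set// memNset ?mul0r ?mul1r ?add0r// => -[[_ /=]].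
  by rewrite ltNge (ltW q0).
- by rewrite !memNset ?mul0r ?addr0// => -[[_ /=]]; rewrite q0 ltxx.
Qed.

(** By Fubini, the pairing in space-time is the integral over time of the pairings
    at fixed times; these tend to 0, and the uniform bound dominates them. *)
Lemma space_time_convergence (F : R -> mS -> R) (v : mS -> R) (e1 C : R) : 0 < e1 -> e1 < 1 -> 0 <= C ->
  (forall e, 0 < e < 1 -> L2 leb3 (O `*` I T) (F e)) -> L2 leb3 (O `*` I T) v ->
  (forall e t, 0 < e < e1 -> 0 <= t <= T -> L2 leb2 O (fun p => F e (p, t) - v (p, t)) /\
    sq leb2 O (fun p => F e (p, t) - v (p, t)) <= C ^+ 2) ->
  (forall t g, 0 <= t <= T -> L2 leb2 O g ->
    vanishes (fun e => ip O (fun p => F e (p, t) - v (p, t)) g)) ->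
  weak_L2_cvg leb3 (O `*` I T) F v.
Proof.
move=> e10 e11 C0 LF Lv bnd lim; split=> // g Lg; have mOI := measurableX mO (mI T).
have [aeg ig] := L2_sections Lg.
have IT t : I T t -> 0 <= t <= T by rewrite /= in_itv.
have lt1 e : 0 < e < e1 -> 0 < e < 1 by move=> /andP[-> h] /=; exact: lt_trans e11.
have iFg e : 0 < e < e1 -> leb3.-integrable (O `*` I T) (EFin \o (fun q => (F e q - v q) * g q)).
  by move=> he; apply: L2_mul_int => //; apply: L2B => //; apply: LF; exact: lt1.
apply: vanishes_cvg.
pose phi e t := ip O (fun p => F e (p, t) - v (p, t)) (fun p => g (p, t)).
have V : vanishes (fun e => \int[leb1]_(t in I T) phi e t).
  apply: (dominated_vanishes (H := fun t => C + C * sq leb2 O (fun p => g (p, t))) (mI T) e10).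
  - move=> e he; have [_ it _] := fubini_st mO (mI T) (iFg e he).
    by apply/measurable_EFinP; exact: measurable_int it.
  - apply: rintD => //; last exact: rintZ.
    by have := L2_int (mI T) (fI T) (L2_cst C (mI T) (fI T)).
  apply: ae_imp aeg => t Lgt It; have Lt := Lgt It; split; last exact: lim _ _ (IT _ It) Lt.
  move=> e he; have [Lh sh] := bnd e t he (IT _ It).
  apply: (le_trans (cauchy_schwarz_norm mO Lh Lt)).
  have s1 : Num.sqrt (sq leb2 O (fun p => F e (p, t) - v (p, t))) <= C.
    by rewrite -(ger0_norm C0) -sqrtr_sqr ler_wsqrtr.
  set S := sq leb2 O (fun p => g (p, t)).
  have S0 : 0 <= S by exact: sq_ge0.
  have s2 : Num.sqrt S <= 1 + S.
    rewrite -ler_sqr ?nnegrE ?sqrtr_ge0 ?addr_ge0// sqr_sqrtr//; have := sqr_ge0 S; lra.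
  have -> : C + C * S = C * (1 + S) by rewrite mulrDr mulr1.
  by apply: ler_pM => //; exact: sqrtr_ge0.
apply: (vanishes_le e10) V => e he.
have L1 := L2_mul_int mOI (LF e (lt1 e he)) Lg; have L2 := L2_mul_int mOI Lv Lg.
have [_ _ E] := fubini_st mO (mI T) (iFg e he).
rewrite /phi -E -RintegralB//; rewrite le_eqVlt; apply/orP; left; apply/eqP; congr (`| _ |).
by apply: eq_Rintegral => q _; rewrite mulrBl.
Qed.

End SpaceTime.

Lemma sq_bounded (R : realType) (E : set (measurableTypeR R * measurableTypeR R)%type) (T : R)
    (v : R -> jet R) (vt : R -> R * R -> R) : 0 < T -> measurable E -> evolution_class E T v vt ->
  exists2 K, 0 <= K & forall t, 0 <= t <= T -> sq (lebesgue2 R) E (v t) <= K.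
Proof.
move=> T0 mE ev; have [cont _] := evolves_sq mE ev.
have [c _ H] := EVT_max (ltW T0) cont.
exists (sq (lebesgue2 R) E (v c)); first exact: sq_ge0.
by move=> t tT; apply: H; rewrite in_itv.
Qed.

Theorem proposition6p1 (R : realType) (alpha beta : R)
    (ab : 0 <= beta < alpha /\ alpha < 1)
    (ueps : R -> R -> R * R -> R) (u0 : R * R -> R)
    (um up : R -> R * R -> R) :
  (forall eps : R, 0 < eps < 1 -> cracked_solution alpha beta eps (ueps eps)) ->
  weak_L2_cvg (lebesgue2 R) Omega
    (fun eps : R => extend alpha eps (ueps eps 0)) u0 ->
  homogenized_solution alpha beta um up ->
  {ae lebesgue2 R, forall p, Omega p -> glue_x0 (um 0) (up 0) p = u0 p} ->
  forall T : R, 0 < T ->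
    weak_L2_cvg (lebesgue_st R) (Omega `*` `[0, T])
      (fun (eps : R) (q : (R * R) * R) => extend alpha eps (ueps eps q.2) q.1)
      (fun q : (R * R) * R => glue_x0 (um q.2) (up q.2) q.1).
Proof.
case: ab => /andP[b0 ba] a1 solved [_ Lu0 init] [umx [umy [umt [upx [upy [upt [evh perh trans weakh]]]]]]] init0 T T0.
have a0 : 0 < alpha := le_lt_trans b0 ba.
pose wm t := Jet (um t) (umx t) (umy t); pose wp t := Jet (up t) (upx t) (upy t).
have [evm evp] := evh T T0.
have /choice[G GP] : forall e : R, exists wu : (R -> jet R) * (R -> R * R -> R), 0 < e < 1 ->
    [/\ forall t, wu.1 t = ueps e t :> (R * R -> R),
      evolution_class (crack_cell alpha e) T wu.1 wu.2,
      forall t, 0 <= t -> periodic_y (crack_cell alpha e) `]-1, 1[%classic e (wu.1 t) &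
      forall t, 0 <= t -> cell_weak alpha beta e (wu.2 t) (wu.1 t)].
  move=> e; have [he|ne] := pselect (0 < e < 1); last by exists (wm, umt).
  have [ux [uy [ut [ev per weak]]]] := solved e he.
  exists (fun t => Jet (ueps e t) (ux t) (uy t), ut) => _; split => //.
  exact: ev.
pose w e t := (G e).1 t; pose ut e := (G e).2.
have wE e t : 0 < e < 1 -> w e t = ueps e t :> (R * R -> R) by move=> /GP[E _ _ _]; exact: E.
have evw e : 0 < e < 1 -> evolution_class (crack_cell alpha e) T (w e) (ut e) by move=> /GP[].
have perw e : 0 < e < 1 -> forall t, 0 <= t -> periodic_y (crack_cell alpha e) `]-1, 1[%classic e (w e t).
  by move=> /GP[].
have weakw e : 0 < e < 1 -> forall t, 0 <= t -> cell_weak alpha beta e (ut e t) (w e t).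
  by move=> /GP[].
have extE e t : 0 < e < 1 -> extend alpha e (w e t) = extend alpha e (ueps e t).
  by move=> he; rewrite wE.
have T00 : 0 <= (0 : R) <= T by rewrite lexx ltW.
have init' g : L2 (lebesgue2 R) Omega g ->
    \int[lebesgue2 R]_(p in Omega) (extend alpha e (w e 0) p * g p) @[e --> 0^'+]
    --> \int[lebesgue2 R]_(p in Omega) (u0 p * g p).
  move=> Lg; apply: vanishes_cvg; apply: (vanishes_le ltr01) (cvg_vanishes (init g Lg)) => e he.
  by rewrite extE.
have perm t : 0 <= t -> periodic_y Omega_minus `]-1, 0[%classic 1 (wm t) by move=> /perh[].
have perp t : 0 <= t -> periodic_y Omega_plus `]0, 1[%classic 1 (wp t) by move=> /perh[].
have mO : measurable (@Omega R : set (measurableTypeR R * measurableTypeR R)%type).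
  exact: measurable_Omega.
have [e1 [C [e10 e11 C0 bnd]]] :=
  difference_bounded b0 ba a1 T0 evw perw weakw evm evp init'.
have pw t g := @pointwise_vanishes R alpha beta T b0 ba a1 T0 w ut evw perw weakw wm wp umt upt
  evm evp perm perp trans weakh u0 Lu0 init' init0 t g.
have [mm [Km Km0 Bm]] : measurable_fun (@Omega_minus R `*` `[0, T]%classic) (fun q : R * R * R => wm q.2 q.1) /\
    exists2 K, 0 <= K & forall t, 0 <= t <= T -> sq (lebesgue2 R) Omega_minus (wm t) <= K.
  by split; [have [] := evm|apply: sq_bounded evm => //; exact: measurable_Omega_minus].
have [mp [Kp Kp0 Bp]] : measurable_fun (@Omega_plus R `*` `[0, T]%classic) (fun q : R * R * R => wp q.2 q.1) /\
    exists2 K, 0 <= K & forall t, 0 <= t <= T -> sq (lebesgue2 R) Omega_plus (wp t) <= K.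
  by split; [have [] := evp|apply: sq_bounded evp => //; exact: measurable_Omega_plus].
apply: (space_time_convergence e10 e11 C0).
- move=> e he; case/andP: (he) => ep ee.
  have -> : (fun q : R * R * R => extend alpha e (ueps e q.2) q.1) =
      (fun q => extend alpha e (w e q.2) q.1) by apply/funext => q; rewrite extE.
  have mD : measurable (crack_cell alpha e : set (measurableTypeR R * measurableTypeR R)%type).
    exact: measurable_cell.
  have [K K0 BK] := sq_bounded T0 mD (evw e he).
  apply: (L2_st (M := e^-1 * (3 * K))).
    by apply: measurable_extend_st => //; have [] := evw e he.
  move=> t; rewrite /= in_itv/= => tT.
  have Lw : L2 (lebesgue2 R) (crack_cell alpha e) (w e t) by have [/(_ t tT)[[]]] := evw e he.
  have [Le S _] := extend_L2 a0 a1 ep ee Lw; split => //.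
  rewrite ler_pdivlMl//; apply: (le_trans S); apply: ler_wpM2l => //; exact: BK.
- apply: (L2_st (M := 2 * Km + 2 * Kp)); first exact: measurable_glue_st mm mp.
  move=> t; rewrite /= in_itv/= => tT.
  have Lm : L2 (lebesgue2 R) Omega_minus (wm t) by have [/(_ t tT)[[]]] := evm.
  have Lp : L2 (lebesgue2 R) Omega_plus (wp t) by have [/(_ t tT)[[]]] := evp.
  have [Lg S] := L2_glue Lm Lp; split => //; apply: (le_trans S).
  by apply: lerD; apply: ler_wpM2l => //; [exact: Bm|exact: Bp].
- move=> e t he tT /=; have h1 : 0 < e < 1 by case/andP: he => -> h /=; exact: lt_trans e11.
  by rewrite -extE//; exact: bnd.
move=> t g tT Lg; apply: (vanishes_le ltr01) (pw t g tT Lg) => e he.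
by rewrite /= extE.
Qed.
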